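(* Let $d\ge1$, let $a>b>0$, put $\varphi(t)=ae^{-bt}$ for $t\ge0$, and set $\alpha_0=a-b$. Let $(Z^i_t)_{i\in\mathbb Z^d,t\ge0}$ be the impulsion Hawkes process on $\mathbb Z^d$ with excitation function $\varphi$ (defined in the context), and let $\Omega_e=\{\lim_{t\to\infty}\sum_{i\in\mathbb Z^d}Z^i_t<\infty\}$. For $t>0$ and $x\in\mathbb R^d$ let $$p_t(x)=\Big(\frac{2d+1}{4\pi t}\Big)^{d/2}\exp\Big(-\frac{(2d+1)|x|^2}{4t}\Big).$$ (i) There are some constants $C>0$ and $t_0>0$ and a random variable $H\ge0$ such that for all $i\in\mathbb Z^d$ and all $t\ge t_0$, $$\mathbb E\big[\big|Z^i_t-Hp_{at}(i)e^{\alpha_0t}\big|\big]\le\frac{Ce^{\alpha_0t}}{t^{d/2+1/3}}.$$ (ii) For all $x\in\mathbb R^d$, $t^{d/2}e^{-\alpha_0t}Z^{\lfloor xt^{1/2}\rfloor}_t\to Hp_a(x)$ in probability as $t\to\infty$, where for $y=(y_1,\dots,y_d)\in\mathbb R^d$, $\lfloor y\rfloor=(\lfloor y_1\rfloor,\dots,\lfloor y_d\rfloor)\in\mathbb Z^d$. (iii) The random variable $H$ is positive on the event $\Omega_e^c$.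
   Context: A counting process is a non-decreasing, càdlàg, integer-valued (finite for all times) process with all its jumps of height $1$. $\mathbb Z^d$ is endowed with the set of edges $\mathcal E=\{(i,j)\in(\mathbb Z^d)^2:|i-j|=0\text{ or }1\}$, $|\cdot|$ being the Euclidean norm; $\sum_{j\to i}$ denotes summation over $\{j:(j,i)\in\mathcal E\}$. Given a family $(\pi^i(ds\,dz))_{i\in\mathbb Z^d}$ of i.i.d. $(\mathcal F_t)_{t\ge0}$-Poisson measures on $[0,\infty)\times[0,\infty)$ with intensity measure $ds\,dz$, the impulsion Hawkes process with excitation function $\varphi$ is the pathwise unique family $(Z^i_t)_{i\in\mathbb Z^d,t\ge0}$ of $(\mathcal F_t)_{t\ge0}$-adapted counting processes such that $\sum_{i\in\mathbb Z^d}\mathbb E[Z^i_t]<\infty$ for all $t\ge0$ and, for all $i\in\mathbb Z^d$, $t\ge 0$, $$Z^i_t=\int_0^t\int_0^\infty\mathbf 1_{\{z\le\sum_{j\to i}(2d+1)^{-1}[\int_0^{s-}\varphi(s-u)\,dZ^j_u+\varphi(s)\mathbf 1_{\{j=0\}}]\}}\,\pi^i(ds\,dz).$$ Statements about random variables are understood up to events of probability zero. *)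

(* Defs.v *)
From HB Require Import structures.
From mathcomp Require Import all_boot all_order all_algebra.
From mathcomp Require Import finmap.
From mathcomp Require Import all_classical all_reals all_analysis.
From mathcomp Require Import measurable_realfun.
Set Implicit Arguments.
Unset Strict Implicit.
Unset Printing Implicit Defensive.
Import Order.TTheory GRing.Theory Num.Theory.
Import numFieldNormedType.Exports.

Local Open Scope classical_set_scope.
Local Open Scope ring_scope.

(* Sites of Z^d are row vectors ['rV[int]_d], points of R^d row vectors
   ['rV[R]_d]. *)

(* The canonical norm of ['rV[R]_d] is the sup norm, hence: *)
Definition euclidean_norm (R : realType) (d : nat) (x : 'rV[R]_d) : R :=
  Num.sqrt (\sum_(k < d) x 0 k ^+ 2).

Definition to_real (R : realType) (d : nat) (i : 'rV[int]_d) : 'rV[R]_d :=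
  map_mx (fun n : int => n%:~R) i.

Definition edge (R : realType) (d : nat) (i j : 'rV[int]_d) : Prop :=
  euclidean_norm (to_real R (i - j)) = 0 \/
  euclidean_norm (to_real R (i - j)) = 1.

Definition floor_site (R : realType) (d : nat) (x : 'rV[R]_d) : 'rV[int]_d :=
  map_mx Num.floor x.

(* Density at x of the centered Gaussian law on R^d with covariance
   (2t/(2d+1)) I. *)
Definition heat_kernel (R : realType) (d : nat) (t : R) (x : 'rV[R]_d) : R :=
  ((2 * d + 1)%:R / (4 * pi * t)) `^ (d%:R / 2) *
  expR (- ((2 * d + 1)%:R * euclidean_norm x ^+ 2 / (4 * t))).

(* Paths are functions on R of which only the restriction to [0, +oo[ is
   meaningful; the same holds for filtrations and processes below. *)
Record counting_path (R : realType) (f : R -> nat) : Prop := CountingPath {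
  counting_nondecreasing : forall s t, 0 <= s -> s <= t -> (f s <= f t)%N ;
  counting_right_continuous : forall t, 0 <= t ->
    ((f s)%:R : R) @[s --> t^'+] --> ((f t)%:R : R) ;
  counting_left_limits : forall t, 0 < t -> cvg (((f s)%:R : R) @[s --> t^'-]) ;
  counting_unit_jumps : forall t, 0 < t ->
    let jump := (f t)%:R - lim (((f s)%:R : R) @[s --> t^'-]) in
    jump != 0 -> jump = 1 }.

(* Extension of f to R by the constant value f 0 on negative times, so that the
   Stieltjes measure df lives on ]0, +oo[.  If f is not a counting path, the
   junk value 0 is used, which makes [stieltjes_ext f] always cumulative. *)
Definition stieltjes_ext (R : realType) (f : R -> nat) (t : R) : R :=
  if `[< counting_path f >] then (f (Num.max 0 t))%:R else 0.

Section stieltjes_ext_cumulative.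
Context (R : realType) (f : R -> nat).

Let stieltjes_ext_nd : nondecreasing (stieltjes_ext f).
Proof.
move=> s t st; rewrite /stieltjes_ext; case: asboolP => // cf.
rewrite ler_nat; apply: (counting_nondecreasing cf).
  by rewrite le_max lexx.
by rewrite ge_max !le_max lexx st orbT.
Qed.

Let stieltjes_ext_rc : right_continuous (stieltjes_ext f).
Proof.
move=> t; rewrite /stieltjes_ext; case: asboolP => cf; last exact: cvg_cst.
have [t0|t0] := leP 0 t.
- apply: cvg_trans (counting_right_continuous cf t0); apply: near_eq_cvg.
  near=> s; rewrite (max_idPr _)//; apply: (le_trans t0); apply: ltW.
  by near: s; exact: nbhs_right_gt.
- apply: cvg_near_cst; near=> s.
  rewrite (max_idPl _)//; apply: ltW.
  by near: s; exact: nbhs_right_lt.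
Unshelve. all: by end_near. Qed.

HB.instance Definition _ := isCumulative.Build R _ R (stieltjes_ext f)
  stieltjes_ext_nd stieltjes_ext_rc.

End stieltjes_ext_cumulative.

Section independence.
Context (R : realType) (dO : measure_display) (Omega : measurableType dO).
Variable P : probability Omega R.
Local Open Scope ereal_scope.

Definition independent_systems (G1 G2 : set (set Omega)) : Prop :=
  forall E1 E2, G1 E1 -> G2 E2 -> P (E1 `&` E2) = P E1 * P E2.

Definition mutually_independent (I : choiceType) (G : I -> set (set Omega)) :
    Prop :=
  forall (J : {fset I}) (E : I -> set Omega),
    (forall i, i \in J -> G i (E i)) ->
    P (\bigcap_(i in [set` J]) E i) = \big[*%E/1]_(i <- J) P (E i).

Definition cvg_in_probability (X : R -> Omega -> R) (Y : Omega -> R) : Prop :=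
  forall eps : R, (0 < eps)%R ->
    P [set w | (eps <= `|X t w - Y w|)%R] @[t --> +oo%R] --> 0.

End independence.

(* Lebesgue measure lives on [measurableTypeR R], a copy of R. *)
Notation plane R := (measurableTypeR R * measurableTypeR R)%type.

Definition quadrant (R : realType) : set (plane R) := `[0, +oo[ `*` `[0, +oo[.
Arguments quadrant : clear implicits.

Section poisson_measures.
Context (R : realType) (dO : measure_display) (Omega : measurableType dO).
Variable P : probability Omega R.

(* A random measure is a kernel.  This is the sigma-algebra generated by the
   restriction to D of the random measure N. *)
Definition sigma_random_measure (dX : measure_display) (X : measurableType dX)
    (N : R.-ker Omega ~> X) (D : set X) : set (set Omega) :=
  <<s [set E | exists A : set X, [/\ measurable A, A `<=` D &
         g_sigma_algebra_preimage (fun w => N w A) E]] >>.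

(* N, restricted to D, is a Poisson measure on D with intensity mu; the values
   of N outside D play no role.  The second argument of [poisson_prob] is a
   dummy: [poisson_prob r _] is the Poisson law of parameter r (the Dirac mass
   at 0 if r = 0). *)
Record poisson_measure (dX : measure_display) (X : measurableType dX)
    (D : set X) (mu : {measure set X -> \bar R}) (N : R.-ker Omega ~> X) :
    Prop := PoissonMeasure {
  poisson_measure_law : forall A : set X, measurable A -> A `<=` D ->
    (mu A < +oo)%E -> forall k : nat,
    P [set w | N w A = (k%:R)%:E] = poisson_prob (fine (mu A)) 0 [set k] ;
  poisson_measure_indep : forall A : nat -> set X,
    (forall n, measurable (A n)) -> (forall n, A n `<=` D) ->
    trivIset setT A ->
    mutually_independent P
      (fun n => g_sigma_algebra_preimage (fun w => N w (A n))) }.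

Record filtration (F : R -> set (set Omega)) : Prop := Filtration {
  filtration_sigma_algebra : forall t, 0 <= t -> sigma_algebra setT (F t) ;
  filtration_measurable : forall t, 0 <= t -> F t `<=` measurable ;
  filtration_nondecreasing : forall s t, 0 <= s -> s <= t -> F s `<=` F t }.

(* (F_t)-Poisson measure on [0, +oo[ x [0, +oo[ with intensity ds dz; the first
   coordinate is time. *)
Record adapted_poisson_measure (F : R -> set (set Omega))
    (N : R.-ker Omega ~> plane R) : Prop := AdaptedPoissonMeasure {
  adapted_poisson_poisson :
    poisson_measure (quadrant R) (@lebesgue_measure R \x @lebesgue_measure R)%E N ;
  adapted_poisson_past : forall t, 0 <= t ->
    sigma_random_measure N (`[0, t] `*` `[0, +oo[) `<=` F t ;
  adapted_poisson_future : forall t, 0 <= t ->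
    independent_systems P (F t)
      (sigma_random_measure N (`]t, +oo[ `*` `[0, +oo[)) }.

(* The common law of the N i is prescribed by [adapted_poisson_measure]. *)
Definition iid_poisson_measures (I : choiceType) (F : R -> set (set Omega))
    (N : I -> R.-ker Omega ~> plane R) : Prop :=
  (forall i, adapted_poisson_measure F (N i)) /\
  mutually_independent P (fun i => sigma_random_measure (N i) (quadrant R)).

End poisson_measures.

Section hawkes.
Context (R : realType) (d : nat).
Context (dO : measure_display) (Omega : measurableType dO).
Implicit Types (phi : R -> R) (Z : 'rV[int]_d -> R -> Omega -> nat).

(* The half-open [0, s[ is the integral up to s-; the term phi(s) at j = 0 is the
   impulsion, i.e. the effect of a fictitious jump of Z^0 at time 0. *)
Definition hawkes_intensity phi Z (i : 'rV[int]_d) (s : R) (w : Omega) :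
    \bar R :=
  (\sum_(j \in [set j | edge R j i])
     ((2 * d + 1)%:R^-1)%:E *
     (\int[lebesgue_stieltjes_measure (stieltjes_ext (Z j ^~ w))]_(u in `[0%R, s[)
         (phi (s - u))%:E
      + (phi s * (j == 0)%:R)%:E))%E.

Record impulsion_hawkes (P : probability Omega R) (F : R -> set (set Omega))
    (N : 'rV[int]_d -> R.-ker Omega ~> plane R) phi Z : Prop :=
    ImpulsionHawkes {
  hawkes_adapted : forall i t, 0 <= t ->
    forall B : set nat, F t (Z i t @^-1` B) ;
  hawkes_counting :
    {ae P, forall w, forall i, counting_path (Z i ^~ w)} ;
  hawkes_summable : forall t, 0 <= t ->
    (\esum_(i in [set: 'rV[int]_d]) 'E_P[fun w => (Z i t w)%:R] < +oo)%E ;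
  hawkes_equation :
    {ae P, forall w, forall i t, 0 <= t ->
      ((Z i t w)%:R)%:E =
      (\int[N i w]_(x in `[0%R, t] `*` `[0%R, +oo[)
         (\1_[set x : plane R | (x.2%:E <= hawkes_intensity phi Z i x.1 w)%E]
            x)%:E)%E} }.

Definition extinction Z : set Omega :=
  [set w | (lim ((\esum_(i in [set: 'rV[int]_d]) ((Z i t w)%:R : R)%:E)
                   @[t --> +oo%R]) < +oo)%E].

End hawkes.

(* Main.v *)
(* With the weights x^j_t = 1_{j = 0} + int_0^t e^{bu} dZ^j_u, the intensity at j
   is a e^{-bs} times the average of x over the neighbours of j. Hence E[x_t]
   solves a lattice heat equation, and e^{-at} times the total mass of x_t is a
   martingale bounded in L^2, with limit n_oo; take H = a n_oo / (a - b).
   The isometry for compensated Poisson integrals, applied to the backward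
   solutions e^{a(t-s)} (walk kernel - heat kernel), bounds the spatial error in
   L^2, the two kernels being compared by Fourier inversion; integrating in
   time gives (i), and (ii) follows by Markov's inequality and scaling.
   For (iii), when the total mass at time u is at least K e^{bu}, the
   conditional variance of n_oo makes {n_oo = 0} improbable given the past;
   when it is smaller, no jump ever occurs after u with probability bounded
   below. So conditionally on the past the event {n_oo = 0, no extinction} has
   probability bounded away from 1, and being determined by the past it is null. *)
Require Import Defs.
From HB Require Import structures.
From mathcomp Require Import all_boot all_order all_algebra.
From mathcomp Require Import finmap.
From mathcomp Require Import all_classical all_reals all_analysis.
From mathcomp Require Import measurable_realfun.
From mathcomp Require Import ring lra zify.
Set Implicit Arguments.
Unset Strict Implicit.
Unset Printing Implicit Defensive.
Import Order.TTheory GRing.Theory Num.Theory.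
Import numFieldNormedType.Exports.

Local Open Scope classical_set_scope.
Local Open Scope ring_scope.
Local Notation mfunT := (measurable_fun setT).
Local Notation sigmaT := g_sigma_algebraType.
Local Notation borel := measurableTypeR.

Create HintDb meas.
Ltac meas_leaf := first [assumption | exact: measurable_cst | exact: measurable_indic | solve [auto with meas nocore]].

Ltac meas :=
  lazymatch goal with
  | |- measurable_fun _ (fun w => EFin (@?f w)) => apply/measurable_EFinP; meas
  | |- measurable_fun _ (fun w => GRing.exp (@?f w) _) => apply: measurable_funX; meas
  | |- measurable_fun _ (fun w => Num.norm (@?f w)) => apply: measurableT_comp => //; meas
  | |- measurable_fun _ (fun w => fine (@?f w)) => apply: measurableT_comp => //; meas
  | |- measurable_fun _ (fun w => expR (@?f w)) => apply: measurableT_comp; [exact: measurable_expR|meas]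
  | |- measurable_fun _ (fun w => (@?f w + @?g w)%R) =>
      first [apply: measurable_funB; meas | apply: measurable_funD; meas | apply: emeasurable_funD; meas]
  | |- measurable_fun _ (fun w => (@?f w * @?g w)%R) =>
      first [apply: measurable_funM; meas | apply: emeasurable_funM; meas]
  | |- measurable_fun _ (fun w => (@?f w * @?g w)%E) => apply: emeasurable_funM; meas
  | |- measurable_fun _ (fun w => \sum_(v <- _) @?f w v) => apply: emeasurable_sum => ?; meas
  | |- _ => first [meas_leaf
     | match goal with |- measurable_fun _ ?f => is_var f; unfold f; meas end
     | match goal with |- measurable_fun _ (fun w => ?f w) => is_var f; unfold f; meas end]
  end.

(** * Fourier analysis of the one-dimensional walk and of its Gaussian limit *)

Section lattice_fourier.
Context {R : realType}.
Local Notation mu := (@lebesgue_measure R).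
Local Notation halfline := (`[0%R, +oo[%classic : set R).

(** The exponential kernel closes the system: the past enters the intensities only through the
    current weights, so that first moments obey a linear equation. The work lies in second moments
    of signed functionals of infinitely many sites, and three devices carry it. The orthogonality of
    Poisson noises is written as an equality between sums of nonnegative integrals, so that it
    passes from rectangles to predictable functions by a pi-system argument in [\bar R]; subtraction
    returns only on bounded boxes, where all moments are finite, and Fatou's lemma removes the
    boxes. A signed backward solution [f] is written as [(f + q) - q], where [q] is affine and both
    terms are nonnegative and nondecreasing on the time interval, because the pathwise formulas are
    proved for such functions. Finally the kernel error depends on the source through a factor
    [(1 + s) * Num.sqrt (1 + |j| ^+ 2)]: the power of [s] is paid by the margin [a - b > 0] between
    the exponents, and the power of [j] by the weight [1 + eps * |j| ^+ 2], almost an eigenfunction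
    of the neighbour average, whose mean grows at rate at most [a * (1 + eps)]. *)

Lemma is_derive_expR_comp (f : R -> R) (x df : R) :
  is_derive x 1 f df -> is_derive x 1 (fun y => expR (f y)) (df * expR (f x)).
Proof.
by move=> fx; rewrite mulrC; exact: (@is_derive1_comp _ expR f).
Qed.

Lemma is_derive_mull (c : R) (f : R -> R) (x df : R) :
  is_derive x 1 f df -> is_derive x 1 (fun y => c * f y) (c * df).
Proof. exact: is_deriveZ. Qed.

Lemma is_derive_gauss (k x : R) :
  is_derive x 1 (fun y : R => expR (- (k * y ^+ 2))) (- (2 * k * x) * expR (- (k * x ^+ 2))).
Proof.
apply: is_derive_expR_comp.
apply: is_derive_eq.
rewrite /GRing.scale/=; ring.
Qed.

Lemma is_derive_cosM (k x : R) : is_derive x 1 (fun y : R => cos (k * y)) (- k * sin (k * x)).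
Proof.
apply: (@is_derive_eq _ _ _ _ _ _ _ _ (@is_derive1_comp _ cos (fun y => k * y) x _ _ _ _)).
rewrite /GRing.scale/=; ring.
Qed.

Lemma is_derive_sinM (k x : R) : is_derive x 1 (fun y : R => sin (k * y)) (k * cos (k * x)).
Proof.
apply: (@is_derive_eq _ _ _ _ _ _ _ _ (@is_derive1_comp _ sin (fun y => k * y) x _ _ _ _)).
rewrite /GRing.scale/=; ring.
Qed.

Lemma derive_continuous (f : R -> R) (x df : R) : is_derive x 1 f df -> {for x, continuous f}.
Proof. by move=> [fx _]; apply/differentiable_continuous/derivable1_diffP. Qed.

Lemma measurable_continuous (D : set R) (f : R -> R) : continuous f ->
  measurable_fun (D : set (borel R)) (EFin \o f).
Proof.
move=> cf; apply/measurable_EFinP; apply: measurable_funTS.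
exact: continuous_measurable_fun.
Qed.

Lemma continuous_gauss (k : R) : continuous (fun y : R => expR (- (k * y ^+ 2))).
Proof. by move=> x; exact: derive_continuous (is_derive_gauss k x). Qed.

Lemma continuous_xgauss (k : R) : continuous (fun y : R => y * expR (- (k * y ^+ 2))).
Proof. by move=> x; apply: cvgM; [exact: cvg_id|exact: continuous_gauss]. Qed.

Lemma gauss_cvg0 (k : R) : 0 < k -> expR (- (k * y ^+ 2)) @[y --> +oo] --> (0 : R).
Proof.
move=> k0; apply: (cvg_comp (fun x => k * x ^+ 2) (fun x => expR (- x)));
  last exact: cvgr_expR.
by apply: gt0_cvgMry => //; exact: cvgr_expr2.
Qed.

Lemma integral_xgauss (k : R) : 0 < k ->
  (\int[mu]_(y in halfline) (y * expR (- (k * y ^+ 2)))%:E = ((2 * k)^-1)%:E)%E.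
Proof.
move=> k0.
pose F (y : R) : R := - (2 * k)^-1 * expR (- (k * y ^+ 2)).
have dF (x : R) : is_derive x 1 F (x * expR (- (k * x ^+ 2))).
  have := is_derive_gauss k x => h.
  apply: is_derive_eq; rewrite /GRing.scale/=.
  by field; rewrite gt_eqF.
rewrite (@ge0_continuous_FTC2y _ _ F 0 0).
- rewrite /F expr0n/= mulr0 oppr0 expR0 mulr1 -EFinB; congr EFin; by rewrite sub0r opprK.
- by move=> x x0; rewrite mulr_ge0 ?expR_ge0.
- by apply: continuous_subspaceT; exact: continuous_xgauss.
- rewrite -[X in _ --> X](mulr0 (- (2 * k)^-1)); apply: cvgMr; exact: gauss_cvg0.
- by move=> x _; have [] := dF x.
- by apply: cvg_at_right_filter; apply: derive_continuous (dF 0).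
- by move=> x _; rewrite derive1E; apply: derive_val.
Qed.

(** Half of the total mass 1 of the centred normal density of variance [1 / (2 * k)]; [s] is its
    standard deviation. *)
Lemma integral_gauss (k : R) : 0 < k ->
  (\int[mu]_(y in halfline) (expR (- (k * y ^+ 2)))%:E = (Num.sqrt (pi / k) / 2)%:E)%E.
Proof.
move=> k0.
pose s := (Num.sqrt (2 * k))^-1.
have s0 : 0 < s by rewrite invr_gt0 sqrtr_gt0 mulr_gt0.
have s2 : s ^+ 2 *+ 2 = k^-1.
  rewrite /s exprVn sqr_sqrtr ?mulr_ge0// ?ltW//; field; rewrite gt_eqF//.
have sp0 : 0 < s ^+ 2 * pi *+ 2 by rewrite pmulrn_lgt0// mulr_gt0 ?exprn_gt0// pi_gt0.
have peak : Num.sqrt (s ^+ 2 * pi *+ 2) = Num.sqrt (pi / k).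
  by rewrite -mulrnAl s2 mulrC.
have := @integral_normal_pdf R 0 s.
have -> : normal_pdf (0:R) s = (fun x : R => (Num.sqrt (pi / k))^-1 * expR (- (k * x ^+ 2))).
  rewrite (normal_pdfE _ (lt0r_neq0 s0)) /normal_peak/normal_fun.
  by apply/funext => x; rewrite peak subr0 s2 invrK mulNr mulrC [k * _]mulrC mulrC.
rewrite ge0_symfun_integralT; last 3 first.
- by move=> x; rewrite mulr_ge0 ?expR_ge0// invr_ge0 sqrtr_ge0.
- by move=> x; apply: cvgM; [exact: cvg_cst|exact: continuous_gauss].
- by move=> x/=; rewrite sqrrN.
have -> : [set x : R | 0 <= x] = halfline.
  by apply/seteqP; split => x/=; rewrite in_itv/= andbT.
under eq_integral do rewrite EFinM.
rewrite ge0_integralZl//; first last.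
- by apply: measurable_continuous; exact: continuous_gauss.
have q0 : 0 < Num.sqrt (pi / k) by rewrite sqrtr_gt0 divr_gt0// pi_gt0.
set I := (\int[mu]_(x in _) _)%E.
(* Infinite values of the integral would contradict the total mass 1. *)
case: I => [r|/eqP|/eqP]; last 2 first.
- by rewrite gt0_muley ?lte_fin ?invr_gt0// gt0_muley// eq_sym.
- by rewrite gt0_muleNy ?lte_fin ?invr_gt0// gt0_muleNy// eq_sym.
rewrite -!EFinM => -[h]; congr EFin.
transitivity (Num.sqrt (pi / k) / 2 * (2 * ((Num.sqrt (pi / k))^-1 * r))).
  by field; rewrite gt_eqF.
by rewrite h mulr1.
Qed.

Lemma Rintegral_FTC2 (f F : R -> R) (a b : R) : a <= b ->
  (forall x : R, is_derive x 1 F (f x)) -> continuous f ->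
  \int[mu]_(x in `[a, b]) f x = F b - F a.
Proof.
rewrite le_eqVlt => /predU1P[<- _ _|ab dF cf].
  by rewrite set_itv1 Rintegral_set1 subrr.
rewrite /Rintegral (@continuous_FTC2 _ f F)//.
- exact: continuous_subspaceT.
- have cF x : {for x, continuous F} by apply: derive_continuous (dF x).
  split.
  + by move=> x _; have [] := dF x.
  + by apply: cvg_at_right_filter; exact: cF.
  + by apply: cvg_at_left_filter; exact: cF.
- by move=> x _; rewrite derive1E; have := dF x => ?; exact: derive_val.
Qed.

(** The integrand may change sign, so the passage to the half-line is dominated convergence along
    the intervals [[0, n]]. *)
Lemma Rintegral_FTC2y (f F : R -> R) (l : R) :
  (forall x : R, is_derive x 1 F (f x)) -> continuous f ->
  mu.-integrable halfline (EFin \o f) -> F y @[y --> +oo] --> l ->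
  \int[mu]_(x in halfline) f x = l - F 0.
Proof.
move=> dF cf fi Fl.
have mf : mfunT f by exact: continuous_measurable_fun.
pose g (n : nat) := EFin \o (f \_ `[0, n%:R]).
have [] := @dominated_convergence _ _ R mu halfline _ g (EFin \o f) (abse \o (EFin \o f)).
- exact: measurable_itv.
- move=> n; apply/measurable_EFinP/measurable_funTS.
  by apply/(measurable_restrictT _ _).1 => //; apply: measurable_funTS.
- by apply/measurable_EFinP/measurable_funTS.
- apply: aeW => x /=; rewrite in_itv/= andbT => x0.
  apply: cvg_near_cst; exists (Num.bound x) => // n /= xn.
  rewrite /g/= patchE ifT// inE/= in_itv/= x0/=.
  by rewrite (le_trans (ltW (archi_boundP x0)))// ler_nat.
- exact: integrable_abse.
- apply: aeW => x n _ /=; rewrite /patch; case: ifPn => // _.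
  by rewrite normr0 lee_fin.
move=> _ _; rewrite -[X in _ --> X]fineK; last first.
  exact: integrable_fin_num.
move=> /fine_cvg h1.
have h2 : (fun n => F n%:R - F 0) @ \oo --> l - F 0.
  apply: cvgB; last exact: cvg_cst.
  exact: (cvg_comp _ _ cvgr_idn).
rewrite /Rintegral; apply: (cvg_unique _ _ h2); first exact: Rhausdorff.
apply: cvg_trans h1; apply: near_eq_cvg; near=> n.
rewrite -(@Rintegral_FTC2 f F)// /Rintegral/=; congr fine.
rewrite -/(\int[mu]_(x in halfline) _)%E.
rewrite integral_mkcond [RHS]integral_mkcond; apply: eq_integral => x _.
have e1 : (x \in halfline) = (0 <= x)%R.
  by apply/idP/idP; rewrite inE/= in_itv/= andbT.
have e2 : (x \in (`[0%R, n%:R]%classic : set R)) = (0 <= x <= n%:R)%R.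
  by apply/idP/idP; rewrite inE/= in_itv/=.
rewrite !patchE e1 e2 /g /= patchE e2.
by case: (0 <= x)%R => //=; case: (x <= n%:R)%R.
Unshelve. all: by end_near. Qed.

Lemma integrable_gauss (k : R) : 0 < k ->
  mu.-integrable halfline (EFin \o (fun y : R => expR (- (k * y ^+ 2)))).
Proof.
move=> k0; apply/integrableP; split.
  apply: measurable_continuous; exact: continuous_gauss.
rewrite [ltLHS](_ : _ = \int[mu]_(y in halfline) (expR (- (k * y ^+ 2)))%:E)%E.
  by rewrite integral_gauss// ltry.
apply: eq_integral.
by move=> y _ /=; rewrite ger0_norm// expR_ge0.
Qed.

Lemma integrable_xgauss (k : R) : 0 < k ->
  mu.-integrable halfline (EFin \o (fun y : R => y * expR (- (k * y ^+ 2)))).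
Proof.
move=> k0; apply/integrableP; split.
  apply: measurable_continuous; exact: continuous_xgauss.
rewrite [ltLHS](_ : _ = \int[mu]_(y in halfline) (y * expR (- (k * y ^+ 2)))%:E)%E.
  by rewrite integral_xgauss// ltry.
apply: eq_integral.
move=> y; rewrite inE/= in_itv/= andbT => y0.
by rewrite ger0_norm// mulr_ge0// expR_ge0.
Qed.

Lemma integrable_le_continuous (D : set R) (f g : R -> R) : measurable D ->
  mu.-integrable D (EFin \o g) -> continuous f ->
  (forall x, D x -> `|f x| <= g x) -> mu.-integrable D (EFin \o f).
Proof.
move=> mD ig cf fg; apply: le_integrable ig => //.
  exact: measurable_continuous.
by move=> x Dx /=; rewrite lee_fin (le_trans (fg _ Dx))// ler_norm.
Qed.

Lemma continuous_cosM (k : R) : continuous (fun y : R => cos (k * y)).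
Proof. by move=> x; exact: derive_continuous (is_derive_cosM k x). Qed.

Lemma continuous_sinM (k : R) : continuous (fun y : R => sin (k * y)).
Proof. by move=> x; exact: derive_continuous (is_derive_sinM k x). Qed.

Lemma norm_cos_le1 (x : R) : `|cos x| <= 1.
Proof. by rewrite ler_norml cos_geN1 cos_le1. Qed.

Lemma norm_sin_le1 (x : R) : `|sin x| <= 1.
Proof. by rewrite ler_norml sin_geN1 sin_le1. Qed.

Lemma integrable_gauss_cos (k x : R) : 0 < k ->
  mu.-integrable halfline (EFin \o (fun y : R => expR (- (k * y ^+ 2)) * cos (x * y))).
Proof.
move=> k0; apply: (integrable_le_continuous _ (integrable_gauss k0)).
- exact: measurable_itv.
- by move=> y; apply: cvgM; [exact: continuous_gauss|exact: continuous_cosM].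
- move=> y _; rewrite normrM [X in X * _]ger0_norm ?expR_ge0//.
  by rewrite ler_piMr ?expR_ge0// norm_cos_le1.
Qed.

Lemma integrable_xgauss_sin (k x : R) : 0 < k ->
  mu.-integrable halfline (EFin \o (fun y : R => y * expR (- (k * y ^+ 2)) * sin (x * y))).
Proof.
move=> k0; apply: (integrable_le_continuous _ (integrable_xgauss k0)).
- exact: measurable_itv.
- by move=> y; apply: cvgM; [exact: continuous_xgauss|exact: continuous_sinM].
- move=> y; rewrite /= in_itv/= andbT => y0.
  rewrite normrM [X in X * _]ger0_norm ?mulr_ge0 ?expR_ge0//.
  by rewrite ler_piMr ?mulr_ge0 ?expR_ge0// norm_sin_le1.
Qed.

(** Half of the Fourier transform of a Gaussian, whose sine part vanishes by parity; [xgauss_sin] is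
    minus its derivative in [x]. *)
Definition gauss_cos (k x : R) := \int[mu]_(y in halfline) (expR (- (k * y ^+ 2)) * cos (x * y)).
Definition xgauss_sin (k x : R) := \int[mu]_(y in halfline) (y * expR (- (k * y ^+ 2)) * sin (x * y)).

(** Integration by parts: [expR (- (k * y ^+ 2)) * sin (x * y)] vanishes at both ends of the
    half-line. *)
Lemma xgauss_sinE (k x : R) : 0 < k -> 2 * k * xgauss_sin k x = x * gauss_cos k x.
Proof.
move=> k0.
pose F (y : R) : R := expR (- (k * y ^+ 2)) * sin (x * y).
pose f1 (y : R) : R := x * (expR (- (k * y ^+ 2)) * cos (x * y)).
pose f2 (y : R) : R := (2 * k) * (y * expR (- (k * y ^+ 2)) * sin (x * y)).
have i1 : mu.-integrable halfline (EFin \o f1).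
  rewrite /f1; have -> : EFin \o f1 = (fun y => x%:E * (EFin \o (fun y => (expR (- (k * y ^+ 2)) * cos (x * y)))%R) y)%E by [].
  by apply: integrableZl => //; exact: integrable_gauss_cos.
have i2 : mu.-integrable halfline (EFin \o f2).
  have -> : EFin \o f2 = (fun y => (2 * k)%:E * (EFin \o (fun y => (y * expR (- (k * y ^+ 2)) * sin (x * y)))%R) y)%E by [].
  by apply: integrableZl => //; exact: integrable_xgauss_sin.
have : \int[mu]_(y in halfline) (f1 y - f2 y) = 0 - F 0.
  apply: Rintegral_FTC2y.
  - move=> y; have h1 := is_derive_gauss k y; have h2 := is_derive_sinM x y.
    apply: is_derive_eq; rewrite /GRing.scale/= /f1 /f2; ring.
  - move=> y; apply: cvgB; apply: cvgM; try exact: cvg_cst; apply: cvgM.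
    + exact: continuous_gauss.
    + exact: continuous_cosM.
    + exact: continuous_xgauss.
    + exact: continuous_sinM.
  - rewrite (_ : _ \o _ = (EFin \o f1) \- (EFin \o f2))%E//.
    by apply: integrableB => //; exact: measurable_itv.
  - apply/cvgr0Pnorm_le => e e0.
    have /cvgr0Pnorm_le/(_ _ e0) := gauss_cvg0 k0; apply: filterS => y.
    apply: le_trans; rewrite /F normrM ler_piMr//; exact: norm_sin_le1.
rewrite /F mulr0 sin0 mulr0 subrr RintegralB//.
move/eqP; rewrite subr_eq0 => /eqP.
rewrite /f1 /f2 !RintegralZl//; try exact: measurable_itv.
- exact: integrable_xgauss_sin.
- exact: integrable_gauss_cos.
Qed.

(** Differentiation under the integral sign, dominated by [|y| * expR (- (k * y ^+ 2))]. *)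
Lemma is_derive_gauss_cos (k x : R) : 0 < k ->
  is_derive x 1 (gauss_cos k) (- xgauss_sin k x).
Proof.
move=> k0.
pose f (x y : R) : R := expR (- (k * y ^+ 2)) * cos (x * y).
have df (x' y : R) : is_derive x' 1 (f ^~ y) (- (y * expR (- (k * y ^+ 2)) * sin (x' * y))).
  have h : is_derive x' 1 (fun z : R => cos (y * z)) (- y * sin (y * x')) := is_derive_cosM y x'.
  have -> : f ^~ y = (fun z : R => expR (- (k * y ^+ 2)) * cos (y * z)).
    by apply/funext => z; rewrite /f [z * y]mulrC.
  apply: is_derive_eq; rewrite /GRing.scale/= [x' * y]mulrC; ring.
have d1 (x' y : R) : partial1of2 f x' y = - (y * expR (- (k * y ^+ 2)) * sin (x' * y)).
  by rewrite partial1of2E; have h := df x' y; exact: derive_val.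
pose G (y : R) := `|y| * expR (- (k * y ^+ 2)).
have xI : (`]x - 1, x + 1[%classic : set R) x by rewrite /= in_itv/=; lra.
have mD : measurable halfline by exact: measurable_itv.
have ii x' : (`]x - 1, x + 1[%classic : set R) x' -> mu.-integrable halfline (EFin \o f x').
  by move=> _; exact: integrable_gauss_cos.
have dd x' y : (`]x - 1, x + 1[%classic : set R) x' -> halfline y -> derivable (f ^~ y) x' 1.
  by move=> _ _; have [] := df x' y.
have G0 y : 0 <= G y by rewrite mulr_ge0 ?expR_ge0.
have iG : mu.-integrable halfline (EFin \o G).
  apply: eq_integrable (integrable_xgauss k0) => // y.
  by rewrite inE/= in_itv/= andbT => y0; rewrite /G ger0_norm.
have bG x' y : (`]x - 1, x + 1[%classic : set R) x' -> halfline y -> `|partial1of2 f x' y| <= G y.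
  move=> _ _; rewrite d1 normrN !normrM [X in _ * X * _]ger0_norm ?expR_ge0//.
  by rewrite ler_piMr ?norm_sin_le1.
apply: DeriveDef.
  by have h := @derivable_under_integral R _ (borel R) mu f halfline mD x _ _ xI ii dd _ G0 iG bG; exact: h.
have h := @differentiation_under_integral R _ (borel R) mu f halfline mD x _ _ xI ii dd _ G0 iG bG.
rewrite -derive1E; rewrite [LHS]h.
under eq_Rintegral do rewrite d1.
rewrite /xgauss_sin -mulN1r -RintegralZl//; last exact: integrable_xgauss_sin.
by apply: eq_Rintegral => y _; rewrite mulN1r.
Qed.

(** By the two previous lemmas the transform solves [G' = - x / (2 * k) * G]; its product with
    [expR (x ^+ 2 / (4 * k))] is therefore constant, equal to the value at 0. *)
Lemma gauss_cosE (k x : R) : 0 < k ->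
  gauss_cos k x = Num.sqrt (pi / k) / 2 * expR (- (x ^+ 2 / (4 * k))).
Proof.
move=> k0; pose h (x : R) := gauss_cos k x * expR (- (- (4 * k)^-1 * x ^+ 2)).
have dh (y : R) : is_derive y 1 h 0.
  have h1 := is_derive_gauss_cos y k0; have h2 := is_derive_gauss (- (4 * k)^-1) y.
  apply: is_derive_eq; rewrite /GRing.scale/=.
  have -> : xgauss_sin k y = y * gauss_cos k y / (2 * k).
    by rewrite -xgauss_sinE//; field; rewrite gt_eqF.
  by field; rewrite gt_eqF.
have := is_derive_0_is_cst x 0 dh; rewrite /h expr0n/= mulr0 oppr0 expR0 mulr1.
have -> : gauss_cos k 0 = Num.sqrt (pi / k) / 2.
  rewrite /gauss_cos /Rintegral -[RHS]/(fine (Num.sqrt (pi / k) / 2)%:E) -integral_gauss//.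
  by congr fine; apply: eq_integral => y _; rewrite mul0r cos0 mulr1.
move=> <-; rewrite -mulrA -expRD [X in expR X](_ : _ = 0) ?expR0 ?mulr1//.
by field; rewrite gt_eqF.
Qed.

Local Notation circle := (`[0%R, pi]%classic : set R).

(** [expR (- (2 * t * (1 - cos y)))] is the characteristic function at time [t] of the walk with
    unit rates towards both neighbours; being even in [y], it is integrated over half a period
    only. *)
Definition walk_fun (t x y : R) : R := expR (- (2 * t * (1 - cos y))) * cos (x * y).

(* At integer x, the transition function of the continuous time walk on Z that
   jumps to each neighbour at rate 1. *)
Definition walk (t x : R) : R := pi^-1 * \int[mu]_(y in circle) walk_fun t x y.

Lemma continuous_walk_fun (t x : R) : continuous (walk_fun t x).
Proof.
move=> y; apply: cvgM; last exact: continuous_cosM.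
have h : is_derive y 1 (fun z : R => expR (- (2 * t * (1 - cos z))))
   (- (2 * t * sin y) * expR (- (2 * t * (1 - cos y)))).
  apply: is_derive_expR_comp.
  by apply: is_derive_eq; rewrite /GRing.scale/=; ring.
exact: derive_continuous h.
Qed.

Lemma integrable_circle (f : R -> R) : continuous f -> mu.-integrable circle (EFin \o f).
Proof.
move=> cf; apply: continuous_compact_integrable; first exact: segment_compact.
exact: continuous_subspaceT.
Qed.

Lemma integrable_walk (t x : R) : mu.-integrable circle (EFin \o walk_fun t x).
Proof. by apply: integrable_circle; exact: continuous_walk_fun. Qed.

(** Under the integral sign the time derivative produces the factor [2 * cos y - 2], and
    [2 * cos y * cos (x * y)] is the sum of [cos ((x + 1) * y)] and [cos ((x - 1) * y)]. *)
Lemma is_derive_walk (t x : R) :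
  is_derive t 1 (walk ^~ x) (walk t (x + 1) + walk t (x - 1) - 2 * walk t x).
Proof.
pose f (s y : R) : R := walk_fun s x y.
have df (s y : R) : is_derive s 1 (f ^~ y) (- (2 * (1 - cos y)) * walk_fun s x y).
  have h : is_derive s 1 (fun z : R => expR (- (2 * z * (1 - cos y))))
     (- (2 * (1 - cos y)) * expR (- (2 * s * (1 - cos y)))).
    by apply: is_derive_expR_comp; apply: is_derive_eq; rewrite /GRing.scale/=; ring.
  by apply: is_derive_eq; rewrite /GRing.scale/= /walk_fun; ring.
have d1 (s y : R) : partial1of2 f s y = - (2 * (1 - cos y)) * walk_fun s x y.
  by rewrite partial1of2E; have h := df s y; exact: derive_val.
(* [M] dominates the time derivative for parameters within distance 1 of [t]: there
   [|s| <= |t| + 1], and [1 - cos y] lies between 0 and 2. *)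
pose M : R := 4 * expR (4 * (`|t| + 1)).
have xI : (`]t - 1, t + 1[%classic : set R) t by rewrite /= in_itv/=; lra.
have mD : measurable circle by exact: measurable_itv.
have ii s : (`]t - 1, t + 1[%classic : set R) s -> mu.-integrable circle (EFin \o f s).
  by move=> _; exact: integrable_walk.
have dd s y : (`]t - 1, t + 1[%classic : set R) s -> circle y -> derivable (f ^~ y) s 1.
  by move=> _ _; have [] := df s y.
have G0 (y : R) : 0 <= cst M y by rewrite mulr_ge0 ?expR_ge0.
have iG : mu.-integrable circle (EFin \o cst M).
  by apply: integrable_circle => y; exact: cvg_cst.
have bG s y : (`]t - 1, t + 1[%classic : set R) s -> circle y -> `|partial1of2 f s y| <= cst M y.
  rewrite /= in_itv/= => st _; rewrite d1 !normrM normrN normrM.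
  have c1 := cos_le1 y; have c2 := cos_geN1 y.
  rewrite (ger0_norm (expR_ge0 _)) [X in _ * X * _]ger0_norm ?subr_ge0//.
  rewrite ger0_norm// /M; apply: ler_pM => //.
  - lra.
  - rewrite -[leRHS]mulr1; apply: ler_pM => //; rewrite ?expR_ge0 ?norm_cos_le1//.
    rewrite ler_expR.
    have h1 : `|s| <= `|t| + 1.
      rewrite -[s](subrK t) addrC (le_trans (ler_normD _ _))// lerD2l ler_norml; lra.
    apply: (le_trans (ler_norm _)); rewrite normrN !normrM.
    rewrite [X in _ * X <= _]ger0_norm ?subr_ge0// ger0_norm//.
    have : `|s| * (1 - cos y) <= (`|t| + 1) * 2 by apply: ler_pM => //; lra.
    lra.
have h := @derivable_under_integral R _ (borel R) mu f circle mD t _ _ xI ii dd _ G0 iG bG.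
have h' := @differentiation_under_integral R _ (borel R) mu f circle mD t _ _ xI ii dd _ G0 iG bG.
have D : is_derive t 1 (fun s => \int[mu]_(y in circle) f s y)
   (\int[mu]_(y in circle) (- (2 * (1 - cos y)) * walk_fun t x y)).
  apply: DeriveDef; first exact: h.
  by rewrite -derive1E [LHS]h'; apply: eq_Rintegral => y _; rewrite d1.
have -> : walk ^~ x = (fun s => pi^-1 * \int[mu]_(y in circle) f s y) by [].
apply: (@is_derive_eq _ _ _ _ _ _ _ _ (is_derive_mull pi^-1 D)).
rewrite /walk [2 * _]mulrCA -!mulrDr -mulrBr; congr (_ * _).
rewrite -RintegralZl//; [|exact: integrable_walk].
rewrite -RintegralD//; [|exact: integrable_walk..].
rewrite -RintegralB//; first last.
- apply: integrable_circle => y; apply: cvgM; first exact: cvg_cst.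
  exact: continuous_walk_fun.
- apply: integrable_circle => y; apply: cvgD; exact: continuous_walk_fun.
apply: eq_Rintegral => y _; rewrite /walk_fun.
have -> : (x + 1) * y = x * y + y by ring.
have -> : (x - 1) * y = x * y - y by ring.
rewrite cosB cosD; ring.
Qed.

Lemma Rintegral_circle1 : \int[mu]_(y in circle) 1 = pi.
Proof.
rewrite (@Rintegral_FTC2 (fun=> 1) id 0 pi) ?subr0//; first exact: pi_ge0.
by move=> x; exact: cvg_cst.
Qed.

(** At time 0 only the cosine remains, and a cosine of nonzero integer frequency has integral 0 over
    half a period. *)
Lemma walk0 (n : int) : walk 0 n%:~R = (n == 0)%:R.
Proof.
rewrite /walk; have [->|n0] := eqVneq n 0.
  have -> : \int[mu]_(y in circle) walk_fun 0 0%:~R y = \int[mu]_(y in circle) 1.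
    by apply: eq_Rintegral => y _; rewrite /walk_fun !(mulr0, mul0r) oppr0 expR0 cos0 mulr1.
  by rewrite Rintegral_circle1 mulVf// gt_eqF// pi_gt0.
have n0' : n%:~R != 0 :> R by rewrite intr_eq0.
have -> : \int[mu]_(y in circle) walk_fun 0 n%:~R y =
   sin (n%:~R * pi) / n%:~R - sin (n%:~R * 0) / n%:~R.
  transitivity (\int[mu]_(y in circle) cos (n%:~R * y)).
    apply: eq_Rintegral => y _.
    by rewrite /walk_fun mulr0 mul0r oppr0 expR0 mul1r.
  apply: (@Rintegral_FTC2 (fun y => cos (n%:~R * y)) (fun y => sin (n%:~R * y) / n%:~R)).
  - exact: pi_ge0.
  - move=> y; have h := is_derive_sinM n%:~R y.
    have := is_derive_mull n%:~R^-1 h; rewrite mulKf//.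
    by under [X in is_derive _ _ X]eq_fun do rewrite mulrC.
  - exact: continuous_cosM.
have spi (m : nat) : sin (m%:R * pi) = 0 :> R.
  elim: m => [|m IH]; first by rewrite mul0r sin0.
  by rewrite -natr1 mulrDl mul1r sinDpi IH oppr0.
have -> : sin (n%:~R * pi) = 0 :> R.
  case: n {n0 n0'} => m; first by rewrite -pmulrn spi.
  by rewrite NegzE mulrNz mulNr sinN -pmulrn spi oppr0.
by rewrite mulr0 sin0 mul0r subrr mulr0.
Qed.

Lemma walk_abs_le1 (t x : R) : 0 <= t -> `|walk t x| <= 1.
Proof.
move=> t0; rewrite /walk normrM ger0_norm ?invr_ge0 ?pi_ge0//.
rewrite mulrC ler_pdivrMr ?pi_gt0// mul1r.
have mD : measurable circle by exact: measurable_itv.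
apply: le_trans.
  by apply: le_normr_Rintegral => //; exact: integrable_walk.
apply: (@le_trans _ _ (\int[mu]_(y in circle) 1)).
  apply: le_Rintegral => //.
  - by have := integrable_norm (integrable_walk t x).
  - by apply: integrable_circle => y; exact: cvg_cst.
  - move=> y _; rewrite /walk_fun normrM ger0_norm ?expR_ge0//.
    rewrite -[leRHS]mulr1; apply: ler_pM; rewrite ?expR_ge0 ?norm_cos_le1//.
    rewrite -expR0 ler_expR oppr_le0 mulr_ge0// ?mulr_ge0// subr_ge0; exact: cos_le1.
by rewrite Rintegral_circle1.
Qed.

(** Mean value theorem. Applied repeatedly, it turns each bound on [sin] or [cos] into the Taylor
    bound of the next order. *)
Lemma is_derive_ge0 (f df : R -> R) : (forall x : R, is_derive x 1 f (df x)) ->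
  (forall x, 0 <= x -> 0 <= df x) -> 0 <= f 0 -> forall x, 0 <= x -> 0 <= f x.
Proof.
move=> fd df0 f0 x; rewrite le_eqVlt => /predU1P[<-//|x0].
have [|c] := @MVT _ f df 0 x x0 (fun x _ => fd x).
  by apply: continuous_subspaceT => z; exact: derive_continuous (fd z).
rewrite in_itv/= => /andP[c0 _] h.
rewrite -[f x](subrK (f 0)) h subr0 addr_ge0// mulr_ge0//; last exact: ltW.
by apply: df0; exact: ltW.
Qed.

Lemma sin_lex (x : R) : 0 <= x -> sin x <= x.
Proof.
move=> x0; rewrite -subr_ge0.
apply: (@is_derive_ge0 (fun x => x - sin x) (fun x => 1 - cos x)) => //.
by rewrite sin0 subr0.
Qed.

Lemma cos_ge_quad (x : R) : 0 <= x -> 1 - cos x <= x ^+ 2 / 2.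
Proof.
move=> x0; rewrite -subr_ge0.
apply: (@is_derive_ge0 (fun x => x ^+ 2 / 2 - (1 - cos x)) (fun x => x - sin x)) => //.
- by move=> y; apply: is_derive_eq; rewrite /GRing.scale/=; field.
- by move=> y y0; rewrite subr_ge0 sin_lex.
- by rewrite cos0 expr0n/= mul0r !subrr.
Qed.

Lemma sin_ge_cubic (x : R) : 0 <= x -> x - x ^+ 3 / 6 <= sin x.
Proof.
move=> x0; rewrite -subr_ge0.
apply: (@is_derive_ge0 (fun x => sin x - (x - x ^+ 3 / 6)) (fun x => x ^+ 2 / 2 - (1 - cos x))) => //.
- by move=> y; apply: is_derive_eq; rewrite /GRing.scale/=; field.
- by move=> y y0; rewrite subr_ge0 cos_ge_quad.
- by rewrite sin0 expr0n/= mul0r !subrr.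
Qed.

Lemma cos_le_quartic (x : R) : 0 <= x -> x ^+ 2 / 2 - x ^+ 4 / 24 <= 1 - cos x.
Proof.
move=> x0; rewrite -subr_ge0.
apply: (@is_derive_ge0 (fun x => (1 - cos x) - (x ^+ 2 / 2 - x ^+ 4 / 24)) (fun x => sin x - (x - x ^+ 3 / 6))) => //.
- by move=> y; apply: is_derive_eq; rewrite /GRing.scale/=; field.
- by move=> y y0; rewrite subr_ge0 sin_ge_cubic.
- by rewrite cos0 !expr0n/= !mul0r !subrr.
Qed.

(** Half-angle formula [1 - cos x = 2 * sin (x / 2) ^+ 2], with [sin z >= z - z ^+ 3 / 6 >= z / 3]
    for [0 <= z <= 2], a range that contains [pi / 2]. *)
Lemma one_minus_cos_ge (x : R) : 0 <= x -> x <= pi -> x ^+ 2 / 18 <= 1 - cos x.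
Proof.
move=> x0 xpi; have p2 := @pihalf_lt2 R.
have h0 : 0 <= x / 2 by lra.
have := sin_ge_cubic h0.
have -> : 1 - cos x = 2 * sin (x / 2) ^+ 2.
  have -> : cos x = cos (x / 2 + x / 2) by congr cos; field.
  by rewrite cosD -!expr2 cos2sin2; ring.
have x2 : x / 2 <= 2 by lra.
set z := x / 2 in h0 x2 *; have -> : x = 2 * z by rewrite /z; field.
have : z / 3 <= z - z ^+ 3 / 6.
  have -> : z - z ^+ 3 / 6 = z * (1 - z ^+ 2 / 6) by field.
  by apply: ler_wpM2l => //; nra.
by move=> h1 h2; nra.
Qed.

Lemma cos_lipschitz (x y : R) : `|cos x - cos y| <= `|x - y|.
Proof.
wlog : x y / x < y => [H|xy].
  have [/H//|yx|->] := ltgtP x y; last by rewrite !subrr normr0.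
  by rewrite distrC [X in _ <= X]distrC H.
have [|c _ h] := @MVT _ cos (fun z => - sin z) x y xy (fun z _ => is_derive_cos z).
  by apply: continuous_subspaceT; exact: continuous_cos.
by rewrite distrC h normrM distrC ler_piMl// normrN norm_sin_le1.
Qed.

Lemma expR_diff_le (x y l : R) : l <= x -> l <= y ->
  `|expR (- x) - expR (- y)| <= `|x - y| * expR (- l).
Proof.
wlog xy : x y / x <= y => [H lx ly|lx ly].
  by have [/H|/ltW/H] := leP x y; [exact|rewrite distrC [X in _ <= X * _]distrC; exact].
rewrite ger0_norm ?subr_ge0 ?ler_expR ?lerN2// distrC ger0_norm ?subr_ge0//.
have -> : expR (- x) - expR (- y) = (1 - expR (- (y - x))) * expR (- x).
  by rewrite mulrBl mul1r -expRD; congr (_ - expR _); ring.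
apply: ler_pM; rewrite ?expR_ge0 ?subr_ge0 ?ler_expR ?lerN2//.
  by rewrite -expR0 ler_expR oppr_le0 subr_ge0.
by have := expR_ge1Dx (- (y - x)); lra.
Qed.

Lemma xexpR_le1 (x : R) : x * expR (- x) <= 1.
Proof.
rewrite expRN -ler_pdivlMr ?invr_gt0 ?expR_gt0// invrK mul1r.
by have := expR_ge1Dx x; lra.
Qed.

(** Density of the centred normal law of variance [2 * t], which is also the variance of the walk at
    time [t]. *)
Definition gauss_kernel (t x : R) : R := (Num.sqrt (4 * pi * t))^-1 * expR (- (x ^+ 2 / (4 * t))).

Lemma gauss_kernelE (t x : R) : 0 < t -> gauss_kernel t x = pi^-1 * gauss_cos t x.
Proof.
move=> t0; rewrite gauss_cosE// mulrA; congr (_ * _).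
have p0 := @pi_gt0 R.
have -> : 4 * pi * t = (2 * pi) ^+ 2 * (pi / t)^-1.
  by move: p0; move: (pi) => p p0; field; rewrite !gt_eqF.
rewrite sqrtrM ?sqr_ge0// sqrtr_sqr ger0_norm; last by rewrite mulr_ge0// ltW.
have q0 : 0 < Num.sqrt (pi / t) by rewrite sqrtr_gt0 divr_gt0.
rewrite sqrtrV ?divr_ge0 ?ltW// invfM invrK.
by move: p0 q0; move: (pi) => p p0 _; field; rewrite gt_eqF.
Qed.

(** Both exponents are at least [2 * L] with [L = t / 36 * y ^+ 2], so a difference of exponentials
    keeps a factor [expR (- (2 * L))]. One copy of [expR (- L)] absorbs the growing factor
    [t * y ^+ 2] in the difference of the exponents, the other copy survives in the bound. *)
Lemma walk_fun_diff (t s x m y : R) : 0 < t -> 0 <= s -> s <= t / 2 ->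
  0 <= y -> y <= pi ->
  `|walk_fun (t - s) (x - m) y - expR (- (t * y ^+ 2)) * cos (x * y)|
  <= 12 * (1 + s) * (1 + `|m|) * (y * expR (- (t / 36 * y ^+ 2))).
Proof.
move=> t0 s0 st y0 ypi; rewrite /walk_fun.
have p2 := @pihalf_lt2 R.
have h1 := one_minus_cos_ge y0 ypi.
have h2 := cos_ge_quad y0.
have h3 := cos_le_quartic y0.
set A := 2 * (t - s) * _; set B := t * _; set L := t / 36 * y ^+ 2.
have LA : 2 * L <= A.
  rewrite /A /L; have : t / 2 * (y ^+ 2 / 18) <= (t - s) * (1 - cos y).
    by apply: ler_pM => //; [lra|rewrite divr_ge0// sqr_ge0|lra].
  lra.
have y2 : 0 <= y ^+ 2 by exact: sqr_ge0.
have L0 : 0 <= L by rewrite /L mulr_ge0// divr_ge0// ltW.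
have LB : 2 * L <= B by rewrite /L /B; nra.
(* [A] and [B] differ by the quartic Taylor remainder of the cosine and by the time shift [s]. *)
have AB : `|A - B| <= t * y ^+ 4 / 12 + s * y ^+ 2.
  have -> : A - B = 2 * t * (1 - cos y - y ^+ 2 / 2) - 2 * s * (1 - cos y).
    by rewrite /A /B; field.
  apply: (le_trans (ler_normB _ _)); apply: lerD.
    rewrite normrM (ger0_norm (mulr_ge0 (ler0n _ 2) (ltW t0))).
    have : `|1 - cos y - y ^+ 2 / 2| <= y ^+ 4 / 24.
      rewrite ler_norml; apply/andP; split; first lra.
      by have : 0 <= y ^+ 4 by [rewrite exprn_ge0]; lra.
    set Y := y ^+ 4; set q := `|_| => h; nra.
  rewrite ger0_norm; last by rewrite mulr_ge0// ?mulr_ge0//; lra.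
  by have := ler_wpM2l s0 h2; lra.
have eD := expR_diff_le LA LB.
have e2L : expR (- (2 * L)) = expR (- L) * expR (- L) by rewrite -expRD; congr expR; ring.
have e0 := expR_ge0 (- L).
have Le := xexpR_le1 L.
have e1 : expR (- L) <= 1 by rewrite -expR0 ler_expR; lra.
have yt : t * y ^+ 2 * expR (- L) <= 36.
  by move: Le; rewrite {1}/L; lra.
have b1 : `|expR (- A) - expR (- B)| <= (12 + 4 * s) * (y * expR (- L)).
  apply: (le_trans eD); rewrite e2L mulrA.
  apply: (@le_trans _ _ ((t * y ^+ 4 / 12 + s * y ^+ 2) * expR (- L) * expR (- L))).
    by rewrite -[leRHS]mulrA ler_wpM2r// mulr_ge0.
  rewrite mulrA ler_wpM2r//.
  have y4 : y <= 4 by lra.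
  have c1 : t * y ^+ 4 / 12 * expR (- L) <= 12 * y.
    have -> : t * y ^+ 4 / 12 * expR (- L) = y ^+ 2 / 12 * (t * y ^+ 2 * expR (- L)) by field.
    have /le_trans -> // : y ^+ 2 / 12 * (t * y ^+ 2 * expR (- L)) <= y ^+ 2 / 12 * 36.
      by apply: ler_wpM2l => //; rewrite divr_ge0.
    have : y ^+ 2 <= 4 * y by rewrite expr2 ler_wpM2r.
    lra.
  have c2 : s * y ^+ 2 * expR (- L) <= s * (4 * y).
    have : y ^+ 2 <= 4 * y by rewrite expr2 ler_wpM2r.
    move/(ler_wpM2l s0); apply: le_trans.
    by rewrite ler_piMr// mulr_ge0.
  lra.
have b2 : expR (- A) * `|cos ((x - m) * y) - cos (x * y)| <= `|m| * (y * expR (- L)).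
  rewrite mulrA mulrC; apply: ler_pM; rewrite ?expR_ge0//.
    apply: (le_trans (cos_lipschitz _ _)).
    by rewrite mulrBl addrC addKr normrN normrM (ger0_norm y0).
  by rewrite ler_expR lerN2; lra.
rewrite [X in `|X|](_ : _ = expR (- A) * (cos ((x - m) * y) - cos (x * y)) +
   (expR (- A) - expR (- B)) * cos (x * y)); last by ring.
apply: (le_trans (ler_normD _ _)); rewrite !normrM (ger0_norm (expR_ge0 _)).
have b3 : `|expR (- A) - expR (- B)| * `|cos (x * y)| <= (12 + 4 * s) * (y * expR (- L)).
  by apply: le_trans b1; rewrite ler_piMr// norm_cos_le1.
apply: (le_trans (lerD b2 b3)); rewrite -mulrDl ler_wpM2r ?mulr_ge0//.
by have m0 := normr_ge0 m; nra.
Qed.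

(** The pointwise bound is integrated: [y * expR (- (t / 36 * y ^+ 2))] has integral [18 / t] over
    the half-line, and [216 = 12 * 18]. The prefactor [1 / pi] is bounded by 1. *)
Lemma walk_gauss_kernel (t s x m : R) : 0 < t -> 0 <= s -> s <= t / 2 ->
  `|walk (t - s) (x - m) - gauss_kernel t x| <= 216 * (1 + s) * (1 + `|m|) / t.
Proof.
move=> t0 s0 st; rewrite gauss_kernelE// /walk -mulrBr normrM.
have p2 := @pi_ge2 R; have p0 := @pi_gt0 R.
have mH : measurable halfline by exact: measurable_itv.
have mC : measurable circle by exact: measurable_itv.
have HC : halfline `&` circle = circle.
  by apply/seteqP; split => y /=; rewrite !in_itv/= ?andbT; [by case|by move=> h; case/andP: (h)].
pose W := walk_fun (t - s) (x - m).
pose G (y : R) : R := expR (- (t * y ^+ 2)) * cos (x * y).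
pose K : R := 12 * (1 + s) * (1 + `|m|).
pose M (y : R) : R := y * expR (- (t / 36 * y ^+ 2)).
have K0 : 12 <= K by rewrite /K; have m0 := normr_ge0 m; nra.
have iW : mu.-integrable halfline (EFin \o (W \_ circle)).
  rewrite -restrict_EFin; apply/integrable_restrict => //.
  rewrite HC; exact: integrable_walk.
have iG : mu.-integrable halfline (EFin \o G) by exact: integrable_gauss_cos.
have t36 : 0 < t / 36 by rewrite divr_gt0.
have iM : mu.-integrable halfline (EFin \o M) by exact: integrable_xgauss.
have -> : \int[mu]_(y in circle) walk_fun (t - s) (x - m) y =
          \int[mu]_(y in halfline) (W \_ circle) y.
  by rewrite -Rintegral_mkcondr HC.
have pi0 : 0 <= (pi : R)^-1 by rewrite invr_ge0 ltW.
rewrite /gauss_cos -RintegralB// (ger0_norm pi0).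
have iD : mu.-integrable halfline (EFin \o (fun y => (W \_ circle) y - G y)).
  rewrite (_ : _ \o _ = (EFin \o (W \_ circle)) \- (EFin \o G))%E//.
  by apply: integrableB.
have h : `|\int[mu]_(y in halfline) ((W \_ circle) y - G y)| <= K * (2 * (t / 36))^-1.
  apply: le_trans; first exact: le_normr_Rintegral.
  have -> : (2 * (t / 36))^-1 = \int[mu]_(y in halfline) M y.
    by rewrite /Rintegral integral_xgauss.
  rewrite -RintegralZl//; apply: le_Rintegral => //.
  - exact: integrable_norm.
  - rewrite (_ : _ \o _ = (fun y => K%:E * (EFin \o M) y)%E)//.
    by apply: integrableZl.
  - move=> y; rewrite /= in_itv/= andbT => y0; rewrite patchE.
    have [yC|yC] := boolP (y \in circle).
      by move: yC; rewrite inE/= in_itv/= => /andP[_ ypi]; exact: walk_fun_diff.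
    (* Beyond [pi] only the Gaussian integrand is left; there [y > 1], which puts it below
       [K * M y]. *)
    have ypi : pi < y by move: yC; rewrite notin_setE/= in_itv/= y0/=; move/negP; rewrite -ltNge.
    rewrite sub0r normrN normrM (ger0_norm (expR_ge0 _)).
    apply: (@le_trans _ _ (expR (- (t * y ^+ 2)))).
      by rewrite ler_piMr ?expR_ge0// norm_cos_le1.
    rewrite /M mulrA; apply: (@le_trans _ _ (1 * expR (- (t / 36 * y ^+ 2)))).
      rewrite mul1r ler_expR lerN2 ler_wpM2r ?sqr_ge0//; lra.
    by rewrite ler_wpM2r ?expR_ge0//; nra.
apply: (@le_trans _ _ (1 * (K * (2 * (t / 36))^-1))).
  by apply: ler_pM => //; rewrite invf_le1//; lra.
rewrite le_eqVlt; apply/orP; left; apply/eqP; rewrite /K; field.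
by rewrite gt_eqF.
Qed.

Lemma gauss_kernel_le (t x : R) : 0 < t -> 0 <= gauss_kernel t x <= (Num.sqrt t)^-1.
Proof.
move=> t0; have p2 := @pi_ge2 R; rewrite /gauss_kernel mulr_ge0 ?expR_ge0 ?invr_ge0 ?sqrtr_ge0//=.
rewrite -[leRHS]mulr1; apply: ler_pM; rewrite ?expR_ge0 ?invr_ge0 ?sqrtr_ge0//.
  rewrite lef_pV2 ?posrE ?sqrtr_gt0//; first by apply: ler_wsqrtr; nra.
  by rewrite mulr_gt0// mulr_gt0// pi_gt0.
by rewrite -expR0 ler_expR oppr_le0 divr_ge0 ?sqr_ge0// mulr_ge0// ltW.
Qed.

End lattice_fourier.

(** * Neighbour averages on the lattice and comparison of the product kernels *)

Section lattice.
Context {R : realType} {d : nat}.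
Local Notation site := 'rV[int]_d.

Definition unit_site (k : 'I_d) : site := delta_mx 0 k.

(** The zero step belongs to the list because [edge] relates every site to itself; hence the count
    [2 * d + 1]. *)
Definition steps : seq site :=
  0 :: [seq unit_site k | k <- index_enum 'I_d] ++ [seq - unit_site k | k <- index_enum 'I_d].

Lemma unit_siteE (k l : 'I_d) : unit_site k 0 l = (l == k)%:R.
Proof. by rewrite mxE eqxx. Qed.

Lemma size_steps : size steps = (2 * d + 1)%N.
Proof. have h : size (index_enum 'I_d) = d by rewrite -sum1_size sum1_card card_ord.
by rewrite /steps -cat1s !size_cat !size_map h /=; lia. Qed.

Lemma uniq_steps : uniq steps.
Proof.
have nz k : unit_site k != 0.
  by apply/eqP => /rowP /(_ k); rewrite unit_siteE eqxx mxE.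
rewrite /steps cons_uniq mem_cat negb_or; apply/andP; split.
  apply/andP; split; apply/mapP => -[k _ /eqP]; first by rewrite eq_sym (negbTE (nz k)).
  by rewrite eq_sym oppr_eq0 (negbTE (nz k)).
have inj k l : unit_site k = unit_site l -> k = l.
  move=> /rowP/(_ k); rewrite !unit_siteE eqxx; case: eqP => // _; lia.
rewrite cat_uniq (map_inj_uniq inj) index_enum_uniq map_inj_uniq; last first.
  by move=> k l h; apply: inj; rewrite -[LHS]opprK h opprK.
rewrite index_enum_uniq andbT andTb -all_predC; apply/allP => _ /mapP[l _ ->] /=.
apply/mapP => -[k _] /rowP/(_ k).
by rewrite !mxE !eqxx /=; case: eqP => //= _; lia.
Qed.

(** The squared norm of an integer vector is an integer sum of squares; when it equals 1, exactly
    one coordinate is nonzero, and that one is 1 or -1. *)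
Lemma edgeE (j i : site) : edge R j i <-> j - i \in steps.
Proof.
set v := j - i; rewrite /edge -/v /euclidean_norm.
pose s : int := \sum_(k < d) v 0 k ^+ 2.
have -> : \sum_(k < d) to_real R v 0 k ^+ 2 = s%:~R :> R.
  by rewrite rmorph_sum; apply: eq_bigr => k _; rewrite mxE rmorphXn.
have s0 : 0 <= s by apply: sumr_ge0 => k _; exact: sqr_ge0.
have sr : 0 <= s%:~R :> R by rewrite ler0z.
have v2 (k : 'I_d) : 0 <= v 0 k ^+ 2 by exact: sqr_ge0.
have v0P : s = 0 -> v = 0.
  move=> h; apply/rowP => k; rewrite [RHS]mxE; apply/eqP.
  by rewrite -sqrf_eq0; move/psumr_eq0P : h => ->.
split.
- case=> h.
    have s00 : s = 0.
      move/eqP : h; rewrite sqrtr_eq0 lerz0 => h.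
      by apply/eqP; rewrite eq_le h.
    by rewrite v0P// mem_head.
  have s1 : s = 1.
    have : (s%:~R : R) = 1 by rewrite -[LHS]sqr_sqrtr// h expr1n.
    by move/eqP; rewrite -[1]/(1%:~R) eqr_int => /eqP.
  have [k vk] : exists k, v 0 k != 0.
    apply/existsP; rewrite -[X in is_true X]negbK negb_exists; apply/negP => /forallP h0.
    move: s1; rewrite /s big1// => k _.
    by have := h0 k; rewrite negbK => /eqP ->; rewrite expr0n.
  have : v 0 k ^+ 2 + \sum_(l < d | l != k) v 0 l ^+ 2 = 1 by rewrite -s1 /s [RHS](bigD1 k).
  set S := \sum_(_ < _ | _) _ => hS.
  have S0 : 0 <= S by apply: sumr_ge0 => l _; exact: v2.
  have vk1 : 1 <= v 0 k ^+ 2 by rewrite -gtz0_ge1 lt_def sqrf_eq0 vk v2.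
  have SE : S = 0 by lia.
  have vl l : l != k -> v 0 l = 0.
    by move=> lk; apply/eqP; rewrite -sqrf_eq0; move/psumr_eq0P : SE => ->.
  have : (v 0 k == 1) || (v 0 k == -1).
    by rewrite -sqrf_eq1; apply/eqP; lia.
  rewrite /steps inE mem_cat; move=> /orP[/eqP vk'|/eqP vk']; apply/orP; right; apply/orP.
    left; apply/mapP; exists k; rewrite ?mem_index_enum//; apply/rowP => l.
    by rewrite unit_siteE; case: eqP => [->//|/eqP /vl ->].
  right; apply/mapP; exists k; rewrite ?mem_index_enum//; apply/rowP => l.
  by rewrite [RHS]mxE unit_siteE; case: eqP => [->//|/eqP /vl ->]; rewrite ?oppr0.
- have ek k : \sum_(l < d) (unit_site k 0 l) ^+ 2 = 1.
    rewrite (bigD1 k)//= unit_siteE eqxx expr1n big1 ?addr0// => l lk.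
    by rewrite unit_siteE (negbTE lk) expr0n.
  rewrite /steps inE mem_cat => /orP[/eqP v0|/orP[|] /mapP[k _ vE]].
  + left; rewrite /s v0 big1 ?sqrtr0// => k _.
    by rewrite mxE expr0n.
  + by right; rewrite /s vE ek sqrtr1.
  + right; rewrite /s vE; under eq_bigr do rewrite mxE sqrrN.
    by rewrite ek sqrtr1.
Qed.

Lemma edge_set (i : site) : [set j | edge R j i] = [set` [seq i + v | v <- steps]].
Proof.
apply/seteqP; split => j; rewrite [X in X -> _]/mkset [X in _ -> X]/mkset.
  by move=> /edgeE h; apply/mapP; exists (j - i) => //; rewrite addrC subrK.
by move=> /mapP[v vs ->]; apply/edgeE; rewrite addrAC subrr add0r.
Qed.

Definition avg (g : site -> R) (i : site) : R :=
  (2 * d + 1)%:R^-1 * \sum_(v <- steps) g (i + v).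

Lemma sum_steps (V : nmodType) (f : site -> V) :
  \sum_(v <- steps) f v = f 0 + \sum_(k < d) (f (unit_site k) + f (- unit_site k)).
Proof.
by rewrite /steps big_cons big_cat !big_map big_split.
Qed.

Section walk_kernel.
Variable a : R.
(** Product of one-dimensional walks. The clock [a * t / (2 * d + 1)] is chosen so that the
    generator becomes [a] times [avg] minus the identity. *)
Definition walk_kernel (t : R) (j : site) : R :=
  \prod_(k < d) walk (a * t / (2 * d + 1)%:R) (j 0 k)%:~R.

Lemma walk_kernel0 (j : site) : walk_kernel 0 j = (j == 0)%:R.
Proof.
rewrite /walk_kernel mulr0 mul0r; under eq_bigr do rewrite walk0.
have [->|j0] := eqVneq j 0; first by rewrite big1// => k _; rewrite mxE eqxx.
have [k jk] : exists k, j 0 k != 0.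
  apply/existsP; rewrite -[X in is_true X]negbK negb_exists; apply/negP => /forallP h0.
  move/eqP : j0; apply; apply/rowP => k; rewrite mxE; apply/eqP.
  by have := h0 k; rewrite negbK.
by rewrite (bigD1 k)//= (negbTE jk) mul0r.
Qed.

Lemma is_derive_prod_ord (n : nat) (f : 'I_n -> R -> R) (df : 'I_n -> R) (t : R) :
  (forall i, is_derive t 1 (f i) (df i)) ->
  is_derive t 1 (fun s => \prod_(i < n) f i s) (\sum_(i < n) df i * \prod_(k < n | k != i) f k t).
Proof.
elim: n f df => [|n IH] f df h.
  rewrite big_ord0 (_ : (fun _ => _) = cst 1); first exact: is_derive_cst.
  by apply/funext => s; rewrite big_ord0.
have -> : (fun s => \prod_(i < n.+1) f i s) = (fun s => f ord0 s * \prod_(i < n) f (lift ord0 i) s).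
  by apply/funext => s; rewrite big_ord_recl.
have h0 := h ord0; have h1 := IH (fun i => f (lift ord0 i)) (fun i => df (lift ord0 i)) (fun i => h (lift ord0 i)).
apply: is_derive_eq; rewrite /GRing.scale/= big_ord_recl.
rewrite [X in _ = df ord0 * X + _]big_mkcond big_ord_recl eqxx/= mul1r.
rewrite addrC; congr (_ + _).
  by rewrite mulrC; congr (_ * _); apply: eq_bigr => i _.
rewrite big_distrr/=; apply: eq_bigr => i _.
rewrite [X in _ = _ * X]big_mkcond big_ord_recl/= -big_mkcond/= mulrCA; congr (_ * (_ * _)).
Qed.

(** By the product rule each coordinate contributes a second difference. The [2 * d] subtracted
    copies of the kernel, together with the zero step of the average, are the [2 * d + 1] copies
    that cancel the normalization. *)
Lemma is_derive_walk_kernel (t : R) (j : site) :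
  is_derive t 1 (walk_kernel ^~ j) (a * (avg (walk_kernel t) j - walk_kernel t j)).
Proof.
set c : R := (2 * d + 1)%:R.
have c0 : c != 0 by rewrite pnatr_eq0 addn1.
pose w (x : int) := walk (a * t / c) x%:~R.
pose f (k : 'I_d) (s : R) := walk (a * s / c) (j 0 k)%:~R.
have df k : is_derive t 1 (f k) (a / c * (w (j 0 k + 1) + w (j 0 k - 1) - 2 * w (j 0 k))).
  have h := is_derive_walk (a * t / c) (j 0 k)%:~R.
  have h2 : is_derive t 1 (fun s : R => a * s / c) (a / c).
    have -> : (fun s : R => a * s / c) = (fun s => a / c * s) by apply/funext => s; rewrite mulrAC.
    apply: (@is_derive_eq _ _ _ _ _ _ _ _ (is_derive_mull (a / c) (@is_derive_id _ _ t 1))).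
    by rewrite mulr1.
  apply: (@is_derive_eq _ _ _ _ _ _ _ _ (@is_derive1_comp _ (walk ^~ (j 0 k)%:~R) _ t _ _ h h2)).
  rewrite /w !rmorphD !rmorphN !rmorph1.
  by rewrite mulrC.
apply: (@is_derive_eq _ _ _ _ _ _ _ _ (is_derive_prod_ord df)).
have sh k (e : int) : walk_kernel t (j + e *: unit_site k) =
    w (j 0 k + e) * \prod_(l < d | l != k) f l t.
  rewrite /walk_kernel (bigD1 k)//=; congr (_ * _).
    by rewrite /w !mxE !eqxx/= mulr1.
  apply: eq_bigr => l lk; rewrite /f !mxE eqxx (negbTE lk)/= mulr0 addr0//.
rewrite /avg sum_steps -/c addr0.
rewrite [X in _ - X](_ : _ = c^-1 * (walk_kernel t j + \sum_(k < d) 2 * walk_kernel t j)); last first.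
  rewrite sumr_const card_ord -[2 * _ *+ d]mulr_natl.
  by rewrite /c natrD natrM in c0 *; field.
rewrite -mulrBr opprD addrACA subrr add0r -sumrB mulr_sumr mulr_sumr.
apply: eq_bigr => k _.
have -> : j + unit_site k = j + 1 *: unit_site k by rewrite scale1r.
have -> : j - unit_site k = j + (-1) *: unit_site k by rewrite scaleN1r.
rewrite !sh.
have -> : walk_kernel t j = w (j 0 k) * \prod_(l < d | l != k) f l t.
  by rewrite -[LHS]/(walk_kernel t j) -[j in LHS]addr0 -(scale0r (unit_site k)) sh addr0.
by ring.
Qed.

Lemma prod_norm_le (n : nat) (M : R) (x : 'I_n -> R) :
  (forall i, `|x i| <= M) -> `|\prod_(i < n) x i| <= M ^+ n.
Proof.
move=> h; rewrite normr_prod -[X in _ ^+ X]card_ord -prodr_const.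
by apply: ler_prod => i _; rewrite normr_ge0 h.
Qed.

(** Factors are exchanged one at a time. The bound is [n * M ^+ (n - 1) * D], written with a
    division by [M] so that it covers [n = 0]. *)
Lemma prod_diff_le (n : nat) (M D : R) (x y : 'I_n -> R) : 0 < M ->
  (forall i, `|x i| <= M) -> (forall i, `|y i| <= M) -> (forall i, `|x i - y i| <= D) ->
  `|\prod_(i < n) x i - \prod_(i < n) y i| <= n%:R * M ^+ n * (D / M).
Proof.
move=> M0; elim: n x y => [|n IH] x y hx hy hD.
  by rewrite !big_ord0 subrr normr0 !mul0r.
rewrite !big_ord_recl.
set X := \prod_(_ < _) _; set Y := \prod_(_ < _) _.
have -> : x ord0 * X - y ord0 * Y = x ord0 * (X - Y) + (x ord0 - y ord0) * Y by ring.
apply: (le_trans (ler_normD _ _)); rewrite !normrM.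
have h1 : `|x ord0| * `|X - Y| <= M * (n%:R * M ^+ n * (D / M)).
  by apply: ler_pM => //; apply: IH => i.
have h2 : `|x ord0 - y ord0| * `|Y| <= D * M ^+ n.
  by apply: ler_pM => //; apply: prod_norm_le => i.
apply: (le_trans (lerD h1 h2)).
rewrite le_eqVlt; apply/orP; left; apply/eqP.
by rewrite -natr1 exprS; field; rewrite gt_eqF.
Qed.

Lemma walk_kernel_abs_le1 (t : R) (j : site) : 0 <= a -> 0 <= t -> `|walk_kernel t j| <= 1.
Proof.
move=> a0 t0; rewrite -[leRHS](expr1n _ d); apply: prod_norm_le => k.
by apply: walk_abs_le1; rewrite mulr_ge0 ?invr_ge0// mulr_ge0.
Qed.

Lemma heat_kernelE (t : R) (j : site) : 0 < a -> 0 < t ->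
  heat_kernel (a * t) (to_real R j) =
  \prod_(k < d) gauss_kernel (a * t / (2 * d + 1)%:R) (j 0 k)%:~R.
Proof.
move=> a0 t0; rewrite /heat_kernel /gauss_kernel.
set c : R := (2 * d + 1)%:R.
have c0 : 0 < c by rewrite ltr0n addn1.
have p0 := @pi_gt0 R.
rewrite big_split/= prodr_const card_ord -expR_sum; congr (_ * expR _).
  have -> : c / (4 * pi * (a * t)) = (4 * pi * (a * t / c))^-1.
    by move: p0; move: (pi) => p p0; field; rewrite !gt_eqF.
  rewrite [_ / 2]mulrC powRrM powR12_sqrt ?invr_ge0; last first.
    by rewrite !mulr_ge0// ?invr_ge0 ltW.
  by rewrite powR_mulrn ?sqrtr_ge0// sqrtrV// !mulr_ge0// ?invr_ge0 ltW.
rewrite /euclidean_norm sqr_sqrtr; last by apply: sumr_ge0 => k _; exact: sqr_ge0.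
rewrite sumrN mulr_sumr mulr_suml; congr (- _); apply: eq_bigr => k _.
by rewrite mxE; field; rewrite !gt_eqF.
Qed.

(** Bookkeeping of the powers of [r = Num.sqrt t]: [n - 1] factors of order [1 / r] and one
    difference of order [1 / r ^+ 2] give [1 / r ^+ n.+1]. *)
Lemma prod_bound_rescale (n : nat) (D M k S r : R) : 0 < M -> 0 < r ->
  k * (M / r) ^+ n * (D * S / r ^+ 2 / (M / r)) = k * M ^+ n * (D / M) * S / r ^+ n.+1.
Proof.
move=> M0 r0; rewrite expr_div_n (exprS r n).
have : r ^+ n != 0 by rewrite expf_neq0// gt_eqF.
move: (r ^+ n) (M ^+ n) => u v u0; field.
by rewrite u0 !gt_eqF.
Qed.

Definition sqnorm (j : site) : R := \sum_(k < d) (j 0 k)%:~R ^+ 2.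

Lemma sqnorm_ge0 (j : site) : 0 <= sqnorm j.
Proof. by apply: sumr_ge0 => k _; exact: sqr_ge0. Qed.

(** Each one-dimensional factor is of order [1 / Num.sqrt t] and each difference of factors of order
    [(1 + s) * (1 + |j|) / t], so exchanging the factors one by one gains a power of [Num.sqrt t]
    over the size of the kernel. The dependence on [s] and [j] stays explicit because it is later
    averaged against the process. *)
Lemma walk_kernel_heat : 0 < a -> exists C T0 : R, [/\ 0 < C, 1 <= T0 &
  forall (t s : R) (i j : site), T0 <= t -> 0 <= s -> s <= t / 2 ->
  `|walk_kernel (t - s) (i - j) - heat_kernel (a * t) (to_real R i)| <=
    C * (1 + s) * Num.sqrt (1 + sqnorm j) / Num.sqrt t ^+ d.+1 /\
  0 <= heat_kernel (a * t) (to_real R i) <= 1].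
Proof.
move=> a0; set c : R := (2 * d + 1)%:R.
have c0 : 0 < c by rewrite ltr0n addn1.
pose b := a / c; have b0 : 0 < b by rewrite divr_gt0.
pose rb := Num.sqrt b; have rb0 : 0 < rb by rewrite sqrtr_gt0.
(* [216] is the constant of [walk_gauss_kernel], and [900] serves to bound a single factor: [216 /
   tau' + 1 / q <= 433 / q <= 866 / (rb * r)] with [q = Num.sqrt tau']. *)
have [n9 n90 n9E] : exists2 x : R, 0 < x & x = 900.
  by exists 900; [rewrite ltr0n|].
have [n2 n20 n2E] : exists2 x : R, 0 < x & x = 216.
  by exists 216; [rewrite ltr0n|].
pose M0 : R := n9 / rb; have M00 : 0 < M0 by apply: divr_gt0.
pose D0 : R := n2 * (1 + b) * 2 / b; have D00 : 0 < D0.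
  by apply: divr_gt0 => //; apply: mulr_gt0 => //; apply: mulr_gt0 => //; lra.
exists (1 + d%:R * M0 ^+ d * (D0 / M0)), (1 + b^-1); split.
- rewrite ltr_wpDr//; apply: mulr_ge0; last by rewrite divr_ge0 ?(ltW D00) ?(ltW M00).
  by rewrite mulr_ge0// exprn_ge0// (ltW M00).
- by rewrite lerDl invr_ge0 (ltW b0).
move=> t s i j Tt s0 st.
have t1 : 1 <= t by apply: le_trans Tt; rewrite lerDl invr_ge0 (ltW b0).
have t0 : 0 < t by lra.
have bt1 : 1 <= b * t.
  have : b^-1 <= t by apply: le_trans Tt; rewrite lerDr.
  by move=> h; have := ler_wpM2l (ltW b0) h; rewrite mulfV ?lt0r_neq0.
pose tau := b * t; have tau0 : 0 < tau by rewrite mulr_gt0.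
pose r := Num.sqrt t; have r0 : 0 < r by rewrite sqrtr_gt0.
have r1 : 1 <= r by rewrite -[1]sqrtr1 ler_wsqrtr.
have rr : r ^+ 2 = t by rewrite sqr_sqrtr// ltW.
have srt : Num.sqrt tau = rb * r by rewrite sqrtrM// ltW.
have bE z : a * z / c = b * z by rewrite /b; ring.
rewrite heat_kernelE//.
have gk x : 0 <= gauss_kernel tau x <= (rb * r)^-1 by rewrite -srt; exact: gauss_kernel_le.
have rbr1 : 1 <= rb * r by rewrite -srt -[1]sqrtr1 ler_wsqrtr.
split; last first.
  rewrite -/c; under eq_bigr do rewrite bE.
  rewrite prodr_ge0 /=; last by move=> k _; case/andP: (gk (j 0 k)%:~R) => _ _; case/andP: (gk (i 0 k)%:~R).
  apply: (le_trans (ler_norm _)); rewrite -[leRHS](expr1n _ d).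
  apply: prod_norm_le => k; case/andP: (gk (i 0 k)%:~R) => h0 h; rewrite ger0_norm//.
  by apply: (le_trans h); rewrite invf_le1// (lt_le_trans ltr01).
set L := Num.sqrt (1 + sqnorm j).
have L0 : 0 <= L by exact: sqrtr_ge0.
have jL k : `|(j 0 k)%:~R : R| <= L.
  rewrite -sqrtr_sqr ler_wsqrtr// /sqnorm (bigD1 k)//= addrCA lerDl.
  by rewrite addr_ge0// sumr_ge0// => l _; exact: sqr_ge0.
have L1 : 1 <= L by rewrite -[1]sqrtr1 ler_wsqrtr// lerDl sqnorm_ge0.
have M : 0 < M0 / r by rewrite divr_gt0.
have wd k : `|walk (a * (t - s) / c) ((i - j) 0 k)%:~R - gauss_kernel tau (i 0 k)%:~R| <=
    D0 * (1 + s) * L / t.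
  rewrite bE mulrBr -/tau !mxE rmorphD rmorphN.
  have bs0 : 0 <= b * s by rewrite mulr_ge0// ltW.
  have bst : b * s <= tau / 2 by rewrite /tau -mulrA ler_pM2l.
  apply: (le_trans (walk_gauss_kernel _ _ tau0 bs0 bst)).
  rewrite -n2E; have -> : D0 * (1 + s) * L / t = n2 * ((1 + b) * (1 + s)) * (2 * L) / tau.
    by rewrite /D0 /tau; field; rewrite !gt_eqF.
  rewrite ler_wpM2r ?invr_ge0 ?(ltW tau0)//.
  apply: ler_pM => //; [apply: mulr_ge0; lra| |].
    by rewrite ler_wpM2l ?(ltW n20)//; nra.
  by have := jL k; lra.
have gM x : `|gauss_kernel tau x| <= M0 / r.
  case/andP: (gk x) => g0 g1; rewrite ger0_norm//; apply: (le_trans g1).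
  have -> : M0 / r = n9 * (rb * r)^-1 by rewrite /M0; field; rewrite !gt_eqF.
  by rewrite ler_peMl ?invr_ge0; lra.
have wM k : `|walk (a * (t - s) / c) ((i - j) 0 k)%:~R| <= M0 / r.
  rewrite bE; set tau' := b * (t - s); set x := _%:~R.
  have tt : tau / 2 <= tau' by rewrite /tau /tau' -mulrA ler_pM2l//; lra.
  have tau'0 : 0 < tau' by apply: lt_le_trans tt; rewrite divr_gt0.
  have h0 : 0 <= tau' / 2 by rewrite divr_ge0// ltW.
  have := walk_gauss_kernel x 0 tau'0 (lexx 0) h0; rewrite -n2E !subr0 normr0 addr0 !mulr1.
  have /andP[g0 g1] := gauss_kernel_le x tau'0.
  have s0' : 0 < Num.sqrt tau' by rewrite sqrtr_gt0.
  have sh : rb * r <= 2 * Num.sqrt tau'.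
    have -> : 2 = Num.sqrt (4 : R) by rewrite (_ : 4 = 2 ^+ 2) ?sqrtr_sqr ?ger0_norm//; ring.
    by rewrite -sqrtrM// -srt ler_wsqrtr//; lra.
  have sq : Num.sqrt tau' ^+ 2 = tau' by rewrite sqr_sqrtr// ltW.
  set q := Num.sqrt tau' in g1 s0' sh sq *.
  have q2 : q^-1 <= 2 / (rb * r).
    by rewrite -[q^-1]mul1r ler_pdivrMr// mulrC mulrA ler_pdivlMr ?mul1r ?(mulrC q)// (lt_le_trans ltr01).
  have qh : 2^-1 <= q by lra.
  have ti : tau'^-1 <= 2 * q^-1.
    rewrite -sq expr2 invfM -subr_ge0 -mulrBl mulr_ge0 ?invr_ge0 ?(ltW s0')//.
    by rewrite subr_ge0 -[leRHS]invrK lef_pV2// posrE// invr_gt0.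
  move=> hd; rewrite -[walk _ _](subrK (gauss_kernel tau' x)).
  apply: (le_trans (ler_normD _ _)); rewrite (ger0_norm g0).
  have -> : M0 / r = n9 * (rb * r)^-1 by rewrite /M0; field; rewrite !gt_eqF.
  rewrite n2E in hd; rewrite n9E; lra.
rewrite /walk_kernel -/c; under [X in _ - X]eq_bigr do rewrite bE.
apply: (le_trans (prod_diff_le M wM _ wd)); first by move=> k; exact: gM.
rewrite -(mulrA D0) -[in X in X <= _]rr (prod_bound_rescale _ _ _ _ M00 r0) !mulrA.
rewrite ler_wpM2r ?invr_ge0 ?exprn_ge0 ?(ltW r0)// ler_wpM2r// ler_wpM2r//; first lra.
by rewrite lerDr.
Qed.

End walk_kernel.
End lattice.

Local Open Scope ereal_scope.

(** * Extension of integral identities from sets to functions; random measures and independence *)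

Section nonneg_induction.
Context {R : realType} {d : measure_display} {T : measurableType d}.
Import HBNNSimple.

(** The increasing approximations by simple functions are finite sums of nonnegative multiples of
    indicators, so these closure rules reach every nonnegative measurable function. *)
Lemma nonneg_measurable_ind (Pr : (T -> \bar R) -> Prop) :
  (forall A, measurable A -> Pr (fun x => (\1_A x)%:E)) ->
  (forall (r : R) f, (0 <= r)%R -> (forall x, 0 <= f x) -> measurable_fun setT f ->
     Pr f -> Pr (fun x => r%:E * f x)) ->
  (forall f g, (forall x, 0 <= f x) -> (forall x, 0 <= g x) -> measurable_fun setT f ->
     measurable_fun setT g -> Pr f -> Pr g -> Pr (fun x => f x + g x)) ->
  (forall (f : (T -> \bar R)^nat) g, (forall n x, 0 <= f n x) -> (forall n, measurable_fun setT (f n)) ->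
     (forall x, nondecreasing_seq (f ^~ x)) -> (forall x, f ^~ x @ \oo --> g x) ->
     (forall n, Pr (f n)) -> Pr g) ->
  forall f, (forall x, 0 <= f x) -> measurable_fun setT f -> Pr f.
Proof.
move=> P1 PZ PD Plim f f0 mf.
pose g := nnsfun_approx measurableT mf.
apply: (Plim (fun n x => (g n x)%:E)).
- by move=> n x; rewrite lee_fin.
- by move=> n; exact/measurable_EFinP.
- by move=> x m n mn; rewrite lee_fin; exact/lefP/nd_nnsfun_approx.
- by move=> x; apply: cvg_nnsfun_approx.
move=> n.
have -> : (fun x => (g n x)%:E) = (fun x => \sum_(r <- fset_set (range (g n)))
    (r%:E * (\1_(g n @^-1` [set r]) x)%:E)).
  apply/funext => x; rewrite fimfunE fsbig_finite//= -sumEFin.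
  by apply: eq_bigr => r _; rewrite EFinM.
have : forall r, r \in (fset_set (range (g n)) : seq R) -> (0 <= r)%R.
  by move=> r; rewrite in_fset_set// inE => -[x _ <-].
have mr r : measurable (g n @^-1` [set r]) by exact: measurable_sfunP.
have m1 r : mfunT (fun x => (\1_(g n @^-1` [set r]) x)%:E : \bar R).
  by meas.
have i0 r x : 0 <= (\1_(g n @^-1` [set r]) x)%:E :> \bar R by rewrite lee_fin.
move: (enum_fset (fset_set (range (g n)))) => s0.
elim: s0 => [|r s IH].
  move=> _.
  have -> : (fun x => \sum_(r <- [::]) (r%:E * (\1_(g n @^-1` [set r]) x)%:E)) =
      (fun x => 0%:E * (\1_(set0 : set T) x)%:E) :> (T -> \bar R).
    by apply/funext => x; rewrite big_nil mul0e.
  apply: PZ => //; [exact/measurable_EFinP|exact: P1].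
move=> h; have r0 : (0 <= r)%R by apply: h; rewrite mem_head.
have h' : forall r, r \in s -> (0 <= r)%R by move=> q qs; apply: h; rewrite inE qs orbT.
under eq_fun do rewrite big_cons.
apply: PD => //.
- by move=> x; rewrite mule_ge0.
- by move=> x; rewrite big_seq; apply: sume_ge0 => q /h' q0; rewrite mule_ge0.
- exact: measurable_funeM.
- by apply: emeasurable_sum => q; exact: measurable_funeM.
- by apply: PZ => //; exact: P1.
- exact: IH.
Qed.

End nonneg_induction.

Section sub_sigma_algebra.
Context {R : realType} {d : measure_display} {T : measurableType d}.
Variables (G : set (set T)) (Gm : G `<=` measurable).

Lemma sub_sigma_mfun (d' : measure_display) (T' : measurableType d') (f : T -> T') :
  mfunT (f : sigmaT G -> T') -> mfunT f.
Proof.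
move=> mf _ B mB; rewrite setTI; have := mf measurableT B mB; rewrite setTI.
exact: (smallest_sub (@sigma_algebra_measurable _ T) Gm).
Qed.

(** Both measures are transported along the identity to the coarser sigma-algebra, where they
    coincide on every measurable set. *)
Lemma sub_sigma_integral (m1 m2 : {measure set T -> \bar R}) (f : T -> \bar R) :
  (forall A, <<s G >> A -> m1 A = m2 A) -> (forall x, 0 <= f x) ->
  mfunT (f : sigmaT G -> \bar R) ->
  \int[m1]_x f x = \int[m2]_x f x.
Proof.
move=> m12 f0 mf.
pose h : T -> sigmaT G := id.
have mh : mfunT h.
  by move=> _ B mB; rewrite setTI; exact: (smallest_sub (@sigma_algebra_measurable _ T) Gm).
have e (m : {measure set T -> \bar R}) : \int[m]_x f x = \int[pushforward m h]_x f x.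
  by rewrite (ge0_integral_pushforward mh m measurableT mf)// => y _; exact: f0.
rewrite !e; apply: eq_measure_integral => A mA _.
exact: m12.
Qed.

End sub_sigma_algebra.

Section finite_random_measure.
Context {R : realType} {d d' : measure_display} {W : measurableType d} {X : measurableType d'}.
Variable k : W -> {measure set X -> \bar R}.
Hypothesis mk : forall U, measurable U -> mfunT (k ^~ U).
Hypothesis kfin : forall w, k w setT < +oo.

Let mass_ge0 w : (0 <= (1 + fine (k w setT))^-1)%R.
Proof. by rewrite invr_ge0 addr_ge0// fine_ge0. Qed.

(** Division by [1 + k w setT] turns a family of finite measures into a uniformly bounded kernel,
    for which integrals depend measurably on [w]; the factor is restored afterwards. *)
Definition scaled_measure (w : W) : {measure set X -> \bar R} := mscale (NngNum (mass_ge0 w)) (k w).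

Let mmass : mfunT (fun w => (1 + fine (k w setT))%R).
Proof. by apply: measurable_funD => //; apply: measurableT_comp => //; exact: mk. Qed.

Let mscaled U : measurable U -> mfunT (scaled_measure ^~ U).
Proof.
move=> mU; apply: emeasurable_funM; last exact: mk.
apply/measurable_EFinP; rewrite /=.
under eq_fun do rewrite -powR_inv1 ?addr_ge0 ?fine_ge0//.
exact: (measurableT_comp (measurable_powR _)).
Qed.

Let scaled_uub : measure_fam_uub scaled_measure.
Proof.
exists 1%R => w; rewrite /scaled_measure /mscale/=.
have : k w setT \is a fin_num by rewrite ge0_fin_numE.
rewrite -[mscale _ _ _]/(_%:E * k w setT) => /fineK h; rewrite -[X in _ * X]h -EFinM lte_fin mulrC ltr_pdivrMr; last by rewrite ltr_pwDl// fine_ge0.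
by rewrite mul1r ltrDr.
Qed.

HB.instance Definition _ := isKernel.Build _ _ W X R scaled_measure mscaled.
HB.instance Definition _ := Kernel_isFinite.Build _ _ W X R scaled_measure scaled_uub.

Lemma measurable_integral_random_measure (f : W * X -> \bar R) :
  (forall z, 0 <= f z) -> mfunT f ->
  mfunT (fun w => \int[k w]_x f (w, x)).
Proof.
move=> f0 mf.
have -> : (fun w => \int[k w]_x f (w, x)) =
  (fun w => (1 + fine (k w setT))%:E * \int[scaled_measure w]_x f (w, x)).
  apply/funext => w; rewrite ge0_integral_mscale//; last exact: measurableT_comp.
  rewrite muleA -EFinM divff ?mul1e// gt_eqF// ltr_pwDl// fine_ge0//.
apply: emeasurable_funM; first exact/measurable_EFinP.
exact: (measurable_fun_integral_finite_kernel _ scaled_measure).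
Qed.

Lemma measurable_xsection_random_measure (A : set (W * X)) : measurable A ->
  mfunT (fun w => k w (xsection A w)).
Proof.
move=> mA.
have := @measurable_integral_random_measure (fun z => (\1_A z)%:E) _ _.
rewrite (_ : (fun w => _) = (fun w => k w (xsection A w))); last first.
  apply/funext => w; rewrite -[LHS]/(\int[k w]_x (\1_A (w, x))%:E).
  rewrite -(setIT (xsection A w)) -integral_indic//; last exact: measurable_xsection.
  by apply: eq_integral => x _; rewrite !indicE mem_xsection.
by apply => //; exact/measurable_EFinP.
Qed.

Variable P : {measure set W -> \bar R}.
Variable v : W -> R.
Hypothesis v0 : forall w, (0 <= v w)%R.
Hypothesis mv : mfunT v.
Local Notation V w := (v w)%:E.

Let mV : mfunT (EFin \o v). Proof. exact/measurable_EFinP. Qed.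
Let V0 w : 0 <= V w. Proof. by rewrite lee_fin. Qed.

(** The measure [v(w) P(dw) k(w, dx)] on the product space. *)
Definition mix (A : set (W * X)) : \bar R := \int[P]_w (V w * k w (xsection A w)).

Let mix0 : mix set0 = 0.
Proof. by rewrite /mix integral0_eq// => w _; rewrite xsection0 measure0 mule0. Qed.

Let mix_ge0 A : 0 <= mix A.
Proof. by apply: integral_ge0 => w _; rewrite mule_ge0. Qed.

Let mix_sigma_additive : semi_sigma_additive mix.
Proof.
move=> F mF tF mUF; rewrite [X in _ --> X](_ : _ = \sum_(n <oo) mix (F n)); last first.
  rewrite /mix -integral_nneseries//; last 2 first.
  - by move=> n; apply: emeasurable_funM => //; exact: measurable_xsection_random_measure.
  - by move=> n w _; rewrite mule_ge0.
  apply: eq_integral => w _; rewrite nneseriesZl//; congr (_ * _).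
  rewrite xsection_bigcup; apply/esym/cvg_lim => //.
  apply: measure_semi_sigma_additive.
  - by move=> n; exact: measurable_xsection.
  - exact: trivIset_xsection.
  - by apply: bigcupT_measurable => n; exact: measurable_xsection.
apply: is_cvg_nneseries => n _ _; exact: mix_ge0.
Qed.

Let mix_mixin := isMeasure.Build _ _ _ mix mix0 mix_ge0 mix_sigma_additive.
Definition mix_measure : {measure set (W * X) -> \bar R} := HB.pack mix mix_mixin.

Lemma mix_measureE A : mix_measure A = \int[P]_w (V w * k w (xsection A w)).
Proof. by []. Qed.

(** Induction on [f] from indicators; the limit step is monotone convergence, first in [x] and then
    in [w]. *)
Lemma integral_mixture (m : {measure set (W * X) -> \bar R}) :
  (forall A, measurable A -> m A = \int[P]_w (V w * k w (xsection A w))) ->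
  forall f : W * X -> \bar R, (forall z, 0 <= f z) -> mfunT f ->
  \int[m]_z f z = \int[P]_w (V w * \int[k w]_x f (w, x)).
Proof.
move=> mE.
have mi f : (forall z, 0 <= f z) -> mfunT f ->
    mfunT (fun w => V w * \int[k w]_x f (w, x)).
  by move=> f0 mf; apply: emeasurable_funM => //; exact: measurable_integral_random_measure.
have gi f w : (forall z, 0 <= f z) -> 0 <= V w * \int[k w]_x f (w, x).
  by move=> f0; rewrite mule_ge0// integral_ge0.
have ms (f : W * X -> \bar R) (w : W) : mfunT f -> mfunT (fun x : X => f (w, x)).
  by move=> mf; exact: measurableT_comp.
apply: nonneg_measurable_ind.
- move=> A mA; rewrite integral_indic// setIT mE//; apply: eq_integral => w _; congr (_ * _).
  rewrite -(setIT (xsection A w)) -integral_indic//; last exact: measurable_xsection.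
  by apply: eq_integral => x _; rewrite !indicE mem_xsection.
- move=> r f r0 f0 mf IH.
  rewrite (ge0_integralZl_EFin _ measurableT (fun z _ => f0 z) mf r0) IH.
  rewrite -(ge0_integralZl_EFin _ measurableT (fun w _ => gi _ w f0) (mi _ f0 mf) r0).
  apply: eq_integral => w _.
  by rewrite (ge0_integralZl_EFin _ measurableT (fun x _ => f0 (w, x)) (ms _ w mf) r0) muleCA.
- move=> f g f0 g0 mf mg IHf IHg.
  rewrite (ge0_integralD _ measurableT (fun z _ => f0 z) mf (fun z _ => g0 z) mg) IHf IHg.
  rewrite -(ge0_integralD _ measurableT (fun w _ => gi _ w f0) (mi _ f0 mf) (fun w _ => gi _ w g0) (mi _ g0 mg)).
  apply: eq_integral => w _.
  rewrite (ge0_integralD _ measurableT (fun x _ => f0 (w, x)) (ms _ w mf) (fun x _ => g0 (w, x)) (ms _ w mg)).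
  by apply: esym; apply: ge0_muleDr; apply: integral_ge0 => x _; [exact: f0|exact: g0].
- move=> f g f0 mf ndf fg IH.
  have h1 : \int[m]_z f n z @[n --> \oo] --> \int[m]_z g z.
    have := @cvg_monotone_convergence _ _ R m setT measurableT f mf (fun n z _ => f0 n z) (fun z _ => ndf z).
    by rewrite (_ : (fun z => limn (f ^~ z)) = g)//; apply/funext => z; apply/cvg_lim.
  have lk w : \int[k w]_x f n (w, x) @[n --> \oo] --> \int[k w]_x g (w, x).
    have := @cvg_monotone_convergence _ _ R (k w) setT measurableT (fun n x => f n (w, x))
      (fun n => ms _ w (mf n)) (fun n x _ => f0 n (w, x)) (fun x _ => ndf (w, x)).
    by rewrite (_ : (fun x => limn _) = (fun x => g (w, x)))//; apply/funext => x; apply/cvg_lim.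
  have ndk w : nondecreasing_seq (fun n => \int[k w]_x f n (w, x)).
    move=> a b ab; apply: ge0_le_integral => //; [exact: ms|exact: ms|].
    by move=> x _; exact: ndf.
  have h2 : \int[P]_w (V w * \int[k w]_x f n (w, x)) @[n --> \oo] -->
      \int[P]_w (V w * \int[k w]_x g (w, x)).
    have := @cvg_monotone_convergence _ _ R P setT measurableT (fun n w => V w * \int[k w]_x f n (w, x))
      (fun n => mi _ (f0 n) (mf n)) (fun n w _ => gi _ w (f0 n))
      (fun w _ a b ab => lee_wpmul2l (V0 w) (ndk w a b ab)).
    rewrite (_ : (fun x => limn _) = (fun w => V w * \int[k w]_x g (w, x)))//.
    by apply/funext => w; apply/cvg_lim => //; exact: cvgeZl.
  apply: (cvg_unique _ h1) => //.
  by rewrite /mkset (_ : (fun n => \int[m]_z f n z) = (fun n => \int[P]_w (V w * \int[k w]_x f n (w, x))))//; apply/funext.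
Qed.

End finite_random_measure.

Section independence_expectation.
Context {R : realType} {d : measure_display} {W : measurableType d}.
Variable P : probability W R.

(** The joint law of two independent variables is the product of their laws, to which Tonelli's
    theorem applies. *)
Lemma expectation_indep (X Y : W -> \bar R) :
  (forall w, 0 <= X w) -> (forall w, 0 <= Y w) ->
  mfunT X -> mfunT Y ->
  (forall A B, measurable A -> measurable B ->
     P (X @^-1` A `&` Y @^-1` B) = P (X @^-1` A) * P (Y @^-1` B)) ->
  \int[P]_w (X w * Y w) = \int[P]_w X w * \int[P]_w Y w.
Proof.
move=> X0 Y0 mX mY XY.
pose mX' := isMeasurableFun.Build _ _ _ _ _ mX.
pose mY' := isMeasurableFun.Build _ _ _ _ _ mY.
pose X' : {mfun W >-> \bar R} := HB.pack X mX'.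
pose Y' : {mfun W >-> \bar R} := HB.pack Y mY'.
pose PX := distribution P X'; pose PY := distribution P Y'.
have mXY : mfunT (fun w => (X w, Y w)) by exact/measurable_fun_pair.
(* The absolute values make the integrand nonnegative everywhere and change nothing on the range of
   [X] and [Y]. *)
pose f (z : \bar R * \bar R) := `|z.1| * `|z.2|.
have mf : mfunT f.
  by apply: emeasurable_funM; exact: measurableT_comp.
have f0 z : 0 <= f z by rewrite mule_ge0.
have e1 : \int[P]_w (X w * Y w) = \int[pushforward P (fun w => (X w, Y w))]_z f z.
  rewrite (ge0_integral_pushforward mXY P measurableT mf)//.
  by apply: eq_integral => w _; rewrite /f/= !gee0_abs.
have e2 : \int[pushforward P (fun w => (X w, Y w))]_z f z = \int[(PX \x PY)%E]_z f z.
  apply: eq_measure_integral => A mA _; apply/esym.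
  apply: (@product_measure_unique _ _ _ _ _ PX PY (pushforward P (fun w => (X w, Y w))) _ A mA).
  by move=> B1 B2 mB1 mB2; exact: XY.
have eX : \int[PX]_x `|x| = \int[P]_w X w.
  rewrite ge0_integral_distribution//.
  by apply: eq_integral => w _ /=; rewrite gee0_abs.
have eY : \int[PY]_x `|x| = \int[P]_w Y w.
  rewrite ge0_integral_distribution//.
  by apply: eq_integral => w _ /=; rewrite gee0_abs.
rewrite e1 e2 fubini_tonelli1// -eX -eY /fubini_F /f/=.
under eq_integral do rewrite ge0_integralZl//.
rewrite ge0_integralZr//; last by apply: integral_ge0.
Qed.

End independence_expectation.

(** * Moments of Poisson variables *)

Section poisson_moments.
Context {R : realType} {d : measure_display} {W : measurableType d}.
Variable P : probability W R.
Variables (X : W -> \bar R) (m : R).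
Hypotheses (mX : mfunT X) (m0 : (0 <= m)%R).
Hypothesis XP : forall k : nat, P [set w | X w = k%:R%:E] = poisson_prob m 0 [set k].

(** The atoms at the integers already carry the total mass 1. *)
Lemma poisson_law_nat : {ae P, forall w, exists k : nat, X w = k%:R%:E}.
Proof.
have mS k : measurable [set w | X w = k%:R%:E].
  rewrite -[X in measurable X]setTI; exact: (mX measurableT (emeasurable_set1 _)).
have PT : P (\bigcup_k [set w | X w = k%:R%:E]) = 1.
  rewrite measure_bigcup//; last first.
    move=> i j _ _ [w [/= -> [h]]]; apply/eqP; by rewrite -(eqr_nat R) h.
  rewrite (eq_eseriesr (fun k _ => XP k)).
  rewrite -measure_bigcup//; last first.
    by move=> i j _ _ [w [/= -> ->]].
  rewrite [X in poisson_prob m 0 X = _](_ : _ = setT) ?probability_setT//.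
  by rewrite -subTset => n _; exists n.
exists (~` (\bigcup_k [set w | X w = k%:R%:E])); split.
- by apply: measurableC; exact: bigcupT_measurable.
- by rewrite probability_setC ?PT ?subee//; exact: bigcupT_measurable.
- by move=> w /= h [k _ /= Xk]; apply: h; exists k.
Qed.

Lemma poisson_expectation_comp (f : nat -> R) (g : \bar R -> \bar R) :
  (forall k, 0 <= f k)%R -> (forall k, g k%:R%:E = (f k)%:E) ->
  mfunT (fun w => g (X w)) -> (forall w, 0 <= g (X w)) ->
  \int[P]_w g (X w) = \sum_(k <oo) ((f k)%:E * poisson_prob m 0 [set k]).
Proof.
move=> f0 gf mg g0.
have mS k : measurable [set w | X w = k%:R%:E].
  rewrite -[X in measurable X]setTI; exact: (mX measurableT (emeasurable_set1 _)).
have ae : ae_eq P setT (fun w => g (X w)) (fun w => \sum_(k <oo) ((f k)%:E * (\1_[set w | X w = k%:R%:E] w)%:E)).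
  apply: filterS poisson_law_nat => w [k Xk] _.
  rewrite (nneseriesD1 (n := k))//; last by move=> n _; rewrite mule_ge0// lee_fin.
  rewrite indicE mem_set// mule1 Xk gf eseries0 ?adde0// => n _ /andP[_ nk].
  rewrite indicE memNset ?mule0//= Xk => -[h]; move/eqP: nk; apply.
  by apply/eqP; rewrite -(eqr_nat R) h.
rewrite (ge0_ae_eq_integral measurableT mg _ (fun w _ => g0 w) _ ae); last 2 first.
- apply: ge0_emeasurable_sum => [k w _ _|k _]; first by rewrite mule_ge0// lee_fin.
  by apply: measurable_funeM; exact/measurable_EFinP.
- by move=> w _; apply: nneseries_ge0 => k _ _; rewrite mule_ge0// lee_fin.
rewrite integral_nneseries//; last 2 first.
- by move=> k; apply: measurable_funeM; exact/measurable_EFinP.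
- by move=> k w _; rewrite mule_ge0// lee_fin.
apply: eq_eseriesr => k _.
have m1 : mfunT (fun w => (\1_[set w | X w = k%:R%:E] w)%:E : \bar R).
  by meas.
have i0 w : setT w -> 0 <= (\1_[set w | X w = k%:R%:E] w)%:E :> \bar R by rewrite lee_fin.
rewrite (ge0_integralZl_EFin _ measurableT i0 m1 (f0 k)).
by rewrite integral_indic// setIT -XP.
Qed.

Lemma poisson_sum1 : \sum_(k <oo) poisson_prob m 0 [set k] = 1.
Proof.
have e : (setT : set nat) = \bigcup_n [set n].
  by apply/esym; rewrite -subTset => n _; exists n.
transitivity (poisson_prob m 0 (\bigcup_n [set n])); last first.
  by rewrite -e; exact: probability_setT.
rewrite measure_bigcup//; last by move=> i j _ _ [w [/= -> ->]].
by apply: eq_eseriesl => i; rewrite in_setT.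
Qed.

(** Shifting the index of the series with this recursion yields both moments below. The case [m = 0]
    is apart because the law is then a Dirac mass. *)
Lemma poisson_prob_succ (k : nat) : k.+1%:R%:E * poisson_prob m 0 [set k.+1] = m%:E * poisson_prob m 0 [set k].
Proof.
rewrite /poisson_prob; case: ifPn => [mp|].
  rewrite !esum_set1 ?lee_fin ?poisson_pmf_ge0// -!EFinM /poisson_pmf mp; congr EFin.
  rewrite exprS factS natrM; field.
  by rewrite pnatr_eq0 -lt0n fact_gt0 /= nat1r pnatr_eq0.
rewrite -leNgt => mn; have -> : m = 0%R by apply/eqP; rewrite eq_le mn m0.
by rewrite mul0e /dirac indicE memNset ?mule0//.
Qed.

Lemma poisson_expectation : (forall w, 0 <= X w) -> \int[P]_w X w = m%:E.
Proof.
move=> X0; rewrite (@poisson_expectation_comp (fun k => k%:R%R) id)//.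
rewrite nneseries_recl//; last by move=> k _; rewrite mule_ge0// lee_fin.
rewrite mul0e add0e -(nneseries_addn 1)//; last by move=> k; rewrite mule_ge0// lee_fin.
under eq_eseriesr do rewrite addn1.
rewrite (eq_eseriesr (fun k _ => poisson_prob_succ k)) nneseriesZl//.
by rewrite poisson_sum1 mule1.
Qed.

Lemma poisson_second_moment : (forall w, 0 <= X w) -> \int[P]_w (X w * X w) = (m ^+ 2 + m)%:E.
Proof.
move=> X0; rewrite (@poisson_expectation_comp (fun k => k%:R ^+ 2)%R (fun x => x * x))//; last 2 first.
- exact: emeasurable_funM.
- by move=> w; rewrite mule_ge0.
rewrite nneseries_recl//; last by move=> k _; rewrite mule_ge0// lee_fin.
rewrite expr0n mul0e add0e -(nneseries_addn 1)//; last by move=> k; rewrite mule_ge0// lee_fin.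
under eq_eseriesr do rewrite addn1.
have h k : ((k.+1%:R ^+ 2)%R)%:E * poisson_prob m 0 [set k.+1] = 
   m%:E * (k%:R%:E * poisson_prob m 0 [set k]) + m%:E * poisson_prob m 0 [set k].
  rewrite expr2 EFinM -muleA poisson_prob_succ muleCA.
  by rewrite -natr1 EFinD ge0_muleDl// mul1e ge0_muleDr// mule_ge0.
rewrite (eq_eseriesr (fun k _ => h k)) nneseriesD//; last 2 first.
- by move=> k _ _; rewrite !mule_ge0// lee_fin.
- by move=> k _ _; rewrite !mule_ge0// lee_fin.
rewrite !nneseriesZl//; last by move=> k _; rewrite mule_ge0.
rewrite poisson_sum1 mule1.
have := poisson_expectation X0; rewrite (@poisson_expectation_comp (fun k => k%:R%R) id)// => ->.
by rewrite -EFinM -EFinD expr2.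
Qed.

End poisson_moments.

Section sigma_expectation.
Context {R : realType} {d : measure_display} {W : measurableType d}.
Variable P : probability W R.

Lemma independent_systems_expectation (G1 G2 : set (set W)) (X Y : W -> \bar R) :
  sigma_algebra setT G1 -> sigma_algebra setT G2 -> G1 `<=` measurable -> G2 `<=` measurable ->
  independent_systems P G1 G2 ->
  (forall w, 0 <= X w) -> (forall w, 0 <= Y w) ->
  mfunT (X : sigmaT G1 -> \bar R) ->
  mfunT (Y : sigmaT G2 -> \bar R) ->
  \int[P]_w (X w * Y w) = \int[P]_w X w * \int[P]_w Y w.
Proof.
move=> s1 s2 m1 m2 ind X0 Y0 mX mY.
apply: expectation_indep => //; try exact: sub_sigma_mfun.
- exact: (sub_sigma_mfun m1).
- exact: (sub_sigma_mfun m2).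
move=> A B mA mB; apply: ind.
- by have := mX measurableT A mA; rewrite setTI => h; rewrite -(sigma_algebra_id s1).
- by have := mY measurableT B mB; rewrite setTI => h; rewrite -(sigma_algebra_id s2).
Qed.

End sigma_expectation.

(** * Rectangles in the plane of times and marks *)

Section rectangles.
Context {R : realType}.
Local Notation leb := (@lebesgue_measure R).

Definition leb2 : {measure set (plane R) -> \bar R} := (leb \x leb)%E.
Definition past_zone (t : R) : set (plane R) := `[0%R, t] `*` `[0%R, +oo[.
Definition future_zone (t : R) : set (plane R) := `]t, +oo[ `*` `[0%R, +oo[.
Definition band (u v z z' : R) : set (plane R) := `]u, v] `*` `]z, z'].
Definition rect (u v z : R) : set (plane R) := `]u, v] `*` `[0%R, z].

Lemma measurable_rect u v z : measurable (rect u v z).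
Proof. by apply: measurableX; exact: measurable_itv. Qed.

Lemma leb_oc (u v : R) : (u <= v)%R -> leb `]u, v] = (v - u)%:E.
Proof.
move=> uv; have := @lebesgue_measure_itv R `]u, v] => ->; rewrite /= lte_fin.
case: ltP => [_|vu]; first by rewrite EFinB.
by have -> : v = u; [apply/eqP; rewrite eq_le uv vu|rewrite subrr].
Qed.

Lemma leb_cc (u v : R) : (u <= v)%R -> leb `[u, v] = (v - u)%:E.
Proof.
move=> uv; have := @lebesgue_measure_itv R `[u, v] => ->; rewrite /= lte_fin.
case: ltP => [_|vu]; first by rewrite EFinB.
by have -> : v = u; [apply/eqP; rewrite eq_le uv vu|rewrite subrr].
Qed.

Lemma leb_rect u v z : (u <= v)%R -> (0 <= z)%R -> leb2 (rect u v z) = ((v - u) * z)%:E.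
Proof.
move=> uv z0; rewrite -[leb2 _]/((leb \x leb)%E (_ `*` _)) product_measure1E; [|exact: measurable_itv..].
by rewrite -[X in _ * X]/(leb `[0%R, z]) -[X in X * _]/(leb `]u, v]) leb_oc// leb_cc// subr0.
Qed.

Lemma leb_band u v z z' : (u <= v)%R -> (z <= z')%R ->
  leb2 (band u v z z') = ((v - u) * (z' - z))%:E.
Proof.
move=> uv zz; rewrite -[leb2 _]/((leb \x leb)%E (_ `*` _)) product_measure1E; [|exact: measurable_itv..].
by rewrite -[X in _ * X]/(leb `]z, z']) -[X in X * _]/(leb `]u, v]) !leb_oc.
Qed.

Lemma rect_time_split u c v z : (u <= c)%R -> (c <= v)%R -> rect u v z = rect u c z `|` rect c v z.
Proof.
move=> uc cv; apply/seteqP; split => -[x y] /=; rewrite /rect/= !in_itv/=.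
  by move=> [/andP[ux xv] h]; have [xc|cx] := leP x c; [left|right]; split => //; lra.
by case=> -[/andP[? ?] ?]; split => //; lra.
Qed.

Lemma rect_time_disj u c v z : [disjoint rect u c z & rect c v z].
Proof.
apply/disj_setPS => -[x y] [] [/= h _] [/= h' _]; move: h h'; rewrite !in_itv/=; lra.
Qed.

Lemma rect_mark_split u v z z' : (0 <= z)%R -> (z <= z')%R ->
  rect u v z' = rect u v z `|` band u v z z'.
Proof.
move=> z0 zz; apply/seteqP; split => -[x y] /=; rewrite /rect /band/= !in_itv/=.
  by move=> [h /andP[ux xv]]; have [xc|cx] := leP y z; [left|right]; split => //; lra.
by case=> -[? /andP[? ?]]; split => //; lra.
Qed.

Lemma rect_mark_disj u v z z' : [disjoint rect u v z & band u v z z'].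
Proof.
apply/disj_setPS => -[x y] [] [/= _ h] [/= _ h']; move: h h'; rewrite !in_itv/=; lra.
Qed.

End rectangles.

Lemma mule_expand {R : realType} (c a x b y : \bar R) : 0 <= c -> 0 <= a -> 0 <= x -> 0 <= b -> 0 <= y ->
  c * ((a + x) * (b + y)) = c * (a * b) + c * a * y + c * b * x + c * (x * y).
Proof.
move=> c0 a0 x0 b0 y0.
rewrite ge0_muleDl// !ge0_muleDr ?adde_ge0 ?mule_ge0//.
rewrite -!muleA (muleC b x) -!addeA; congr (_ + (_ + _)).
Qed.

Lemma ge0_integralD4 {R : realType} {d : measure_display} {W : measurableType d}
    (m : {measure set W -> \bar R}) (f g h k : W -> \bar R) :
  (forall w, 0 <= f w) -> (forall w, 0 <= g w) -> (forall w, 0 <= h w) -> (forall w, 0 <= k w) ->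
  mfunT f -> mfunT g -> mfunT h -> mfunT k ->
  \int[m]_w (f w + g w + h w + k w) =
  \int[m]_w f w + \int[m]_w g w + \int[m]_w h w + \int[m]_w k w.
Proof.
move=> f0 g0 h0 k0 mf mg mh mk.
have mfg : mfunT (f \+ g) by meas.
have mfgh : mfunT ((f \+ g) \+ h) by meas.
by rewrite ge0_integralD//= 1?ge0_integralD//= ?ge0_integralD// => w _; rewrite /= ?adde_ge0.
Qed.

(** * Covariances of the Poisson measures on rectangles, given the past *)

Section poisson_family.
Context {R : realType} {dO : measure_display} {W : measurableType dO}.
Variables (P : probability W R) (F : R -> set (set W)).
Context {I : choiceType}.
Variable N : I -> R.-ker W ~> plane R.
Hypotheses (hF : filtration F) (hN : iid_poisson_measures P F N).
Local Notation leb := (@lebesgue_measure R).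

Lemma filtration_id t : (0 <= t)%R -> <<s F t >> = F t.
Proof. by move=> t0; apply: sigma_algebra_id; exact: (filtration_sigma_algebra hF). Qed.

Definition future i u := sigma_random_measure (N i) (future_zone u).

Lemma sigma_random_measure_sub i D : sigma_random_measure (N i) D `<=` measurable.
Proof.
apply: smallest_sub; first exact: sigma_algebra_measurable.
move=> _ [A [mA _ [B mB <-]]]; rewrite setTI.
by rewrite -[X in measurable X]setTI; apply: (measurable_kernel (N i) A).
Qed.

Lemma sigma_random_measure_sigma i D : sigma_algebra setT (sigma_random_measure (N i) D).
Proof. exact: smallest_sigma_algebra. Qed.

Lemma sigma_random_measure_fun i (D A : set (plane R)) (G : set (set W)) : measurable A -> A `<=` D ->
  sigma_random_measure (N i) D `<=` G ->
  mfunT ((fun w => N i w A) : sigmaT G -> \bar R).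
Proof.
move=> mA AD DG _ B mB; apply: sub_sigma_algebra; apply: DG; apply: sub_sigma_algebra.
by exists A; split => //; exists B.
Qed.

Lemma past_measurable i A t : measurable A -> (0 <= t)%R -> A `<=` past_zone t ->
  mfunT ((fun w => N i w A) : sigmaT (F t) -> \bar R).
Proof.
move=> mA t0 AD; apply: (sigma_random_measure_fun mA AD).
by have [/(_ i) hi _] := hN; exact: (adapted_poisson_past hi).
Qed.

Lemma future_measurable i A t : measurable A -> A `<=` future_zone t ->
  mfunT ((fun w => N i w A) : sigmaT (future i t) -> \bar R).
Proof. by move=> mA AD; exact: (sigma_random_measure_fun mA AD). Qed.

Lemma past_future_expectation i t (X Y : W -> \bar R) : (0 <= t)%R ->
  (forall w, 0 <= X w) -> (forall w, 0 <= Y w) ->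
  mfunT (X : sigmaT (F t) -> \bar R) ->
  mfunT (Y : sigmaT (future i t) -> \bar R) ->
  \int[P]_w (X w * Y w) = \int[P]_w X w * \int[P]_w Y w.
Proof.
move=> t0; apply: independent_systems_expectation.
- exact: (filtration_sigma_algebra hF).
- exact: sigma_random_measure_sigma.
- exact: (filtration_measurable hF).
- exact: sigma_random_measure_sub.
- by have [/(_ i) hi _] := hN; exact: (adapted_poisson_future hi).
Qed.

Lemma sub_quadrant (A B : set R) : A `<=` `[0%R, +oo[ -> B `<=` `[0%R, +oo[ -> A `*` B `<=` quadrant R.
Proof. by move=> hA hB [x y] [/= /hA ? /hB ?]. Qed.

Lemma rect_quadrant u v z : (0 <= u)%R -> rect u v z `<=` quadrant R.
Proof.
move=> u0; apply: sub_quadrant => x /=; rewrite !in_itv/= andbT; lra.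
Qed.

Lemma rect_future t u v z : (t <= u)%R -> rect u v z `<=` @future_zone R t.
Proof.
move=> tu [x y] [] /=; rewrite /future_zone/= !in_itv/= !andbT; lra.
Qed.

Lemma rect_past t u v z : (0 <= u)%R -> (v <= t)%R -> rect u v z `<=` @past_zone R t.
Proof.
move=> u0 vt [x y] [] /=; rewrite /past_zone/= !in_itv/= !andbT => h1 h2; lra.
Qed.

Lemma poisson_law i A m : measurable A -> A `<=` quadrant R -> leb2 A = m%:E ->
  forall k : nat, P [set w | N i w A = k%:R%:E] = poisson_prob m 0 [set k].
Proof.
move=> mA AQ Am k; have [/(_ i) hi _] := hN.
rewrite -[m]/(fine m%:E) -Am.
apply: (poisson_measure_law (adapted_poisson_poisson hi) mA AQ).
by rewrite [X in X < _]Am ltry.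
Qed.

Lemma intensity i A m : measurable A -> A `<=` quadrant R -> leb2 A = m%:E ->
  \int[P]_w N i w A = m%:E.
Proof.
move=> mA AQ Am; apply: poisson_expectation => //.
- exact: (measurable_kernel (N i) A).
- by rewrite -lee_fin -Am.
- exact: poisson_law.
Qed.

Lemma intensity2 i A m : measurable A -> A `<=` quadrant R -> leb2 A = m%:E ->
  \int[P]_w (N i w A * N i w A) = (m ^+ 2 + m)%:E.
Proof.
move=> mA AQ Am; apply: poisson_second_moment => //.
- exact: (measurable_kernel (N i) A).
- by rewrite -lee_fin -Am.
- exact: poisson_law.
Qed.

(** The pair is completed by empty sets into a disjoint sequence, over which a Poisson measure has
    independent values. *)
Lemma disjoint_expectation i A A' : measurable A -> measurable A' -> A `<=` quadrant R -> A' `<=` quadrant R ->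
  [disjoint A & A'] ->
  \int[P]_w (N i w A * N i w A') = \int[P]_w N i w A * \int[P]_w N i w A'.
Proof.
move=> mA mA' AQ AQ' dA; apply: expectation_indep => //; try exact: (measurable_kernel (N i)).
move=> B B' mB mB'.
pose C (n : nat) := if n == 0%N then A else if n == 1%N then A' else set0.
have [/(_ i) hi _] := hN.
have := poisson_measure_indep (adapted_poisson_poisson hi) (A := C).
have mC n : measurable (C n).
  by rewrite /C; case: ifP => // _; case: ifP => // _; exact: measurable0.
have CQ n : C n `<=` quadrant R by case: n => [|[|n]].
have tC : trivIset setT C.
  move=> [|[|a]] [|[|b]] _ _ [x [/= xa xb]] //.
  - by move/disj_setPS : dA => /(_ x); case.
  - by move/disj_setPS : dA => /(_ x); case.
move=> /(_ mC CQ tC [fset 0%N; 1%N]%fset (fun n => if n == 0%N then (fun w => N i w A) @^-1` B else (fun w => N i w A') @^-1` B')).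
rewrite big_fsetU1/= ?inE// big_seq_fset1/=.
rewrite (_ : \bigcap_(i in _) _ = (fun w => N i w A) @^-1` B `&` (fun w => N i w A') @^-1` B'); last first.
  apply/seteqP; split => w.
    move=> h; split; first by apply: (h 0%N); rewrite /= !inE.
    by apply: (h 1%N); rewrite /= !inE.
  by move=> [h1 h2] n /=; rewrite !inE => /orP[|] /eqP ->.
apply=> n; rewrite !inE => /orP[|] /eqP -> /=.
- by exists B => //; rewrite setTI.
- by exists B' => //; rewrite setTI.
Qed.

Lemma cross_expectation i j A A' : i != j -> measurable A -> measurable A' -> A `<=` quadrant R -> A' `<=` quadrant R ->
  \int[P]_w (N i w A * N j w A') = \int[P]_w N i w A * \int[P]_w N j w A'.
Proof.
move=> ij mA mA' AQ AQ'; apply: expectation_indep => //; try exact: (measurable_kernel (N _)).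
move=> B B' mB mB'; have [_] := hN.
move=> /(_ [fset i; j]%fset (fun n => if n == i then (fun w => N i w A) @^-1` B else (fun w => N j w A') @^-1` B')).
rewrite big_fsetU1/= ?inE ?(negbTE ij)// big_seq_fset1/= eqxx eq_sym (negbTE ij).
rewrite (_ : \bigcap_(i in _) _ = (fun w => N i w A) @^-1` B `&` (fun w => N j w A') @^-1` B'); last first.
  apply/seteqP; split => w.
    move=> h; split; first by have := h i; rewrite /= !inE eqxx; exact.
    by have := h j; rewrite /= !inE eqxx orbT eq_sym (negbTE ij); exact.
  by move=> [h1 h2] n /=; rewrite !inE => /orP[|] /eqP ->; rewrite ?eqxx// eq_sym (negbTE ij).
apply=> n; rewrite !inE => /orP[|] /eqP ->.
- by rewrite eqxx; apply: sub_sigma_algebra; exists A; split => //; exists B => //; rewrite setTI.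
- by rewrite eq_sym (negbTE ij); apply: sub_sigma_algebra; exists A'; split => //; exists B' => //; rewrite setTI.
Qed.

Lemma indic_past t C : F t C ->
  mfunT ((fun w => (\1_C w)%:E) : sigmaT (F t) -> \bar R).
Proof.
move=> FC; apply/measurable_EFinP; apply: measurable_indic.
exact: sub_sigma_algebra.
Qed.

Lemma integral_indic_past t C : (0 <= t)%R -> F t C -> \int[P]_w (\1_C w)%:E = P C.
Proof.
move=> t0 FC; rewrite integral_indic ?setIT//.
exact: (filtration_measurable hF t0).
Qed.

Lemma band_quadrant u v z z' : (0 <= u)%R -> (0 <= z)%R -> @band R u v z z' `<=` quadrant R.
Proof.
by move=> u0 z0; apply: sub_quadrant => x /=; rewrite !in_itv/= andbT; lra.
Qed.

Lemma measurable_band u v z z' : measurable (@band R u v z z').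
Proof. by apply: measurableX; exact: measurable_itv. Qed.

Lemma intensity_rect i u v z : (0 <= u)%R -> (u <= v)%R -> (0 <= z)%R ->
  \int[P]_w N i w (rect u v z) = ((v - u) * z)%:E.
Proof.
move=> u0 uv z0; apply: intensity; [exact: measurable_rect|exact: rect_quadrant|exact: leb_rect].
Qed.

Lemma past_rect_expectation j t v z (X : W -> \bar R) : (0 <= t)%R -> (t <= v)%R -> (0 <= z)%R ->
  (forall w, 0 <= X w) ->
  mfunT (X : sigmaT (F t) -> \bar R) ->
  \int[P]_w (X w * N j w (rect t v z)) = \int[P]_w X w * ((v - t) * z)%:E.
Proof.
move=> t0 tv z0 X0 mX; rewrite -(intensity_rect j t0 tv z0).
apply: (@past_future_expectation j t) => //.
by apply: future_measurable; [exact: measurable_rect|exact: rect_future].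
Qed.

(** The taller rectangle is the union of the lower one and a disjoint band, so that the covariance
    is the variance over the lower rectangle. *)
Lemma same_rect_expectation i u v z z' : (0 <= u)%R -> (u <= v)%R -> (0 <= z)%R -> (0 <= z')%R ->
  \int[P]_w (N i w (rect u v z) * N i w (rect u v z')) =
  (((v - u) * z) * ((v - u) * z') + (v - u) * Num.min z z')%:E.
Proof.
move=> u0 uv; wlog zz' : z z' / (z <= z')%R => [H z0 z'0|z0 z'0].
  have [zz|/ltW zz] := leP z z'; first by rewrite H// min_l.
  by under eq_integral do rewrite muleC; rewrite H// min_l//; congr EFin; rewrite mulrC.
have mr q : measurable (rect u v q) by exact: measurable_rect.
have mb : measurable (band u v z z') by exact: measurable_band.
have e w : N i w (rect u v z') = N i w (rect u v z) + N i w (band u v z z').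
  by rewrite (rect_mark_split u v z0 zz') measureU//; apply/disj_set2P; exact: rect_mark_disj.
under eq_integral do rewrite e ge0_muleDr//.
rewrite ge0_integralD//; last 2 first.
- by apply: emeasurable_funM; exact: (measurable_kernel (N i)).
- by apply: emeasurable_funM; exact: (measurable_kernel (N i)).
rewrite (@intensity2 _ _ ((v - u) * z)%R)//; [|exact: rect_quadrant|exact: leb_rect].
rewrite disjoint_expectation//; [|exact: rect_quadrant|exact: band_quadrant|exact: rect_mark_disj].
rewrite intensity_rect// (@intensity _ _ ((v - u) * (z' - z))%R)//; [|exact: band_quadrant|exact: leb_band].
by rewrite -EFinM -EFinD min_l//; congr EFin; ring.
Qed.

Lemma diag_expectation_same i C u v z z' : (0 <= u)%R -> (u <= v)%R -> (0 <= z)%R -> (0 <= z')%R -> F u C ->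
  \int[P]_w ((\1_C w)%:E * (N i w (rect u v z) * N i w (rect u v z'))) =
  P C * (((v - u) * z) * ((v - u) * z') + (v - u) * Num.min z z')%:E.
Proof.
move=> u0 uv z0 z'0 FC.
rewrite (@past_future_expectation i u)//; first by rewrite (integral_indic_past u0 FC) same_rect_expectation.
- exact: indic_past.
- by apply: emeasurable_funM; apply: future_measurable; (try exact: measurable_rect); exact: rect_future.
Qed.

(** [F u] is independent of the future of [N i] and of the future of [N j] separately, and [N i],
    [N j] are independent of each other; pairwise independence does not factor a triple product. The
    interval is therefore cut into [n] cells: products over distinct cells factor one by one through
    adaptedness, and products within a cell, bounded by dropping the indicator, add up to order
    [1 / n]. *)
Lemma diag_expectation_cross i j C u v z z' : i != j ->
  (0 <= u)%R -> (u <= v)%R -> (0 <= z)%R -> (0 <= z')%R -> F u C ->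
  \int[P]_w ((\1_C w)%:E * (N i w (rect u v z) * N j w (rect u v z'))) =
  P C * (((v - u) * z) * ((v - u) * z'))%:E.
Proof.
move=> ij u0 uv z0 z'0 FC.
have mC : measurable C by exact: (filtration_measurable hF u0).
have m1 : mfunT (fun w => (\1_C w)%:E : \bar R) by meas.
have mN l x y q : mfunT (fun w => N l w (rect x y q)).
  by apply: (measurable_kernel (N l)); exact: measurable_rect.
have c0 w : 0 <= (\1_C w)%:E :> \bar R by rewrite lee_fin.
have PC : P C \is a fin_num by exact: fin_num_measure.
pose p := fine (P C); have pE : P C = p%:E by rewrite fineK.
pose S t := \int[P]_w ((\1_C w)%:E * (N i w (rect u t z) * N j w (rect u t z'))).
(* After [k] cells of length [dl], every cell has contributed an error of at most
   [dl * z * (dl * z')]. *)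
have step (dl : R) (k : nat) : (0 <= dl)%R -> exists2 e : R, S (u + k%:R * dl)%R = e%:E &
   (`|e - p * (k%:R * dl * z * (k%:R * dl * z'))| <= k%:R * (dl * z * (dl * z')))%R.
  move=> dl0; elim: k => [|k [e SE he]].
    exists 0%R; last by rewrite !mul0r mulr0 subr0 normr0.
    rewrite /S mul0r addr0 integral0_eq// => w _.
    have -> : rect u u z = set0.
      by apply/seteqP; split => // -[x y] [/=]; rewrite in_itv/=; lra.
    by rewrite measure0 mul0e mule0.
  set t := (u + k%:R * dl)%R in SE.
  have ut : (u <= t)%R by rewrite lerDl mulr_ge0.
  have t0 : (0 <= t)%R by exact: le_trans ut.
  have -> : (u + k.+1%:R * dl)%R = (t + dl)%R by rewrite /t -natr1; ring.
  have tt : (t <= t + dl)%R by rewrite lerDl.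
  have FtC : F t C by exact: (filtration_nondecreasing hF u0 ut).
  have sp l q w : N l w (rect u (t + dl)%R q) = N l w (rect u t q) + N l w (rect t (t + dl)%R q).
    rewrite (rect_time_split q ut tt) measureU//; [exact: measurable_rect|exact: measurable_rect|].
    by apply/disj_set2P; exact: rect_time_disj.
  have E1 : \int[P]_w ((\1_C w)%:E * N i w (rect u t z) * N j w (rect t (t + dl)%R z')) =
      (p * (k%:R * dl * z) * (dl * z'))%:E.
    rewrite past_rect_expectation//; last first.
      apply: emeasurable_funM; first exact: indic_past.
      by apply: past_measurable => //; [exact: measurable_rect|exact: rect_past].
    rewrite past_rect_expectation//; last exact: indic_past.
    rewrite (integral_indic_past u0 FC) pE -!EFinM; congr EFin; rewrite /t; ring.
  have E2 : \int[P]_w ((\1_C w)%:E * N j w (rect u t z') * N i w (rect t (t + dl)%R z)) =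
      (p * (k%:R * dl * z') * (dl * z))%:E.
    rewrite past_rect_expectation//; last first.
      apply: emeasurable_funM; first exact: indic_past.
      by apply: past_measurable => //; [exact: measurable_rect|exact: rect_past].
    rewrite past_rect_expectation//; last exact: indic_past.
    rewrite (integral_indic_past u0 FC) pE -!EFinM; congr EFin; rewrite /t; ring.
  (* The product within the new cell is not computed: its mean [Q] is only bounded by the mean
     without the indicator. *)
  pose Q := \int[P]_w ((\1_C w)%:E * (N i w (rect t (t + dl)%R z) * N j w (rect t (t + dl)%R z'))).
  have Q0 : 0 <= Q by apply: integral_ge0 => w _; rewrite !mule_ge0.
  have Q1 : Q <= ((dl * z) * (dl * z'))%:E.
    have -> : ((dl * z) * (dl * z'))%:E = \int[P]_w (N i w (rect t (t + dl)%R z) * N j w (rect t (t + dl)%R z')).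
      rewrite cross_expectation//; try exact: measurable_rect; try exact: rect_quadrant.
      by rewrite !intensity_rect// -EFinM; congr EFin; ring.
    apply: ge0_le_integral => //.
    - by meas.
    - exact: emeasurable_funM.
    - move=> w _; rewrite -[leRHS]mul1e; apply: lee_wpmul2r; first by rewrite mule_ge0.
      by rewrite lee_fin indicE; case: (_ \in _); rewrite ?ler01.
  have QE : Q = (fine Q)%:E by rewrite fineK// ge0_fin_numE// (le_lt_trans Q1)// ltry.
  move: Q0 Q1; rewrite QE !lee_fin; move: (fine Q) QE => q QE q0 q1.
  exists (e + p * (k%:R * dl * z) * (dl * z') + p * (k%:R * dl * z') * (dl * z) + q)%R.
    rewrite !EFinD -SE -E1 -E2 -QE /S /Q.
    have mM (f g : W -> \bar R) := @emeasurable_funM _ _ _ setT f g.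
    rewrite -ge0_integralD4//; try by [move=> w; rewrite ?mule_ge0|apply: (mM _ _ m1); exact: mM|apply: (mM _ _ (mM _ _ m1 _))].
    by apply: eq_integral => w _; rewrite !sp mule_expand.
  have p01 : (0 <= p <= 1)%R by rewrite -!lee_fin -pE measure_ge0 probability_le1.
  set B := (dl * z * (dl * z'))%R in q1 he *.
  have -> : (e + p * (k%:R * dl * z) * (dl * z') + p * (k%:R * dl * z') * (dl * z) + q -
      p * (k.+1%:R * dl * z * (k.+1%:R * dl * z')) =
      (e - p * (k%:R * dl * z * (k%:R * dl * z'))) + (q - p * B))%R.
    by rewrite -natr1 /B; ring.
  apply: (le_trans (ler_normD _ _)); rewrite -natr1 mulrDl mul1r; apply: lerD => //.
  by rewrite ler_norml; apply/andP; split; nra.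
set M := ((v - u) * z * ((v - u) * z'))%R.
have M0 : (0 <= M)%R by rewrite /M !mulr_ge0// subr_ge0.
(* With [n.+1] cells the total error is at most [M / n.+1]; the discrepancy does not depend on [n],
   hence vanishes. *)
have h n : exists2 e, S v = e%:E & (n.+1%:R * `|e - p * M| <= M)%R.
  have n0 : (n.+1%:R : R) != 0%R by rewrite pnatr_eq0.
  have [|e] := step ((v - u) / n.+1%:R)%R n.+1; first by rewrite divr_ge0// subr_ge0.
  have -> : (u + n.+1%:R * ((v - u) / n.+1%:R) = v)%R by field; rewrite addrC natr1.
  move=> Se; set A := (_ - _)%R; set C' := (_ * _)%R => hA; exists e => //.
  have -> : (e - p * M = A)%R by rewrite /A /M; field; rewrite addrC natr1.
  have -> : (M = n.+1%:R * C')%R by rewrite /C' /M; field; rewrite addrC natr1.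
  by rewrite ler_pM2l.
have [e Se _] := h 0%N.
rewrite -/(S v) Se pE -EFinM; congr EFin; apply/eqP; rewrite -subr_eq0 -normr_le0 leNgt; apply/negP => d0.
have [e' + /=] := h (Num.bound (M / `|e - p * M|)%R); rewrite Se => -[<-]; apply/negP; rewrite -ltNge.
rewrite -ltr_pdivrMr//; apply: (lt_le_trans (archi_boundP _)); first by rewrite divr_ge0// ltW.
by rewrite ler_nat.
Qed.

Lemma diag_expectation i j C u v z z' :
  (0 <= u)%R -> (u <= v)%R -> (0 <= z)%R -> (0 <= z')%R -> F u C ->
  \int[P]_w ((\1_C w)%:E * (N i w (rect u v z) * N j w (rect u v z'))) =
  P C * (((v - u) * z) * ((v - u) * z') + (i == j)%:R * ((v - u) * Num.min z z'))%:E.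
Proof.
move=> u0 uv z0 z'0 FC; have [->|ij] := eqVneq i j.
  by rewrite diag_expectation_same// mul1r.
by rewrite diag_expectation_cross// mul0r addr0.
Qed.

(* E[(1_B N^i(R)) (1_B' N^j(R'))] + E[1_B |R| 1_B' |R'|] equals the sum of the
   two mixed terms plus the bracket: this is the orthogonality relation between
   the compensated variables, in a form free of subtractions. *)
Lemma generator_isometry_le i j B B' u u' v z z' :
  (0 <= u)%R -> (u <= u')%R -> (u' <= v)%R -> (0 <= z)%R -> (0 <= z')%R -> F u B -> F u' B' ->
  let C := B `&` B' in
  \int[P]_w ((\1_C w)%:E * (N i w (rect u v z) * N j w (rect u' v z'))) +
  P C * (((v - u) * z) * ((v - u') * z'))%:E =
  \int[P]_w ((\1_C w)%:E * N i w (rect u v z)) * ((v - u') * z')%:E +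
  \int[P]_w ((\1_C w)%:E * N j w (rect u' v z')) * ((v - u) * z)%:E +
  P C * ((i == j)%:R * ((v - u') * Num.min z z'))%:E.
Proof.
move=> u0 uu uv z0 z'0 FB FB' C.
have u'0 : (0 <= u')%R by exact: le_trans uu.
have FC : F u' C.
  have [? ? ?] := filtration_sigma_algebra hF u'0.
  have FB2 := filtration_nondecreasing hF u0 uu FB.
  rewrite -(filtration_id u'0); apply: (@measurableI _ (sigmaT (F u'))); exact: sub_sigma_algebra.
have mC : measurable C by exact: (filtration_measurable hF u'0).
have m1 : mfunT (fun w => (\1_C w)%:E : \bar R) by meas.
have mN l x y q : mfunT (fun w => N l w (rect x y q)).
  by apply: (measurable_kernel (N l)); exact: measurable_rect.
have c0 w : 0 <= (\1_C w)%:E :> \bar R by rewrite lee_fin.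
have PC : P C \is a fin_num by exact: fin_num_measure.
have sp w : N i w (rect u v z) = N i w (rect u u' z) + N i w (rect u' v z).
  rewrite (rect_time_split z uu uv) measureU//; [exact: measurable_rect|exact: measurable_rect|].
  by apply/disj_set2P; exact: rect_time_disj.
have E1 : \int[P]_w ((\1_C w)%:E * N i w (rect u v z)) =
   \int[P]_w ((\1_C w)%:E * N i w (rect u u' z)) + P C * ((v - u') * z)%:E.
  rewrite -(integral_indic_past u'0 FC) -(past_rect_expectation i u'0 uv z0 c0 (indic_past FC)).
  rewrite -ge0_integralD//; try exact: emeasurable_funM.
  by apply: eq_integral => w _; rewrite sp ge0_muleDr.
have E2 : \int[P]_w ((\1_C w)%:E * (N i w (rect u v z) * N j w (rect u' v z'))) =
   \int[P]_w ((\1_C w)%:E * N i w (rect u u' z)) * ((v - u') * z')%:E +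
   P C * (((v - u') * z) * ((v - u') * z') + (i == j)%:R * ((v - u') * Num.min z z'))%:E.
  rewrite -diag_expectation// -(@past_rect_expectation j)//; last first.
    apply: emeasurable_funM; first exact: indic_past.
    by apply: past_measurable => //; [exact: measurable_rect|exact: rect_past].
  rewrite -ge0_integralD//; try by [move=> w _; rewrite !mule_ge0|repeat apply: emeasurable_funM].
  by apply: eq_integral => w _; rewrite sp ge0_muleDl// ge0_muleDr ?mule_ge0// muleA.
have E3 : \int[P]_w ((\1_C w)%:E * N j w (rect u' v z')) = P C * ((v - u') * z')%:E.
  by rewrite past_rect_expectation//; [rewrite (integral_indic_past u'0 FC)|exact: indic_past].
have fE : \int[P]_w ((\1_C w)%:E * N i w (rect u u' z)) \is a fin_num.
  rewrite ge0_fin_numE; last by apply: integral_ge0 => w _; rewrite mule_ge0.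
  apply: (@le_lt_trans _ _ ((u' - u) * z)%:E); last by rewrite ltry.
  rewrite -(intensity_rect i u0 uu z0); apply: ge0_le_integral => //.
  - exact: emeasurable_funM.
  - move=> w _; rewrite -[leRHS]mul1e; apply: lee_wpmul2r => //.
    by rewrite lee_fin indicE; case: (_ \in _); rewrite ?ler01.
rewrite E1 E2 E3; move: fE PC => /fineK <- /fineK <-.
move: (fine _) (fine _) => x p.
by rewrite -!(EFinM, EFinD); congr EFin; ring.
Qed.

End poisson_family.

(** * Densities, pi-systems and the abstract isometry *)

Section density.
Context {R : realType} {d : measure_display} {T : measurableType d}.
Variables (m m' : {measure set T -> \bar R}) (g : T -> R).
Hypotheses (g0 : forall x, (0 <= g x)%R) (mg : mfunT g).
Hypothesis mE : forall A, measurable A -> m A = \int[m']_(x in A) (g x)%:E.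

Let mg' : mfunT (fun x => (g x)%:E). Proof. exact/measurable_EFinP. Qed.
Let g0' x : 0 <= (g x)%:E. Proof. by rewrite lee_fin. Qed.

Lemma integral_density (f : T -> \bar R) : (forall x, 0 <= f x) -> mfunT f ->
  \int[m]_x f x = \int[m']_x (f x * (g x)%:E).
Proof.
move: f; apply: nonneg_measurable_ind.
- move=> A mA; rewrite integral_indic// setIT mE// integral_mkcond; apply: eq_integral => x _.
  by rewrite patchE indicE; case: (_ \in _); rewrite ?mul1e ?mul0e.
- move=> r f r0 f0 mf e; rewrite (ge0_integralZl_EFin _ measurableT (fun w _ => f0 w) mf r0) e.
  rewrite -ge0_integralZl_EFin//; last 2 first.
  + by move=> x _; rewrite mule_ge0.
  + exact: emeasurable_funM.
  by apply: eq_integral => x _; rewrite muleA.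
- move=> f h f0 h0 mf mh ef eh; rewrite (ge0_integralD _ measurableT (fun z _ => f0 z) mf (fun z _ => h0 z) mh).
  rewrite ef eh -ge0_integralD//; try (by move=> x _; rewrite mule_ge0); try exact: emeasurable_funM.
  by apply: eq_integral => x _; rewrite ge0_muleDl.
- move=> f h f0 mf nd lim e.
  have -> : h = fun x => limn (f ^~ x) by apply/funext => x; apply/esym/cvg_lim.
  rewrite monotone_convergence//.
  have -> : \int[m']_x (limn (f ^~ x) * (g x)%:E) = \int[m']_x limn (fun n => f n x * (g x)%:E).
    apply: eq_integral => x _; apply/esym/cvg_lim => //.
    rewrite (cvg_lim _ (lim x))//.
    by apply: cvgeZr.
  rewrite monotone_convergence//.
  + by congr (limn _); apply/funext.
  + by move=> n; exact: emeasurable_funM.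
  + by move=> n x _; rewrite mule_ge0.
  + by move=> x _ p q pq; apply: lee_wpmul2r => //; exact: nd.
Qed.

End density.

Section density_measure.
Context {R : realType} {d : measure_display} {T : measurableType d}.
Variables (m : {measure set T -> \bar R}) (g : T -> R).
Hypotheses (g0 : forall x, (0 <= g x)%R) (mg : mfunT g).

Let dens (A : set T) : \bar R := \int[m]_(x in A) (g x)%:E.

Let dens0 : dens set0 = 0. Proof. by rewrite /dens integral_set0. Qed.

Let dens_ge0 A : 0 <= dens A.
Proof. by apply: integral_ge0 => x _; rewrite lee_fin. Qed.

Let dens_sigma_additive : semi_sigma_additive dens.
Proof.
move=> U mU tU mUU; rewrite [X in _ --> X](_ : _ = \sum_(n <oo) dens (U n)); last first.
  rewrite /dens ge0_integral_bigcup//.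
  + by apply: measurable_funTS; exact/measurable_EFinP.
  + by move=> x _; rewrite lee_fin.
apply: is_cvg_nneseries => n _ _; exact: dens_ge0.
Qed.

Let dens_mixin := isMeasure.Build _ _ _ dens dens0 dens_ge0 dens_sigma_additive.
Definition density_measure : {measure set T -> \bar R} := HB.pack dens dens_mixin.

Lemma integral_density_measure (f : T -> \bar R) : (forall x, 0 <= f x) -> mfunT f ->
  \int[density_measure]_x f x = \int[m]_x (f x * (g x)%:E).
Proof. exact: integral_density. Qed.

End density_measure.

Section pi_system.
Context {R : realType} {d : measure_display} {T : measurableType d}.
Variable G : set (set T).
Hypotheses (Gm : G `<=` measurable) (GT : G setT) (GI : setI_closed G).

(** Finite measures that agree on a pi-system containing the whole space agree on the sigma-algebra
    that it generates. *)
Lemma pi_system_integral (m1 m2 : {measure set T -> \bar R}) (f : T -> \bar R) :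
  (forall A, G A -> m1 A = m2 A) -> m1 setT < +oo -> (forall x, 0 <= f x) ->
  mfunT (f : sigmaT G -> \bar R) ->
  \int[m1]_x f x = \int[m2]_x f x.
Proof.
move=> e fin f0 mf; apply: (@sub_sigma_integral _ _ _ G) => // A GA.
apply: (@g_sigma_algebra_measure_unique _ _ _ G Gm (fun=> setT)) => //.
by rewrite bigcup_const.
Qed.

End pi_system.

Lemma xsection_setT (T1 T2 : Type) (x : T1) : xsection [set: T1 * T2] x = setT.
Proof. by apply/seteqP; split => // y _; rewrite /xsection/= in_setT. Qed.

Lemma integral_mix_measure {R : realType} {d d' : measure_display} {W : measurableType d}
    {X : measurableType d'} (k : W -> {measure set X -> \bar R})
    (mk : forall U, measurable U -> mfunT (k ^~ U)) (kfin : forall w, k w setT < +oo)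
    (P : {measure set W -> \bar R}) (v : W -> R) (v0 : forall w, (0 <= v w)%R) (mv : mfunT v)
    (f : W * X -> \bar R) : (forall z, 0 <= f z) -> mfunT f ->
  \int[mix_measure mk kfin P v0 mv]_z f z = \int[P]_w ((v w)%:E * \int[k w]_x f (w, x)).
Proof. by apply: integral_mixture. Qed.

Section compensated_isometry.
Context {R : realType} {d d' : measure_display} {W : measurableType d} {X : measurableType d'}.
Variables (P : probability W R) (G : set (set (W * X))) (L : {measure set X -> \bar R}).
Hypotheses (Gm : G `<=` measurable) (GT : G setT) (GI : setI_closed G) (Lfin : L setT < +oo).

Let mL U : measurable U -> mfunT ((fun _ : W => L) ^~ U).
Proof. by move=> _; exact: measurable_cst. Qed.
Let Lfin' (w : W) : (fun _ : W => L) w setT < +oo. Proof. exact: Lfin. Qed.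
Let one0 (w : W) : (0 <= cst (1%R : R) w)%R. Proof. by []. Qed.
Let m_one : mfunT (cst (1%R : R) : W -> R). Proof. exact: measurable_cst. Qed.

Section one_step.
Variable k : W -> {measure set X -> \bar R}.
Hypothesis mk : forall U, measurable U -> mfunT (k ^~ U).
Hypothesis kfin : forall w, k w setT < +oo.
Variables (u v : W -> R) (h : W * X -> R).
Hypotheses (u0 : forall w, (0 <= u w)%R) (v0 : forall w, (0 <= v w)%R) (h0 : forall z, (0 <= h z)%R).
Hypotheses (mu : mfunT u) (mv : mfunT v) (mh : mfunT h).
Hypothesis base : forall A, G A ->
  \int[P]_w ((u w)%:E * k w (xsection A w)) + \int[P]_w ((v w)%:E * L (xsection A w)) =
  \int[P]_w ((v w)%:E * k w (xsection A w)) + \int[P]_w ((u w)%:E * L (xsection A w)) +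
  \int[P]_w \int[L]_x ((\1_A (w, x))%:E * (h (w, x))%:E).
Hypothesis ufin : \int[P]_w ((u w)%:E * k w setT) < +oo.
Hypothesis vfin : \int[P]_w ((v w)%:E * L setT) < +oo.

(** Each side is the integral of [f] against one measure on the product space, built from [u] and
    [v] as mixtures and from [h] as a density. By [base] the two measures agree on the pi-system
    [G], hence on what it generates. *)
Lemma bilinear_step (f : W * X -> \bar R) : (forall z, 0 <= f z) ->
  mfunT (f : sigmaT G -> \bar R) ->
  \int[P]_w ((u w)%:E * \int[k w]_x f (w, x)) + \int[P]_w ((v w)%:E * \int[L]_x f (w, x)) =
  \int[P]_w ((v w)%:E * \int[k w]_x f (w, x)) + \int[P]_w ((u w)%:E * \int[L]_x f (w, x)) +
  \int[P]_w \int[L]_x (f (w, x) * (h (w, x))%:E).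
Proof.
move=> f0 mf.
have mf' : mfunT f by exact: (sub_sigma_mfun Gm).
have mL1 := integral_mix_measure mL Lfin' P one0 m_one.
pose m1 := measure_add (mix_measure mk kfin P u0 mu) (mix_measure mL Lfin' P v0 mv).
pose m3 := density_measure (mix_measure mL Lfin' P one0 m_one) h0 mh.
pose m2 := measure_add (measure_add (mix_measure mk kfin P v0 mv) (mix_measure mL Lfin' P u0 mu)) m3.
have iL g : (forall z, 0 <= g z) -> mfunT g ->
    \int[m3]_z g z = \int[P]_w \int[L]_x (g (w, x) * (h (w, x))%:E).
  move=> g0 mg; rewrite integral_density_measure// mL1//.
  - by apply: eq_integral => w _; rewrite mul1e.
  - by move=> z; rewrite mule_ge0// lee_fin.
  - by meas.
have m2E A : m2 A = mix_measure mk kfin P v0 mv A + mix_measure mL Lfin' P u0 mu A + m3 A.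
  by rewrite [LHS]measure_addE; congr (_ + _); exact: measure_addE.
have e A : G A -> m1 A = m2 A.
  move=> GA; rewrite m2E /m1 measure_addE !mix_measureE base//; congr (_ + _).
  have -> : m3 A = \int[m3]_z (\1_A z)%:E by rewrite integral_indic ?setIT//; exact: Gm.
  rewrite iL//.
  by apply/measurable_EFinP; apply: measurable_indic; exact: Gm.
have fin : m1 setT < +oo.
  rewrite /m1 measure_addE !mix_measureE lte_add_pinfty//.
  - by under eq_integral do rewrite xsection_setT.
  - by under eq_integral do rewrite xsection_setT.
have := pi_system_integral Gm GT GI e fin f0 mf.
rewrite ge0_integral_measure_add// !integral_mix_measure// => ->.
rewrite ge0_integral_measure_add//.
rewrite ge0_integral_measure_add//.
by rewrite !integral_mix_measure// iL.
Qed.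

End one_step.

Variables k1 k2 : W -> {measure set X -> \bar R}.
Hypothesis mk1 : forall U, measurable U -> mfunT (k1 ^~ U).
Hypothesis mk2 : forall U, measurable U -> mfunT (k2 ^~ U).
Hypotheses (kfin1 : forall w, k1 w setT < +oo) (kfin2 : forall w, k2 w setT < +oo).
Variable c : R.
Hypothesis c0 : (0 <= c)%R.
Hypothesis gen : forall A A', G A -> G A' ->
  \int[P]_w (k1 w (xsection A w) * k2 w (xsection A' w)) +
  \int[P]_w (L (xsection A w) * L (xsection A' w)) =
  \int[P]_w (k1 w (xsection A w) * L (xsection A' w)) +
  \int[P]_w (L (xsection A w) * k2 w (xsection A' w)) +
  c%:E * \int[P]_w L (xsection (A `&` A') w).
Hypothesis mom12 : \int[P]_w (k1 w setT * k2 w setT) < +oo.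

Let bounded_integral (m : {measure set X -> \bar R}) (f : W * X -> R) (M : R) w :
  m setT < +oo -> (forall z, 0 <= f z <= M)%R -> mfunT f ->
  \int[m]_x (f (w, x))%:E <= M%:E * m setT.
Proof.
move=> mfin fM mf; rewrite -integral_cst//; apply: ge0_le_integral => //.
- by move=> x _; rewrite lee_fin; case/andP: (fM (w, x)).
- by apply/measurable_EFinP; exact: measurableT_comp.
- by move=> x _; rewrite lee_fin; case/andP: (fM (w, x)).
Qed.

Let fin_integral (m : {measure set X -> \bar R}) (f : W * X -> R) (M : R) w :
  m setT < +oo -> (forall z, 0 <= f z <= M)%R -> mfunT f ->
  (fine (\int[m]_x (f (w, x))%:E))%:E = \int[m]_x (f (w, x))%:E.
Proof.
move=> mfin fM mf; rewrite fineK// ge0_fin_numE.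
  apply: (le_lt_trans (bounded_integral w mfin fM mf)); rewrite lte_mul_pinfty//.
  by have /andP[h1 h2] := fM (w, point); rewrite lee_fin (le_trans h1).
by apply: integral_ge0 => x _; rewrite lee_fin; case/andP: (fM (w, x)).
Qed.

Let fin_measure (m : {measure set X -> \bar R}) A : m setT < +oo -> measurable A -> (fine (m A))%:E = m A.
Proof.
move=> mfin mA; rewrite fineK// ge0_fin_numE//; apply: le_lt_trans mfin.
by apply: le_measure; rewrite ?inE.
Qed.

(** The identity is bilinear and its arguments are extended from [G] one after the other: with [A']
    fixed, the masses of its sections serve as weights while [A] is replaced by [f]; with [f] fixed,
    its integrals serve as weights while [A'] is replaced by [g]. The bound [M] keeps the second
    family of weights integrable. *)
Lemma compensated_isometry (f g : W * X -> R) (M : R) :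
  (forall z, 0 <= f z <= M)%R -> (forall z, 0 <= g z)%R ->
  mfunT (f : sigmaT G -> R) ->
  mfunT (g : sigmaT G -> R) ->
  \int[P]_w (\int[k1 w]_x (f (w, x))%:E * \int[k2 w]_x (g (w, x))%:E) +
  \int[P]_w (\int[L]_x (f (w, x))%:E * \int[L]_x (g (w, x))%:E) =
  \int[P]_w (\int[k1 w]_x (f (w, x))%:E * \int[L]_x (g (w, x))%:E) +
  \int[P]_w (\int[L]_x (f (w, x))%:E * \int[k2 w]_x (g (w, x))%:E) +
  c%:E * \int[P]_w \int[L]_x (f (w, x) * g (w, x))%:E.
Proof.
move=> fM g0 mf mg.
have M0 : (0 <= M)%R by have /andP[h1 h2] := fM point; exact: le_trans h2.
have f0 z : (0 <= f z)%R by case/andP: (fM z).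
have mf' : mfunT f by exact: (sub_sigma_mfun Gm).
have mg' : mfunT g by exact: (sub_sigma_mfun Gm).
have mEf : mfunT ((fun z => (f z)%:E) : sigmaT G -> \bar R) by meas.
have mEg : mfunT ((fun z => (g z)%:E) : sigmaT G -> \bar R) by meas.
have mkf : mfunT (fun w => fine (\int[k1 w]_x (f (w, x))%:E)).
  apply: measurableT_comp => //.
  apply: (@measurable_integral_random_measure _ _ _ _ _ k1 mk1 kfin1 (EFin \o f)) => //.
  exact/measurable_EFinP.
have mLf : mfunT (fun w => fine (\int[L]_x (f (w, x))%:E)).
  apply: measurableT_comp => //.
  apply: (@measurable_integral_random_measure _ _ _ _ _ _ mL Lfin' (EFin \o f)) => //.
  exact/measurable_EFinP.
have mcf : mfunT (fun z => c * f z)%R by meas.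
have cf0 z : (0 <= c * f z)%R by rewrite mulr_ge0.
have stepA A' : G A' ->
    \int[P]_w (\int[k1 w]_x (f (w, x))%:E * k2 w (xsection A' w)) +
    \int[P]_w (\int[L]_x (f (w, x))%:E * L (xsection A' w)) =
    \int[P]_w (\int[k1 w]_x (f (w, x))%:E * L (xsection A' w)) +
    \int[P]_w (\int[L]_x (f (w, x))%:E * k2 w (xsection A' w)) +
    \int[P]_w \int[L]_x ((\1_A' (w, x))%:E * (c * f (w, x))%:E).
  move=> GA'; have mA' := Gm GA'.
  have mu : mfunT (fun w => fine (k2 w (xsection A' w))).
    by apply: measurableT_comp => //; exact: measurable_xsection_random_measure.
  have mv : mfunT (fun w => fine (L (xsection A' w))).
    apply: measurableT_comp => //.
    exact: (@measurable_xsection_random_measure _ _ _ _ _ _ mL Lfin').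
  have mh : mfunT (fun z => c * \1_A' z)%R by meas.
  have h0 z : (0 <= c * \1_A' z)%R by rewrite mulr_ge0.
  have mx w A : G A -> measurable (xsection A w) by move=> GA; apply: measurable_xsection; exact: Gm.
  have k2E w : (fine (k2 w (xsection A' w)))%:E = k2 w (xsection A' w) by rewrite fin_measure//; exact: mx.
  have LE w : (fine (L (xsection A' w)))%:E = L (xsection A' w) by rewrite fin_measure//; exact: mx.
  have := @bilinear_step k1 mk1 kfin1 _ _ _ (fun w => fine_ge0 (measure_ge0 (k2 w) (xsection A' w)))
     (fun w => fine_ge0 (measure_ge0 L (xsection A' w))) h0 mu mv mh.
  move=> /(_ _ _ _ (EFin \o f)) H.
  under eq_integral do rewrite muleC -k2E.
  under [X in _ + X = _]eq_integral do rewrite muleC -LE.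
  under [X in _ = X + _ + _]eq_integral do rewrite muleC -LE.
  under [X in _ = _ + X + _]eq_integral do rewrite muleC -k2E.
  have -> : \int[P]_w \int[L]_x ((\1_A' (w, x))%:E * (c * f (w, x))%:E) =
            \int[P]_w \int[L]_x ((f (w, x))%:E * (c * \1_A' (w, x))%:E).
    by apply: eq_integral => w _; apply: eq_integral => x _; rewrite -!EFinM; congr EFin; ring.
  rewrite H//.
  - move=> A GA.
    under eq_integral do rewrite k2E muleC.
    under [X in _ + X = _]eq_integral do rewrite LE muleC.
    under [X in _ = X + _ + _]eq_integral do rewrite LE muleC.
    under [X in _ = _ + X + _]eq_integral do rewrite k2E muleC.
    rewrite gen//; congr (_ + _).
    rewrite -ge0_integralZl_EFin//; last first.
      apply: (@measurable_xsection_random_measure _ _ _ _ _ _ mL Lfin').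
      by apply: measurableI => //; exact: Gm.
    apply: eq_integral => w _.
    have mI : measurable (xsection (A `&` A') w).
      by apply: measurable_xsection; apply: measurableI => //; exact: Gm.
    rewrite -[X in L X]setIT -integral_indic// -ge0_integralZl_EFin//; last first.
      exact/measurable_EFinP.
    apply: eq_integral => x _; rewrite -!EFinM; congr EFin.
    by rewrite indicE mem_xsection !indicE in_setI; case: (_ \in A); case: (_ \in A'); rewrite /= ?mulr0 ?mul0r ?mulr1 ?mul1r.
  - apply: le_lt_trans mom12; apply: ge0_le_integral => //.
    + by apply: emeasurable_funM; [exact/measurable_EFinP|exact: mk1].
    + by apply: emeasurable_funM; [exact: mk1|exact: mk2].
    + move=> w _; rewrite k2E muleC; apply: lee_wpmul2l => //.
      by apply: le_measure; rewrite ?inE//; exact: mx.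
  - apply: (@le_lt_trans _ _ (\int[P]_w (cst (L setT * L setT) w))).
      apply: ge0_le_integral => //.
      + by apply: emeasurable_funM => //; exact/measurable_EFinP.
      + move=> w _; rewrite LE; apply: lee_wpmul2r => //.
        by apply: le_measure; rewrite ?inE//; exact: mx.
    rewrite integral_cst//.
    rewrite [X in _ * X](@probability_setT _ _ _ P) mule1.
    by rewrite lte_mul_pinfty// ge0_fin_numE.
have kfE w := fin_integral w (kfin1 w) fM mf'.
have LfE w := fin_integral w Lfin fM mf'.
have kf0 w : (0 <= fine (\int[k1 w]_x (f (w, x))%:E))%R.
  by apply: fine_ge0; apply: integral_ge0 => x _; rewrite lee_fin.
have Lf0 w : (0 <= fine (\int[L]_x (f (w, x))%:E))%R.
  by apply: fine_ge0; apply: integral_ge0 => x _; rewrite lee_fin.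
have := @bilinear_step k2 mk2 kfin2 _ _ _ kf0 Lf0 cf0 mkf mLf mcf.
move=> /(_ _ _ _ (EFin \o g)) H.
under eq_integral do rewrite -kfE.
under [X in _ + X = _]eq_integral do rewrite -LfE.
under [X in _ = X + _ + _]eq_integral do rewrite -kfE.
under [X in _ = _ + X + _]eq_integral do rewrite -LfE.
rewrite H//.
- rewrite [in RHS](addeC (\int[P]_w _)); congr (_ + _).
  rewrite -ge0_integralZl_EFin//; last 2 first.
  + by move=> w _; apply: integral_ge0 => x _; rewrite lee_fin mulr_ge0.
  + apply: (@measurable_integral_random_measure _ _ _ _ _ _ mL Lfin' (fun z => (f z * g z)%:E)) => //.
      by move=> z; rewrite lee_fin mulr_ge0.
    by meas.
  apply: eq_integral => w _; rewrite -ge0_integralZl_EFin//; last 2 first.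
  + by move=> x _; rewrite lee_fin mulr_ge0.
  + by apply/measurable_EFinP; apply: (measurableT_comp (measurable_funM mf' mg')).
  by apply: eq_integral => x _; rewrite -!EFinM; congr EFin; ring.
- move=> A GA; under eq_integral do rewrite kfE.
  under [X in _ + X = _]eq_integral do rewrite LfE.
  under [X in _ = _ + X + _]eq_integral do rewrite kfE.
  under [X in _ = X + _ + _]eq_integral do rewrite LfE.
  by rewrite stepA//; congr (_ + _); rewrite addeC.
- apply: (@le_lt_trans _ _ (M%:E * \int[P]_w (k1 w setT * k2 w setT))); last first.
    by rewrite lte_mul_pinfty// ge0_fin_numE//; apply: integral_ge0 => w _; rewrite mule_ge0.
  rewrite -ge0_integralZl_EFin//; last 1 first.
  + by apply: emeasurable_funM; [exact: mk1|exact: mk2].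
  apply: ge0_le_integral => //.
  + by move=> w _; rewrite mule_ge0 ?lee_fin.
  + by apply: emeasurable_funM; [exact/measurable_EFinP|exact: mk2].
  + by apply: emeasurable_funM => //; apply: emeasurable_funM; [exact: mk1|exact: mk2].
  + move=> w _; rewrite kfE muleA; apply: lee_wpmul2r => //.
    exact: bounded_integral.
- apply: (@le_lt_trans _ _ (\int[P]_w (cst (M%:E * L setT * L setT) w))).
    apply: ge0_le_integral => //.
    + by move=> w _; rewrite mule_ge0 ?lee_fin.
    + by apply: emeasurable_funM => //; exact/measurable_EFinP.
    + move=> w _; rewrite LfE; apply: lee_wpmul2r => //; exact: bounded_integral.
  rewrite integral_cst//.
  rewrite [X in _ * X](@probability_setT _ _ _ P) mule1.
  have /fineK <- : L setT \is a fin_num by rewrite ge0_fin_numE.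
  by rewrite -!EFinM ltry.
Qed.

End compensated_isometry.

Lemma integral_mrestr {R : realType} {d : measure_display} {T : measurableType d}
    (m : {measure set T -> \bar R}) (D : set T) (mD : measurable D) (f : T -> \bar R) :
  (forall x, 0 <= f x) -> mfunT f ->
  \int[mrestr m mD]_x f x = \int[m]_(x in D) f x.
Proof.
move=> f0 mf.
rewrite (@integral_density _ _ _ _ m (fun x => \1_D x))//; last 2 first.
- exact: measurable_indic.
- by move=> A mA; rewrite integral_indic// setIC.
rewrite [RHS]integral_mkcond; apply: eq_integral => x _.
by rewrite patchE indicE; case: (_ \in _); rewrite ?mule1 ?mule0.
Qed.

(** * Predictable sets, the isometry on boxes and the compensation formula *)

Section predictable.
Context {R : realType} {dO : measure_display} {W : measurableType dO}.
Variables (P : probability W R) (F : R -> set (set W)).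
Context {I : choiceType}.
Variable N : I -> R.-ker W ~> plane R.
Hypotheses (hF : filtration F) (hN : iid_poisson_measures P F N).
Local Notation leb2 := (@leb2 R).

(** Predictable rectangles, open on the left in time so that the event [B] is known before the
    rectangle starts. The marks fill intervals [[0, z]], which suits conditions of the form mark
    [<=] intensity. [setT] makes the pi-system contain the whole space. *)
Definition pred_gen : set (set (W * plane R)) :=
  [set A | A = setT \/ exists u z B, [/\ (0 <= u)%R, (0 <= z)%R, F u B &
     A = B `*` (`]u, +oo[ `*` `[0%R, z])]].

Local Notation G := pred_gen.

Lemma pred_gen_measurable : G `<=` measurable.
Proof.
move=> _ [->//|[u [z [B [u0 z0 FB ->]]]]].
apply: measurableX; first exact: (filtration_measurable hF u0).
by apply: measurableX; exact: measurable_itv.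
Qed.

Lemma pred_genT : G setT. Proof. by left. Qed.

Lemma pred_genI : setI_closed G.
Proof.
move=> A A' [->|]; first by rewrite setTI.
move=> [u [z [B [u0 z0 FB ->]]]] [->|]; first by rewrite setIT; right; exists u, z, B.
move=> [u' [z' [B' [u'0 z'0 FB' ->]]]].
right; exists (Num.max u u'), (Num.min z z'), (B `&` B').
have m0 : (0 <= Num.max u u')%R by rewrite le_max u0.
split => //.
- by rewrite le_min z0.
- have [? ? ?] := filtration_sigma_algebra hF m0.
  have h1 : F (Num.max u u') B by apply: (filtration_nondecreasing hF u0 _ FB); rewrite le_max lexx.
  have h2 : F (Num.max u u') B' by apply: (filtration_nondecreasing hF u'0 _ FB'); rewrite le_max lexx orbT.
  rewrite -(filtration_id hF m0); apply: (@measurableI _ (sigmaT (F _))); exact: sub_sigma_algebra.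
- apply/seteqP; split => -[w [s x]] /=; rewrite !in_itv/= !andbT gt_max le_min.
    by move=> [[? [? /andP[? ?]]] [? [? /andP[? ?]]]]; split => //; split; apply/andP; split => //; apply/andP.
  by move=> [[? ?] [/andP[? ?] /andP[? /andP[? ?]]]]; repeat split => //; apply/andP.
Qed.

Definition box K : set (plane R) := rect 0 K K.
Lemma measurable_box K : measurable (box K). Proof. exact: measurable_rect. Qed.

Lemma leb_box K : (0 <= K)%R -> leb2 (box K) = (K ^+ 2)%:E.
Proof. by move=> K0; rewrite /box leb_rect// subr0 expr2. Qed.

(* Every generator can be replaced, inside a box, by a rectangle started at a
   time at which it is known whether the rectangle is empty. *)
Lemma pred_gen_trace A K : (0 <= K)%R -> G A ->
  exists B u z, [/\ (0 <= u <= K)%R, (0 <= z)%R, F u B &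
    forall w, xsection A w `&` box K = if w \in B then rect u K z else set0].
Proof.
move=> K0 [->|[u [z [B [u0 z0 FB ->]]]]].
  exists setT, 0%R, K; split => //; first by rewrite lexx.
    by rewrite -(filtration_id hF (lexx _)); exact: (@measurableT _ (sigmaT (F 0%R))).
  by move=> w; rewrite xsection_setT setTI in_setT.
have [uK|Ku] := leP u K.
  exists B, u, (Num.min z K); split => //; [by rewrite u0|by rewrite le_min z0|].
  move=> w; case: ifPn => [wB|/negP wB].
    apply/seteqP; split => -[s x] /=; rewrite /xsection/= /box /rect/= !in_setE/= !in_itv/= !andbT le_min.
      by move=> [[_ [? /andP[? ?]]] [/andP[? ?] /andP[? ?]]]; split; apply/andP; split => //; apply/andP.
    move=> [/andP[? ?] /andP[? /andP[? ?]]]; split; last by split; apply/andP; split => //; exact: le_lt_trans u0 _.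
    by split; [rewrite inE in wB|split => //; apply/andP].
  apply/seteqP; split => // -[s x] /=; rewrite /xsection/= in_setE/= => -[[h _] _].
  by apply: wB; rewrite inE.
exists set0, 0%R, 0%R; split => //; first by rewrite lexx.
  by rewrite -(filtration_id hF (lexx _)); exact: (@measurable0 _ (sigmaT (F 0%R))).
move=> w; rewrite in_set0; apply/seteqP; split => // -[s x] /=.
rewrite /xsection/= /box /rect/= in_setE/= !in_itv/= !andbT => -[[_ [us _]] [/andP[_ sK] _]].
by have := lt_le_trans (lt_trans Ku us) sK; rewrite ltxx.
Qed.

(** A modification of [N i] that is finite on boxes for every [w] and not only almost surely, as the
    results on finite random measures require. *)
Definition points i w : {measure set (plane R) -> \bar R} :=
  if `[< forall n : nat, N i w (box n%:R) < +oo >] then N i w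
  else (@mzero _ _ R : {measure set (plane R) -> \bar R}).

Lemma box_sub K K' : (K <= K')%R -> box K `<=` box K'.
Proof. by move=> KK [s x] []; rewrite /box /rect/= !in_itv/= => h1 h2; split; lra. Qed.

Lemma points_fin i w K : points i w (box K) < +oo.
Proof.
rewrite /points; case: asboolP => h; last by rewrite [X in X < _](_ : _ = 0).
apply: le_lt_trans (h (Num.bound `|K|)); apply: le_measure; rewrite ?inE; try exact: measurable_box.
apply: box_sub; apply: le_trans (ler_norm _) _; apply: ltW; exact: archi_boundP.
Qed.

Lemma points_ae i : {ae P, forall w, points i w = N i w}.
Proof.
have h n : {ae P, forall w, N i w (box n%:R) < +oo}.
  have mN := measurable_kernel (N i) _ (measurable_box n%:R).
  have h : P.-integrable setT (fun w => N i w (box n%:R)).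
    apply/integrableP; split => //.
    under eq_integral do rewrite gee0_abs//.
    by rewrite (intensity_rect hN)// ltry.
  have := integrable_ae measurableT h.
  by apply: filterS => w /(_ Logic.I)/fin_numPlt/andP[].
have := ae_foralln h; apply: filterS => w hw.
by rewrite /points asboolT.
Qed.

Lemma measurable_points i A : measurable A -> mfunT (fun w => points i w A).
Proof.
move=> mA.
rewrite [X in measurable_fun _ X](_ : _ =
    fun w => if w \in \bigcap_n [set w | N i w (box n%:R) < +oo] then N i w A else 0); last first.
  apply/funext => w; rewrite /points; case: asboolP => h; case: ifPn => // h'.
    by exfalso; move/negP: h'; apply; rewrite inE => n _; exact: h.
  by exfalso; apply: h => n; move: h'; rewrite inE => /(_ n Logic.I).
apply: measurable_fun_ifT.
- apply: (measurable_fun_bool true); rewrite setTI /preimage/=.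
  rewrite [X in measurable X](_ : _ = \bigcap_n [set w | N i w (box n%:R) < +oo]); last first.
    by apply/seteqP; split => w /= h; [exact: set_mem|exact: mem_set].
  apply: bigcapT_measurable => n; rewrite -[X in measurable X]setTI.
  apply: emeasurable_fun_infty_o => //; exact: (measurable_kernel (N i) _ (measurable_box _)).
- exact: (measurable_kernel (N i)).
- exact: measurable_cst.
Qed.

Definition box_points i K w : {measure set (plane R) -> \bar R} := mrestr (points i w) (measurable_box K).
Definition boxed_leb K : {measure set (plane R) -> \bar R} := mrestr leb2 (measurable_box K).

Lemma box_pointsE i K w A : box_points i K w A = points i w (A `&` box K).
Proof. by []. Qed.

Lemma box_points_fin i K w : box_points i K w setT < +oo.
Proof. by rewrite box_pointsE setTI points_fin. Qed.

Lemma measurable_box_points i K A : measurable A -> mfunT (fun w => box_points i K w A).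
Proof. by move=> mA; apply: measurable_points; apply: measurableI => //; exact: measurable_box. Qed.

Lemma boxed_leb_fin K : boxed_leb K setT < +oo.
Proof.
rewrite -[X in X < _]/(leb2 (setT `&` box K)) setTI.
have [K0|K0] := leP 0%R K; first by rewrite leb_box// ltry.
rewrite (_ : box K = set0) ?measure0//.
by apply/seteqP; split => // -[s x] [] /=; rewrite in_itv/=; lra.
Qed.

(** The relation is symmetric in the two rectangles, so that the starting times may be put in
    order. *)
Let rectangles_isometry i j B B' u u' v z z' :
  (0 <= u <= v)%R -> (0 <= u' <= v)%R -> (0 <= z)%R -> (0 <= z')%R -> F u B -> F u' B' ->
  let C := B `&` B' in
  \int[P]_w ((\1_C w)%:E * (N i w (rect u v z) * N j w (rect u' v z'))) +
  P C * (((v - u) * z) * ((v - u') * z'))%:E =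
  \int[P]_w ((\1_C w)%:E * N i w (rect u v z)) * ((v - u') * z')%:E +
  \int[P]_w ((\1_C w)%:E * N j w (rect u' v z')) * ((v - u) * z)%:E +
  P C * ((i == j)%:R * ((v - Num.max u u') * Num.min z z'))%:E.
Proof.
move=> /andP[u0 uv] /andP[u'0 u'v] z0 z'0 FB FB' C; have [uu|/ltW uu] := leP u u'.
  exact: (generator_isometry_le hF hN).
rewrite /C setIC eq_sym minC [X in _ = X + _]addeC mulrC.
under eq_integral do rewrite (muleC (N i _ _)).
exact: (generator_isometry_le hF hN).
Qed.

(** Inside the box every generator is a rectangle switched on by an event known at its start; up to
    null sets the identity is [rectangles_isometry]. *)
Lemma boxed_isometry_gen i j K A A' : (0 <= K)%R -> G A -> G A' ->
  let k1 := box_points i K in let k2 := box_points j K in let L := boxed_leb K in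
  \int[P]_w (k1 w (xsection A w) * k2 w (xsection A' w)) +
  \int[P]_w (L (xsection A w) * L (xsection A' w)) =
  \int[P]_w (k1 w (xsection A w) * L (xsection A' w)) +
  \int[P]_w (L (xsection A w) * k2 w (xsection A' w)) +
  ((i == j)%:R)%:E * \int[P]_w L (xsection (A `&` A') w).
Proof.
move=> K0 GA GA' k1 k2 L.
have mA := pred_gen_measurable GA; have mA' := pred_gen_measurable GA'.
have [B [u [z [uK z0 FB Bx]]]] := pred_gen_trace K0 GA.
have [B' [u' [z' [uK' z'0 FB' Bx']]]] := pred_gen_trace K0 GA'.
have /andP[u0 uk] := uK; have /andP[u0' uk'] := uK'.
have mB : measurable B by exact: (filtration_measurable hF u0).
have mB' : measurable B' by exact: (filtration_measurable hF u0').
have mC : measurable (B `&` B') by exact: measurableI.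
have LE w : L (xsection A w) = (\1_B w * ((K - u) * z))%:E.
  rewrite -[LHS]/(leb2 (xsection A w `&` box K)) Bx indicE; case: ifP => _.
    by rewrite leb_rect// mul1r.
  by rewrite measure0 mul0r.
have LE' w : L (xsection A' w) = (\1_B' w * ((K - u') * z'))%:E.
  rewrite -[LHS]/(leb2 (xsection A' w `&` box K)) Bx' indicE; case: ifP => _.
    by rewrite leb_rect// mul1r.
  by rewrite measure0 mul0r.
have LEI w : L (xsection (A `&` A') w) = (\1_(B `&` B') w)%:E * ((K - Num.max u u') * Num.min z z')%:E.
  rewrite -[LHS]/(leb2 (xsection (A `&` A') w `&` box K)).
  have -> : xsection (A `&` A') w `&` box K = (xsection A w `&` box K) `&` (xsection A' w `&` box K).
    by rewrite xsectionI setIACA setIid.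
  rewrite Bx Bx' indicE in_setI; case: (w \in B); case: (w \in B'); rewrite /= ?setI0 ?set0I ?measure0 ?mul0e//.
  rewrite mul1e -leb_rect; [|by rewrite ge_max uk|by rewrite le_min z0].
  congr (leb2 _); apply/seteqP; split => -[s x] /=; rewrite /rect/= !in_itv/= gt_max le_min.
    by move=> [[/andP[-> ->] /andP[-> ->]] [/andP[-> _] /andP[_ ->]]].
  by move=> [/andP[/andP[-> ->] ->] /andP[-> /andP[-> ->]]].
have kE (i0 : I) (A0 B0 : set _) (u1 z1 : R) (w : W) :
    (forall w, xsection A0 w `&` box K = if w \in B0 then rect u1 K z1 else set0) ->
    points i0 w = N i0 w ->
    box_points i0 K w (xsection A0 w) = (\1_B0 w)%:E * N i0 w (rect u1 K z1).
  move=> e h; rewrite box_pointsE e h indicE; case: ifP => _; first by rewrite mul1e.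
  by rewrite measure0 mul0e.
have mN i0 u1 z1 : mfunT (fun w => N i0 w (rect u1 K z1)).
  by apply: (measurable_kernel (N i0)); exact: measurable_rect.
have m1 (C : set W) : measurable C -> mfunT (fun w => (\1_C w)%:E : \bar R).
  by move=> ?; exact/measurable_EFinP.
have mk i0 A0 : measurable A0 -> mfunT (fun w => box_points i0 K w (xsection A0 w)).
  move=> mA0; apply: measurable_xsection_random_measure => //.
  - by move=> U; exact: measurable_box_points.
  - by move=> w; exact: box_points_fin.
have -> : \int[P]_w (k1 w (xsection A w) * k2 w (xsection A' w)) =
    \int[P]_w ((\1_(B `&` B') w)%:E * (N i w (rect u K z) * N j w (rect u' K z'))).
  apply: ae_eq_integral => //.
  - by apply: emeasurable_funM; exact: mk.
  - by meas.
  - apply: filterS2 (points_ae i) (points_ae j) => w hi hj _.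
    by rewrite (kE _ _ _ _ _ _ Bx hi) (kE _ _ _ _ _ _ Bx' hj) muleACA -EFinM indicI.
have -> : \int[P]_w (k1 w (xsection A w) * L (xsection A' w)) =
    \int[P]_w ((\1_(B `&` B') w)%:E * N i w (rect u K z)) * ((K - u') * z')%:E.
  rewrite -ge0_integralZr//; last 2 first.
  - by meas.
  - by rewrite lee_fin mulr_ge0// subr_ge0.
  apply: ae_eq_integral => //.
  - by apply: emeasurable_funM; [exact: mk|under eq_fun do rewrite LE' EFinM; apply: emeasurable_funM => //; exact: m1].
  - by meas.
  - apply: filterS (points_ae i) => w hi _.
    rewrite (kE _ _ _ _ _ _ Bx hi) LE' EFinM muleACA -EFinM -muleA; congr (_ * _).
    by rewrite indicI.
have -> : \int[P]_w (L (xsection A w) * k2 w (xsection A' w)) =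
    \int[P]_w ((\1_(B `&` B') w)%:E * N j w (rect u' K z')) * ((K - u) * z)%:E.
  rewrite -ge0_integralZr//; last 2 first.
  - by meas.
  - by rewrite lee_fin mulr_ge0// subr_ge0.
  apply: ae_eq_integral => //.
  - by apply: emeasurable_funM; [under eq_fun do rewrite LE EFinM; apply: emeasurable_funM => //; exact: m1|exact: mk].
  - by meas.
  - apply: filterS (points_ae j) => w hj _.
    rewrite (kE _ _ _ _ _ _ Bx' hj) LE EFinM muleACA -EFinM -muleA indicI.
    by congr (_ * _); rewrite muleC.
have -> : \int[P]_w (L (xsection A w) * L (xsection A' w)) =
    P (B `&` B') * (((K - u) * z) * ((K - u') * z'))%:E.
  have -> : P (B `&` B') = \int[P]_w (\1_(B `&` B') w)%:E by rewrite integral_indic// setIT.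
  rewrite -ge0_integralZr//; last 2 first.
  - exact: m1.
  - by rewrite lee_fin !mulr_ge0// subr_ge0.
  by apply: eq_integral => w _; rewrite LE LE' indicI -!EFinM mulrACA.
under [X in _ = _ + _ * X]eq_integral do rewrite LEI.
rewrite ge0_integralZr//; last 2 first.
- exact: m1.
- by rewrite lee_fin mulr_ge0 ?subr_ge0 ?ge_max ?uk// le_min z0.
rewrite integral_indic// setIT muleCA -EFinM.
exact: rectangles_isometry.
Qed.

Lemma boxed_moment2 i j K : (0 <= K)%R ->
  \int[P]_w (box_points i K w setT * box_points j K w setT) < +oo.
Proof.
move=> K0.
have F0 : F 0%R setT by rewrite -(filtration_id hF (lexx _)); exact: (@measurableT _ (sigmaT (F 0%R))).
rewrite (ae_eq_integral (fun w => (\1_(@setT W) w)%:E * (N i w (box K) * N j w (box K))))//.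
- rewrite (diag_expectation hF hN)// probability_setT mul1e ltry//.
- by apply: emeasurable_funM; exact: measurable_box_points.
- apply: emeasurable_funM; first exact/measurable_EFinP.
  by apply: emeasurable_funM; apply: (measurable_kernel (N _)); exact: measurable_box.
- apply: filterS2 (points_ae i) (points_ae j) => w hi hj _.
  by rewrite !box_pointsE !setTI hi hj indicT mul1e.
Qed.

Local Notation predictable f := (mfunT (f : sigmaT G -> \bar R)).
Local Notation rpredictable f := (mfunT (f : sigmaT G -> R)).

Lemma predictable_measurable (f : W * plane R -> \bar R) : predictable f -> mfunT f.
Proof. exact: (sub_sigma_mfun pred_gen_measurable). Qed.

Lemma boxed_isometry i j K (f g : W * plane R -> R) (M : R) : (0 <= K)%R ->
  (forall z, 0 <= f z <= M)%R -> (forall z, 0 <= g z)%R -> rpredictable f -> rpredictable g ->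
  let k1 := box_points i K in let k2 := box_points j K in let L := boxed_leb K in
  \int[P]_w (\int[k1 w]_x (f (w, x))%:E * \int[k2 w]_x (g (w, x))%:E) +
  \int[P]_w (\int[L]_x (f (w, x))%:E * \int[L]_x (g (w, x))%:E) =
  \int[P]_w (\int[k1 w]_x (f (w, x))%:E * \int[L]_x (g (w, x))%:E) +
  \int[P]_w (\int[L]_x (f (w, x))%:E * \int[k2 w]_x (g (w, x))%:E) +
  ((i == j)%:R)%:E * \int[P]_w \int[L]_x (f (w, x) * g (w, x))%:E.
Proof.
move=> K0 fM g0 mf mg k1 k2 L.
apply: (compensated_isometry pred_gen_measurable pred_genT pred_genI
  (boxed_leb_fin K) _ _ _ _ _ _ _ fM g0 mf mg).
- by move=> U; exact: measurable_box_points.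
- by move=> U; exact: measurable_box_points.
- by move=> w; exact: box_points_fin.
- by move=> w; exact: box_points_fin.
- by [].
- by move=> A A' GA GA'; exact: boxed_isometry_gen.
- exact: boxed_moment2.
Qed.

(** It is enough to compare the two mean measures on the pi-system: a rectangle switched on by an
    event [B] of the past has a mean number of points equal to its area times [P B]. *)
Lemma boxed_compensation i K (f : W * plane R -> \bar R) : (0 <= K)%R ->
  (forall z, 0 <= f z) -> predictable f ->
  \int[P]_w \int[box_points i K w]_x f (w, x) = \int[P]_w \int[boxed_leb K]_x f (w, x).
Proof.
move=> K0 f0 mf.
have one0 (w : W) : (0 <= cst (1%R : R) w)%R by [].
have m_one : mfunT (cst (1%R : R) : W -> R) by meas.
have mL U : measurable U -> mfunT ((fun _ : W => boxed_leb K) ^~ U).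
  by move=> _; exact: measurable_cst.
have Lfin (w : W) : (fun _ : W => boxed_leb K) w setT < +oo by exact: boxed_leb_fin.
have mk U : measurable U -> mfunT ((box_points i K) ^~ U) by exact: measurable_box_points.
have kfin w : box_points i K w setT < +oo by exact: box_points_fin.
pose m1 := mix_measure mk kfin P one0 m_one; pose m2 := mix_measure mL Lfin P one0 m_one.
have mf' := predictable_measurable mf.
have e A : G A -> m1 A = m2 A.
  move=> GA; rewrite /m1 /m2 !mix_measureE.
  have [B [u [z [/andP[u0 uK] z0 FB Bx]]]] := pred_gen_trace K0 GA.
  have mA := pred_gen_measurable GA.
  have mB : measurable B by exact: (filtration_measurable hF u0).
  have m1B : mfunT (fun w => (\1_B w)%:E : \bar R) by meas.
  transitivity (\int[P]_w ((\1_B w)%:E * N i w (rect u K z))).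
    apply: ae_eq_integral => //.
    - under eq_fun do rewrite mul1e.
      exact: (@measurable_xsection_random_measure _ _ _ _ _ (box_points i K)).
    - by apply: emeasurable_funM => //; apply: (measurable_kernel (N i)); exact: measurable_rect.
    - apply: filterS (points_ae i) => w h _; rewrite mul1e box_pointsE Bx h indicE.
      by case: ifP => _; rewrite ?mul1e// measure0 mul0e.
  rewrite (past_rect_expectation hF hN)//; last exact: indic_past.
  rewrite -ge0_integralZr//; last by rewrite lee_fin mulr_ge0// subr_ge0.
  apply: eq_integral => w _; rewrite mul1e -[RHS]/(leb2 (xsection A w `&` box K)) Bx indicE.
  by case: ifP => _; rewrite ?leb_rect// ?mul1e// measure0 mul0e.
have fin : m1 setT < +oo.
  rewrite e; last exact: pred_genT.
  rewrite /m2 mix_measureE; under eq_integral do rewrite mul1e xsection_setT.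
  by rewrite integral_cst// [X in _ * X](@probability_setT _ _ _ P) mule1 boxed_leb_fin.
have := pi_system_integral pred_gen_measurable pred_genT pred_genI e fin f0 mf.
rewrite !integral_mix_measure//.
under eq_integral do rewrite mul1e.
by under [X in _ = X -> _]eq_integral do rewrite mul1e.
Qed.

(** The union of the boxes; time 0 is left out because predictable rectangles are open on the
    left. *)
Definition oquad : set (plane R) := `]0%R, +oo[ `*` `[0%R, +oo[.

Lemma bigcup_box : \bigcup_n box n%:R = oquad.
Proof.
apply/seteqP; split => [-[s x] [n _] []|[s x] []]; rewrite /oquad/= !in_itv/= !andbT.
  by move=> /andP[-> _] /andP[].
move=> s0 x0; exists (Num.bound (s + x)) => //.
have := archi_boundP (addr_ge0 (ltW s0) x0).
by rewrite /box /rect/= !in_itv/= => h; split; apply/andP; split => //; lra.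
Qed.

Lemma integral_oquad (m : {measure set (plane R) -> \bar R}) (f : plane R -> \bar R) :
  (forall x, 0 <= f x) -> mfunT f ->
  \int[m]_(x in oquad) f x = limn (fun n => \int[mrestr m (measurable_box n%:R)]_x f x).
Proof.
move=> f0 mf; rewrite -bigcup_box.
have -> : (fun n => \int[mrestr m (measurable_box n%:R)]_x f x) = (fun n => \int[m]_(x in box n%:R) f x).
  by apply/funext => n; rewrite integral_mrestr.
apply/esym/cvg_lim => //.
apply: ge0_nondecreasing_set_cvg_integral => //.
- by move=> p q pq; apply/subsetPset; apply: box_sub; rewrite ler_nat.
- by move=> n; exact: measurable_box.
- by move=> n; exact: measurable_funTS.
Qed.

Lemma nondecreasing_boxed_integral (m : {measure set (plane R) -> \bar R}) (f : plane R -> \bar R) :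
  (forall x, 0 <= f x) -> mfunT f ->
  {homo (fun n => \int[mrestr m (measurable_box n%:R)]_x f x) : p q / (p <= q)%N >-> p <= q}.
Proof.
move=> f0 mf p q pq; rewrite !integral_mrestr//.
apply: ge0_subset_integral => //; try exact: measurable_box; first exact: measurable_funTS.
by apply: box_sub; rewrite ler_nat.
Qed.

Lemma measurable_boxed_integral i K (f : W * plane R -> \bar R) : (forall z, 0 <= f z) ->
  mfunT f -> mfunT (fun w => \int[box_points i K w]_x f (w, x)).
Proof.
move=> f0 mf; apply: measurable_integral_random_measure => //.
- by move=> U; exact: measurable_box_points.
- by move=> w; exact: box_points_fin.
Qed.

Lemma measurable_boxed_leb_integral K (f : W * plane R -> \bar R) : (forall z, 0 <= f z) ->
  mfunT f -> mfunT (fun w => \int[boxed_leb K]_x f (w, x)).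
Proof.
move=> f0 mf; apply: (@measurable_integral_random_measure _ _ _ _ _ (fun=> boxed_leb K)) => //.
by move=> w; exact: boxed_leb_fin.
Qed.

Lemma measurable_points_integral i (f : W * plane R -> \bar R) : (forall z, 0 <= f z) ->
  mfunT f -> mfunT (fun w => \int[points i w]_(x in oquad) f (w, x)).
Proof.
move=> f0 mf; rewrite [X in measurable_fun _ X](_ : _ =
   fun w => limn (fun n => \int[box_points i n%:R w]_x f (w, x))); last first.
  by apply/funext => w; rewrite integral_oquad//; exact: measurableT_comp.
apply: (@emeasurable_fun_cvg _ _ _ _ (fun n w => \int[box_points i n%:R w]_x f (w, x))).
- by move=> n; exact: measurable_boxed_integral.
- move=> w _; apply: ereal_nondecreasing_is_cvgn => p q pq.
  by apply: nondecreasing_boxed_integral => //; exact: measurableT_comp.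
Qed.

(** Monotone limit of the formula on growing boxes. *)
Theorem compensation i (f : W * plane R -> \bar R) : (forall z, 0 <= f z) -> predictable f ->
  \int[P]_w \int[points i w]_(x in oquad) f (w, x) =
  \int[P]_w \int[leb2]_(x in oquad) f (w, x).
Proof.
move=> f0 mf; have mf' := predictable_measurable mf.
have ms w : mfunT (fun x => f (w, x)) by exact: measurableT_comp.
have eP w : \int[points i w]_(x in oquad) f (w, x) =
    limn (fun n => \int[box_points i n%:R w]_x f (w, x)).
  exact: (integral_oquad (points i w) (fun x => f0 (w, x)) (ms w)).
have eL w : \int[leb2]_(x in oquad) f (w, x) = limn (fun n => \int[boxed_leb n%:R]_x f (w, x)).
  exact: (integral_oquad leb2 (fun x => f0 (w, x)) (ms w)).
under eq_integral do rewrite eP.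
under [RHS]eq_integral do rewrite eL.
have mcP := @monotone_convergence _ _ _ P _ measurableT (fun n w => \int[box_points i n%:R w]_x f (w, x)).
have mcL := @monotone_convergence _ _ _ P _ measurableT (fun n w => \int[boxed_leb n%:R]_x f (w, x)).
rewrite mcP; last 3 first.
- by move=> n; exact: measurable_boxed_integral.
- by move=> n w _; apply: integral_ge0 => x _; exact: f0.
- by move=> w _ p q; exact: (nondecreasing_boxed_integral (points i w) (fun x => f0 (w, x)) (ms w)).
rewrite mcL; last 3 first.
- by move=> n; exact: measurable_boxed_leb_integral.
- by move=> n w _; apply: integral_ge0 => x _; exact: f0.
- by move=> w _ p q; exact: (nondecreasing_boxed_integral leb2 (fun x => f0 (w, x)) (ms w)).
by congr (limn _); apply/funext => n; exact: boxed_compensation.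
Qed.

End predictable.

Local Close Scope ereal_scope.

(** * Square-integrable variables and the isometry for compensated integrals *)

Section sq_integrable.
Context {R : realType} {d : measure_display} {W : measurableType d}.
Variable P : {measure set W -> \bar R}.

Definition sq_integrable (X : W -> R) : Prop :=
  mfunT X /\ P.-integrable setT (EFin \o (fun w => X w ^+ 2)).

Lemma sq_integrableM (X Y : W -> R) : sq_integrable X -> sq_integrable Y ->
  P.-integrable setT (EFin \o (fun w => X w * Y w)).
Proof.
move=> [mX X2] [mY Y2]; apply: le_integrable (integrableD measurableT X2 Y2) => //.
  by apply/measurable_EFinP; exact: measurable_funM.
move=> w _ /=; rewrite lee_fin normrM [leRHS]ger0_norm ?addr_ge0 ?sqr_ge0//.
rewrite -(real_normK (num_real (X w))) -(real_normK (num_real (Y w))).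
have := sqr_ge0 (`|X w| - `|Y w|); have := normr_ge0 (X w); have := normr_ge0 (Y w); nra.
Qed.

Lemma sq_integrable_le (X Y : W -> R) : mfunT X -> (forall w, `|X w| <= Y w) ->
  sq_integrable Y -> sq_integrable X.
Proof.
move=> mX XY [mY Y2]; split => //; apply: le_integrable Y2 => //.
  by apply/measurable_EFinP; exact: measurable_funX.
move=> w _ /=; rewrite lee_fin !ger0_norm ?sqr_ge0//.
by rewrite -(real_normK (num_real (X w))) lerXn2r// ?nnegrE// (le_trans _ (XY w)).
Qed.

Lemma sq_integrableD (X Y : W -> R) : sq_integrable X -> sq_integrable Y ->
  sq_integrable (fun w => X w + Y w).
Proof.
move=> [mX X2] [mY Y2]; split; first exact: measurable_funD.
have := integrableD measurableT (integrableD measurableT X2 Y2) (integrableD measurableT X2 Y2).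
move=> h; apply: le_integrable h => //.
  by apply/measurable_EFinP; apply: measurable_funX; exact: measurable_funD.
move=> w _ /=; rewrite lee_fin !ger0_norm ?sqr_ge0 ?addr_ge0 ?sqr_ge0//.
have := sqr_ge0 (X w - Y w); nra.
Qed.

Lemma sq_integrableZ c (X : W -> R) : sq_integrable X -> sq_integrable (fun w => c * X w).
Proof.
move=> [mX X2]; split; first exact: measurable_funM.
have := integrableZl measurableT (c ^+ 2) X2.
by under eq_fun do rewrite /= -EFinM -exprMn.
Qed.

Lemma sq_integrableB (X Y : W -> R) : sq_integrable X -> sq_integrable Y ->
  sq_integrable (fun w => X w - Y w).
Proof.
move=> hX hY; under eq_fun do rewrite -mulN1r.
by apply: sq_integrableD => //; exact: sq_integrableZ.
Qed.

End sq_integrable.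

Section comp_integrals.
Context {R : realType} {dO : measure_display} {W : measurableType dO}.
Variables (P : probability W R) (F : R -> set (set W)).
Context {I : choiceType}.
Variable N : I -> R.-ker W ~> plane R.
Hypotheses (hF : filtration F) (hN : iid_poisson_measures P F N).
Variable K : R.
Hypothesis K0 : 0 <= K.
Local Notation G := (pred_gen F).
Local Notation predictable f := (mfunT (f : sigmaT G -> R)).
Implicit Types (f p q : W * plane R -> R) (i j : I).

Definition boxed_int i f w : R := \int[box_points N i K w]_x f (w, x).
Definition boxed_mean f w : R := \int[boxed_leb K]_x f (w, x).
Definition comp_int i f w : R := boxed_int i f w - boxed_mean f w.

Let bounded_integrable (m : {measure set (plane R) -> \bar R}) f M w : (m setT < +oo)%E ->
  (forall z, `|f z| <= M) -> mfunT f -> m.-integrable setT (fun x => (f (w, x))%:E).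
Proof.
move=> mfin fM mf; apply: measurable_bounded_integrable => //; first exact: measurableT_comp.
exists M; split; first exact: num_real.
by move=> x Mx y _ /=; rewrite (le_trans (fM _))// ltW.
Qed.

Let ge0_bounded f M : (forall z, 0 <= f z <= M) -> forall z, `|f z| <= M.
Proof. by move=> h z; have /andP[? ?] := h z; rewrite ger0_norm. Qed.

Let pm f : predictable f -> mfunT f.
Proof. exact: (sub_sigma_mfun (pred_gen_measurable hF)). Qed.

Lemma boxed_intE i f M w : (forall z, `|f z| <= M) -> predictable f ->
  (boxed_int i f w)%:E = (\int[box_points N i K w]_x (f (w, x))%:E)%E.
Proof.
move=> fM /pm mf; rewrite fineK//; apply: integrable_fin_num => //.
by apply: bounded_integrable fM mf; exact: box_points_fin.
Qed.

Lemma boxed_meanE f M w : (forall z, `|f z| <= M) -> predictable f ->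
  (boxed_mean f w)%:E = (\int[boxed_leb K]_x (f (w, x))%:E)%E.
Proof.
move=> fM /pm mf; rewrite fineK//; apply: integrable_fin_num => //.
by apply: bounded_integrable fM mf; exact: boxed_leb_fin.
Qed.

Let norm_bounded_integral (m : {measure set (plane R) -> \bar R}) f M w : (m setT < +oo)%E ->
  (forall z, `|f z| <= M) -> mfunT f ->
  `|\int[m]_x f (w, x)| <= M * fine (m setT).
Proof.
move=> mfin fM mf; have mi := bounded_integrable w mfin fM mf.
apply: (le_trans (le_normr_Rintegral measurableT mi)).
have -> : M * fine (m setT) = \int[m]_x (cst M x) by rewrite Rintegral_cst.
apply: le_Rintegral => //.
- by apply: integrable_norm.
- by apply: measurable_bounded_integrable => //; exact: (bounded_cst M).
Qed.

Lemma boxed_int_measurable i f M : (forall z, 0 <= f z <= M) -> predictable f ->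
  mfunT (boxed_int i f).
Proof.
move=> fM /pm mf; apply: measurableT_comp => //.
apply: (@measurable_boxed_integral _ _ _ _ N i K (EFin \o f)) => //; last exact/measurable_EFinP.
by move=> z; rewrite lee_fin; case/andP: (fM z).
Qed.

Lemma boxed_mean_measurable f M : (forall z, 0 <= f z <= M) -> predictable f ->
  mfunT (boxed_mean f).
Proof.
move=> fM /pm mf; apply: measurableT_comp => //.
apply: (@measurable_boxed_leb_integral _ _ _ K (EFin \o f)) => //; last exact/measurable_EFinP.
by move=> z; rewrite lee_fin; case/andP: (fM z).
Qed.

Lemma boxed_int_square i f M : (forall z, 0 <= f z <= M) -> predictable f ->
  sq_integrable P (boxed_int i f).
Proof.
move=> fM pf; have fM' := ge0_bounded fM.
have mk := measurable_box_points N i K measurableT.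
apply: (@sq_integrable_le _ _ _ _ _ (fun w => M * fine (box_points N i K w setT))).
- exact: boxed_int_measurable fM pf.
- by move=> w; apply: norm_bounded_integral => //; [exact: box_points_fin|exact: pm].
- apply: sq_integrableZ; split; first exact: measurableT_comp.
  have h := boxed_moment2 hF hN i i K0.
  apply/integrableP; split; first by apply/measurable_EFinP; apply: measurable_funX; exact: measurableT_comp.
  apply: le_lt_trans h; under eq_integral do rewrite gee0_abs ?lee_fin ?sqr_ge0//=.
  apply: ge0_le_integral => //.
  + by move=> w _; rewrite lee_fin sqr_ge0.
  + by apply/measurable_EFinP; apply: measurable_funX; exact: measurableT_comp.
  + exact: emeasurable_funM.
  + by move=> w _; rewrite expr2 EFinM fineK// ge0_fin_numE// box_points_fin.
Qed.

Lemma boxed_mean_square f M : (forall z, 0 <= f z <= M) -> predictable f ->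
  sq_integrable P (boxed_mean f).
Proof.
move=> fM pf; have fM' := ge0_bounded fM.
apply: (@sq_integrable_le _ _ _ _ _ (fun w => M * fine (boxed_leb K setT))).
- exact: boxed_mean_measurable fM pf.
- by move=> w; apply: norm_bounded_integral => //; [exact: boxed_leb_fin|exact: pm].
- split => //.
  exact: finite_measure_integrable_cst.
Qed.

Lemma comp_int_square i f M : (forall z, 0 <= f z <= M) -> predictable f ->
  sq_integrable P (comp_int i f).
Proof.
by move=> fM pf; apply: sq_integrableB; [exact: boxed_int_square fM pf|exact: boxed_mean_square fM pf].
Qed.

Let EFin_Rintegral (X : W -> R) : P.-integrable setT (EFin \o X) ->
  (\int[P]_w X w)%R%:E = (\int[P]_w (X w)%:E)%E.
Proof. by move=> h; rewrite fineK// integrable_fin_num. Qed.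

Lemma sq_integrable_integrable (X : W -> R) : sq_integrable P X -> P.-integrable setT (EFin \o X).
Proof.
move=> [mX X2]; have h := integrableD measurableT X2 (finite_measure_integrable_cst P 1 measurableT).
apply: le_integrable h => //; first exact/measurable_EFinP.
move=> w _ /=; rewrite lee_fin [leRHS]ger0_norm ?addr_ge0 ?sqr_ge0//.
rewrite -(real_normK (num_real (X w))); have := sqr_ge0 (`|X w| - 1); have := normr_ge0 (X w); nra.
Qed.

Let mulr_bounded p q M : (forall z, 0 <= p z <= M) -> (forall z, 0 <= q z <= M) ->
  forall z, 0 <= p z * q z <= M * M.
Proof.
by move=> pM qM z; have /andP[? ?] := pM z; have /andP[? ?] := qM z; rewrite mulr_ge0// ler_pM.
Qed.

Lemma boxed_mean_integrable p M : (forall z, 0 <= p z <= M) -> predictable p ->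
  P.-integrable setT (EFin \o boxed_mean p).
Proof. by move=> pM hp; apply: sq_integrable_integrable; exact: boxed_mean_square pM hp. Qed.

(** On a box every term of the subtraction-free isometry is finite, so that it can be rearranged
    into a covariance. *)
Lemma comp_int_cov0 i j p q M : (forall z, 0 <= p z <= M) -> (forall z, 0 <= q z <= M) ->
  predictable p -> predictable q ->
  \int[P]_w (comp_int i p w * comp_int j q w) =
  (i == j)%:R * \int[P]_w boxed_mean (fun z => p z * q z) w.
Proof.
move=> pM qM hp hq.
have pM' := ge0_bounded pM; have qM' := ge0_bounded qM.
have q0 z : 0 <= q z by case/andP: (qM z).
have := boxed_isometry hF hN i j K0 pM q0 hp hq; cbv zeta.
have X2 := boxed_int_square i pM hp; have Y2 := boxed_int_square j qM hq.
have x2 := boxed_mean_square pM hp; have y2 := boxed_mean_square qM hq.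
have pqM z : `|p z * q z| <= M * M by rewrite normrM ler_pM.
have hpq : predictable (fun z => p z * q z) by exact: measurable_funM.
under eq_integral do rewrite -(boxed_intE i _ pM' hp) -(boxed_intE j _ qM' hq) -EFinM.
under [X in (_ + X)%E = _]eq_integral do rewrite -(boxed_meanE _ pM' hp) -(boxed_meanE _ qM' hq) -EFinM.
under [X in _ = (X + _ + _)%E]eq_integral do rewrite -(boxed_intE i _ pM' hp) -(boxed_meanE _ qM' hq) -EFinM.
under [X in _ = (_ + X + _)%E]eq_integral do rewrite -(boxed_meanE _ pM' hp) -(boxed_intE j _ qM' hq) -EFinM.
under [X in _ = (_ + _ + _ * X)%E]eq_integral do rewrite -(boxed_meanE _ pqM hpq).
have XY := sq_integrableM X2 Y2; have xy := sq_integrableM x2 y2.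
have Xy := sq_integrableM X2 y2; have xY := sq_integrableM x2 Y2.
have L := boxed_mean_integrable (mulr_bounded pM qM) hpq.
rewrite -!EFin_Rintegral// -!EFinM -!EFinD => -[e].
rewrite /comp_int.
have -> : \int[P]_w ((boxed_int i p w - boxed_mean p w) * (boxed_int j q w - boxed_mean q w)) =
  \int[P]_w ((boxed_int i p w * boxed_int j q w + boxed_mean p w * boxed_mean q w) -
             (boxed_int i p w * boxed_mean q w + boxed_mean p w * boxed_int j q w)).
  by apply: eq_Rintegral => w _; ring.
rewrite RintegralB//; [|exact: (integrableD measurableT XY xy)|exact: (integrableD measurableT Xy xY)].
by rewrite !RintegralD// e; ring.
Qed.

Let pos f z : R := Num.max (f z) 0.
Let neg f z : R := Num.max (- f z) 0.

Let posB f M : (forall z, `|f z| <= M) -> forall z, 0 <= pos f z <= M.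
Proof.
by move=> h z; rewrite /pos le_max lexx orbT/= ge_max (le_trans (ler_norm _) (h z)) (le_trans _ (h z)).
Qed.

Let negB f M : (forall z, `|f z| <= M) -> forall z, 0 <= neg f z <= M.
Proof.
move=> h z; rewrite /neg le_max lexx orbT/= ge_max (le_trans _ (h z)) ?(le_trans _ (h z))//.
by rewrite -normrN ler_norm.
Qed.

Let posP f : predictable f -> predictable (pos f).
Proof. by move=> hf; apply: measurable_maxr. Qed.

Let negP f : predictable f -> predictable (neg f).
Proof. by move=> hf; apply: measurable_maxr => //; exact: measurableT_comp. Qed.

Let pos_neg f z : f z = pos f z - neg f z.
Proof.
rewrite /pos /neg; have [h|h] := leP (f z) 0; have [h'|h'] := leP (- f z) 0; lra.
Qed.

Lemma comp_int_pos_neg i f M w : (forall z, `|f z| <= M) -> predictable f ->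
  comp_int i f w = comp_int i (pos f) w - comp_int i (neg f) w.
Proof.
move=> fM hf.
have h (m : {measure set (plane R) -> \bar R}) : (m setT < +oo)%E ->
    \int[m]_x f (w, x) = \int[m]_x pos f (w, x) - \int[m]_x neg f (w, x).
  move=> mfin; rewrite -RintegralB//; first by apply: eq_Rintegral => x _; exact: pos_neg.
  - apply: (bounded_integrable w mfin (ge0_bounded (posB fM))); exact: pm (posP hf).
  - apply: (bounded_integrable w mfin (ge0_bounded (negB fM))); exact: pm (negP hf).
rewrite /comp_int /boxed_int /boxed_mean h ?box_points_fin// h ?boxed_leb_fin//; ring.
Qed.

(** Both sides are bilinear, and each integrand is the difference of its positive and negative
    parts. *)
Lemma comp_int_cov i j f g M : (forall z, `|f z| <= M) -> (forall z, `|g z| <= M) ->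
  predictable f -> predictable g ->
  \int[P]_w (comp_int i f w * comp_int j g w) =
  (i == j)%:R * \int[P]_w boxed_mean (fun z => f z * g z) w.
Proof.
move=> fM gM hf hg.
have pf := posB fM; have nf := negB fM; have pg := posB gM; have ng := negB gM.
have hpf := posP hf; have hnf := negP hf; have hpg := posP hg; have hng := negP hg.
have S1 := comp_int_square i pf hpf; have S2 := comp_int_square i nf hnf.
have S3 := comp_int_square j pg hpg; have S4 := comp_int_square j ng hng.
have I13 := sq_integrableM S1 S3; have I14 := sq_integrableM S1 S4.
have I23 := sq_integrableM S2 S3; have I24 := sq_integrableM S2 S4.
transitivity (\int[P]_w ((comp_int i (pos f) w * comp_int j (pos g) w +
    comp_int i (neg f) w * comp_int j (neg g) w) -
   (comp_int i (pos f) w * comp_int j (neg g) w +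
    comp_int i (neg f) w * comp_int j (pos g) w))).
  apply: eq_Rintegral => w _.
  by rewrite (comp_int_pos_neg i w fM hf) (comp_int_pos_neg j w gM hg); ring.
rewrite RintegralB//; [|exact: (integrableD measurableT I13 I24)|exact: (integrableD measurableT I14 I23)].
rewrite !RintegralD// (comp_int_cov0 i j pf pg)// (comp_int_cov0 i j nf ng)//.
rewrite (comp_int_cov0 i j pf ng)// (comp_int_cov0 i j nf pg)//.
have factor (c x1 x2 x3 x4 : R) : c * x1 + c * x2 - (c * x3 + c * x4) = c * (x1 + x2 - (x3 + x4)) by ring.
rewrite factor; congr (_ * _).
have mul p q : predictable p -> predictable q -> predictable (fun z => p z * q z) by exact: measurable_funM.
have B13 := boxed_mean_integrable (mulr_bounded pf pg) (mul _ _ hpf hpg).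
have B14 := boxed_mean_integrable (mulr_bounded pf ng) (mul _ _ hpf hng).
have B23 := boxed_mean_integrable (mulr_bounded nf pg) (mul _ _ hnf hpg).
have B24 := boxed_mean_integrable (mulr_bounded nf ng) (mul _ _ hnf hng).
rewrite -!RintegralD// -RintegralB//; [|exact: (integrableD measurableT B13 B24)|exact: (integrableD measurableT B14 B23)].
apply: eq_Rintegral => w _; rewrite /boxed_mean.
have bi p q : (forall z, 0 <= p z <= M) -> (forall z, 0 <= q z <= M) -> predictable p -> predictable q ->
    (boxed_leb K).-integrable setT (fun x => (p (w, x) * q (w, x))%:E).
  move=> pM qM hp hq.
  apply: (bounded_integrable w (boxed_leb_fin K) (ge0_bounded (mulr_bounded pM qM))); exact: pm (mul _ _ hp hq).
have D13 := bi _ _ pf pg hpf hpg; have D14 := bi _ _ pf ng hpf hng.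
have D23 := bi _ _ nf pg hnf hpg; have D24 := bi _ _ nf ng hnf hng.
rewrite -!RintegralD// -RintegralB//; [|exact: (integrableD measurableT D13 D24)|exact: (integrableD measurableT D14 D23)].
by apply: eq_Rintegral => x _; rewrite (pos_neg f) (pos_neg g); ring.
Qed.

Lemma comp_int_square_bounded i f M : (forall z, `|f z| <= M) -> predictable f ->
  sq_integrable P (comp_int i f).
Proof.
move=> fM hf; rewrite (_ : comp_int i f =
  (fun w => comp_int i (pos f) w - comp_int i (neg f) w)).
  apply: sq_integrableB; first by apply: (comp_int_square i (posB fM)); exact: posP.
  by apply: (comp_int_square i (negB fM)); exact: negP.
by apply/funext => w; exact: comp_int_pos_neg fM hf.
Qed.

Lemma boxed_mean_sqrE f M : (forall z, `|f z| <= M) -> predictable f ->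
  (\int[P]_w boxed_mean (fun z => f z ^+ 2) w)%R%:E = (\int[P]_w \int[boxed_leb K]_x ((f (w, x)) ^+ 2)%:E)%E.
Proof.
move=> fM hf; have hM z : 0 <= f z ^+ 2 <= M ^+ 2.
  by rewrite sqr_ge0/= -(real_normK (num_real (f z))) lerXn2r// nnegrE// (le_trans _ (fM z)).
have hp : predictable (fun z => f z ^+ 2) by exact: measurable_funX.
rewrite EFin_Rintegral; last exact: boxed_mean_integrable hM hp.
by apply: eq_integral => w _; rewrite (boxed_meanE w (ge0_bounded hM) hp).
Qed.

(** Compensated integrals at distinct sites are orthogonal, so the expanded square keeps its
    diagonal only. *)
Theorem comp_int_isometry (J : seq I) (f : I -> W * plane R -> R) M : uniq J ->
  (forall j z, `|f j z| <= M) -> (forall j, predictable (f j)) ->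
  (\int[P]_w ((\sum_(j <- J) comp_int j (f j) w) ^+ 2)%:E =
   \sum_(j <- J) \int[P]_w \int[boxed_leb K]_x ((f j (w, x)) ^+ 2)%:E)%E.
Proof.
move=> uJ fM hf.
have S j := comp_int_square_bounded j (fM j) (hf j).
have I2 i j := sq_integrableM (S i) (S j).
under eq_integral => w _.
  rewrite expr2 big_distrlr/= -sumEFin.
  under eq_bigr do rewrite -sumEFin.
  over.
rewrite integral_sum//; last first.
  by move=> i; apply: integrable_sum => // j _; exact: I2.
apply: eq_big_seq => i iJ; rewrite integral_sum//; last by move=> j; exact: I2.
rewrite (bigD1_seq i)//= big1 ?adde0; last first.
  move=> j ij; rewrite -(EFin_Rintegral (I2 i j)).
  by rewrite (comp_int_cov i j (fM i) (fM j))// eq_sym (negbTE ij) mul0r.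
rewrite -(EFin_Rintegral (I2 i i)) (comp_int_cov i i (fM i) (fM i))// eqxx mul1r.
by rewrite -(boxed_mean_sqrE (fM i) (hf i)).
Qed.

End comp_integrals.

Local Open Scope ereal_scope.

(** * Sums over a countable set along an enumeration *)

Section countable_sums.
Context {R : realType} {T : countType}.
Implicit Types (g h : T -> \bar R) (s : seq T).

(** The elements of code below [n]: an increasing exhaustion by duplicate-free lists, which turns
    sums over all sites into limits of sequences. *)
Definition initial (n : nat) : seq T := pmap (@pickle_inv T) (iota 0 n).

Lemma mem_initial j n : (j \in initial n) = (choice.pickle j < n)%N.
Proof.
rewrite mem_pmap; apply/mapP/idP => [[k]|jn].
  rewrite mem_iota add0n /= => kn e.
  by have := @pickle_invK T k; rewrite -e /= => ->.
by exists (choice.pickle j); [rewrite mem_iota|rewrite pickleK_inv].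
Qed.

Lemma initial_uniq n : uniq (initial n).
Proof. by apply: (pmap_uniq (@pickle_invK T)); exact: iota_uniq. Qed.

Lemma sub_initial s : exists n, forall j, j \in s -> j \in initial n.
Proof.
elim: s => [|i s [n h]]; first by exists 0%N.
exists (maxn n (choice.pickle i).+1) => j; rewrite inE mem_initial => /orP[/eqP ->|/h].
  by rewrite leq_max ltnSn orbT.
by rewrite mem_initial => jn; rewrite leq_max jn.
Qed.

Lemma le_seq_sum g s s' : (forall j, 0 <= g j) -> uniq s -> uniq s' -> {subset s <= s'} ->
  \sum_(j <- s) g j <= \sum_(j <- s') g j.
Proof.
move=> g0 us us' ss.
rewrite [leRHS](bigID (mem s))/= -[in leRHS]big_filter.
have -> : \sum_(i <- [seq i <- s' | i \in s]) g i = \sum_(i <- s) g i.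
  apply: perm_big; apply: uniq_perm => //; first exact: filter_uniq.
  by move=> j; rewrite mem_filter; case: (boolP (j \in s)) => // /ss ->.
by rewrite leeDl// sume_ge0.
Qed.

Lemma sub_initial_le n m : (n <= m)%N -> {subset initial n <= initial m}.
Proof. by move=> nm j; rewrite !mem_initial => /leq_trans; apply. Qed.

Definition lsum g : \bar R := limn (fun n => \sum_(j <- initial n) g j).

Lemma nondecreasing_initial_sum g : (forall j, 0 <= g j) ->
  {homo (fun n => \sum_(j <- initial n) g j) : n m / (n <= m)%N >-> n <= m}.
Proof. by move=> g0 n m nm; apply: le_seq_sum => //; [exact: initial_uniq..|exact: sub_initial_le]. Qed.

Lemma is_cvg_initial_sum g : (forall j, 0 <= g j) -> cvgn (fun n => \sum_(j <- initial n) g j).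
Proof. by move=> g0; apply: ereal_nondecreasing_is_cvgn => n m; exact: nondecreasing_initial_sum. Qed.

Lemma seq_sum_le_lsum g s : (forall j, 0 <= g j) -> uniq s -> \sum_(j <- s) g j <= lsum g.
Proof.
move=> g0 us; have [n sn] := sub_initial s.
apply: le_trans (le_seq_sum g0 us (initial_uniq n) sn) _.
apply: lime_ge; first exact: is_cvg_initial_sum.
by exists n => // m nm; exact: nondecreasing_initial_sum.
Qed.

Lemma le_lsum_bound g M : (forall j, 0 <= g j) ->
  (forall n, \sum_(j <- initial n) g j <= M) -> lsum g <= M.
Proof. by move=> g0 gM; apply: lime_le; [exact: is_cvg_initial_sum|exact: nearW]. Qed.

Lemma lsum_ge0 g : (forall j, 0 <= g j) -> 0 <= lsum g.
Proof. by move=> g0; have := seq_sum_le_lsum g0 (isT : uniq [::]); rewrite big_nil. Qed.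

Lemma le_lsum1 g j : (forall j, 0 <= g j) -> g j <= lsum g.
Proof. by move=> g0; have := seq_sum_le_lsum g0 (isT : uniq [:: j]); rewrite big_seq1. Qed.

Lemma le_lsum g h : (forall j, 0 <= g j) -> (forall j, g j <= h j) -> lsum g <= lsum h.
Proof.
move=> g0 gh; have h0 j : 0 <= h j by exact: le_trans (gh j).
apply: le_lsum_bound => // n; apply: le_trans (seq_sum_le_lsum h0 (initial_uniq n)).
by apply: lee_sum => j _.
Qed.

Lemma eq_lsum g h : g =1 h -> lsum g = lsum h.
Proof. by move=> /funext ->. Qed.

Lemma lsumD g h : (forall j, 0 <= g j) -> (forall j, 0 <= h j) ->
  lsum (fun j => g j + h j) = lsum g + lsum h.
Proof.
move=> g0 h0; rewrite /lsum; under eq_fun do rewrite big_split/=.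
apply: limeD; [exact: is_cvg_initial_sum|exact: is_cvg_initial_sum|].
by apply: ge0_adde_def; rewrite inE; exact: lsum_ge0.
Qed.

Lemma lsumZ (c : R) g : (0 <= c)%R -> (forall j, 0 <= g j) ->
  lsum (fun j => c%:E * g j) = c%:E * lsum g.
Proof.
move=> c0 g0; rewrite /lsum -limeMl//; last exact: is_cvg_initial_sum.
by congr (limn _); apply/funext => n; rewrite ge0_sume_distrr.
Qed.

Lemma lsum_finite g s : uniq s -> (forall j, 0 <= g j) -> (forall j, j \notin s -> g j = 0) ->
  lsum g = \sum_(j <- s) g j.
Proof.
move=> us g0 gs; apply/eqP; rewrite eq_le seq_sum_le_lsum// andbT.
apply: le_lsum_bound => // n.
rewrite (bigID (mem s))/= [X in _ + X]big1 ?adde0// -big_filter.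
by apply: le_seq_sum; rewrite ?filter_uniq ?initial_uniq// => j; rewrite mem_filter => /andP[].
Qed.

Lemma lsum_esum g : (forall j, 0 <= g j) -> lsum g = (\esum_(j in setT) g j)%R.
Proof.
move=> g0; apply/eqP; rewrite eq_le; apply/andP; split.
  apply: le_lsum_bound => // n; apply: esum_ge; exists [set` initial n] => //=; first by split => //; exact: finite_seq.
  by rewrite fsbig_seq//; exact: initial_uniq.
apply: ge_ereal_sup => /= _ [A [finA _] <-].
rewrite fsbig_finite//=; apply: seq_sum_le_lsum => //; exact: fset_uniq.
Qed.

(** An injective reindexing can only decrease a sum of nonnegative terms; the inequality is used for
    the bijection and for its inverse. *)
Lemma lsum_reindex g (f f' : T -> T) : cancel f f' -> cancel f' f -> (forall j, 0 <= g j) ->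
  lsum (fun j => g (f j)) = lsum g.
Proof.
move=> fK f'K g0.
have le (e e' : T -> T) h : cancel e e' -> (forall j, 0 <= h j) -> lsum (fun j => h (e j)) <= lsum h.
  move=> eK h0; apply: le_lsum_bound => // n.
  rewrite -(big_map e xpredT h); apply: seq_sum_le_lsum => //.
  by rewrite map_inj_uniq ?initial_uniq//; exact: can_inj eK.
apply/eqP; rewrite eq_le (le _ f')//=.
have := le f' f (fun j => g (f j)) f'K (fun j => g0 _).
by rewrite (_ : (fun j => g (f (f' j))) = g)//; apply/funext => j; rewrite f'K.
Qed.

Lemma lsum_seq (I : Type) (r : seq I) (g : I -> T -> \bar R) : (forall i j, 0 <= g i j) ->
  lsum (fun j => \sum_(i <- r) g i j) = \sum_(i <- r) lsum (g i).
Proof.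
move=> g0; elim: r => [|i r IH].
  rewrite big_nil; under eq_lsum do rewrite big_nil.
  by rewrite (@lsum_finite _ [::])// big_nil.
rewrite big_cons; under eq_lsum do rewrite big_cons.
by rewrite lsumD ?IH// => j; exact: sume_ge0.
Qed.

(** The partial sums are bounded integers, hence reach a maximum, at some [n]; a nonzero value
    outside [initial n] would exceed it. *)
Lemma lsum_nat_finite (f : T -> nat) : lsum (fun j => ((f j)%:R)%:E) < +oo ->
  exists n, forall j, j \notin initial n -> f j = 0%N.
Proof.
move=> fin.
have g0 j : 0 <= (((f j)%:R : R)%:E) by rewrite lee_fin.
pose S n := (\sum_(j <- initial n) f j)%N.
have SE n : ((S n)%:R : R)%:E = \sum_(j <- initial n) ((f j)%:R)%:E.
  by rewrite sumEFin /S natr_sum.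
have [M SM] : exists M, forall n, (S n <= M)%N.
  have L0 := lsum_ge0 g0.
  exists (Num.bound (fine (lsum (fun j => ((f j)%:R : R)%:E)))) => n.
  rewrite -(ler_nat R); apply: ltW; apply: le_lt_trans (archi_boundP (fine_ge0 L0)).
  by rewrite -lee_fin fineK ?ge0_fin_numE// SE seq_sum_le_lsum// initial_uniq.
have exS : exists m, `[< exists n, S n = m >] by exists (S 0%N); apply/asboolP; exists 0%N.
have bS m : `[< exists n, S n = m >] -> (m <= M)%N by move=> /asboolP[n <-].
have [m /asboolP[n Sn] mmax] := ex_maxnP exS bS.
exists n => j jn; apply/eqP; rewrite -leqn0 leqNgt; apply/negP => fj.
have : (S (maxn n (choice.pickle j).+1) <= m)%N by apply: mmax; apply/asboolP; eexists.
apply/negP; rewrite -ltnNge -Sn.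
apply: (@leq_trans (\sum_(i <- j :: initial n) f i)).
  by rewrite big_cons -[X in (X < _)%N]add0n ltn_add2r.
rewrite -(ler_nat R) -lee_fin /S !natr_sum -!sumEFin.
apply: le_seq_sum => //; rewrite /= ?jn ?initial_uniq// => i; rewrite inE => /orP[/eqP ->|].
  by rewrite mem_initial leq_max ltnSn orbT.
by rewrite !mem_initial => h; rewrite leq_max h.
Qed.

Section integral.
Context {dO : measure_display} {W : measurableType dO}.

Lemma measurable_lsum (D : set W) (g : T -> W -> \bar R) : measurable D -> (forall j w, 0 <= g j w) ->
  (forall j, measurable_fun D (g j)) -> measurable_fun D (fun w => lsum (g ^~ w)).
Proof.
move=> mD g0 mg; apply: (@emeasurable_fun_cvg _ _ _ _ (fun n w => \sum_(j <- initial n) g j w)).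
  by move=> n; exact: emeasurable_sum.
by move=> w _; exact: is_cvg_initial_sum.
Qed.

Lemma integral_lsum (m : {measure set W -> \bar R}) (g : T -> W -> \bar R) : (forall j w, 0 <= g j w) ->
  (forall j, mfunT (g j)) ->
  \int[m]_w lsum (g ^~ w) = lsum (fun j => \int[m]_w g j w).
Proof.
move=> g0 mg.
have := @monotone_convergence _ _ _ m _ measurableT (fun n w => \sum_(j <- initial n) g j w).
move=> ->; last 3 first.
- by move=> n; exact: emeasurable_sum.
- by move=> n w _; exact: sume_ge0.
- by move=> w _ p q; exact: nondecreasing_initial_sum.
by congr (limn _); apply/funext => n; rewrite ge0_integral_sum.
Qed.

End integral.

End countable_sums.

(** * Predictability of time, of marks and of regions under an intensity *)

Section predictable_functions.
Context {R : realType} {dO : measure_display} {W : measurableType dO}.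
Variable F : R -> set (set W).
Hypothesis hF : filtration F.
Local Notation G := (pred_gen F).
Local Notation predictable f := (mfunT (f : sigmaT G -> \bar R)).
Local Notation predictable_set A := (<<s G >> A).

(* On the null set of points of the plane that the generators do not separate,
   the time coordinate is replaced by 0 and the mark by +oo. *)
Definition ptime (x : plane R) : R := if ((0 < x.1) && (0 <= x.2))%R then x.1 else 0%R.
Definition pmark (x : plane R) : \bar R := if ((0 < x.1) && (0 <= x.2))%R then (x.2)%:E else +oo.

Lemma ptime_gt0 x : (0 < ptime x)%R <-> oquad x.
Proof.
rewrite /ptime /oquad/= !in_itv/= !andbT; split.
  by case: ifPn => [/andP[]//|_]; rewrite ltxx.
by move=> [h1 h2]; rewrite h1 h2.
Qed.

Lemma ptimeE x : oquad x -> ptime x = x.1.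
Proof. by move=> [/=]; rewrite /ptime !in_itv/= !andbT => -> ->. Qed.

Lemma pmarkE x : oquad x -> pmark x = x.2%:E.
Proof. by move=> [/=]; rewrite /pmark !in_itv/= !andbT => -> ->. Qed.

Lemma predictable_rect A c z : (0 <= c)%R -> (0 <= z)%R -> F c A ->
  predictable_set (A `*` (`]c, +oo[ `*` `[0%R, z])).
Proof. by move=> c0 z0 FA; apply: sub_sigma_algebra; right; exists c, z, A. Qed.

Lemma filtrationT c : (0 <= c)%R -> F c setT.
Proof. by move=> c0; rewrite -(filtration_id hF c0); exact: (@measurableT _ (sigmaT (F c))). Qed.

Lemma predictable_after A c : (0 <= c)%R -> F c A -> predictable_set (A `*` [set x | (c < ptime x)%R]).
Proof.
move=> c0 FA.
have -> : A `*` [set x | (c < ptime x)%R] = \bigcup_n (A `*` (`]c, +oo[ `*` `[0%R, n%:R])).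
  apply/seteqP; split => -[w x] /=.
    move=> [Aw cx]; have /ptime_gt0 Qx : (0 < ptime x)%R by exact: le_lt_trans cx.
    rewrite ptimeE// in cx; case: Qx => /=; rewrite !in_itv/= !andbT => x0 x2.
    exists (Num.bound x.2) => //=; rewrite !in_itv/= cx x2/=; split => //; split => //.
    by apply: ltW; exact: archi_boundP.
  move=> [n _ [/= Aw []]]; rewrite !in_itv/= andbT => cx /andP[x2 _]; split => //.
  by rewrite ptimeE// /oquad/= !in_itv/= !andbT x2 (le_lt_trans c0 cx).
apply: (@bigcup_measurable _ (sigmaT G)) => n _.
exact: predictable_rect.
Qed.

Lemma predictable_oquad : predictable_set [set z | oquad z.2].
Proof.
have -> : [set z : W * plane R | oquad z.2] = setT `*` [set x | (0 < ptime x)%R].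
  by apply/seteqP; split => -[w x] /=; [move/ptime_gt0|move=> [_ /ptime_gt0]].
by apply: predictable_after => //; exact: filtrationT.
Qed.

(** Induction on [phi] from indicators of events of [F c]; a quantity known at time [c] is switched
    on strictly after [c]. *)
Lemma predictable_adapted c (phi : W -> \bar R) : (0 <= c)%R -> (forall w, 0 <= phi w) ->
  mfunT (phi : sigmaT (F c) -> \bar R) ->
  predictable (fun z => phi z.1 * ((c < ptime z.2)%R%:R)%:E).
Proof.
move=> c0; move: phi; apply: (@nonneg_measurable_ind _ _ (sigmaT (F c))).
- move=> A mA; have FA : F c A by move: mA; rewrite /measurable/= filtration_id.
  rewrite [X in measurable_fun _ X](_ : _ =
    fun z : sigmaT G => (\1_(A `*` [set x | (c < ptime x)%R]) z)%:E).
    apply/measurable_EFinP; apply: measurable_indic; exact: predictable_after.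
  apply/funext => -[w x]; rewrite -EFinM; congr EFin; rewrite !indicE.
  have -> : ((w, x) \in A `*` [set x | (c < ptime x)%R]) = (w \in A) && (c < ptime x)%R.
    apply/idP/andP; rewrite !inE/=; first by move=> -[].
    by move=> [].
  by case: (_ \in _); case: (_ < _)%R; rewrite /= ?mulr0 ?mulr1.
- move=> r f r0 f0 mf IH; under eq_fun do rewrite -muleA.
  by apply: emeasurable_funM => //; exact: measurable_cst.
- move=> f g f0 g0 mf mg IHf IHg; under eq_fun do rewrite ge0_muleDl//.
  exact: emeasurable_funD.
- move=> f g f0 mf nd lim IH.
  apply: (@emeasurable_fun_cvg _ _ _ _ (fun n (z : sigmaT G) => f n z.1 * ((c < ptime z.2)%R%:R)%:E)) => //.
  by move=> z _; apply: cvgeZr.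
Qed.

Lemma predictable_ptime : mfunT ((fun z => ptime z.2) : sigmaT G -> R).
Proof.
apply: (measurability _ (@RGenOInfty.measurableE R)) => _ [_ [c ->] <-]; rewrite setTI.
have [c0|c0] := leP 0%R c.
  rewrite [X in measurable X](_ : _ = setT `*` [set x | (c < ptime x)%R]).
    by apply: predictable_after => //; exact: filtrationT.
  by apply/seteqP; split => -[w x] /=; rewrite in_itv/= andbT => // -[].
rewrite [X in measurable X](_ : _ = setT); first exact: measurableT.
apply/seteqP; split => // -[w x] _ /=; rewrite in_itv/= andbT; apply: lt_le_trans c0 _.
by rewrite /ptime; case: ifP => // /andP[/ltW].
Qed.

(** Sublevel sets of the mark are generators, whence the minus sign; the value [+oo] keeps the
    excluded points out of all of them. *)
Lemma predictable_pmark : predictable (fun z => - pmark z.2).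
Proof.
apply: (measurability _ (@ErealGenCInfty.measurableE R)) => _ [_ [c ->] <-]; rewrite setTI.
have [c0|c0] := leP c 0%R.
  rewrite [X in measurable X](_ : _ = setT `*` (`]0%R, +oo[ `*` `[0%R, (- c)%R])).
    by apply: predictable_rect; rewrite ?oppr_ge0//; exact: filtrationT.
  apply/seteqP; split => -[w x] /=; rewrite !in_itv/= !andbT /pmark.
    case: ifPn => [/andP[-> x2]|_ /=]; last by rewrite leeNy_eq.
    by rewrite x2 -EFinN lee_fin lerNr.
  by move=> [_ [x1 /andP[x2 xc]]]; rewrite x1 x2/= lee_fin lerNr.
rewrite [X in measurable X](_ : _ = set0); first exact: measurable0.
apply/seteqP; split => // -[w x] /=; rewrite in_itv/= andbT /pmark.
case: ifPn => [/andP[_ x2]|_ /=]; last by rewrite leeNy_eq.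
by rewrite lee_fin => h; lra.
Qed.

(** A comparison between two predictable functions, restricted to the points where [pmark] is the
    true mark. *)
Lemma predictable_below (lam : W * plane R -> \bar R) : predictable lam ->
  predictable_set [set z | oquad z.2 /\ z.2.2%:E <= lam z].
Proof.
move=> mlam.
have -> : [set z | oquad z.2 /\ z.2.2%:E <= lam z] =
    [set z | oquad z.2] `&` [set z | - lam z <= - pmark z.2].
  by apply/seteqP; split => z /= [Qz]; rewrite leeN2 pmarkE.
apply: (@measurableI _ (sigmaT G)); first exact: predictable_oquad.
have h := measurable_fun_lee (measurableT_comp (@oppe_measurable R setT) mlam) predictable_pmark.
by have := h measurableT [set true]; rewrite setTI; apply.
Qed.

End predictable_functions.

(** * Stieltjes integrals against counting paths as limits of Riemann sums *)

Section counting_measure.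
Context {R : realType}.
Variable f : R -> nat.
Hypothesis cf : counting_path f.

Definition path_meas := lebesgue_stieltjes_measure (stieltjes_ext f).

Lemma stieltjes_extE t : stieltjes_ext f t = (f (Num.max 0%R t))%:R :> R.
Proof. by rewrite /stieltjes_ext asboolT. Qed.

Lemma path_meas_oc c e : (c <= e)%R ->
  path_meas `]c, e] = (stieltjes_ext f e - stieltjes_ext f c)%:E.
Proof.
move=> ce; rewrite /path_meas /lebesgue_stieltjes_measure.
rewrite [LHS]measurable_mu_extE/=; last exact: is_ocitv.
by rewrite wlength_itv_bnd.
Qed.

Lemma path_meas_oc0 c e : (0 <= c)%R -> (c <= e)%R ->
  path_meas `]c, e] = ((f e)%:R - (f c)%:R)%:E.
Proof. by move=> c0 ce; rewrite path_meas_oc// !stieltjes_extE !max_r// (le_trans c0). Qed.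

Lemma path_meas_empty : path_meas set0 = 0. Proof. exact: measure0. Qed.

Lemma path_meas_set0 : path_meas [set (0%R : R)] = 0.
Proof.
apply/eqP; rewrite eq_le measure_ge0 andbT.
apply: (@le_trans _ _ (path_meas `](-1)%R, 0%R])).
  apply: le_measure; rewrite ?inE; [exact: measurable_set1|exact: measurable_itv|].
  by move=> x /= ->; rewrite in_itv/=; lra.
by rewrite path_meas_oc ?lerN10// !stieltjes_extE !max_l ?subrr// lerN10.
Qed.

Lemma path_meas_co_fin (s : R) : path_meas `[0%R, s[ < +oo.
Proof.
have [s0|s0] := leP 0%R s; last first.
  rewrite set_itv_ge; first by rewrite path_meas_empty.
  by rewrite bnd_simp -leNgt ltW.
apply: (@le_lt_trans _ _ (path_meas `](-1)%R, s])).
  apply: le_measure; rewrite ?inE; try exact: measurable_itv.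
  by move=> x /=; rewrite !in_itv/=; lra.
by rewrite path_meas_oc ?ltry//; lra.
Qed.

Variable b : R.
Hypothesis b0 : (0 < b)%R.
Local Notation e u := (expR (b * u))%:E.

Lemma measurable_exp (D : set R) : measurable_fun D (fun u : R => e u).
Proof.
have c : continuous (fun u : R => expR (b * u)).
  by move=> x; apply: continuous_comp; [exact: mulrl_continuous|exact: continuous_expR].
exact: (measurable_continuous c).
Qed.

(** Riemann sum over the grid of mesh [1 / m.+1] with left end points. Only the cells that end
    before [s] are used, so that the sum is known before time [s]; the maximum with 0 keeps it
    nonnegative even for a path that is not monotone. *)
Definition grid_sum (m : nat) (s : R) : \bar R :=
  \sum_(k <oo) (expR (b * (k%:R / m.+1%:R)) *
     Num.max ((f (k.+1%:R / m.+1%:R))%:R - (f (k%:R / m.+1%:R))%:R) 0)%:E * ((k.+1%:R / m.+1%:R < s)%R%:R)%:E.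

Ltac side := first [exact: measurable_itv | exact: measurable_exp | exact: measurable_cst
  | by move=> ? _; rewrite ?mule_ge0// ?lee_fin ?expR_ge0 | by rewrite lee_fin expR_ge0
  | by apply: emeasurable_funM => //; exact: measurable_exp].

Let cell m k : set R := `](k%:R / m.+1%:R)%R, (k.+1%:R / m.+1%:R)%R].
Let C m (s : R) k : set R := if (k.+1%:R / m.+1%:R < s)%R then cell m k else set0.

Let mC m s k : measurable (C m s k : set (borel R)).
Proof. by rewrite /C; case: ifP => _; [exact: measurable_itv|exact: measurable0]. Qed.

Let m_gt0 (m : nat) : (0 < (m.+1%:R : R))%R. Proof. by rewrite ltr0n. Qed.

Let cell_lt m k : (k%:R / m.+1%:R < k.+1%:R / m.+1%:R :> R)%R.
Proof. by rewrite ltr_pM2r ?invr_gt0// ltr_nat. Qed.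

Let tC m s : trivIset setT (C m s).
Proof.
move=> i j _ _ [x [/=]]; rewrite /C; case: ifP => // _; case: ifP => // _.
rewrite /cell/= !in_itv/= => /andP[h1 h2] /andP[h3 h4].
have := lt_le_trans h1 h4; have := lt_le_trans h3 h2.
by rewrite !ltr_pM2r ?invr_gt0// !ltr_nat !ltnS => ij ji; apply/eqP; rewrite eqn_leq ij ji.
Qed.

Let term m (s : R) k : \bar R := (expR (b * (k%:R / m.+1%:R)) *
     Num.max ((f (k.+1%:R / m.+1%:R))%:R - (f (k%:R / m.+1%:R))%:R) 0)%:E * ((k.+1%:R / m.+1%:R < s)%R%:R)%:E.

Let termE m s k : term m s k = (expR (b * (k%:R / m.+1%:R)))%:E * path_meas (C m s k).
Proof.
rewrite /term /C EFinM -muleA; congr (_ * _); case: ifP => _; last by rewrite mule0 path_meas_empty.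
rewrite mule1 path_meas_oc0 ?divr_ge0//; last by rewrite ltW// cell_lt.
rewrite max_l// subr_ge0 ler_nat; apply: (counting_nondecreasing cf); first by rewrite divr_ge0.
by rewrite ltW// cell_lt.
Qed.

Let term_le m s k : term m s k <= \int[path_meas]_(u in C m s k) e u.
Proof.
rewrite termE -integral_cst; last exact: mC.
apply: ge0_le_integral; first [exact: mC|side|idtac].
move=> u; rewrite /C; case: ifP => // _; rewrite /cell/= in_itv/= => /andP[ku _].
by rewrite lee_fin ler_expR ler_pM2l// ltW.
Qed.

Let term_ge m s k :
  (expR (- (b / m.+1%:R)))%:E * \int[path_meas]_(u in C m s k) e u <= term m s k.
Proof.
rewrite termE -ge0_integralZl; first [exact: mC|side|idtac].
rewrite -integral_cst; last exact: mC.
apply: ge0_le_integral; first [exact: mC|side|idtac].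
move=> u; rewrite /C; case: ifP => // _; rewrite /cell/= in_itv/= => /andP[_ uk].
rewrite -EFinM lee_fin -expRD ler_expR -mulrN -mulrDr ler_pM2l//.
by rewrite addrC lerBlDr; apply: le_trans uk _; rewrite -natr1 mulrDl mul1r.
Qed.

Let sum_cells m s : \sum_(k <oo) \int[path_meas]_(u in C m s k) e u =
  \int[path_meas]_(u in \bigcup_k C m s k) e u.
Proof.
rewrite ge0_integral_bigcup//; first [by move=> k; exact: mC|side].
Qed.

Let mUC m s : measurable (\bigcup_k C m s k : set (borel R)).
Proof. by apply: bigcupT_measurable => k; exact: mC. Qed.

Lemma grid_sum_le m s : (grid_sum m s <= \int[path_meas]_(u in `[0%R, s[) e u).
Proof.
apply: (@le_trans _ _ (\int[path_meas]_(u in \bigcup_k C m s k) e u)).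
  by rewrite -sum_cells; apply: lee_nneseries => k _; [rewrite mule_ge0// lee_fin ?mulr_ge0 ?expR_ge0 ?le_max ?lexx ?orbT|exact: term_le].
apply: ge0_subset_integral; first [exact: mUC|side|idtac].
move=> u [k _]; rewrite /C; case: ifP => // ks; rewrite /cell/= !in_itv/= => /andP[ku uk].
by rewrite (le_lt_trans uk ks) andbT ltW// (le_lt_trans _ ku)// divr_ge0.
Qed.

(** Within a cell the exponential varies by a factor of at most [expR (b / m.+1)], and the cells
    used cover all positive times up to distance [1 / m.+1] from [s]. *)
Lemma grid_sum_ge m s :
  (expR (- (b / m.+1%:R)))%:E * \int[path_meas]_(u in `]0%R, (s - m.+1%:R^-1)%R[) e u <= grid_sum m s.
Proof.
apply: (@le_trans _ _ ((expR (- (b / m.+1%:R)))%:E * \int[path_meas]_(u in \bigcup_k C m s k) e u)).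
  apply: lee_wpmul2l; first by rewrite lee_fin expR_ge0.
  apply: ge0_subset_integral; first [exact: mUC|side|idtac].
  move=> u /=; rewrite in_itv/= => /andP[u0 us].
  have n0 := m_gt0 m.
  have um0 : (0 < u * m.+1%:R)%R by rewrite mulr_gt0.
  (* [k.+1] is the index of the first grid point at or after [u]. *)
  have [k kE] : exists k : nat, (k%:R < u * m.+1%:R <= k.+1%:R)%R.
    have := archi_boundP (ltW um0); set B := Num.bound _ => hB.
    have [|k /= hk hmin] := @ex_minnP (fun k => (u * m.+1%:R <= k.+1%:R)%R).
      by exists B; rewrite (le_trans (ltW hB))// ler_nat.
    exists k; rewrite hk andbT; case: k hk hmin => [|k] hk hmin //.
    by rewrite ltNge; apply/negP => /hmin; rewrite ltnn.
  move/andP: kE => [ku uk]; exists k => //; rewrite /C.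
  have kus : (k.+1%:R / m.+1%:R < s)%R.
    rewrite -natr1 mulrDl mul1r -ltrBrDr; apply: le_lt_trans us.
    by rewrite ler_pdivrMr// ltW.
  by rewrite kus /cell/= in_itv/= ltr_pdivrMr// ku ler_pdivlMr.
rewrite -sum_cells -nneseriesZl//; last first.
  by move=> k _; apply: integral_ge0 => x _; rewrite lee_fin expR_ge0.
apply: lee_nneseries => k _; last exact: term_ge.
by rewrite mule_ge0 ?lee_fin ?expR_ge0// integral_ge0// => x _; rewrite lee_fin expR_ge0.
Qed.

(** The constant extension of the path to negative times leaves no atom at 0. *)
Lemma integral_co_oo (h : R -> \bar R) (s : R) : (forall u, 0 <= h u) -> mfunT h ->
  \int[path_meas]_(u in `[0%R, s[) h u = \int[path_meas]_(u in `]0%R, s[) h u.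
Proof.
move=> h0 mh; have [s0|s0] := leP s 0%R.
  by rewrite !set_itv_ge// bnd_simp -leNgt// ltW.
have -> : `[0%R, s[%classic = [set (0%R : R)] `|` `]0%R, s[.
  by rewrite setU1itv// bnd_simp.
rewrite ge0_integral_setU//=.
- rewrite null_set_integral ?add0e//; [exact: measurable_funTS|exact: path_meas_set0].
- exact: measurable_funTS.
- by apply/disj_setPS => u [/= ->]; rewrite in_itv/= ltxx.
Qed.

Lemma exp_integral_fin s : \int[path_meas]_(u in `[0%R, s[) e u < +oo.
Proof.
apply: (@le_lt_trans _ _ (\int[path_meas]_(u in `[0%R, s[) (cst (e s) u))).
  apply: ge0_le_integral; first [side|idtac].
  by move=> u /=; rewrite in_itv/= => /andP[_ us]; rewrite lee_fin ler_expR ler_pM2l// ltW.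
rewrite integral_cst//.
by rewrite lte_mul_pinfty ?lee_fin ?expR_ge0// path_meas_co_fin.
Qed.

(** Squeezed between the two previous bounds as the mesh goes to 0. *)
Lemma cvg_grid_sum s : grid_sum m s @[m --> \oo] --> \int[path_meas]_(u in `[0%R, s[) e u.
Proof.
have Sfin : \int[path_meas]_(u in `[0%R, s[) e u \is a fin_num.
  rewrite ge0_fin_numE ?exp_integral_fin// integral_ge0// => x _; by rewrite lee_fin expR_ge0.
apply: (@squeeze_cvge _ _ _ _ (fun m => (expR (- (b / m.+1%:R)))%:E * \int[path_meas]_(u in `]0%R, (s - m.+1%:R^-1)%R[) e u) _ (fun=> \int[path_meas]_(u in `[0%R, s[) e u)).
- by apply: nearW => m; rewrite grid_sum_ge grid_sum_le.
- rewrite -[X in _ --> X]mul1e; apply: cvgeM.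
  + by rewrite mule_def_fin.
  + apply: cvg_EFin; first exact: nearW.
    rewrite -[X in _ --> X](@expR0 R).
    apply: (@cvg_comp _ _ _ (fun m => - (b / m.+1%:R))%R expR); last exact: continuous_expR.
    rewrite -[X in _ `=>` nbhs X]oppr0; apply: cvgN; rewrite -[X in _ --> X](mulr0 b).
    by apply: cvgM; [exact: cvg_cst|exact: cvg_harmonic].
  + rewrite integral_co_oo//; last exact: measurable_exp.
    have -> : `]0%R, s[%classic = \bigcup_m `]0%R, (s - m.+1%:R^-1)%R[%classic.
      apply/seteqP; split => u /=; rewrite in_itv/=.
        move=> /andP[u0 us].
        have h : (0 < s - u)%R by rewrite subr_gt0.
        exists (Num.bound (s - u)^-1) => //=; rewrite in_itv/= u0/= ltrBrDr addrC -ltrBrDr.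
        rewrite invf_plt ?posrE ?ltr0n//; apply: lt_trans (archi_boundP _) _; first by rewrite invr_ge0 ltW.
        by rewrite ltr_nat.
      move=> [m _ /=]; rewrite in_itv/= => /andP[-> us]/=; apply: lt_trans us _.
      by rewrite gtrBl invr_gt0.
    apply: ge0_nondecreasing_set_cvg_integral => //.
    * move=> p q pq; apply/subsetPset => u /=; rewrite !in_itv/= => /andP[-> h]/=; apply: lt_le_trans h _.
      by rewrite lerD2l lerN2 lef_pV2 ?posrE// ler_nat.
    * by move=> n; exact: measurable_exp.
- exact: cvg_cst.
Qed.

End counting_measure.

(* A discrete Gronwall inequality and spatial weights *)
Local Close Scope ereal_scope.

(** The increment is controlled by the value at the right end point, as in an implicit Euler scheme:
    [n] equal steps multiply [Y] by at most [(1 - x / n) ^ (- n)], which is below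
    [expR (x / (1 - x / n))] and so tends to at most [expR x]. *)
Lemma discrete_gronwall {R : realType} (Y : R -> R) (k u t : R) : 0 <= k -> u <= t ->
  (forall s, u <= s <= t -> 0 <= Y s) ->
  (forall s s', u <= s -> s <= s' -> s' <= t -> Y s' <= Y s + k * (s' - s) * Y s') ->
  Y t <= expR (k * (t - u)) * Y u.
Proof.
move=> k0 ut Y0 hY; set x := k * (t - u).
have x0 : 0 <= x by rewrite mulr_ge0// subr_ge0.
have step n : x < n.+1%:R -> Y t <= (1 - x / n.+1%:R)^-1 ^+ n.+1 * Y u.
  move=> xn; have n0 : 0 < n.+1%:R :> R by rewrite ltr0n.
  have q0 : 0 < 1 - x / n.+1%:R by rewrite subr_gt0 ltr_pdivrMr// mul1r.
  pose s (m : nat) := u + m%:R * ((t - u) / n.+1%:R).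
  have sn : s n.+1 = t by rewrite /s mulrC divfK ?gt_eqF// addrC subrK.
  have h0 : 0 <= (t - u) / n.+1%:R by rewrite divr_ge0 ?subr_ge0// ltW.
  have smon m m' : (m <= m')%N -> s m <= s m'.
    by move=> mm; rewrite lerD2l ler_wpM2r// ler_nat.
  suff H m : (m <= n.+1)%N -> Y (s m) <= (1 - x / n.+1%:R)^-1 ^+ m * Y u by rewrite -{1}sn; exact: H.
  elim: m => [_|m IH mn]; first by rewrite /s mul0r addr0 expr0 mul1r.
  have hm := hY (s m) (s m.+1).
  have um : u <= s m by rewrite lerDl mulr_ge0.
  have mt : s m.+1 <= t by rewrite -sn smon.
  have := hm um (smon _ _ (leqnSn m)) mt.
  have -> : k * (s m.+1 - s m) = x / n.+1%:R by rewrite /s /x -natr1; ring.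
  have := IH (ltnW mn) => h1 h2.
  rewrite exprS -mulrA mulrC ler_pdivlMr// mulrC.
  apply: le_trans h1; rewrite mulrBl mul1r lerBlDr; apply: le_trans h2 _; by rewrite lexx.
have Yu0 : 0 <= Y u by apply: Y0; rewrite lexx.
have bd n : x < n.+1%:R -> Y t <= expR (x / (1 - x / n.+1%:R)) * Y u.
  move=> xn; apply: le_trans (step _ xn) _; apply: ler_wpM2r => //.
  have n0 : 0 < n.+1%:R :> R by rewrite ltr0n.
  have q0 : 0 < 1 - x / n.+1%:R by rewrite subr_gt0 ltr_pdivrMr// mul1r.
  have -> : x / (1 - x / n.+1%:R) = (x / n.+1%:R / (1 - x / n.+1%:R)) *+ n.+1.
    by rewrite -[RHS]mulr_natr (mulrAC x n.+1%:R^-1) -[RHS]mulrA mulVf ?gt_eqF// mulr1.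
  rewrite -[X in expR X]mulr_natr expRM_natr lerXn2r ?nnegrE ?expR_ge0 ?invr_ge0 ?(ltW q0)//.
  apply: le_trans (expR_ge1Dx _).
  by rewrite -[X in _ <= X + _](divff (lt0r_neq0 q0)) -mulrDl subrK mul1r.
have lim : expR (x / (1 - x / n.+1%:R)) * Y u @[n --> \oo] --> expR x * Y u.
  apply: cvgM; last exact: cvg_cst.
  apply: (@cvg_comp _ _ _ (fun n => x / (1 - x / n.+1%:R)) expR); last exact: continuous_expR.
  have c1 : (1 - x / n.+1%:R) @[n --> \oo] --> (1 : R).
    rewrite -[X in _ --> X]subr0; apply: cvgB; first exact: cvg_cst.
    by rewrite -[X in _ --> X](mulr0 x); apply: cvgM; [exact: cvg_cst|exact: cvg_harmonic].
  rewrite -[X in _ `=>` nbhs X]divr1.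
  by apply: cvgM; [exact: cvg_cst|apply: cvgV => //; rewrite oner_eq0].
rewrite -(cvg_lim _ lim)//; apply: limr_ge; first by apply/cvg_ex; eexists; exact: lim.
exists (Num.bound x) => // n /= xn; apply: bd.
by apply: lt_le_trans (archi_boundP x0) _; rewrite ler_nat ltnW.
Qed.

Lemma fine_le_scale {R : realType} (k : R) (x y : \bar R) : x \is a fin_num -> y \is a fin_num ->
  fine x <= k * fine y -> (x <= k%:E * y)%E.
Proof. by move=> xf yf h; rewrite -(fineK xf) -(fineK yf) -EFinM lee_fin. Qed.

Lemma fine_le_add_scale {R : realType} (k : R) (x y : \bar R) : x \is a fin_num -> y \is a fin_num ->
  (x <= y + k%:E * x)%E -> fine x <= fine y + k * fine x.
Proof. by move=> xf yf; rewrite -{1 2}(fineK xf) -(fineK yf) -EFinM -EFinD lee_fin. Qed.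

Lemma le_scale_eq {R : realType} (k x x' y y' : \bar R) : x = x' -> y = y' -> (x' <= k * y' -> x <= k * y)%E.
Proof. by move=> -> ->. Qed.

Section weights.
Context {R : realType} {d : nat}.
Local Notation site := 'rV[int]_d.
Local Notation sqnorm := (@sqnorm R d).

(** Only coordinate [k] changes, and [(x + 1) ^+ 2 + (x - 1) ^+ 2 = 2 * x ^+ 2 + 2]. *)
Lemma sqnorm_step (j : site) k : sqnorm (j + unit_site k) + sqnorm (j - unit_site k) = 2 * sqnorm j + 2.
Proof.
rewrite /sqnorm -big_split/= mulr_sumr (bigD1 k)//= [in RHS](bigD1 k)//=.
rewrite !mxE !eqxx/= !intrD mulrNz.
have -> : \sum_(i < d | i != k) (((j + unit_site k) 0 i)%:~R ^+ 2 + ((j - unit_site k) 0 i)%:~R ^+ 2 : R) =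
    \sum_(i < d | i != k) 2 * (j 0 i)%:~R ^+ 2.
  apply: eq_bigr => i ik; rewrite !mxE eqxx (negbTE ik)/= oppr0 !addr0; ring.
ring.
Qed.

(** Averaging adds [2 * d / (2 * d + 1)], less than 1, to the squared norm. The cap [L] makes the
    weight bounded, as the growth estimate for weighted means requires. *)
Lemma avg_sqnorm_le (L : R) (j : site) : 0 <= L ->
  avg (fun i => Num.min (sqnorm i) L) j <= Num.min (sqnorm j) L + 1.
Proof.
move=> L0; rewrite /avg.
have n0 : 0 < (2 * d + 1)%:R :> R by rewrite ltr0n addn1.
rewrite mulrC ler_pdivrMr//.
have [jL|Lj] := leP (sqnorm j) L; last first.
  apply: (@le_trans _ _ (\sum_(v <- @steps d) L)); first by apply: ler_sum => v _; rewrite ge_min lexx orbT.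
  by rewrite big_const_seq count_predT size_steps iter_addr_0 -[leLHS]mulr_natr mulrDl mul1r lerDl ler0n//.
apply: (@le_trans _ _ (\sum_(v <- @steps d) sqnorm (j + v))).
  by apply: ler_sum => v _; rewrite ge_min lexx.
rewrite sum_steps addr0.
under eq_bigr do rewrite sqnorm_step.
rewrite sumr_const card_ord -mulr_natr natrD natrM; have := ler0n R d; nra.
Qed.

(** The average exceeds the weight by at most [eps], which is at most [eps] times the weight because
    the weight is at least 1. *)
Lemma weight_avg (eps L : R) (j : site) : 0 <= eps -> 0 <= L ->
  avg (fun i => 1 + eps * Num.min (sqnorm i) L) j <= (1 + eps) * (1 + eps * Num.min (sqnorm j) L).
Proof.
move=> e0 L0; have n0 : 0 < (2 * d + 1)%:R :> R by rewrite ltr0n addn1.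
have -> : avg (fun i => 1 + eps * Num.min (sqnorm i) L) j = 1 + eps * avg (fun i => Num.min (sqnorm i) L) j.
  rewrite /avg big_split/= -mulr_sumr big_const_seq count_predT size_steps iter_addr_0 mulrDr -[1 *+ _]/(_%:R).
  by rewrite mulVf ?gt_eqF// mulrCA.
have m0 : 0 <= Num.min (sqnorm j) L by rewrite le_min sqnorm_ge0.
apply: (@le_trans _ _ (1 + eps * (Num.min (sqnorm j) L + 1))); first by rewrite lerD2l ler_wpM2l// avg_sqnorm_le.
rewrite mulrDl mul1r mulrDr mulr1; nra.
Qed.

Lemma sum_steps_opp (V : nmodType) (f : site -> V) : \sum_(v <- @steps d) f (- v) = \sum_(v <- @steps d) f v.
Proof.
by rewrite !sum_steps oppr0; congr (_ + _); apply: eq_bigr => k _; rewrite opprK addrC.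
Qed.

(** The neighbour average is symmetric for the counting measure: each shift is reindexed away, and
    the set of steps is stable under negation. *)
Lemma lsum_avg (c : site -> R) (g : site -> \bar R) : (forall j, 0 <= c j) -> (forall j, 0 <= g j)%E ->
  lsum (fun j => (c j)%:E * (((2 * d + 1)%:R^-1)%:E * \sum_(v <- steps) g (j + v)%R))%E =
  lsum (fun j => (avg c j)%:E * g j)%E.
Proof.
move=> c0 g0; have n0 : 0 <= (2 * d + 1)%:R^-1 :> R by rewrite invr_ge0.
have h0 v j : (0 <= (c j * (2 * d + 1)%:R^-1)%:E * g (j + v)%R)%E by rewrite mule_ge0 ?lee_fin ?mulr_ge0.
have h1 v j : (0 <= (c (j - v)%R * (2 * d + 1)%:R^-1)%:E * g j)%E by rewrite mule_ge0 ?lee_fin ?mulr_ge0.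
transitivity (lsum (fun j => \sum_(v <- steps) ((c j * (2 * d + 1)%:R^-1)%:E * g (j + v)%R)%E)%E).
  apply: eq_lsum => j; rewrite muleA -EFinM ge0_sume_distrr//.
rewrite lsum_seq//.
transitivity (\sum_(v <- steps) lsum (fun j => (c (j - v)%R * (2 * d + 1)%:R^-1)%:E * g j))%E.
  apply: eq_bigr => v _; rewrite -[RHS](@lsum_reindex _ _ _ (fun j => j + v) (fun j => j - v)).
  - by apply: eq_lsum => j; rewrite addrK.
  - by move=> j; rewrite addrK.
  - by move=> j; rewrite subrK.
  - by [].
rewrite -lsum_seq//; apply: eq_lsum => j.
rewrite -ge0_sume_distrl; last by move=> v _; rewrite lee_fin mulr_ge0.
by rewrite sumEFin -mulr_suml /avg mulrC (sum_steps_opp (fun v => c (j + v))).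
Qed.

End weights.

Local Open Scope ereal_scope.

(* Locks wcount, which conversion would otherwise unfold. *)
Fact wcount_key : unit. Proof. exact: tt. Qed.

Lemma integral_deriv {R : realType} (g g' : R -> R) (r t : R) : (r <= t)%R ->
  (forall s : R, is_derive s 1%R g (g' s)) -> continuous g' -> (forall s, r <= s <= t -> 0 <= g' s)%R ->
  \int[@lebesgue_measure R]_(s in `]r, t[) (g' s)%:E = (g t - g r)%:E.
Proof.
move=> rt dg cg g0.
have mg : mfunT (EFin \o g' : borel R -> \bar R) by exact: measurable_continuous.
rewrite -(Rintegral_FTC2 rt dg cg) /Rintegral fineK; last first.
  rewrite ge0_fin_numE; last by apply: integral_ge0 => s /=; rewrite in_itv/= lee_fin; exact: g0.
  apply: (@le_lt_trans _ _ (\int[@lebesgue_measure R]_(s in `[r, t]) `|(g' s)%:E|)).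
    have g0' (s : R) : `[r, t]%classic s -> 0 <= (g' s)%:E by rewrite /= in_itv/= lee_fin; exact: g0.
    have m1 : measurable_fun `[r, t] (fun s : borel R => (g' s)%:E) by exact: measurable_funTS.
    have m2 : measurable_fun `[r, t] (fun s : borel R => `|(g' s)%:E|).
      by apply: measurable_funTS; apply: measurableT_comp => //.
    by apply: ge0_le_integral => // s _; exact: lee_abs.
  have /integrableP[_ h] : (@lebesgue_measure R).-integrable `[r, t] (EFin \o g').
    by apply: continuous_compact_integrable; [exact: segment_compact|exact: continuous_subspaceT].
  exact: h.
by rewrite -(@integral_itv_bndoo _ r t _ true false)//; exact: measurable_funTS.
Qed.

(** * Integration by parts for Stieltjes integrals *)

Section integration_by_parts.
Context {R : realType}.
Local Notation T := (borel R).
Local Notation leb := (@lebesgue_measure R).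
Variable m : {sigma_finite_measure set T -> \bar R}.
Variables (x0 : \bar R) (h : T -> \bar R) (g g' : R -> R) (u t : R).
Hypotheses (x00 : 0 <= x0) (h0 : forall r, 0 <= h r) (mh : mfunT h).
Hypotheses (ut : (u <= t)%R) (dg : forall s : R, is_derive s 1%R g (g' s)) (cg' : continuous g').
Hypotheses (g0 : forall s, (u <= s <= t)%R -> (0 <= g s)%R) (g'0 : forall s, (u <= s <= t)%R -> (0 <= g' s)%R).

Let mg' D : measurable_fun D (EFin \o g' : T -> \bar R). Proof. exact: measurable_continuous. Qed.

Let mg D : measurable_fun D (EFin \o g : T -> \bar R).
Proof. by apply: measurable_continuous => s; exact: (derive_continuous (dg s)). Qed.

(** Integrand of the double integral over [u <= r < s < t]; integrating first in [r] or first in [s]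
    gives [I1] or [I2]. *)
Let k (x : T * T) : \bar R := (g' x.1)%:E * h x.2 * (((u <= x.2) && (x.2 < x.1) && (x.1 < t))%R%:R)%:E.

Let k0 x : 0 <= k x.
Proof.
rewrite /k; case: (boolP (_ && _ && _)) => [/andP[/andP[h1 h2] h3]|_]; last by rewrite mule0.
rewrite mule1 mule_ge0// lee_fin g'0// (ltW h3) andbT.
exact: le_trans h1 (ltW h2).
Qed.

Let mk : mfunT k.
Proof.
apply: emeasurable_funM.
  have h1 := @mg' setT.
  by apply: emeasurable_funM; [exact: measurableT_comp h1 measurable_fst|exact: measurableT_comp mh measurable_snd].
apply/measurable_EFinP; apply: measurableT_comp => //.
apply: measurable_and; first apply: measurable_and.
- by apply: measurable_fun_ler => //; exact: measurable_snd.
- by apply: measurable_fun_ltr; [exact: measurable_snd|exact: measurable_fst].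
- by apply: measurable_fun_ltr => //; exact: measurable_fst.
Qed.

Let I1 : \int[leb]_(s in `]u, t[) ((g' s)%:E * \int[m]_(r in `[u, s[) h r) = \int[leb]_s \int[m]_r k (s, r).
Proof.
rewrite [LHS]integral_mkcond; apply: eq_integral => s _; rewrite patchE.
case: ifPn => [|/negP hs].
  rewrite inE/= in_itv/= => /andP[us st].
  rewrite -ge0_integralZl; [|exact: measurable_itv|exact: measurable_funTS|by []|by rewrite lee_fin g'0 ?(ltW us) ?(ltW st)].
  rewrite [LHS]integral_mkcond; apply: eq_integral => r _; rewrite patchE mem_setE/= in_itv/= /k/= st andbT.
  by case: (_ && _); rewrite ?mule1 ?mule0.
rewrite integral0_eq// => r _; rewrite /k/=; case: (boolP (_ && _ && _)) => [/andP[/andP[h1 h2] h3]|_]; last by rewrite mule0.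
by exfalso; apply: hs; rewrite inE/= in_itv/= h3 andbT; exact: le_lt_trans h2.
Qed.

Let deriv_tail r : (u <= r <= t)%R -> \int[leb]_(s in `]r, t[) (g' s)%:E = (g t - g r)%:E.
Proof.
move=> /andP[ur rt]; apply: integral_deriv => // s /andP[rs st].
by rewrite g'0// st andbT (le_trans ur).
Qed.

Let gt_ge r : (u <= r <= t)%R -> 0 <= (g t - g r)%:E.
Proof.
move=> urt; rewrite -deriv_tail//; apply: integral_ge0 => s /=; rewrite in_itv/= => /andP[rs st].
by case/andP: urt => ur _; rewrite lee_fin g'0// (ltW st) (le_trans ur (ltW rs)).
Qed.

Let I2 : \int[m]_(r in `[u, t[) (h r * (g t - g r)%:E) = \int[m]_r \int[leb]_s k (s, r).
Proof.
rewrite [LHS]integral_mkcond; apply: eq_integral => r _; rewrite patchE.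
case: ifPn => [|/negP hr].
  rewrite inE/= in_itv/= => /andP[ur rt].
  rewrite -deriv_tail ?ur ?(ltW rt)// -ge0_integralZl; [|exact: measurable_itv|exact: mg'| |exact: h0].
    rewrite [LHS]integral_mkcond; apply: eq_integral => s _; rewrite patchE mem_setE/= in_itv/= /k/= ur/=.
    by case: (_ && _); rewrite ?mule1 ?mule0// muleC.
  by move=> s /=; rewrite in_itv/= => /andP[rs st]; rewrite lee_fin g'0// (ltW st) (le_trans ur (ltW rs)).
rewrite integral0_eq// => s _; rewrite /k/=; case: (boolP (_ && _ && _)) => [/andP[/andP[h1 h2] h3]|_]; last by rewrite mule0.
by exfalso; apply: hr; rewrite inE/= in_itv/= h1; exact: lt_trans h3.
Qed.

Let g'n s : `]u, t[%classic s -> 0 <= (g' s)%:E.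
Proof. by rewrite /= in_itv/= lee_fin => /andP[us st]; rewrite g'0// (ltW us) (ltW st). Qed.

Let mH : mfunT (fun s : T => \int[m]_(r in `[u, s[) h r).
Proof.
have -> : (fun s : T => \int[m]_(r in `[u, s[) h r) =
    fubini_F m (fun x : T * T => h x.2 * (((u <= x.2) && (x.2 < x.1))%R%:R)%:E).
  apply/funext => s; rewrite /fubini_F [LHS]integral_mkcond; apply: eq_integral => r _.
  rewrite patchE mem_setE/= in_itv/=.
  by case: (_ && _); rewrite ?mule1 ?mule0.
apply: measurable_fun_fubini_tonelli_F.
  apply: emeasurable_funM; first exact: measurableT_comp mh measurable_snd.
  apply/measurable_EFinP; apply: measurableT_comp => //; apply: measurable_and.
  + by apply: measurable_fun_ler => //; exact: measurable_snd.
  + by apply: measurable_fun_ltr; [exact: measurable_snd|exact: measurable_fst].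
by move=> x; rewrite mule_ge0 ?lee_fin.
Qed.

Let H0 s : 0 <= \int[m]_(r in `[u, s[) h r. Proof. exact: integral_ge0. Qed.

Let E1 : \int[leb]_(s in `]u, t[) ((g' s)%:E * (x0 + \int[m]_(r in `[u, s[) h r)) =
  (g t - g u)%:E * x0 + \int[m]_(r in `[u, t[) (h r * (g t - g r)%:E).
Proof.
rewrite I2 -(@fubini_tonelli _ _ _ _ _ leb m k mk k0) -I1 -deriv_tail ?lexx//.
rewrite -ge0_integralZr; [|exact: measurable_itv|exact: mg'|exact: g'n|exact: x00].
rewrite -ge0_integralD; first (by apply: eq_integral => s _; rewrite ge0_muleDr).
- exact: measurable_itv.
- by move=> s su; apply: mule_ge0 => //; exact: g'n.
- by apply: emeasurable_funM => //; exact: mg'.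
- by move=> s su; apply: mule_ge0 => //; exact: g'n.
- by apply: emeasurable_funM; [exact: mg'|exact: measurable_funTS].
Qed.

(** [g t - g r] is the integral of [g'] over []r, t[], and all terms are nonnegative, so Tonelli's
    theorem exchanges the two integrals. *)
Lemma stieltjes_parts :
  (g t)%:E * (x0 + \int[m]_(r in `[u, t[) h r) = (g u)%:E * x0 +
    \int[m]_(r in `[u, t[) ((g r)%:E * h r) +
    \int[leb]_(s in `]u, t[) ((g' s)%:E * (x0 + \int[m]_(r in `[u, s[) h r)).
Proof.
rewrite E1 ge0_muleDr// addeACA -ge0_muleDl; last 2 first.
- by rewrite lee_fin g0// lexx.
- by rewrite gt_ge// lexx.
rewrite -EFinD subrKC; congr (_ + _).
have ri r : `[u, t[%classic r -> (u <= r <= t)%R by rewrite /= in_itv/= => /andP[-> /ltW].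
rewrite -ge0_integralD.
- rewrite -ge0_integralZl; [|exact: measurable_itv|exact: measurable_funTS|by []|by rewrite lee_fin g0// ut lexx].
  apply: eq_integral => r; rewrite inE => /ri rut.
  rewrite [in RHS](muleC (h r)) -ge0_muleDl; [|by rewrite lee_fin g0|exact: gt_ge].
  by rewrite -EFinD subrKC.
- exact: measurable_itv.
- by move=> r /ri rut; rewrite mule_ge0// lee_fin g0.
- by apply: emeasurable_funM; [exact: mg|exact: measurable_funTS].
- by move=> r /ri rut; rewrite mule_ge0// gt_ge.
- apply: emeasurable_funM; first exact: measurable_funTS.
  by apply/measurable_EFinP; apply: measurable_funB; [exact: measurable_cst|by apply/measurable_EFinP; exact: mg].
Qed.

End integration_by_parts.

(** * Auxiliary estimates: limits of integrals, exponentials, the heat kernel at lattice points *)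

Lemma integral_lsum_dom {R : realType} {T : countType} {dO : measure_display} {W : measurableType dO}
    (m : {measure set W -> \bar R}) (D : set W) (g : T -> W -> \bar R) : measurable D ->
  (forall j w, D w -> 0 <= g j w) -> (forall j, measurable_fun D (g j)) ->
  \int[m]_(w in D) lsum (g ^~ w) = lsum (fun j => \int[m]_(w in D) g j w).
Proof.
move=> mD g0 mg.
have := @monotone_convergence _ _ _ m _ mD (fun n w => \sum_(j <- initial n) g j w).
move=> ->; last 3 first.
- by move=> n; exact: emeasurable_sum.
- by move=> n w Dw; apply: sume_ge0 => j _; exact: g0.
- move=> w Dw p q pq; apply: le_seq_sum => //; [by move=> j; exact: g0|exact: initial_uniq..|exact: sub_initial_le].
by congr (limn _); apply/funext => n; rewrite ge0_integral_sum// => j w Dw; exact: g0.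
Qed.

(** Finiteness of the left side forces finiteness of each term on the right, and the balance then
    holds between real numbers. *)
Lemma fine_balance {R : realType} (c c' : R) (x y z z' : \bar R) : x < +oo -> 0 <= x ->
  0 <= y -> (0 <= c')%R -> 0 <= z -> 0 <= z' -> y < +oo -> c%:E * x = c'%:E * y + z + z' ->
  [/\ z < +oo, z' < +oo & (c * fine x = c' * fine y + fine z + fine z')%R].
Proof.
case: x => [x| |]// _ _; case: y => [y| |]// y0 c'0; case: z => [z| |]//; case: z' => [z'| |]// _ _ _.
by rewrite -!EFinM -!EFinD => -[->]; rewrite !ltry.
Qed.

Lemma fine_sum_balance {R : realType} {I : eqType} (r : seq I) (A B C D : I -> \bar R) :
  (forall i, A i < +oo) -> (forall i, B i < +oo) -> (forall i, C i < +oo) -> (forall i, D i < +oo) ->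
  (forall i, 0 <= A i) -> (forall i, 0 <= B i) -> (forall i, 0 <= C i) -> (forall i, 0 <= D i) ->
  \sum_(i <- r) A i + \sum_(i <- r) B i = \sum_(i <- r) C i + \sum_(i <- r) D i ->
  (\sum_(i <- r) fine (A i) + \sum_(i <- r) fine (B i) = \sum_(i <- r) fine (C i) + \sum_(i <- r) fine (D i))%R.
Proof.
move=> A1 B1 C1 D1 A0 B0 C0 D0.
have E (h : I -> \bar R) : (forall i, h i < +oo) -> (forall i, 0 <= h i) ->
    \sum_(i <- r) h i = (\sum_(i <- r) fine (h i))%:E.
  move=> h1 h0; rewrite -sumEFin; apply: eq_bigr => i _; rewrite fineK//.
  by rewrite ge0_fin_numE.
by rewrite !E// -!EFinD => -[].
Qed.

(** Fatou's lemma; the almost sure limit is replaced by the lower limit, which is measurable. *)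
Lemma integral_limit_le {R : realType} {dO : measure_display} {W : measurableType dO}
    (m : {measure set W -> \bar R}) (D : W -> \bar R) (S : nat -> W -> \bar R) (M : \bar R) :
  mfunT D -> (forall w, 0 <= D w) ->
  (forall n, mfunT (S n)) -> (forall n w, 0 <= S n w) ->
  {ae m, forall w, S n w @[n --> \oo] --> D w} ->
  (\forall n \near \oo, \int[m]_w S n w <= M) -> \int[m]_w D w <= M.
Proof.
move=> mD D0 mS S0 hD hM.
have mE : mfunT (fun w => limn_einf (S ^~ w)).
  have -> : (fun w => limn_einf (S ^~ w)) = (fun w => - limn_esup (-%E \o (S ^~ w))).
    by apply/funext => w; rewrite limn_esupN oppeK.
  apply: measurableT_comp => //; apply: measurable_fun_limn_esup => n.
  exact: measurableT_comp.
have -> : \int[m]_w D w = \int[m]_w limn_einf (S ^~ w).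
  apply: ae_eq_integral => //.
  by apply: filterS hD => w hw _; rewrite (cvg_limn_einf_sup hw).1.
apply: le_trans (@fatou _ _ _ m _ measurableT S mS (fun n w _ => S0 n w)) _.
rewrite limn_einf_lim; apply: lime_le; first exact: is_cvg_einfs.
apply: filterS hM => n; apply: le_trans.
by apply: ereal_inf_lbound; exists n => /=.
Qed.

Lemma Rintegral_scaled_diff {R : realType} {dO : measure_display} {T : measurableType dO}
    (m : {measure set T -> \bar R}) (c : R) (g h : T -> R) (A B : \bar R) :
  mfunT g -> mfunT h -> (forall x, 0 <= g x)%R -> (forall x, 0 <= h x)%R ->
  \int[m]_x (g x)%:E = A -> \int[m]_x (h x)%:E = B -> A < +oo -> B < +oo ->
  (\int[m]_x (c * (g x - h x)) = c * (fine A - fine B))%R.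
Proof.
move=> mg mh g0 h0 <- <- gf hf.
have I (k : T -> R) : mfunT k -> (forall x, 0 <= k x)%R -> \int[m]_x (k x)%:E < +oo ->
    m.-integrable setT (EFin \o k).
  move=> mk k0 kf; apply/integrableP; split; first exact/measurable_EFinP.
  by under eq_integral do rewrite gee0_abs ?lee_fin//.
have Ig := I _ mg g0 gf; have Ih := I _ mh h0 hf.
by rewrite RintegralZl ?RintegralB//; exact: (integrableB measurableT Ig Ih).
Qed.

Lemma continuous_expRM {R : realType} (k : R) : continuous (fun s : R => expR (k * s)).
Proof. by move=> s; apply: continuous_comp; [exact: mulrl_continuous|exact: continuous_expR]. Qed.

Lemma is_derive_expRM {R : realType} (c k s : R) :
  is_derive s 1%R (fun s => c * expR (k * s))%R (c * (k * expR (k * s)))%R.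
Proof.
have dk : is_derive s 1%R (fun s => k * s)%R k by apply: is_derive_eq (is_derive_mull k (is_derive_id s 1%R)) _; rewrite mulr1.
exact: is_derive_mull (is_derive_expR_comp dk).
Qed.

Lemma integral_expR {R : realType} (c k u t : R) : (0 <= c)%R -> k != 0%R -> (u <= t)%R ->
  \int[@lebesgue_measure R]_(s in `]u, t[) (c * expR (k * s))%:E = (c / k * (expR (k * t) - expR (k * u)))%:E.
Proof.
move=> c0 k0 ut.
have dg (s : R) : is_derive s 1%R (fun s => c / k * expR (k * s))%R (c * expR (k * s))%R.
  by apply: is_derive_eq (is_derive_expRM (c / k) k s) _; field.
rewrite (integral_deriv ut dg); first by rewrite mulrBr.
- by move=> s; apply: cvgM; [exact: cvg_cst|exact: continuous_expRM].
- by move=> s _; rewrite mulr_ge0 ?expR_ge0.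
Qed.

Lemma expR_integral_le {R : realType} (c k u t : R) : (0 <= c)%R -> (0 < k)%R ->
  \int[@lebesgue_measure R]_(s in `]u, t[) (c * expR (- (k * s)))%:E <= (c / k * expR (- (k * u)))%:E.
Proof.
move=> c0 k0; have [ut|tu] := leP u t; last first.
  rewrite set_itv_ge ?integral_set0; last by rewrite bnd_simp -leNgt ltW.
  by rewrite lee_fin mulr_ge0 ?expR_ge0// divr_ge0// ltW.
under eq_integral do rewrite -mulNr; have k1 := lt0r_neq0 k0.
rewrite integral_expR ?oppr_eq0// lee_fin invrN mulrN mulNr -mulrN opprB !mulNr mulrBr gerBl.
by rewrite mulr_ge0 ?expR_ge0// divr_ge0// ltW.
Qed.

Lemma avg_cst {R : realType} {d : nat} (c : R) (j : 'rV[int]_d) : avg (fun=> c) j = c.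
Proof.
by rewrite /avg big_const_seq count_predT size_steps iter_addr_0 -[X in (_ * X)%R]mulr_natl mulKf.
Qed.

Lemma square_le_expR {R : realType} (k : R) : (0 < k)%R ->
  exists2 K : R, (0 < K)%R & forall s, (0 <= s)%R -> ((1 + s) ^+ 2 <= K * expR (k * s))%R.
Proof.
move=> k0; exists (2 + 4 / k ^+ 2)%R; first by rewrite addr_gt0// divr_gt0// exprn_gt0.
move=> s s0; have := expR_ge1Dxn 1 (mulr_ge0 (ltW k0) s0) => h.
have K0 : (0 <= 2 + 4 / k ^+ 2 :> R)%R by rewrite addr_ge0// divr_ge0// sqr_ge0.
apply: le_trans (ler_wpM2l K0 h).
have -> : ((2 + 4 / k ^+ 2) * (1 + (k * s) ^+ 2 / 2`!%:R) = 2 + 2 * s ^+ 2 + (4 / k ^+ 2 + k ^+ 2 * s ^+ 2))%R.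
  by rewrite -[2`!]/2%N; field; rewrite gt_eqF.
have h1 : (0 <= 4 / k ^+ 2 + k ^+ 2 * s ^+ 2 :> R)%R.
  by rewrite addr_ge0// ?divr_ge0 ?sqr_ge0// mulr_ge0 ?sqr_ge0.
have h2 := sqr_ge0 (1 - s)%R; rewrite sqrrB in h2; rewrite sqrrD; move: h1 h2; lra.
Qed.

Lemma expRN_le_invX {R : realType} (n : nat) (k : R) : (0 < k)%R ->
  exists2 K : R, (0 < K)%R & forall t, (0 < t)%R -> (expR (- (k * t)) <= K / t ^+ n.+1)%R.
Proof.
move=> k0; exists ((n.+1)`!%:R / k ^+ n.+1)%R; first by rewrite divr_gt0 ?exprn_gt0// ltr0n fact_gt0.
move=> t t0; have kt : (0 < k * t)%R by rewrite mulr_gt0.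
have := expR_ge1Dxn n (ltW kt) => h.
have p0 : (0 < (k * t) ^+ n.+1 / (n.+1)`!%:R)%R by rewrite divr_gt0 ?exprn_gt0// ltr0n fact_gt0.
rewrite expRN; apply: (@le_trans _ _ ((k * t) ^+ n.+1 / (n.+1)`!%:R)^-1)%R.
  by rewrite lef_pV2 ?posrE ?expR_gt0//; apply: le_trans h; rewrite lerDr.
by rewrite invf_div exprMn invfM mulrA.
Qed.

(** The inequality [|y| <= eta / 2 + y ^+ 2 / (2 * eta)] is integrated; [eta] is the order of
    magnitude of [Y] in [L^2]. *)
Lemma integral_norm_le {R : realType} {dO : measure_display} {W : measurableType dO}
    (P : probability W R) (Y : W -> R) (eta K : R) : (0 < eta)%R -> mfunT Y ->
  \int[P]_w ((Y w) ^+ 2)%:E <= (K * eta ^+ 2)%:E -> \int[P]_w (`|Y w|%:E) <= ((1 + K) / 2 * eta)%:E.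
Proof.
move=> eta0 mY h.
have mY2 : mfunT (fun w => ((Y w) ^+ 2)%:E) by meas.
have Y20 w : 0 <= ((Y w) ^+ 2)%:E by rewrite lee_fin sqr_ge0.
have c0 : 0 <= ((2 * eta)^-1)%:E by rewrite lee_fin invr_ge0 mulr_ge0// ltW.
have mcY2 : mfunT (fun w => ((2 * eta)^-1)%:E * ((Y w) ^+ 2)%:E).
  by meas.
have e0 : 0 <= (eta / 2)%:E by rewrite lee_fin divr_ge0// ltW.
apply: (@le_trans _ _ (\int[P]_w ((eta / 2)%:E + ((2 * eta)^-1)%:E * ((Y w) ^+ 2)%:E))).
  apply: ge0_le_integral => //.
  - by meas.
  - by meas.
  move=> w _; rewrite -EFinM -EFinD lee_fin -(real_normK (num_real (Y w))).
  have -> : (eta / 2 + (2 * eta)^-1 * `|Y w| ^+ 2 = `|Y w| + (2 * eta)^-1 * (eta - `|Y w|) ^+ 2)%R.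
    by field; rewrite gt_eqF.
  by rewrite lerDl mulr_ge0 ?sqr_ge0// invr_ge0 mulr_ge0// ltW.
rewrite ge0_integralD//; last by move=> w _; rewrite mule_ge0.
rewrite integral_cst// [X in _ * X + _](@probability_setT _ _ _ P) mule1 ge0_integralZl//.
apply: (@le_trans _ _ ((eta / 2)%:E + ((2 * eta)^-1)%:E * (K * eta ^+ 2)%:E)).
  by rewrite leeD2l// lee_wpmul2l.
by rewrite -EFinM -EFinD lee_fin le_eqVlt; apply/orP; left; apply/eqP; field; rewrite gt_eqF.
Qed.

(** The average at [j] sees finitely many sites, so the cap of [weight_avg] can be chosen inactive
    on all of them. *)
Lemma avg_weight_le {R : realType} {d : nat} (eps : R) (j : 'rV[int]_d) : (0 <= eps)%R ->
  (avg (fun i => 1 + eps * sqnorm i) j <= (1 + eps) * (1 + eps * sqnorm j))%R.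
Proof.
move=> e0; pose L : R := (\sum_(v <- @steps d) sqnorm (j + v))%R.
have L0 : (0 <= L)%R by apply: sumr_ge0 => v _; exact: sqnorm_ge0.
have -> : avg (fun i : 'rV[int]_d => 1 + eps * sqnorm i)%R j = avg (fun i => 1 + eps * Num.min (sqnorm i) L)%R j.
  rewrite /avg; congr (_ * _)%R; apply: eq_big_seq => v vs; rewrite min_l// /L (big_rem v)//= lerDl.
  by apply: sumr_ge0 => k _; exact: sqnorm_ge0.
apply: le_trans (weight_avg j e0 L0) _; apply: ler_wpM2l; first by rewrite addr_ge0.
by rewrite lerD2l ler_wpM2l// ge_min lexx.
Qed.

Lemma summable_norm_cvg {R : realType} (n : nat -> R) :
  \sum_(0 <= k <oo) (`|(n k.+1 - n k)%R|%:E) < +oo -> cvgn n.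
Proof.
move=> h.
have cs : cvgn [normed series (telescope n)]%R.
  apply: nondecreasing_is_cvgn.
    by apply: nondecreasing_series => k _ _; exact: normr_ge0.
  exists (fine (\sum_(0 <= k <oo) (`|(n k.+1 - n k)%R|%:E))) => _ [m _ <-].
  rewrite -lee_fin fineK; last first.
    by rewrite ge0_fin_numE//; apply: nneseries_ge0 => k _ _; rewrite lee_fin.
  rewrite /series/= -sumEFin; apply: nneseries_lim_ge => k _ _; by rewrite lee_fin.
have := normed_cvg cs; rewrite telescopeK => c.
have -> : n = (fun k => (n k - n 0%N) + n 0%N)%R by apply/funext => k; rewrite subrK.
by apply: is_cvgD => //; exact: is_cvg_cst.
Qed.

Lemma integral_le_lincomb {R : realType} {dO : measure_display} {T : measurableType dO} (P : probability T R)
    (f U V : T -> \bar R) (c0 c1 c2 m1 m2 : R) :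
  mfunT f -> mfunT U -> mfunT V ->
  (forall w, 0 <= f w) -> (forall w, 0 <= U w) -> (forall w, 0 <= V w) -> (0 <= c0)%R -> (0 <= c1)%R -> (0 <= c2)%R ->
  \int[P]_w U w <= m1%:E -> \int[P]_w V w <= m2%:E ->
  {ae P, forall w, f w <= c0%:E + (c1%:E * U w + c2%:E * V w)} ->
  \int[P]_w f w <= (c0 + (c1 * m1 + c2 * m2))%:E.
Proof.
move=> mf mU mV f0 U0 V0 c00 c10 c20 hU hV hf.
have m1' : mfunT (fun w => c1%:E * U w) by meas.
have m2' : mfunT (fun w => c2%:E * V w) by meas.
have p1 w : 0 <= c1%:E * U w by exact: mule_ge0.
have p2 w : 0 <= c2%:E * V w by exact: mule_ge0.
have m12 : mfunT (fun w => c1%:E * U w + c2%:E * V w) by exact: emeasurable_funD.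
have p12 w : 0 <= c1%:E * U w + c2%:E * V w by exact: adde_ge0.
apply: (@le_trans _ _ (\int[P]_w (cst c0%:E w + (c1%:E * U w + c2%:E * V w)))).
  apply: ae_ge0_le_integral => //.
  - by move=> w _; exact: adde_ge0.
  - by meas.
  by apply: filterS hf.
have -> : \int[P]_w (cst c0%:E w + (c1%:E * U w + c2%:E * V w)) = c0%:E + \int[P]_w (c1%:E * U w + c2%:E * V w).
  have mc : mfunT (cst c0%:E : T -> \bar R) by exact: measurable_cst.
  rewrite ge0_integralD//.
  by rewrite integral_cst// [X in _ * X + _](@probability_setT _ _ _ P) mule1.
have -> : \int[P]_w (c1%:E * U w + c2%:E * V w) = c1%:E * \int[P]_w U w + c2%:E * \int[P]_w V w.
  have -> : \int[P]_w (c1%:E * U w + c2%:E * V w) = \int[P]_w (c1%:E * U w) + \int[P]_w (c2%:E * V w) by apply: ge0_integralD.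
  by congr (_ + _); apply: ge0_integralZl_EFin.
by rewrite !EFinD !EFinM leeD2l// leeD//; apply: lee_wpmul2l.
Qed.

Lemma norm_diff_integral_le {R : realType} {dO : measure_display} {T : measurableType dO}
    (m : {measure set T -> \bar R}) (D : set T) (f g : T -> R) : measurable D ->
  measurable_fun D f -> measurable_fun D g -> (forall x, D x -> 0 <= f x)%R -> (forall x, D x -> 0 <= g x)%R ->
  \int[m]_(x in D) (f x)%:E < +oo -> \int[m]_(x in D) (g x)%:E < +oo ->
  `|(fine (\int[m]_(x in D) (f x)%:E) - fine (\int[m]_(x in D) (g x)%:E))%R|%:E <=
  \int[m]_(x in D) (`|(f x - g x)%R|%:E).
Proof.
move=> mD mf mg f0 g0 ff gf.
have I (k : T -> R) : measurable_fun D k -> (forall x, D x -> 0 <= k x)%R -> \int[m]_(x in D) (k x)%:E < +oo ->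
    m.-integrable D (EFin \o k).
  move=> mk k0 kf; apply/integrableP; split; first exact/measurable_EFinP.
  rewrite (eq_integral (fun x => (k x)%:E))// => x; rewrite inE => Dx /=; rewrite ger0_norm ?k0//.
have If := I f mf f0 ff; have Ig := I g mg g0 gf.
have IB := integrableB mD If Ig.
have -> : (fine (\int[m]_(x in D) (f x)%:E) - fine (\int[m]_(x in D) (g x)%:E) = \int[m]_(x in D) (f x - g x))%R.
  by rewrite RintegralB.
apply: (@le_trans _ _ (\int[m]_(x in D) `|f x - g x|)%R%:E); first by rewrite lee_fin; exact: le_normr_Rintegral.
by rewrite /Rintegral fineK//; apply: integrable_fin_num => //; exact: integrable_norm IB.
Qed.

Lemma sqnorm0 {R : realType} {d : nat} : sqnorm (0 : 'rV[int]_d)%R = 0%R :> R.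
Proof. by rewrite /sqnorm big1// => k _; rewrite mxE expr0n. Qed.

Lemma powR_half {R : realType} (t : R) n : (0 <= t)%R -> (t `^ (n%:R / 2) = Num.sqrt t ^+ n)%R.
Proof. by move=> t0; rewrite mulrC powRrM -powR12_sqrt// powR_mulrn// powR_ge0. Qed.

Lemma inv_sqrt_cvg {R : realType} : (Num.sqrt t)^-1%R @[t --> +oo%R] --> (0 : R)%R.
Proof.
have h : {for (0 : R)%R, continuous Num.sqrt} by exact: sqrt_continuous.
have c : Num.sqrt t^-1%R @[t --> +oo%R] --> (0 : R)%R.
  rewrite -[X in _ --> X]sqrtr0; apply: (@cvg_comp _ _ _ (fun t : R => t^-1)%R Num.sqrt) h.
  by apply/gtr0_cvgV0; [exact: nbhs_pinfty_gt|exact: cvg_id].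
apply: cvg_trans c; apply: near_eq_cvg; near=> t; rewrite sqrtrV//; near: t; exact: nbhs_pinfty_ge.
Unshelve. all: by end_near. Qed.

Lemma euclidean_norm_sqr {R : realType} {d : nat} (x : 'rV[R]_d) : (euclidean_norm x ^+ 2 = \sum_(k < d) x 0%R k ^+ 2)%R.
Proof. by rewrite /euclidean_norm sqr_sqrtr// sumr_ge0// => k _; exact: sqr_ge0. Qed.

Lemma heat_kernel_scale {R : realType} {d : nat} (a t : R) (x : 'rV[R]_d) : (0 < a)%R -> (0 < t)%R ->
  (t `^ (d%:R / 2) * heat_kernel (a * t) x = heat_kernel a ((Num.sqrt t)^-1 *: x))%R.
Proof.
move=> a0 t0; have p0 := @pi_gt0 R.
have c0 : (0 <= (2 * d + 1)%:R / (4 * pi * (a * t)) :> R)%R by rewrite divr_ge0// !mulr_ge0// ltW.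
have a1 := lt0r_neq0 a0; have t1 := lt0r_neq0 t0; have p1 := lt0r_neq0 p0.
rewrite /heat_kernel mulrA -powRM ?(ltW t0)//; congr (_ `^ _ * expR (- _))%R.
  move: (2 * d + 1)%:R%R => c; move: (pi : R) p1 => p p1.
  by field; rewrite a1 t1 p1.
rewrite !euclidean_norm_sqr.
have -> : (\sum_(k < d) ((Num.sqrt t)^-1 *: x) 0%R k ^+ 2 = t^-1 * \sum_(k < d) x 0%R k ^+ 2)%R.
  rewrite mulr_sumr; apply: eq_bigr => k _; by rewrite mxE exprMn exprVn sqr_sqrtr// ltW.
by field; rewrite a1 t1.
Qed.

(** After rescaling, rounding to a site moves each coordinate by at most [1 / Num.sqrt t]. *)
Lemma heat_kernel_floor_cvg {R : realType} {d : nat} (a : R) (x : 'rV[R]_d) :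
  heat_kernel a ((Num.sqrt t)^-1 *: to_real R (floor_site (Num.sqrt t *: x)))%R @[t --> +oo%R] --> heat_kernel a x.
Proof.
have coord (k : 'I_d) : ((Num.sqrt t)^-1 * (Num.floor (Num.sqrt t * x 0%R k))%:~R)%R @[t --> +oo%R] --> x 0%R k.
  have s0 : (Num.sqrt t)^-1%R @[t --> +oo%R] --> (0 : R)%R by exact: inv_sqrt_cvg.
  apply: (@squeeze_cvgr _ _ _ _ (fun t => x 0%R k - (Num.sqrt t)^-1)%R (fun t => x 0%R k)).
  - near=> t; have t0 : (0 < Num.sqrt t)%R by rewrite sqrtr_gt0; near: t; exact: nbhs_pinfty_gt.
    have := floor_le (Num.sqrt t * x 0%R k)%R; have := ltW (floorD1_gt (Num.sqrt t * x 0%R k)%R).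
    rewrite intrD mulr1z => h1 h2; apply/andP; split; last by rewrite mulrC ler_pdivrMr// [leRHS]mulrC.
    rewrite lerBlDr; set y := (_%:~R)%R.
    have -> : ((Num.sqrt t)^-1 * y + (Num.sqrt t)^-1 = (y + 1) / Num.sqrt t)%R by ring.
    by rewrite ler_pdivlMr// [leLHS]mulrC.
  - by rewrite -[X in _ --> X]subr0; apply: cvgB => //; exact: cvg_cst.
  - exact: cvg_cst.
rewrite /heat_kernel.
under eq_fun do rewrite euclidean_norm_sqr.
rewrite euclidean_norm_sqr.
apply: cvgM; first exact: cvg_cst.
apply: (@cvg_comp _ _ _ _ expR); last exact: continuous_expR.
apply: cvgN; apply: cvgM; last exact: cvg_cst.
apply: cvgM; first exact: cvg_cst.
apply: cvg_big => [|k _]; first exact: add_continuous.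
by under eq_fun do rewrite !mxE; apply: cvgM; exact: coord.
Unshelve. all: by end_near. Qed.

Lemma markov_le {R : realType} {dO : measure_display} {T : measurableType dO} (P : probability T R)
    (Y : T -> R) (U : T -> \bar R) (eps : R) : (0 < eps)%R -> mfunT Y -> mfunT U ->
  (forall w, (`|Y w|%R)%:E <= U w) -> eps%:E * P [set w | (eps <= `|Y w|)%R] <= \int[P]_w U w.
Proof.
move=> eps0 mY mU hY; set A := [set w | _].
have mA : measurable A.
  have m : mfunT (fun w => `|Y w|%R) by meas.
  have -> : A = setT `&` (fun w => `|Y w|%R) @^-1` `[eps, +oo[%classic.
    by rewrite setTI; apply/seteqP; split => w /=; rewrite in_itv/= andbT.
  by apply: m => //; exact: measurableT.
have mI : mfunT (fun w => (\1_A w)%:E : \bar R) by meas.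
have -> : eps%:E * P A = \int[P]_w (eps%:E * (\1_A w)%:E).
  rewrite ge0_integralZl_EFin ?integral_indic ?setIT ?(ltW eps0)//.
have mi : mfunT (fun w => eps%:E * (\1_A w)%:E) by meas.
have h0 w : 0 <= eps%:E * (\1_A w)%:E by rewrite mule_ge0 ?lee_fin// ltW.
have hle w : eps%:E * (\1_A w)%:E <= U w.
  apply: le_trans (hY w); rewrite indicE; case: (boolP (w \in A)); last by rewrite mule0 lee_fin.
  by rewrite inE/= mule1 lee_fin.
by apply: ge0_le_integral => // w _.
Qed.

Section probability_facts.
Context {R : realType} {dO : measure_display} {T : measurableType dO} (P : probability T R).

Lemma probabilityE A : measurable A -> P A = (fine (P A))%:E.
Proof. by move=> mA; rewrite fineK// fin_num_measure. Qed.

Lemma finePDI A B : measurable A -> measurable B ->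
  fine (P A) = (fine (P (A `\` B)) + fine (P (A `&` B)))%R.
Proof.
move=> mA mB; apply: EFin_inj; rewrite EFinD -!probabilityE//; last 2 first.
- exact: measurableI.
- exact: measurableD.
exact: measureDI.
Qed.

Lemma le_fineP A B : measurable A -> measurable B -> A `<=` B -> (fine (P A) <= fine (P B))%R.
Proof. by move=> mA mB AB; rewrite -lee_fin -!probabilityE//; apply: le_measure; rewrite ?inE. Qed.

Lemma fineP_ge0 A : (0 <= fine (P A))%R.
Proof. by rewrite fine_ge0// measure_ge0. Qed.

Lemma fine_nonincreasing_cvg (A : nat -> set T) : (forall n, measurable (A n)) -> (forall n, A n.+1 `<=` A n) ->
  fine (P (A n)) @[n --> \oo] --> fine (P (\bigcap_n A n)).
Proof.
move=> mA nA; have mI : measurable (\bigcap_n A n) by exact: bigcap_measurable.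
have ni : nonincreasing_seq A by apply/nonincreasing_seqP => n; apply/subsetPset; exact: nA.
have Pf : P (A 0%N) < +oo by rewrite (probabilityE (mA 0%N)) ltry.
by apply: fine_cvg; rewrite -probabilityE//; exact: nonincreasing_cvg_mu.
Qed.

(** The events [U n] of some occurrence from index [n] on decrease to a null event. *)
Lemma probability_eventually_null (A : nat -> set T) (e : R) : (0 < e)%R -> (forall n, measurable (A n)) ->
  {ae P, forall w, exists k0, forall k, (k0 <= k)%N -> ~ A k w} -> exists k0, forall k, (k0 <= k)%N -> (fine (P (A k)) <= e)%R.
Proof.
move=> e0 mA ae0.
pose U n := \bigcup_(k in [set k | (n <= k)%N]) A k.
have mU n : measurable (U n) by apply: bigcup_measurable => k _; exact: mA.
have UU n : U n.+1 `<=` U n by move=> w [k /= /ltnW nk Ak]; exists k.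
have U0 : P (\bigcap_n U n) = 0.
  apply: measure_negligible; first exact: bigcap_measurable.
  apply: negligibleS ae0 => w Uw [k0 hk]; have [k /= k0k] := Uw k0 Logic.I; exact: hk.
have := fine_nonincreasing_cvg mU UU; rewrite U0 => /cvgrPdist_le /(_ e e0)[k0 _ h].
exists k0 => k kk; have := h k kk; rewrite /= sub0r normrN ger0_norm ?fineP_ge0// => h1.
by apply: le_trans h1; apply: le_fineP => // w Aw; exists k => /=.
Qed.

End probability_facts.

Section hawkes.
Context {R : realType} {d : nat}.
Variables (a b : R) (hb : (0 < b)%R) (hab : (b < a)%R).
Context {dO : measure_display} {W : measurableType dO}.
Variables (P : probability W R) (F : R -> set (set W)) (hF : filtration F).
Local Notation site := 'rV[int]_d.
Variable N : site -> R.-ker W ~> plane R.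
Hypothesis hN : iid_poisson_measures P F N.
Variable Z : site -> R -> W -> nat.
Hypothesis hZ : impulsion_hawkes P F N (fun t => a * expR (- (b * t)))%R Z.
Local Notation leb := (@lebesgue_measure R).

Let a0 : (0 < a)%R. Proof. exact: lt_trans hab. Qed.

(** * Paths of the process as projections of Poisson points *)

Section paths.
Local Notation G := (pred_gen F).
Local Notation predictable f := (mfunT (f : sigmaT G -> \bar R)).
Local Notation e u := (expR (b * u))%:E.

(* 1_{j = 0} + int_{[0, s[} e^{bu} dZ^j_u for almost every path; as an upper
   limit of Riemann sums it is everywhere defined, and predictable. *)
Definition wcount : site -> R -> W -> \bar R := locked_with wcount_key
  (fun j s w => ((j == 0)%:R)%:E + limn_esup (fun m => grid_sum (Z j ^~ w) b m s)).

Lemma wcountEsup j s w : wcount j s w =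
  ((j == 0)%:R)%:E + limn_esup (fun m => grid_sum (Z j ^~ w) b m s).
Proof. by rewrite /wcount unlock. Qed.

(** The intensity in terms of the weights. On good paths it is [hawkes_intensity]; unlike the latter
    it comes with predictability for all [w]. *)
Definition rate (j : site) (s : R) (w : W) : \bar R :=
  (a * expR (- (b * s)) / (2 * d + 1)%:R)%:E * \sum_(v <- steps) wcount (j + v)%R s w.

Local Notation X := wcount.

Let term_ge0 (j : site) m k s w : 0 <= (expR (b * (k%:R / m.+1%:R)) *
     Num.max ((Z j (k.+1%:R / m.+1%:R) w)%:R - (Z j (k%:R / m.+1%:R) w)%:R) 0)%:E *
     ((k.+1%:R / m.+1%:R < s :> R)%R%:R)%:E.
Proof. by rewrite mule_ge0 ?lee_fin// mulr_ge0 ?expR_ge0// le_max lexx orbT. Qed.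

Lemma grid_sum_ge0 j m s w : 0 <= grid_sum (Z j ^~ w) b m s.
Proof. by apply: nneseries_ge0 => k _ _; exact: term_ge0. Qed.

Lemma wcount_ge0 j s w : 0 <= X j s w.
Proof.
rewrite wcountEsup adde_ge0 ?lee_fin// limn_esup_lim; apply: lime_ge; first exact: is_cvg_esups.
apply: nearW => m; apply: le_trans (grid_sum_ge0 j m s w) _.
by apply: ereal_sup_ubound; exists m => /=.
Qed.

Lemma rate_ge0 j s w : 0 <= rate j s w.
Proof.
rewrite mule_ge0//; last by apply: sume_ge0 => v _; exact: wcount_ge0.
by rewrite lee_fin divr_ge0// mulr_ge0 ?expR_ge0// (le_trans (ltW hb)) ?(ltW hab).
Qed.

Lemma count_adapted j t : (0 <= t)%R ->
  mfunT ((fun w => (Z j t w)%:R) : sigmaT (F t) -> R).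
Proof.
move=> t0 _ B mB; rewrite setTI; apply: sub_sigma_algebra.
exact: (hawkes_adapted hZ j t0 (fun n => B n%:R)).
Qed.

Lemma filtration_measurable_fun s t (f : W -> \bar R) : (0 <= s)%R -> (s <= t)%R ->
  mfunT (f : sigmaT (F s) -> \bar R) ->
  mfunT (f : sigmaT (F t) -> \bar R).
Proof.
move=> s0 st mf _ B mB; rewrite setTI.
have := mf measurableT B mB; rewrite setTI => h.
have t0 := le_trans s0 st.
move: h; rewrite /measurable/= !filtration_id// => h.
exact: (filtration_nondecreasing hF s0 st).
Qed.

Let increment_adapted j m k :
  mfunT ((fun w => (expR (b * (k%:R / m.+1%:R)) *
     Num.max ((Z j (k.+1%:R / m.+1%:R) w)%:R - (Z j (k%:R / m.+1%:R) w)%:R) 0)%:E) :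
     sigmaT (F (k.+1%:R / m.+1%:R)%R) -> \bar R).
Proof.
have k0 : (0 <= k%:R / m.+1%:R :> R)%R by rewrite divr_ge0.
have k1 : (0 <= k.+1%:R / m.+1%:R :> R)%R by rewrite divr_ge0.
have kk : (k%:R / m.+1%:R <= k.+1%:R / m.+1%:R :> R)%R by rewrite ler_pM2r ?invr_gt0// ler_nat.
apply/measurable_EFinP; apply: measurable_funM => //.
apply: measurable_maxr => //.
apply: measurable_funB; first exact: count_adapted.
have := filtration_measurable_fun k0 kk (f := fun w => ((Z j (k%:R / m.+1%:R) w)%:R)%:E).
by move=> /(_ _)/measurable_EFinP; apply; apply/measurable_EFinP; exact: count_adapted.
Qed.

Lemma wcount_adapted j s : (0 <= s)%R ->
  mfunT (X j s : sigmaT (F s) -> \bar R).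
Proof.
move=> s0; have -> : X j s = fun w => ((j == 0)%:R)%:E + limn_esup (fun m => grid_sum (Z j ^~ w) b m s).
  by apply/funext => w; exact: wcountEsup.
apply: emeasurable_funD => //.
apply: measurable_fun_limn_esup => m.
apply: ge0_emeasurable_sum => [k w _ _|k _]; first exact: term_ge0.
have [ks|ks] := ltP (k.+1%:R / m.+1%:R)%R s.
  under eq_fun do rewrite mule1.
  apply: filtration_measurable_fun (ltW ks) _; first by rewrite divr_ge0.
  exact: increment_adapted.
by under eq_fun do rewrite mule0; exact: measurable_cst.
Qed.

Lemma wcount_predictable j : predictable (fun z => X j (ptime z.2) z.1).
Proof.
under eq_fun do rewrite wcountEsup.
apply: emeasurable_funD => //.
apply: measurable_fun_limn_esup => m.
apply: ge0_emeasurable_sum => [k w _ _|k _]; first exact: term_ge0.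
apply: (@predictable_adapted _ _ _ _ hF (k.+1%:R / m.+1%:R)%R (fun w => (expR (b * (k%:R / m.+1%:R)) *
     Num.max ((Z j (k.+1%:R / m.+1%:R) w)%:R - (Z j (k%:R / m.+1%:R) w)%:R) 0)%:E));
  [by rewrite divr_ge0| |exact: increment_adapted].
by move=> w; rewrite lee_fin mulr_ge0 ?expR_ge0// le_max lexx orbT.
Qed.

Lemma rate_predictable j : predictable (fun z => rate j (ptime z.2) z.1).
Proof.
apply: emeasurable_funM.
  apply/measurable_EFinP; apply: measurable_funM => //.
  apply: measurable_funM => //.
  apply: measurableT_comp; first exact: measurable_expR.
  under eq_fun do rewrite -mulNr.
  by apply: measurable_funM => //; exact: predictable_ptime.
by apply: emeasurable_sum => v; exact: wcount_predictable.
Qed.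

Definition below_set (j : site) : set (W * plane R) :=
  [set z | oquad z.2 /\ z.2.2%:E <= rate j (ptime z.2) z.1].

Lemma below_set_predictable j : <<s G >> (below_set j).
Proof. exact: (predictable_below hF (rate_predictable j)). Qed.

Lemma measurable_below_set j : measurable (below_set j).
Proof.
apply: (smallest_sub (@sigma_algebra_measurable _ _) (pred_gen_measurable hF)).
exact: below_set_predictable.
Qed.

Lemma in_below_set j w s z : (0 < s)%R -> (0 <= z)%R ->
  below_set j (w, (s, z)) <-> z%:E <= rate j s w.
Proof.
move=> s0 z0; have Q : oquad (s, z) by rewrite /oquad/= !in_itv/= s0 z0.
by rewrite /below_set/= ptimeE//=; split => [[]|].
Qed.

Local Notation phi := (fun t : R => a * expR (- (b * t)))%R.

Definition hawkes_below i w : set (plane R) := [set x | x.2%:E <= hawkes_intensity phi Z i x.1 w].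

(** The almost sure properties used path by path, gathered once. [good_start] disposes of time 0,
    which the predictable regions do not contain. *)
Record good_path (w : W) : Prop := GoodPath {
  good_counting : forall j, counting_path (Z j ^~ w) ;
  good_finite : forall n : nat, lsum (fun j : site => ((Z j n%:R w)%:R : R)%:E) < +oo ;
  good_start : forall j, points N j w (`[0%R, 0%R] `*` `[0%R, +oo[) = 0 ;
  good_equation : forall i t, (0 <= t)%R -> ((Z i t w)%:R)%:E =
      \int[points N i w]_(x in `[0%R, t] `*` `[0%R, +oo[)
         (\1_(hawkes_below i w) x)%:E }.

Lemma forall_site_ae (Q : site -> set W) : (forall j, {ae P, forall w, Q j w}) ->
  {ae P, forall w, forall j, Q j w}.
Proof.
move=> h.
have : {ae P, forall w, forall n, oapp (Q ^~ w) True (@pickle_inv site n)}.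
  by apply: ae_foralln => n; case: pickle_inv => [j|] /=; [exact: h|exact: nearW].
apply: filterS => w hw j; have := hw (choice.pickle j).
by rewrite pickleK_inv.
Qed.

(** A vertical line has area 0, so the mean number of points on it is 0. *)
Lemma line_null j (t : R) : (0 <= t)%R -> {ae P, forall w, points N j w (`[t, t] `*` `[0%R, +oo[) = 0}.
Proof.
move=> t0.
have mL : measurable (`[t, t] `*` `[0%R, +oo[ : set (plane R)).
  by apply: measurableX; exact: measurable_itv.
have LQ : `[t, t] `*` `[0%R, +oo[ `<=` quadrant R.
  by move=> [s z] [] /=; rewrite /quadrant/= !in_itv/= !andbT => /andP[ts _] z0; rewrite (le_trans t0 ts).
have leb0 : @leb2 R (`[t, t] `*` `[0%R, +oo[) = 0%R%:E.
  rewrite -[LHS]/((lebesgue_measure \x lebesgue_measure)%E (_ `*` _)) product_measure1E; [|exact: measurable_itv..].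
  rewrite -[X in X * _]/(lebesgue_measure `[t, t]) leb_cc// subrr mul0e//.
have E0 := intensity hN j mL LQ leb0.
have mN := measurable_kernel (N j) _ mL.
have h : \int[P]_w `|N j w (`[t, t] `*` `[0%R, +oo[)| = 0.
  by under eq_integral do rewrite gee0_abs//; rewrite E0.
move/(ae_eq_integral_abs P measurableT mN) : h => h.
have h' : {ae P, forall w, [set: W] w -> N j w (`[t, t] `*` `[0%R, +oo[) = 0} := h.
apply: filterS2 h' (points_ae hN j) => w h1 h2.
by rewrite h2 (h1 Logic.I).
Qed.

Lemma measurable_count j t : (0 <= t)%R -> mfunT (fun w => (Z j t w)%:R : R).
Proof.
move=> t0; apply: (sub_sigma_mfun (filtration_measurable hF t0)).
exact: count_adapted.
Qed.

Lemma good_path_ae : {ae P, forall w, good_path w}.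
Proof.
have hfin : {ae P, forall w, forall n : nat, lsum (fun j : site => ((Z j n%:R w)%:R : R)%:E) < +oo}.
  apply: ae_foralln => n.
  have mZ j : mfunT (fun w => ((Z j n%:R w)%:R : R)%:E).
    by apply/measurable_EFinP; exact: measurable_count.
  have mL : mfunT (fun w => lsum (fun j : site => ((Z j n%:R w)%:R : R)%:E)).
    exact: (@measurable_lsum _ _ _ _ _ (fun j w => ((Z j n%:R w)%:R : R)%:E)).
  have L0 w : 0 <= lsum (fun j : site => ((Z j n%:R w)%:R : R)%:E) by exact: lsum_ge0.
  have h : P.-integrable setT (fun w => lsum (fun j : site => ((Z j n%:R w)%:R : R)%:E)).
    apply/integrableP; split => //.
    under eq_integral do rewrite gee0_abs//.
    rewrite (@integral_lsum _ _ _ _ _ (fun j w => ((Z j n%:R w)%:R : R)%:E))//.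
    rewrite lsum_esum; last by move=> j; apply: integral_ge0 => w _; rewrite lee_fin.
    have := hawkes_summable hZ (ler0n R n); apply: le_lt_trans.
    by rewrite le_eqVlt; apply/orP; left; apply/eqP; apply: eq_esum => j _; rewrite unlock.
  have := integrable_ae measurableT h.
  by apply: filterS => w /(_ Logic.I)/fin_numPlt/andP[].
have hstart : {ae P, forall w, forall j, points N j w (`[0%R, 0%R] `*` `[0%R, +oo[) = 0}.
  by apply: forall_site_ae => j; exact: line_null.
have hpt : {ae P, forall w, forall j, points N j w = N j w}.
  by apply: forall_site_ae => j; exact: (points_ae hN).
have hcount := hawkes_counting hZ.
have heq := hawkes_equation hZ.
apply: filterS3 (filterI hfin hstart) (filterI hpt hcount) heq => w [h1 h2] [h3 h4] h5.
by split => // i t t0; rewrite h3 h5.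
Qed.

(** On a good path the Riemann sums converge, so their upper limit is the integral. *)
Lemma wcountE w j s : good_path w ->
  X j s w = ((j == 0)%:R)%:E + \int[path_meas (Z j ^~ w)]_(u in `[0%R, s[) e u.
Proof.
move=> gw; rewrite wcountEsup; congr (_ + _).
by have [_ ->] := cvg_limn_einf_sup (cvg_grid_sum (good_counting gw j) hb (s := s)).
Qed.

(** The kernel factorizes, [expR (- (b * (s - u))) = expR (- (b * s)) * expR (b * u)], which is the
    origin of the weights; the impulsion becomes the initial unit mass at site 0. *)
Lemma hawkes_intensityE w i s : good_path w -> (0 <= s)%R ->
  hawkes_intensity phi Z i s w = rate i s w.
Proof.
move=> gw s0; rewrite /hawkes_intensity /rate (edge_set i).
rewrite -fsbig_seq; last by rewrite map_inj_uniq ?uniq_steps//; exact: addrI.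
rewrite big_map ge0_sume_distrr; last by move=> v _; exact: wcount_ge0.
apply: eq_bigr => v _; rewrite wcountE//.
have -> : \int[lebesgue_stieltjes_measure (stieltjes_ext (Z (i + v)%R ^~ w))]_(u in `[0%R, s[)
    (a * expR (- (b * (s - u))))%:E =
  (a * expR (- (b * s)))%:E * \int[path_meas (Z (i + v)%R ^~ w)]_(u in `[0%R, s[) e u.
  rewrite -ge0_integralZl//.
  - apply: eq_integral => u _; rewrite -EFinM -mulrA -expRD; congr (_ * expR _)%:E; ring.
  - exact: measurable_exp.
  - by rewrite lee_fin mulr_ge0 ?expR_ge0// (le_trans (ltW hb)) ?(ltW hab).
have I0 : 0 <= \int[path_meas (Z (i + v)%R ^~ w)]_(u in `[0%R, s[) e u.
  by apply: integral_ge0 => u _; rewrite lee_fin expR_ge0.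
rewrite addeC EFinM -ge0_muleDr ?lee_fin//.
by rewrite muleA -EFinM; congr (_%:E * _); rewrite mulrC.
Qed.

Lemma measurable_below_section i w : measurable (xsection (below_set i) w).
Proof. by apply: measurable_xsection; exact: measurable_below_set. Qed.

Let mfst : mfunT (fst : plane R -> borel R). Proof. exact: measurable_fst. Qed.

(** Image on the time axis of the points that lie under the intensity; it is identified below with
    the Stieltjes measure of the path. *)
Definition jump_measure i w : {measure set (borel R) -> \bar R} :=
  measure_function_pushforward__canonical__measure_function_Measure
    (mrestr (points N i w) (measurable_below_section i w)) mfst.

Lemma jump_measureE i w (A : set R) :
  jump_measure i w A = points N i w ([set x | A x.1] `&` xsection (below_set i) w).
Proof. by []. Qed.

Lemma count_jump_measure i w t : good_path w -> (0 <= t)%R ->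
  ((Z i t w)%:R)%:E = jump_measure i w `]0%R, t]%classic.
Proof.
move=> gw t0; rewrite (good_equation gw i t0) jump_measureE.
set D := `[0%R, t] `*` `[0%R, +oo[; set S := hawkes_below i w.
(* The region under the intensity up to time [t] splits into its slice [A0] at time 0, which carries
   no point, and its part [A1] at positive times, a section of [below_set]. *)
pose c0 := rate i 0%R w.
pose A0 : set (plane R) := [set (0%R : R)] `*` (`[0%R, +oo[ `&` [set z : R | z%:E <= c0]).
set A1 := [set x : plane R | `]0%R, t]%classic x.1] `&` xsection (below_set i) w.
have mD : measurable D by apply: measurableX; exact: measurable_itv.
have mA1 : measurable A1.
  apply: measurableI; last exact: measurable_below_section.
  by rewrite -[X in measurable X]setTI; apply: mfst => //; exact: measurable_itv.
have mA0 : measurable A0.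
  apply: measurableX; first exact: measurable_set1.
  apply: measurableI => //.
  have := @measurable_fun_lee _ (borel R) R setT EFin (cst c0).
  move=> /(_ _ _ measurableT [set true]); rewrite setTI => h.
  exact: h.
have SE : S `&` D = A0 `|` A1.
  apply/seteqP; split => -[s z]; rewrite /S /hawkes_below /D /A0 /A1 /xsection/= !in_itv/= !andbT ?in_setE.
    move=> [Sz [/andP[s0 st] z0]].
    have [s00|s00] := eqVneq s 0%R.
      by left; split => //; split => //; move: Sz; rewrite s00 hawkes_intensityE.
    have sp : (0 < s)%R by rewrite lt0r s00.
    right; split; first by rewrite sp st.
    by apply/in_below_set => //; rewrite -hawkes_intensityE.
  move=> [[-> [z0 Sz]]|[/andP[s0 st] [Q Sz]]].
    by rewrite lexx t0 z0 hawkes_intensityE.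
  move: Q Sz; rewrite /oquad/= !in_itv/= !andbT => -[_ z0].
  rewrite ptimeE; last by rewrite /oquad/= !in_itv/= s0 z0.
  by move=> h; rewrite hawkes_intensityE//; [rewrite (ltW s0) st z0|exact: ltW].
have -> : \int[points N i w]_(x in D) (\1_S x)%:E = \int[points N i w]_(x in D) (\1_(A0 `|` A1) x)%:E.
  apply: eq_integral => x; rewrite inE => Dx; congr EFin; rewrite -SE !indicE in_setI.
  by rewrite (mem_set Dx) andbT.
rewrite integral_indic//; last exact: measurableU.
have AD : (A0 `|` A1) `&` D = A0 `|` A1 by apply/setIidPl; rewrite -SE; exact: subIsetr.
rewrite AD measureU//; last first.
  apply/seteqP; split => // -[s z] [] [/= -> _] [/=]; by rewrite in_itv/= ltxx.
have A00 : points N i w A0 = 0.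
  apply/eqP; rewrite eq_le measure_ge0 andbT -(good_start gw i); apply: le_measure; rewrite ?inE//.
    by apply: measurableX; exact: measurable_itv.
  by move=> [s z] [/= -> [z0 _]]; rewrite in_itv/= lexx.
by rewrite -[RHS]add0e; congr (_ + _).
Qed.

(** Both measures give the increment of the count to intervals of nonnegative times and nothing to
    times before 0, and half-open intervals determine them. *)
Lemma path_jump_measure i w (A : set R) : good_path w -> measurable (A : set (borel R)) ->
  path_meas (Z i ^~ w) A = jump_measure i w A.
Proof.
move=> gw; have cf := good_counting gw i.
have addJ (A1 A2 : set R) : measurable (A1 : set (borel R)) -> measurable (A2 : set (borel R)) ->
    A1 `&` A2 = set0 -> jump_measure i w (A1 `|` A2) = jump_measure i w A1 + jump_measure i w A2.
  exact: (@measureU _ _ _ (jump_measure i w)).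
have pos t t' : (0 <= t)%R -> (t <= t')%R -> jump_measure i w `]t, t']%classic = ((Z i t' w)%:R - (Z i t w)%:R)%:E.
  move=> t0 tt; have t'0 := le_trans t0 tt.
  have sp : `]0%R, t']%classic = `]0%R, t] `|` `]t, t'].
    by rewrite (@itv_bndbnd_setU _ _ (BRight 0%R) (BRight t) (BRight t'))// bnd_simp.
  have := count_jump_measure i gw t'0; rewrite sp addJ; [|exact: measurable_itv..|].
    rewrite -count_jump_measure//; case: (jump_measure i w `]t, t']%classic) => // r.
    by rewrite -EFinD => -[->]; rewrite addrAC subrr add0r.
  by apply/seteqP; split => // x [] /=; rewrite !in_itv/= => /andP[_ xt] /andP[tx _]; move: (lt_le_trans tx xt); rewrite ltxx.
have neg (t : R) : (t <= 0)%R -> jump_measure i w `]-oo, t]%classic = 0.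
  move=> t0; rewrite jump_measureE (_ : _ `&` _ = set0) ?measure0//.
  apply/seteqP; split => // -[s z] []; rewrite /xsection/= in_setE/= in_itv/= => st.
  by move=> [[/=]]; rewrite in_itv/= andbT => s0 _ _; move: (lt_le_trans s0 (le_trans st t0)); rewrite ltxx.
move=> mA; apply: lebesgue_stieltjes_measure_unique mA => _ [[u v] /= uv <-].
rewrite -[LHS]/(path_meas (Z i ^~ w) `]u, v]) -[RHS]/(jump_measure i w `]u, v]%classic).
have [{}uv|vu] := leP u v; last first.
  have -> : `]u, v]%classic = set0 by rewrite set_itv_ge// bnd_simp -leNgt ltW.
  by transitivity (0 : \bar R); [exact: path_meas_empty|exact/esym/(measure0 (jump_measure i w))].
rewrite path_meas_oc// !stieltjes_extE//.
have [v0|v0] := leP v 0%R.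
  rewrite (max_l (le_trans uv v0)) subrr; apply/esym/eqP; rewrite eq_le measure_ge0 andbT -[leRHS](neg v v0).
  apply: le_measure; rewrite ?inE; [exact: measurable_itv|exact: measurable_itv|].
  by move=> x /=; rewrite !in_itv/= => /andP[].
have [u0|u0] := leP u 0%R; last first.
  by rewrite pos// ltW.
have -> : `]u, v]%classic = `]u, 0%R] `|` `]0%R, v].
  by rewrite (@itv_bndbnd_setU _ _ (BRight u) (BRight 0%R) (BRight v))// bnd_simp// ltW.
rewrite addJ; [|exact: measurable_itv..|]; last first.
  by apply/seteqP; split => // x [] /=; rewrite !in_itv/= => /andP[_ xt] /andP[tx _]; move: (lt_le_trans tx xt); rewrite ltxx.
rewrite (pos 0%R v) ?(ltW v0)// (_ : jump_measure i w `]u, 0%R]%classic = 0) ?add0e//.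
apply/eqP; rewrite eq_le measure_ge0 andbT -[leRHS](neg 0%R)//.
apply: le_measure; rewrite ?inE; [exact: measurable_itv|exact: measurable_itv|].
by move=> x /=; rewrite !in_itv/= => /andP[].
Qed.

Definition below i (z : W * plane R) : R := \1_(below_set i) z.

Lemma path_integralE i w (D : set R) (h : R -> \bar R) : good_path w ->
  measurable (D : set (borel R)) -> (forall u, 0 <= h u) ->
  mfunT (h : borel R -> \bar R) ->
  \int[path_meas (Z i ^~ w)]_(u in D) h u =
  \int[points N i w]_(x in oquad) (h x.1 * (\1_D x.1 * below i (w, x))%:E).
Proof.
move=> gw mD h0 mh.
transitivity (\int[jump_measure i w]_(u in D) h u).
  by apply: eq_measure_integral => A mA _; exact: path_jump_measure.
rewrite (ge0_integral_pushforward mfst)//; [|exact: measurable_funTS].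
have mfD : measurable (fst @^-1` D : set (plane R)).
  by rewrite -[X in measurable X]setTI; exact: mfst.
rewrite integral_mkcond integral_mrestr//; last 2 first.
- by move=> x; rewrite patchE; case: ifP => // _; exact: h0.
- apply/(measurable_restrictT _ mfD); apply: measurable_funTS.
  exact: measurableT_comp mh mfst.
rewrite integral_mkcond [RHS]integral_mkcond; apply: eq_integral => x _; rewrite !patchE /below.
rewrite !indicE.
have -> : ((w, x) \in below_set i) = (x \in xsection (below_set i) w) by rewrite mem_xsection.
case: (boolP (x \in xsection _ w)) => xB; last by rewrite mulr0 mule0; case: ifP.
have -> : x \in oquad by move: xB; rewrite !inE /xsection/= inE => -[].
have -> : (x \in fst @^-1` D) = (x.1 \in D) by [].
by case: (x.1 \in D); rewrite /= ?mulr1n ?mulr0n ?mulr1 ?mul0r ?mule1 ?mule0.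
Qed.

End paths.

#[local] Hint Resolve measurable_count : meas.

Local Notation X := wcount.

(** * First moments of the weights *)

Section first_moment.
Local Notation G := (pred_gen F).
Local Notation predictable f := (mfunT (f : sigmaT G -> \bar R)).
Local Notation e u := (expR (b * u))%:E.
Local Notation lam := (rate).

Definition nbr_mean (j : site) (s : R) (w : W) : \bar R :=
  ((2 * d + 1)%:R^-1)%:E * \sum_(v <- steps) X (j + v)%R s w.

Lemma nbr_mean_ge0 j s w : 0 <= nbr_mean j s w.
Proof.
rewrite mule_ge0 ?lee_fin ?invr_ge0//; apply: sume_ge0 => v _; exact: wcount_ge0.
Qed.

Lemma exp_rate j s w : e s * lam j s w = a%:E * nbr_mean j s w.
Proof.
rewrite /rate /nbr_mean !muleA -!EFinM; congr (_%:E * _).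
by rewrite mulrA mulrA (mulrC (expR _) a) -!mulrA; congr (_ * _)%R; rewrite mulrA -expRD subrr expR0 mul1r.
Qed.

Lemma ptime_line (s : R) : (0 <= s)%R -> ptime (s, 0%R : R) = s.
Proof.
rewrite /ptime/= lexx andbT => s0; case: ltP => // h; by apply/eqP; rewrite eq_le s0 h.
Qed.

Lemma section_measurable (f : R -> W -> \bar R) w : predictable (fun z => f (ptime z.2) z.1) ->
  mfunT (fun s : borel R => f (ptime (s, 0%R : R)) w).
Proof.
move=> mf.
have mf' : mfunT (fun z : W * plane R => f (ptime z.2) z.1).
  exact: (sub_sigma_mfun (pred_gen_measurable hF)).
have h : mfunT (fun s : borel R => (w, (s, 0%R)) : W * plane R).
  by apply: measurable_fun_pair.
exact: (measurableT_comp mf' h).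
Qed.

Lemma section_measurable_nonneg (f : R -> W -> \bar R) w (D : set R) :
  predictable (fun z => f (ptime z.2) z.1) -> measurable (D : set (borel R)) ->
  D `<=` `[0%R, +oo[ -> measurable_fun D (fun s : borel R => f s w).
Proof.
move=> mf mD D0.
apply: (@eq_measurable_fun _ _ _ _ D (fun s : borel R => f (ptime (s, 0%R : R)) w)).
  by move=> s; rewrite inE => /D0/=; rewrite in_itv/= andbT => s0; rewrite ptime_line.
by apply: measurable_funTS; exact: section_measurable.
Qed.

Lemma leb_below (r : \bar R) : 0 <= r -> leb (`[0%R, +oo[ `&` [set z : R | z%:E <= r]) = r.
Proof.
case: r => [r| |] // r0.
  have -> : `[0%R, +oo[ `&` [set z : R | z%:E <= r%:E] = `[0%R, r]%classic.
    apply/seteqP; split => z /=; rewrite !in_itv/= andbT ?lee_fin; first by move=> [-> ->].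
    by move=> /andP[-> ->].
  by rewrite leb_cc ?subr0//.
have -> : `[0%R, +oo[ `&` [set z : R | z%:E <= +oo] = `[0%R, +oo[%classic.
  by apply/seteqP; split => z /=; [move=> []|split => //; rewrite leey].
by have := @lebesgue_measure_itv R `[0%R, +oo[ => ->; rewrite /= ltry.
Qed.

(** Tonelli's theorem: the vertical section at time [s] of the region under the intensity has length
    [rate j s w]. *)
Lemma integral_below j w (g : R -> \bar R) : (forall s, 0 <= g s) ->
  mfunT (g : borel R -> \bar R) ->
  \int[leb2]_(x in oquad) (g x.1 * (below j (w, x))%:E) =
  \int[leb]_(s in `]0%R, +oo[) (g s * lam j s w).
Proof.
move=> g0 mg.
have mB := measurable_below_section j w.
have mQ : measurable (oquad : set (plane R)) by apply: measurableX; exact: measurable_itv.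
pose f (x : plane R) := g x.1 * (\1_(xsection (below_set j) w) x)%:E.
have f0 x : 0 <= f x by rewrite mule_ge0// lee_fin.
have mf : mfunT f.
  apply: emeasurable_funM; first exact: measurableT_comp mg measurable_fst.
  by apply/measurable_EFinP; exact: measurable_indic.
transitivity (\int[leb2]_x f x).
  rewrite integral_mkcond; apply: eq_integral => x _; rewrite patchE /f /below !indicE mem_xsection.
  case: ifPn => // /negP xQ; rewrite (_ : ((w, x) \in below_set j) = false) ?mule0//.
  by apply/negbTE/negP; rewrite inE => -[h _]; apply: xQ; rewrite inE.
rewrite /leb2 fubini_tonelli1// [RHS]integral_mkcond; apply: eq_integral => s _.
rewrite patchE /fubini_F /f.
have mS : measurable (xsection (xsection (below_set j) w) s) by exact: measurable_xsection.
transitivity (\int[leb]_z (g s * (\1_(xsection (xsection (below_set j) w) s) z)%:E)).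
  apply: eq_integral => z _; congr (_ * _%:E); rewrite !indicE; congr (_%:R).
  by rewrite [in RHS]mem_xsection.
rewrite ge0_integralZl//; last by apply/measurable_EFinP; exact: measurable_indic.
have E : xsection (xsection (below_set j) w) s = [set z | below_set j (w, (s, z))].
  by apply/seteqP; split => z; [move=> /set_mem/set_mem|move=> h; apply/mem_set/mem_set].
rewrite integral_indic// setIT; case: ifPn => hs.
  congr (_ * _); rewrite -[RHS]leb_below; last exact: rate_ge0.
  move: hs; rewrite inE/= in_itv/= andbT => s0.
  congr (leb _); rewrite E; apply/seteqP; split => z /=; rewrite in_itv/= andbT.
    move=> bz; have [[_ /=]] := bz; rewrite in_itv/= andbT => z0 _.
    by split => //; exact/(in_below_set j w s0 z0).
  by move=> [z0 zl]; apply/(in_below_set j w s0 z0).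
rewrite (_ : xsection _ _ = set0) ?measure0 ?mule0//.
rewrite E; apply/seteqP; split => // z /= [[s0 _] _].
by move/negP: hs; apply; rewrite inE.
Qed.

Lemma path_atom_null j w (u : R) : good_path w ->
  (0 <= u)%R -> points N j w (`[u, u] `*` `[0%R, +oo[) = 0 -> path_meas (Z j ^~ w) [set u] = 0.
Proof.
move=> gw u0 nl; rewrite (path_jump_measure j gw)//.
apply/eqP; rewrite eq_le measure_ge0 andbT -nl; apply: le_measure; rewrite ?inE.
- apply: measurableI; last exact: measurable_below_section.
  by rewrite -[X in measurable X]setTI; apply: measurable_fst => //; exact: measurable_set1.
- by apply: measurableX; exact: measurable_itv.
- move=> [s x] [/= ->]; rewrite /xsection/= inE => -[[/= _ x0] _].
  by split => //=; rewrite in_itv/= lexx.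
Qed.

Lemma path_integral_oo j w (h : R -> \bar R) (u t : R) : good_path w -> (0 <= u)%R ->
  points N j w (`[u, u] `*` `[0%R, +oo[) = 0 ->
  (forall s, 0 <= h s) -> mfunT (h : borel R -> \bar R) ->
  \int[path_meas (Z j ^~ w)]_(s in `[u, t[) h s = \int[path_meas (Z j ^~ w)]_(s in `]u, t[) h s.
Proof.
move=> gw u0 nl h0 mh; have [tu|ut] := leP t u.
  by rewrite !set_itv_ge// bnd_simp -leNgt// ltW.
have -> : `[u, t[%classic = [set u] `|` `]u, t[ by rewrite setU1itv// bnd_simp.
have z := path_atom_null gw u0 nl.
rewrite ge0_integral_setU//=.
- by rewrite null_set_integral ?add0e//; exact: measurable_funTS.
- exact: measurable_funTS.
- by apply/disj_setPS => s [/= ->]; rewrite in_itv/= ltxx.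
Qed.

Lemma integral_co_split j w (h : R -> \bar R) (u t : R) : (0 <= u)%R -> (u <= t)%R ->
  (forall s, 0 <= h s) -> mfunT (h : borel R -> \bar R) ->
  \int[path_meas (Z j ^~ w)]_(s in `[0%R, t[) h s =
  \int[path_meas (Z j ^~ w)]_(s in `[0%R, u[) h s + \int[path_meas (Z j ^~ w)]_(s in `[u, t[) h s.
Proof.
move=> u0 ut h0 mh; rewrite -ge0_integral_setU//=.
- by congr (integral _ _ _); rewrite -(@itv_bndbnd_setU _ _ (BLeft 0%R) (BLeft u) (BLeft t))// bnd_simp.
- exact: measurable_funTS.
- by apply/disj_setPS => s [/=]; rewrite !in_itv/= => /andP[_ su] /andP[us _]; move: (lt_le_trans su us); rewrite ltxx.
Qed.

Definition window (u t : R) (z : W * plane R) : R :=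
  ((u < ptime z.2) && (ptime z.2 < t))%R%:R.

(** Almost surely no point sits at time [u], so the window may be open at both ends. *)
Lemma increment_ae u t : (0 <= u)%R -> (u <= t)%R ->
  {ae P, forall w, forall j, X j t w = X j u w +
    \int[points N j w]_(x in oquad) (expR (b * ptime x) * window u t (w, x) * below j (w, x))%:E}.
Proof.
move=> u0 ut.
have hl : {ae P, forall w, forall j, points N j w (`[u, u] `*` `[0%R, +oo[) = 0}.
  by apply: forall_site_ae => j; exact: (line_null j u0).
apply: filterS2 hl (good_path_ae) => w hl gw j.
rewrite !(wcountE _ _ gw) -addeA; congr (_ + _).
have mexp : mfunT ((fun s => e s) : borel R -> \bar R) by exact: measurable_exp.
have e0 s : 0 <= e s by rewrite lee_fin expR_ge0.
rewrite (integral_co_split _ _ u0 ut)//; congr (_ + _).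
rewrite path_integral_oo// (path_integralE)//.
apply: eq_integral => x; rewrite inE => Qx; rewrite -EFinM; congr EFin.
rewrite /window/= ptimeE// -mulrA; congr (_ * (_ * _))%R.
by rewrite indicE; congr (_%:R); rewrite mem_setE/= in_itv/=.
Qed.

Let predictable_below_fun j : mfunT (below j : sigmaT G -> R).
Proof. apply: measurable_indic; exact: below_set_predictable. Qed.

Lemma predictable_exp c : mfunT ((fun z => expR (c * ptime z.2)) : sigmaT G -> R).
Proof.
apply: measurableT_comp; first exact: measurable_expR.
by apply: measurable_funM => //; exact: (predictable_ptime hF).
Qed.

Lemma predictable_window (u t : R) (phi : W -> R) : (0 <= u)%R -> (forall w, 0 <= phi w)%R ->
  mfunT (phi : sigmaT (F u) -> R) ->
  mfunT ((fun z => phi z.1 * window u t z)%R : sigmaT G -> R).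
Proof.
move=> u0 phi0 mphi; apply/measurable_EFinP.
have h : predictable (fun z => (phi z.1)%:E * ((u < ptime z.2)%R%:R)%:E * ((ptime z.2 < t)%R%:R)%:E).
  apply: emeasurable_funM.
    apply: (@predictable_adapted _ _ _ _ hF u (EFin \o phi)) => //; exact/measurable_EFinP.
  apply/measurable_EFinP; apply: measurableT_comp => //.
  apply: (measurable_fun_ltr (predictable_ptime hF)); exact: measurable_cst.
apply: eq_measurable_fun h => z _ /=; rewrite -!EFinM /window; congr EFin.
by case: (u < _)%R; case: (_ < t)%R; rewrite /= ?mulr0 ?mulr1 ?mul0r.
Qed.

(** The compensation formula applied to [phi * window * expR (b * s) * below]; by [exp_rate] the
    factor [expR (b * s)] cancels the decay of the rate. The test function [phi] makes the formula a
    statement given [F u]. *)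
Theorem mean_increment u t (phi : W -> R) j : (0 <= u)%R -> (u <= t)%R -> (forall w, 0 <= phi w)%R ->
  mfunT (phi : sigmaT (F u) -> R) ->
  \int[P]_w ((phi w)%:E * X j t w) = \int[P]_w ((phi w)%:E * X j u w) +
   \int[P]_w ((phi w)%:E * \int[leb]_(s in `]u, t[) (a%:E * nbr_mean j s w)).
Proof.
move=> u0 ut phi0 mphi.
have t0 := le_trans u0 ut.
have mphi' : mfunT phi by exact: (sub_sigma_mfun (filtration_measurable hF u0)).
pose g z : R := (phi z.1 * window u t z * expR (b * ptime z.2) * below j z)%R.
have g0 z : (0 <= g z)%R by rewrite /g !mulr_ge0 ?expR_ge0.
have pg : mfunT (g : sigmaT G -> R).
  apply: measurable_funM => //; apply: measurable_funM; last exact: predictable_exp.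
  exact: predictable_window.
have pEg : predictable (fun z => (g z)%:E) by exact/measurable_EFinP.
have mg : mfunT (fun z => (g z)%:E) by exact: (predictable_measurable hF pEg).
have mX s : (0 <= s)%R -> mfunT (X j s).
  move=> s0; apply: (sub_sigma_mfun (filtration_measurable hF s0)).
  exact: wcount_adapted.
have X0 s w := wcount_ge0 j s w.
have mEphi : mfunT (fun w => (phi w)%:E) by meas.
have h1 : \int[P]_w ((phi w)%:E * X j t w) =
   \int[P]_w ((phi w)%:E * X j u w + \int[points N j w]_(x in oquad) (g (w, x))%:E).
  apply: ae_eq_integral => //.
  - by meas.
  - apply: emeasurable_funD; first by apply: emeasurable_funM => //; exact: mX.
    by apply: (@measurable_points_integral _ _ _ _ N j (fun z => (g z)%:E)) => // z; rewrite lee_fin.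
  - apply: filterS (increment_ae u0 ut) => w hw _; rewrite hw.
    have mw : measurable_fun oquad (fun x : plane R =>
        (expR (b * ptime x) * window u t (w, x) * below j (w, x))%:E).
      have pw : mfunT ((fun z => expR (b * ptime z.2) * window u t z * below j z)%R
          : sigmaT G -> R).
        apply: measurable_funM => //; apply: measurable_funM; first exact: predictable_exp.
        have := predictable_window t u0 (fun _ : W => @ler01 R) (@measurable_cst _ _ _ _ _ _).
        by under eq_fun do rewrite mul1r.
      have mw' : mfunT (fun z => expR (b * ptime z.2) * window u t z * below j z)%R.
        exact: (sub_sigma_mfun (pred_gen_measurable hF) pw).
      apply/measurable_EFinP; apply: measurable_funTS.
      exact: (measurableT_comp mw' (measurable_pair1 w)).
    rewrite ge0_muleDr//; last by apply: integral_ge0 => x _; rewrite lee_fin !mulr_ge0 ?expR_ge0.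
    congr (_ + _); rewrite -ge0_integralZl//; last 3 first.
    + by apply: measurableX; exact: measurable_itv.
    + by move=> x _; rewrite lee_fin !mulr_ge0 ?expR_ge0.
    + by rewrite lee_fin.
    by apply: eq_integral => x _; rewrite -EFinM /g/=; congr EFin; ring.
rewrite h1 ge0_integralD//; last 4 first.
- by move=> w _; rewrite mule_ge0 ?lee_fin.
- by meas.
- by move=> w _; apply: integral_ge0 => x _; rewrite lee_fin.
- by apply: (@measurable_points_integral _ _ _ _ N j (fun z => (g z)%:E)) => // z; rewrite lee_fin.
congr (_ + _); rewrite (compensation hF hN j _ pEg); last by move=> z; rewrite lee_fin.
apply: eq_integral => w _.
pose h (s : R) : \bar R := (phi w * \1_(`]u, t[%classic : set R) s)%:E * e s.
have h0 s : 0 <= h s by rewrite mule_ge0 ?lee_fin ?mulr_ge0 ?expR_ge0.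
have mh : mfunT (h : borel R -> \bar R).
  apply: emeasurable_funM; last exact: measurable_exp.
  by apply/measurable_EFinP; apply: measurable_funM.
transitivity (\int[leb2]_(x in oquad) (h x.1 * (below j (w, x))%:E)).
  apply: eq_integral => x; rewrite inE => Qx; rewrite /g /h /window/= ptimeE// -!EFinM; congr EFin.
  rewrite indicE mem_setE in_itv/=; ring.
rewrite integral_below//.
have mnm : measurable_fun `]u, t[ (fun s : borel R => nbr_mean j s w).
  apply: (@section_measurable_nonneg (fun s w => nbr_mean j s w)); [|exact: measurable_itv|].
    apply: emeasurable_funM => //.
    by apply: emeasurable_sum => v; exact: wcount_predictable.
  by move=> s /=; rewrite !in_itv/= andbT => /andP[us _]; rewrite (le_trans u0)// ltW.
have nm0 s := nbr_mean_ge0 j s w.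
rewrite -ge0_integralZl//; last 3 first.
- by meas.
- by move=> s _; rewrite mule_ge0// lee_fin ltW.
- by rewrite lee_fin.
rewrite [LHS]integral_mkcond [RHS]integral_mkcond; apply: eq_integral => s _; rewrite !patchE /h indicE.
case: (boolP (s \in `]u, t[%classic)) => sut; last first.
  by case: ifP => // _; rewrite mulr0 !mul0e.
have -> : s \in `]0%R, +oo[%classic.
  move: sut; rewrite !inE/= !in_itv/= andbT => /andP[us _]; exact: le_lt_trans us.
by rewrite mulr1 -muleA exp_rate.
Qed.

End first_moment.

Local Notation nm := nbr_mean.

(** * Growth in mean of weighted total masses *)

Section total_mass.
Local Notation sqnorm := (@sqnorm R d).
Local Notation e u := (expR (b * u))%:E.

Lemma measurable_wcount j s : (0 <= s)%R -> mfunT (X j s).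
Proof.
move=> s0; apply: (sub_sigma_mfun (filtration_measurable hF s0)).
exact: wcount_adapted.
Qed.

Lemma wcount_mono j s t w : good_path w -> (s <= t)%R -> X j s w <= X j t w.
Proof.
move=> gw st; rewrite !(wcountE _ _ gw) leeD2l//.
apply: ge0_subset_integral => //=; first exact: measurable_exp.
by move=> u /=; rewrite !in_itv/= => /andP[-> us]; exact: lt_le_trans st.
Qed.

Lemma wcount_le j s w : good_path w -> (0 <= s)%R ->
  X j s w <= ((j == 0)%:R + expR (b * s) * (Z j s w)%:R)%:E.
Proof.
move=> gw s0; rewrite (wcountE _ _ gw) EFinD leeD2l//.
have [->|sn] := eqVneq s 0%R.
  by rewrite set_itvco0 integral_set0 lee_fin mulr_ge0 ?expR_ge0.
have sp : (0 < s)%R by rewrite lt0r sn.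
have cf := good_counting gw j.
have e0 u : 0 <= e u by rewrite lee_fin expR_ge0.
rewrite (integral_co_oo cf)//; last exact: measurable_exp.
apply: (@le_trans _ _ (\int[path_meas (Z j ^~ w)]_(u in `]0%R, s]) (expR (b * s))%:E)).
  apply: (@le_trans _ _ (\int[path_meas (Z j ^~ w)]_(u in `]0%R, s]) e u)).
    apply: ge0_subset_integral => //=; first exact: measurable_exp.
    by move=> u /=; rewrite !in_itv/= => /andP[-> /ltW].
  apply: ge0_le_integral => //=; first exact: measurable_exp.
  move=> u; rewrite in_itv/= => /andP[_ us]; by rewrite lee_fin ler_expR ler_pM2l.
rewrite integral_cst => //.
rewrite [X in _ * X](path_meas_oc0 cf)// EFinM; apply: lee_pmul; rewrite ?lee_fin ?expR_ge0 ?gerBl// subr_ge0 ler_nat; exact: (counting_nondecreasing cf).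
Qed.

Definition total : R -> W -> \bar R := locked_with wcount_key (fun s w => lsum (fun j => X j s w)).

Lemma totalE s w : total s w = lsum (fun j => X j s w).
Proof. by rewrite /total unlock. Qed.

Lemma total_ge0 s w : 0 <= total s w.
Proof. by rewrite totalE; apply: lsum_ge0 => j; exact: wcount_ge0. Qed.

(** A weight is at most its initial value plus [expR (b * s)] times the count, and the mean counts
    are summable by [hawkes_summable]. *)
Lemma weighted_mean_fin (c : site -> R) L (phi : W -> R) M s : (0 <= s)%R -> (forall j, 0 <= c j <= L)%R ->
  (forall w, 0 <= phi w <= M)%R -> mfunT phi ->
  lsum (fun j => (c j)%:E * \int[P]_w ((phi w)%:E * X j s w)) < +oo.
Proof.
move=> s0 cL phiM mphi.
have phi0 w : (0 <= phi w)%R by case/andP: (phiM w).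
have c0 j : (0 <= c j)%R by case/andP: (cL j).
have L0 : (0 <= L)%R by case/andP: (cL (0 : site)%R) => /le_trans h /h.
have X0 j w : 0 <= (phi w)%:E * X j s w by rewrite mule_ge0 ?lee_fin ?wcount_ge0.
have IX0 j : 0 <= \int[P]_w ((phi w)%:E * X j s w) by exact: integral_ge0.
have M0 : (0 <= M)%R by case/andP: (phiM point) => /le_trans h /h.
have Z0 j : 0 <= \int[P]_w ((Z j s w)%:R : R)%:E by apply: integral_ge0 => w _; rewrite lee_fin.
have mZ j : mfunT (fun w => ((Z j s w)%:R : R)%:E).
  by meas.
have h4 j w : 0 <= (M * ((j == 0)%:R + expR (b * s) * (Z j s w)%:R))%:E.
  by rewrite lee_fin !(mulr_ge0, addr_ge0) ?expR_ge0.
have h5 j : mfunT (fun w => (M * ((j == 0)%:R + expR (b * s) * (Z j s w)%:R))%:E).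
  by meas.
have le1 j : (c j)%:E * \int[P]_w ((phi w)%:E * X j s w) <=
    (L * M)%:E * ((j == 0)%:R)%:E + (L * M * expR (b * s))%:E * \int[P]_w ((Z j s w)%:R : R)%:E.
  have -> : (L * M)%:E * ((j == 0)%:R)%:E + (L * M * expR (b * s))%:E * \int[P]_w ((Z j s w)%:R : R)%:E
     = L%:E * \int[P]_w (M * ((j == 0)%:R + expR (b * s) * (Z j s w)%:R))%:E.
    rewrite -[X in _ + X]ge0_integralZl//; last by rewrite lee_fin !mulr_ge0 ?expR_ge0.
    have -> : (L * M)%:E * ((j == 0)%:R)%:E = \int[P]_w (L * M * (j == 0)%:R)%:E.
      by rewrite integral_cst// [X in _ = _ * X](@probability_setT _ _ _ P) mule1.
    have h1 : 0 <= (L * M * (j == 0)%:R)%:E by rewrite lee_fin !mulr_ge0.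
    have h2 w : 0 <= (L * M * expR (b * s))%:E * ((Z j s w)%:R)%:E by rewrite -EFinM lee_fin !mulr_ge0 ?expR_ge0.
    have h3 : mfunT (fun w => (L * M * expR (b * s))%:E * ((Z j s w)%:R)%:E).
      by meas.
    rewrite -ge0_integralD// -ge0_integralZl//.
    by apply: eq_integral => w _; rewrite -!EFinM -EFinD; congr EFin; ring.
  apply: lee_pmul; rewrite ?lee_fin//; first by case/andP: (cL j).
  apply: ae_ge0_le_integral => //.
  - apply: emeasurable_funM; [exact/measurable_EFinP|exact: measurable_wcount].
  apply: filterS (good_path_ae) => w gw _; rewrite EFinM.
  apply: lee_pmul; rewrite ?lee_fin ?wcount_ge0//; first by case/andP: (phiM w).
  exact: wcount_le.
apply: le_lt_trans (le_lsum _ le1) _.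
  by move=> j; rewrite mule_ge0 ?lee_fin.
rewrite lsumD; last 2 first.
- by move=> j; rewrite -EFinM lee_fin !mulr_ge0.
- by move=> j; rewrite mule_ge0// lee_fin !mulr_ge0 ?expR_ge0.
apply: lte_add_pinfty.
  rewrite (@lsum_finite _ _ _ [:: (0 : site)%R])//.
  - by rewrite big_seq1 -EFinM ltry.
  - by move=> j; rewrite -EFinM lee_fin !mulr_ge0.
  - by move=> j; rewrite inE => /negbTE ->; rewrite mule0.
rewrite lsumZ//; last by rewrite !mulr_ge0 ?expR_ge0.
apply: lte_mul_pinfty; rewrite ?lee_fin ?mulr_ge0 ?expR_ge0//.
rewrite lsum_esum//; have := hawkes_summable hZ s0; apply: le_lt_trans.
by rewrite le_eqVlt; apply/orP; left; apply/eqP; apply: eq_esum => j _; rewrite unlock.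
Qed.

Lemma nbr_mean_mono j s t w : good_path w -> (s <= t)%R -> nm j s w <= nm j t w.
Proof.
move=> gw st; rewrite /nbr_mean lee_pmul2l ?lte_fin ?invr_gt0 ?ltr0n ?addn1//.
by apply: lee_sum => v _; exact: wcount_mono.
Qed.

Lemma measurable_nbr_mean j s : (0 <= s)%R -> mfunT (nm j s).
Proof.
move=> s0; apply: emeasurable_funM => //.
by apply: emeasurable_sum => v; exact: measurable_wcount.
Qed.

Lemma mean_neighbour j s (phi : W -> R) : (0 <= s)%R -> (forall w, 0 <= phi w)%R -> mfunT phi ->
  \int[P]_w ((phi w)%:E * nm j s w) =
  ((2 * d + 1)%:R^-1)%:E * \sum_(v <- steps) \int[P]_w ((phi w)%:E * X (j + v)%R s w).
Proof.
move=> s0 phi0 mphi.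
have m1 v : mfunT (fun w => (phi w)%:E * X (j + v)%R s w).
  by apply: emeasurable_funM; [exact/measurable_EFinP|exact: measurable_wcount].
have p0 v w : 0 <= (phi w)%:E * X (j + v)%R s w by rewrite mule_ge0 ?lee_fin ?wcount_ge0.
have S0 w : 0 <= \sum_(v <- steps) (phi w)%:E * X (j + v)%R s w by exact: sume_ge0.
have mS : mfunT (fun w => \sum_(v <- steps) (phi w)%:E * X (j + v)%R s w) by exact: emeasurable_sum.
have k0 : 0 <= ((2 * d + 1)%:R^-1 : R)%:E by rewrite lee_fin invr_ge0.
rewrite -ge0_integral_sum// -ge0_integralZl//.
apply: eq_integral => w _; rewrite /nbr_mean muleCA; congr (_ * _).
by rewrite ge0_sume_distrr// => v _; exact: wcount_ge0.
Qed.

Local Notation predictable f := (mfunT (f : sigmaT (pred_gen F) -> \bar R)).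

Lemma measurable_time_integral (f : R -> W -> \bar R) (D : set R) :
  predictable (fun z => f (ptime z.2) z.1) -> (forall s w, 0 <= f s w) ->
  measurable (D : set (borel R)) -> D `<=` `[0%R, +oo[ ->
  mfunT (fun w => \int[leb]_(s in D) f s w).
Proof.
move=> pf f0 mD D0.
have mf : mfunT (fun z : W * plane R => f (ptime z.2) z.1).
  exact: (predictable_measurable hF).
have h : mfunT (fun x : W * borel R => (x.1, (x.2, 0%R)) : W * plane R).
  apply: measurable_fun_pair; first exact: measurable_fst.
  by apply: measurable_fun_pair => //; exact: measurable_snd.
have mg : mfunT (fun x : W * borel R => f (ptime (x.2, 0%R : R)) x.1 * (\1_D x.2)%:E).
  apply: emeasurable_funM; first exact: (measurableT_comp mf h).
  apply/measurable_EFinP; apply: measurableT_comp; last exact: measurable_snd.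
  exact: measurable_indic.
have -> : (fun w => \int[leb]_(s in D) f s w) =
    fubini_F leb (fun x : W * borel R => f (ptime (x.2, 0%R : R)) x.1 * (\1_D x.2)%:E).
  apply/funext => w; rewrite /fubini_F [LHS]integral_mkcond; apply: eq_integral => s _ /=.
  rewrite patchE indicE; case: ifPn => [sD|_]; last by rewrite mule0.
  by rewrite mule1 ptime_line//; move: sD; rewrite inE => /D0/=; rewrite in_itv/= andbT.
by apply: measurable_fun_fubini_tonelli_F => // x; rewrite mule_ge0 ?lee_fin.
Qed.

(** The weights being nondecreasing, a mean grows over []s, s'[] by at most [a * (s' - s)] times the
    neighbour average at the later time [s']. Summed against [c], the average moves onto [c] by
    symmetry and costs the factor [theta]; the discrete Gronwall inequality concludes. *)
Theorem weighted_mean_growth (c : site -> R) L theta (phi : W -> R) M u t :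
  (0 <= u)%R -> (u <= t)%R -> (forall j, 0 <= c j <= L)%R -> (0 <= theta)%R ->
  (forall j, avg c j <= theta * c j)%R -> (forall w, 0 <= phi w <= M)%R ->
  mfunT (phi : sigmaT (F u) -> R) ->
  lsum (fun j => (c j)%:E * \int[P]_w ((phi w)%:E * X j t w)) <=
  (expR (a * theta * (t - u)))%:E * lsum (fun j => (c j)%:E * \int[P]_w ((phi w)%:E * X j u w)).
Proof.
move=> u0 ut cL th0 avgc phiM mphi.
have phi0 w : (0 <= phi w)%R by case/andP: (phiM w).
have c0 j : (0 <= c j)%R by case/andP: (cL j).
have mphi' : mfunT phi by exact: (sub_sigma_mfun (filtration_measurable hF u0)).
pose x j s := \int[P]_w ((phi w)%:E * X j s w).
have x0 j s : 0 <= x j s by apply: integral_ge0 => w _; rewrite mule_ge0 ?wcount_ge0 ?lee_fin.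
pose Y s := lsum (fun j => (c j)%:E * x j s).
have cx0 j s : 0 <= (c j)%:E * x j s by rewrite mule_ge0 ?lee_fin.
have Y0 s : 0 <= Y s by exact: lsum_ge0.
have Yfin s : (0 <= s)%R -> Y s \is a fin_num.
  by move=> s0; rewrite ge0_fin_numE//; exact: weighted_mean_fin phiM mphi'.
have t0 := le_trans u0 ut.
apply: (@fine_le_scale _ _ (Y t) (Y u)); rewrite ?Yfin//.
apply: (discrete_gronwall (Y := fun s => fine (Y s))) => //.
- by rewrite mulr_ge0// ltW.
- by move=> s _; exact: fine_ge0.
move=> s s' us ss' s't.
have s0 := le_trans u0 us; have s'0 := le_trans s0 ss'.
apply: fine_le_add_scale; rewrite ?Yfin//.
have inc j : x j s' <= x j s + (a * (s' - s))%:E * (((2 * d + 1)%:R^-1)%:E * \sum_(v <- steps) x (j + v)%R s').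
  have mphis : mfunT (phi : sigmaT (F s) -> R).
    apply/measurable_EFinP; apply: (filtration_measurable_fun u0 us); exact/measurable_EFinP.
  rewrite {1}/x (mean_increment _ s0 ss' phi0 mphis) leeD2l//.
  have n0 w : 0 <= (phi w)%:E * nm j s' w by rewrite mule_ge0 ?nbr_mean_ge0 ?lee_fin.
  have mn : mfunT (fun w => (phi w)%:E * nm j s' w).
    by apply: emeasurable_funM; [exact/measurable_EFinP|exact: measurable_nbr_mean].
  have k0 : 0 <= (a * (s' - s))%:E by rewrite lee_fin mulr_ge0 ?subr_ge0// ltW.
  rewrite -mean_neighbour// -ge0_integralZl//.
  have mI : mfunT (fun w => \int[leb]_(r in `]s, s'[) (a%:E * nm j r w)).
    apply: (@measurable_time_integral (fun r w => a%:E * nm j r w)).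
    - apply: emeasurable_funM => //.
      apply: emeasurable_funM => //.
      by apply: emeasurable_sum => v; exact: wcount_predictable.
    - by move=> r w; rewrite mule_ge0 ?nbr_mean_ge0 ?lee_fin ?(ltW a0).
    - exact: measurable_itv.
    - by move=> r /=; rewrite !in_itv/= andbT => /andP[sr _]; rewrite (le_trans s0)// ltW.
  apply: ae_ge0_le_integral => //.
  - move=> w _; rewrite mule_ge0 ?lee_fin//; apply: integral_ge0 => r _.
    by rewrite mule_ge0 ?nbr_mean_ge0 ?lee_fin ?(ltW a0).
  - by meas.
  - by move=> w _; rewrite mule_ge0.
  - by apply: emeasurable_funM => //; exact: measurable_cst.
  apply: filterS (good_path_ae) => w gw _.
  rewrite muleCA; apply: lee_pmul; rewrite ?lee_fin//.
    apply: integral_ge0 => r _; by rewrite mule_ge0 ?nbr_mean_ge0 ?lee_fin ?(ltW a0).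
  apply: (@le_trans _ _ (\int[leb]_(r in `]s, s'[) (cst (a%:E * nm j s' w) r))).
    apply: ge0_le_integral => //=.
    - by move=> r _; rewrite mule_ge0 ?nbr_mean_ge0 ?lee_fin ?(ltW a0).
    - apply: emeasurable_funM => //.
      apply: (section_measurable_nonneg); [|exact: measurable_itv|].
        apply: emeasurable_funM => //.
        by apply: emeasurable_sum => v; exact: wcount_predictable.
      by move=> r /=; rewrite !in_itv/= andbT => /andP[sr _]; rewrite (le_trans s0)// ltW.
    - move=> r; rewrite in_itv/= => /andP[_ /ltW rs].
      by rewrite lee_pmul2l ?lte_fin//; exact: nbr_mean_mono.
  rewrite integral_cst => //.
  rewrite [X in _ * X](lebesgue_measure_itv `]s, s'[)/= lte_fin; case: ifPn => [_|_].
    by rewrite -EFinB EFinM muleAC.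
  by rewrite mule0 mule_ge0 ?nbr_mean_ge0 ?lee_fin.
apply: (@le_trans _ _ (lsum (fun j => (c j)%:E * x j s + (a * (s' - s))%:E *
     ((c j)%:E * (((2 * d + 1)%:R^-1)%:E * \sum_(v <- steps) x (j + v)%R s'))))).
  apply: le_lsum => // j; rewrite muleCA -ge0_muleDr ?mule_ge0 ?lee_fin ?invr_ge0 ?mulr_ge0 ?subr_ge0 ?(ltW a0)//; last exact: sume_ge0.
  by apply: lee_pmul => //; rewrite lee_fin.
have k0 : (0 <= a * (s' - s))%R by rewrite mulr_ge0 ?subr_ge0// ltW.
have s1 j : 0 <= (c j)%:E * (((2 * d + 1)%:R^-1)%:E * \sum_(v <- steps) x (j + v)%R s').
  by rewrite !mule_ge0 ?lee_fin ?invr_ge0//; exact: sume_ge0.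
rewrite lsumD ?lsumZ//; last by move=> j; rewrite mule_ge0.
rewrite leeD2l// (mulrAC a) (EFinM _ theta) -muleA; apply: lee_pmul; rewrite ?lee_fin//.
  by apply: lsum_ge0 => j; exact: s1.
rewrite (lsum_avg c0 (x0 ^~ s')) /Y -lsumZ//.
apply: le_lsum => j.
  rewrite mule_ge0// lee_fin mulr_ge0 ?invr_ge0//; exact: sumr_ge0.
by rewrite muleA -EFinM; apply: lee_pmul; rewrite ?lee_fin// mulr_ge0 ?invr_ge0 ?sumr_ge0.
Qed.

Lemma measurable_total s : (0 <= s)%R -> mfunT (total s).
Proof.
move=> s0; have -> : total s = fun w => lsum (fun j => X j s w) by apply/funext => w; exact: totalE.
apply: (@measurable_lsum _ _ _ _ _ (fun j w => X j s w)) => // [j w|j].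
  exact: wcount_ge0.
exact: measurable_wcount.
Qed.

Lemma integral_total s (phi : W -> R) : (0 <= s)%R -> (forall w, 0 <= phi w)%R -> mfunT phi ->
  \int[P]_w ((phi w)%:E * total s w) = lsum (fun j => \int[P]_w ((phi w)%:E * X j s w)).
Proof.
move=> s0 phi0 mphi; rewrite -(@integral_lsum _ _ _ _ _ (fun j w => (phi w)%:E * X j s w)).
- by apply: eq_integral => w _; rewrite totalE lsumZ// => j; exact: wcount_ge0.
- by move=> j w; rewrite mule_ge0 ?lee_fin ?wcount_ge0.
- by move=> j; apply: emeasurable_funM; [exact/measurable_EFinP|exact: measurable_wcount].
Qed.

Lemma total_growth (phi : W -> R) M u t : (0 <= u)%R -> (u <= t)%R -> (forall w, 0 <= phi w <= M)%R ->
  mfunT (phi : sigmaT (F u) -> R) ->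
  \int[P]_w ((phi w)%:E * total t w) <= (expR (a * (t - u)))%:E * \int[P]_w ((phi w)%:E * total u w).
Proof.
move=> u0 ut phiM mphi.
have mphi' : mfunT phi by exact: (sub_sigma_mfun (filtration_measurable hF u0)).
have phi0 w : (0 <= phi w)%R by case/andP: (phiM w).
have avg1 (j : site) : (avg (fun=> 1) j <= 1 * 1 :> R)%R.
  by rewrite /avg mulr1 big_const_seq count_predT size_steps iter_addr_0 -[X in (_ * X)%R]/(_%:R)%R mulVf// pnatr_eq0 addn1.
have one (j : site) : (0 <= (1 : R) <= 1)%R by rewrite ler01 lexx.
have h := weighted_mean_growth u0 ut one ler01 avg1 phiM mphi.
have E s : (0 <= s)%R -> \int[P]_w ((phi w)%:E * total s w) = lsum (fun j => 1%R%:E * \int[P]_w ((phi w)%:E * X j s w)).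
  by move=> s0; rewrite integral_total//; apply: eq_lsum => j; rewrite mul1e.
by apply: (le_scale_eq (E t (le_trans u0 ut)) (E u u0)); move: h; rewrite mulr1.
Qed.

Lemma total_start w : good_path w -> total 0%R w = 1.
Proof.
move=> gw; rewrite totalE; under eq_lsum do rewrite (wcountE _ _ gw) set_itvco0 integral_set0 adde0.
rewrite (@lsum_finite _ _ _ [:: (0 : site)%R])//.
- by rewrite big_seq1 eqxx.
- by move=> j; rewrite inE => /negbTE ->.
Qed.

Lemma weighted_start j w : good_path w -> X j 0%R w = ((j == 0)%:R)%:E.
Proof. by move=> gw; rewrite (wcountE _ _ gw) set_itvco0 integral_set0 adde0. Qed.

Lemma mean_total_le t : (0 <= t)%R -> \int[P]_w total t w <= (expR (a * t))%:E.
Proof.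
move=> t0; have E s : \int[P]_w (1%R%:E * total s w) = \int[P]_w total s w.
  by apply: eq_integral => w _; rewrite mul1e.
have one (w : W) : (0 <= (1 : R) <= 1)%R by rewrite ler01 lexx.
have h := total_growth (lexx 0%R) t0 one (@measurable_cst _ _ _ _ _ (1 : R)%R).
have E0 : \int[P]_w (1%R%:E * total 0%R w) = 1%R%:E.
  rewrite (E 0%R); transitivity (\int[P]_w (cst 1%R%:E w)); last by rewrite integral_cst// mul1e; exact: probability_setT.
  apply: ae_eq_integral => //; first exact: measurable_total.
  by apply: filterS (good_path_ae) => w gw _; rewrite total_start.
by rewrite -(E t); apply: (le_trans h); rewrite E0 mule1 subr0.
Qed.

(** The growth estimate is for bounded weights, so the squared norm is capped. The cap [L] exceeds
    the squared norms of the first [n] sites, where it is inactive, and [n] is arbitrary. *)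
Lemma mean_spread_le (eps t : R) : (0 <= eps)%R -> (0 <= t)%R ->
  \int[P]_w lsum (fun j => (1 + eps * sqnorm j)%:E * X j t w) <= (expR (a * (1 + eps) * t))%:E.
Proof.
move=> e0 t0; have c0 (j : site) : (0 <= 1 + eps * sqnorm j :> R)%R.
  by rewrite addr_ge0// mulr_ge0// sqnorm_ge0.
have X0 j w : 0 <= X j t w by exact: wcount_ge0.
have EX0 j : 0 <= \int[P]_w X j t w by exact: integral_ge0.
rewrite (@integral_lsum _ _ _ _ _ (fun j w => (1 + eps * sqnorm j)%:E * X j t w)); last 2 first.
- by move=> j w; rewrite mule_ge0 ?lee_fin.
- by move=> j; apply: emeasurable_funM => //; exact: measurable_wcount.
have -> : lsum (fun j => \int[P]_w ((1 + eps * sqnorm j)%:E * X j t w)) =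
    lsum (fun j => (1 + eps * sqnorm j)%:E * \int[P]_w X j t w).
  apply: eq_lsum => j; rewrite ge0_integralZl ?lee_fin//; exact: measurable_wcount.
apply: le_lsum_bound => [j|n]; first by rewrite mule_ge0 ?lee_fin.
pose L : R := (\sum_(j <- initial n) sqnorm j)%R.
have L0 : (0 <= L)%R by apply: sumr_ge0 => j _; exact: sqnorm_ge0.
pose c (j : site) : R := (1 + eps * Num.min (sqnorm j) L)%R.
have cn0 j : (0 <= c j)%R by rewrite addr_ge0// mulr_ge0// le_min sqnorm_ge0.
have cL j : (0 <= c j <= 1 + eps * L)%R.
  by rewrite cn0 lerD2l ler_wpM2l// ge_min lexx orbT.
have th0 : (0 <= 1 + eps)%R by rewrite addr_ge0.
have avgc j : (avg c j <= (1 + eps) * c j)%R by exact: weight_avg.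
have one (w : W) : (0 <= (1 : R) <= 1)%R by rewrite ler01 lexx.
have S0 : lsum (fun j : site => (c j)%:E * \int[P]_w (1%R%:E * X j 0%R w)) = 1%R%:E.
  have E j : \int[P]_w (1%R%:E * X j 0%R w) = ((j == 0)%:R)%:E.
    transitivity (\int[P]_w (cst ((j == 0)%:R)%:E w)); last first.
      by rewrite integral_cst// [X in _ * X](@probability_setT _ _ _ P) mule1.
    apply: ae_eq_integral => //.
      by apply: emeasurable_funM => //; exact: measurable_wcount.
    by apply: filterS (good_path_ae) => w gw _; rewrite mul1e weighted_start.
  under eq_lsum do rewrite E.
  rewrite (@lsum_finite _ _ _ [:: (0 : site)%R])//.
  - rewrite big_seq1 eqxx mule1 /c (_ : sqnorm _ = 0%R) ?min_l// ?mulr0 ?addr0//.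
    by rewrite /sqnorm big1// => k _; rewrite mxE expr0n.
  - by move=> j; rewrite mule_ge0 ?lee_fin.
  - by move=> j; rewrite inE => /negbTE ->; rewrite mule0.
have h := weighted_mean_growth (lexx 0%R) t0 cL th0 avgc one (@measurable_cst _ _ _ _ _ (1 : R)%R).
apply: (@le_trans _ _ ((expR (a * (1 + eps) * (t - 0)))%:E * 1%R%:E)); last by rewrite mule1 subr0.
rewrite -S0; apply: le_trans h.
have E j : \int[P]_w (1%R%:E * X j t w) = \int[P]_w X j t w by apply: eq_integral => w _; rewrite mul1e.
under eq_lsum do rewrite E.
apply: le_trans (seq_sum_le_lsum _ (initial_uniq n)); last by move=> j; rewrite mule_ge0 ?lee_fin.
rewrite big_seq [leRHS]big_seq; apply: lee_sum => j jn; apply: lee_pmul; rewrite ?lee_fin//.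
rewrite lerD2l ler_wpM2l// le_min lexx /L (big_rem j)//= lerDl.
by apply: sumr_ge0 => k _; exact: sqnorm_ge0.
Qed.

End total_mass.

#[local] Hint Resolve measurable_wcount measurable_total : meas.

(** * Pathwise evolution against a backward solution, and its second moment *)

Section evolution.
Local Notation lam := (rate).
Local Notation e u := (expR (b * u))%:E.

Lemma wcount_split j w u s : good_path w -> (0 <= u)%R -> (u <= s)%R ->
  X j s w = X j u w + \int[path_meas (Z j ^~ w)]_(r in `[u, s[) e r.
Proof.
move=> gw u0 us; rewrite !(wcountE _ _ gw) -addeA; congr (_ + _).
by apply: integral_co_split => //; exact: measurable_exp.
Qed.

Lemma measurable_path_count j w (D : set R) : measurable (D : set (borel R)) ->
  D `<=` `[0%R, +oo[ -> measurable_fun D (fun s : borel R => X j s w).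
Proof.
by move=> mD D0; apply: (section_measurable_nonneg) => //; exact: wcount_predictable.
Qed.

Lemma itv_oo_sub (u t : R) : (0 <= u)%R -> `]u, t[ `<=` `[0%R, +oo[.
Proof. by move=> u0 s /=; rewrite !in_itv/= andbT => /andP[us _]; rewrite (le_trans u0)// ltW. Qed.

Lemma wcount_parts j w (g g' : R -> R) u t : good_path w -> (0 <= u)%R -> (u <= t)%R ->
  (forall s : R, is_derive s 1%R g (g' s)) -> continuous g' ->
  (forall s, (u <= s <= t)%R -> (0 <= g s)%R) -> (forall s, (u <= s <= t)%R -> (0 <= g' s)%R) ->
  (g t)%:E * X j t w = (g u)%:E * X j u w + \int[path_meas (Z j ^~ w)]_(s in `[u, t[) ((g s)%:E * e s)
    + \int[leb]_(s in `]u, t[) ((g' s)%:E * X j s w).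
Proof.
move=> gw u0 ut dg cg' g0 g'0.
rewrite (wcount_split _ gw u0 ut) (stieltjes_parts (u := u) _ _ _ _ _ dg)//.
- congr (_ + _); apply: eq_integral => s; rewrite inE/= in_itv/= => /andP[/ltW us _].
  by rewrite (wcount_split _ gw u0 us).
- exact: wcount_ge0.
- exact: measurable_exp.
Qed.

Lemma window_itv u t (w : W) x : oquad x -> window u t (w, x) = (x.1 \in `]u, t[)%:R :> R.
Proof. by move=> Qx; rewrite /window/= ptimeE// in_itv. Qed.

(** Integrand of the jump integral against [h]: a jump of [Z j] at time [s] raises the weight at [j]
    by [expR (b * s)]. *)
Definition jweight (h : R -> R) u t j (z : W * plane R) : R :=
  (h (ptime z.2) * expR (b * ptime z.2) * window u t z * below j z)%R.

Lemma jweight_ge0 h u t j z : (forall s, (u <= s <= t)%R -> (0 <= h s)%R) -> (0 <= jweight h u t j z)%R.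
Proof.
move=> h0; rewrite /jweight mulr_ge0// /window.
case: (boolP (_ && _)) => [/andP[h1 h2]|_]; last by rewrite mulr0.
by rewrite mulr1 mulr_ge0 ?expR_ge0// h0// !ltW.
Qed.

Lemma predictable_jweight h (c v : R) j : (0 <= c)%R -> continuous h ->
  mfunT (jweight h c v j : sigmaT (pred_gen F) -> R).
Proof.
move=> c0 ch; apply: measurable_funM; last first.
  by apply: measurable_indic; exact: below_set_predictable.
apply: measurable_funM; last first.
  have := predictable_window v c0 (fun _ : W => @ler01 R) (@measurable_cst _ _ _ _ _ _).
  by under eq_fun do rewrite mul1r.
apply: measurable_funM; last exact: predictable_exp.
by apply: measurableT_comp; [exact: continuous_measurable_fun|exact: (predictable_ptime hF)].
Qed.

Lemma measurable_jweight h (c v : R) j : (0 <= c)%R -> continuous h -> mfunT (jweight h c v j).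
Proof.
move=> c0 ch; exact: (sub_sigma_mfun (pred_gen_measurable hF) (predictable_jweight v j c0 ch)).
Qed.

Lemma nbr_mean_le_total w j t : nm j t w <= total t w.
Proof.
have X0 i : 0 <= X i t w by exact: wcount_ge0.
have n1 : (1 <= (2 * d + 1)%:R :> R)%R by rewrite ler1n addn1.
apply: (@le_trans _ _ (1%R%:E * \sum_(v <- steps) X (j + v)%R t w)).
  by apply: lee_pmul; rewrite ?lee_fin ?invr_ge0 ?sume_ge0// invf_le1// (lt_le_trans ltr01).
rewrite mul1e totalE -(big_map (fun v => j + v)%R xpredT (fun i => X i t w)).
by apply: seq_sum_le_lsum => //; rewrite map_inj_uniq ?uniq_steps//; exact: addrI.
Qed.

Lemma rate_le_total w j s t : good_path w -> (0 <= s)%R -> (s <= t)%R ->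
  lam j s w <= a%:E * total t w.
Proof.
move=> gw s0 st; have r0 := rate_ge0 j s w.
have aa : (0 <= a)%R by rewrite ltW// (lt_trans hb).
apply: (@le_trans _ _ (e s * lam j s w)).
  by rewrite -[leLHS]mul1e; apply: lee_pmul => //; rewrite lee_fin -expR0 ler_expR mulr_ge0// ltW.
rewrite exp_rate; apply: lee_pmul; rewrite ?lee_fin ?nbr_mean_ge0//.
apply: le_trans (nbr_mean_mono j gw st) _; exact: nbr_mean_le_total.
Qed.

Let pos_part (h : R -> R) (s : R) : \bar R := (Num.max (h s) 0)%:E.

Let pos_part_ge0 h s : 0 <= pos_part h s.
Proof. by rewrite lee_fin le_max lexx orbT. Qed.

Let measurable_pos_part h : continuous h -> mfunT (pos_part h : borel R -> \bar R).
Proof.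
move=> ch; apply/measurable_EFinP; apply: measurable_maxr => //.
by apply/measurable_EFinP; exact: measurable_continuous.
Qed.

Let pos_partE (h : R -> R) u t s : (forall s, (u <= s <= t)%R -> (0 <= h s)%R) -> (u <= s <= t)%R -> pos_part h s = (h s)%:E.
Proof. by move=> h0 us; rewrite /pos_part max_l// h0. Qed.

Lemma path_jweight j w (h : R -> R) u t : good_path w -> (0 <= u)%R ->
  points N j w (`[u, u] `*` `[0%R, +oo[) = 0 -> continuous h ->
  (forall s, (u <= s <= t)%R -> (0 <= h s)%R) ->
  \int[path_meas (Z j ^~ w)]_(s in `[u, t[) ((h s)%:E * e s) =
  \int[points N j w]_(x in oquad) (jweight h u t j (w, x))%:E.
Proof.
move=> gw u0 nl ch h0.
have mp := measurable_pos_part ch.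
have mpe : mfunT ((fun s => pos_part h s * e s) : borel R -> \bar R).
  by apply: emeasurable_funM => //; exact: measurable_exp.
have pe0 s : 0 <= pos_part h s * e s by rewrite mule_ge0 ?pos_part_ge0 ?lee_fin ?expR_ge0.
transitivity (\int[path_meas (Z j ^~ w)]_(s in `[u, t[) (pos_part h s * e s)).
  apply: eq_integral => s; rewrite inE/= in_itv/= => /andP[us st].
  by rewrite (pos_partE h0)// us ltW.
rewrite (path_integral_oo t gw u0 nl pe0 mpe).
rewrite (path_integralE j gw _ pe0 mpe) => //.
apply: eq_integral => x; rewrite inE => Qx.
rewrite /jweight window_itv//= ptimeE// indicE mem_setE.
case: (boolP (x.1 \in `]u, t[)) => [|_]; last by rewrite mul0r mule0 mulr0 mul0r.
rewrite in_itv/= => /andP[us st]; rewrite (pos_partE h0) ?(ltW us) ?(ltW st)//.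
by rewrite -!EFinM mul1r mulr1.
Qed.

(** This is the compensator of the jump integral: integrating the marks out leaves the rate, which
    [exp_rate] turns into [a] times the neighbour mean. *)
Lemma leb_jweight j w (h : R -> R) u t : (0 <= u)%R -> continuous h ->
  (forall s, (u <= s <= t)%R -> (0 <= h s)%R) ->
  \int[leb2]_(x in oquad) (jweight h u t j (w, x))%:E =
  \int[leb]_(s in `]u, t[) ((a * h s)%:E * nm j s w).
Proof.
move=> u0 ch h0.
pose g (s : R) : \bar R := pos_part h s * e s * (\1_(`]u, t[%classic : set R) s)%:E.
have g0 s : 0 <= g s by rewrite !mule_ge0 ?pos_part_ge0 ?lee_fin ?expR_ge0.
have mg : mfunT (g : borel R -> \bar R).
  apply: emeasurable_funM; first by apply: emeasurable_funM; [exact: measurable_pos_part|exact: measurable_exp].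
  by apply/measurable_EFinP; apply: measurable_indic; exact: measurable_itv.
transitivity (\int[leb2]_(x in oquad) (g x.1 * (below j (w, x))%:E)).
  apply: eq_integral => x; rewrite inE => Qx.
  rewrite /jweight /g window_itv//= ptimeE// indicE mem_setE.
  case: (boolP (x.1 \in `]u, t[)) => [|_]; last by rewrite mulr0 mul0r mule0 mul0e.
  by rewrite in_itv/= => /andP[us st]; rewrite (pos_partE h0) ?(ltW us) ?(ltW st)// mulr1 mule1 -!EFinM.
rewrite (integral_below j w g0 mg).
rewrite [LHS]integral_mkcond [RHS]integral_mkcond; apply: eq_integral => s _; rewrite !patchE /g indicE.
case: (boolP (s \in `]u, t[%classic)) => sut; last by case: ifP; rewrite ?mule0 ?mul0e.
move: sut; rewrite inE/= in_itv/= => /andP[us st].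
rewrite mem_set; last by rewrite /= in_itv/= andbT; exact: le_lt_trans us.
rewrite mule1 -muleA (exp_rate j s w) (pos_partE h0) ?(ltW us) ?(ltW st)//.
by rewrite muleA -EFinM mulrC.
Qed.

(** The total count at an integer time beyond [t] is finite, so finitely many sites are active;
    these and their neighbours are put into [initial n]. *)
Lemma good_path_support w t : good_path w -> (0 <= t)%R ->
  exists n, forall j s, j \notin initial n -> (s <= t)%R -> X j s w = 0 /\ nm j s w = 0.
Proof.
move=> gw t0; pose m := Num.bound t.
have tm : (t <= m%:R)%R by apply: ltW; exact: archi_boundP.
have [n1 h1] := lsum_nat_finite (good_finite gw m).
have X1 j : j != 0%R -> j \notin initial n1 -> X j m%:R w = 0.
  move=> j0 jn; apply/eqP; rewrite eq_le wcount_ge0 andbT.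
  apply: (le_trans (wcount_le j gw _)) => //.
  by rewrite h1// (negbTE j0) mulr0 addr0.
pose S : seq site := (0%R : site) :: initial n1.
have [n hn] := sub_initial (S ++ [seq (i - v)%R | i <- S, v <- @steps d]).
have X0 j : j \notin S -> X j m%:R w = 0.
  by rewrite inE negb_or => /andP[j0 jn]; exact: X1.
have X0' j s : j \notin S -> (s <= t)%R -> X j s w = 0.
  move=> jS st; apply/eqP; rewrite eq_le wcount_ge0 andbT -(X0 j jS).
  by apply: (wcount_mono _ gw); exact: le_trans tm.
exists n => j s jn st; split.
  by apply: X0' => //; apply: contra jn => jS; apply: hn; rewrite mem_cat jS.
rewrite /nbr_mean big1_seq ?mule0// => v /= vs; apply: X0' => //.
apply: contra jn => jS; apply: hn; rewrite mem_cat; apply/orP; right.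
by apply/allpairsP; exists ((j + v)%R, v); rewrite addrK.
Qed.

Lemma total_fin w t : good_path w -> (0 <= t)%R -> total t w < +oo.
Proof.
move=> gw t0; have [n hn] := good_path_support gw t0.
have X0 j : 0 <= X j t w by exact: wcount_ge0.
rewrite totalE (@lsum_finite _ _ _ (initial n)) ?initial_uniq//; last by move=> j jn; have [] := hn j t jn (lexx t).
apply: lte_sum_pinfty => j _; apply: le_lt_trans (wcount_le j gw t0) _; exact: ltry.
Qed.

Section backward_equation.
Variables (f : site -> R -> R) (u t M : R).
Hypotheses (u0 : (0 <= u)%R) (ut : (u <= t)%R) (M0 : (0 <= M)%R).
Hypothesis df : forall j (s : R), is_derive s 1%R (f j) (- (a * avg (f ^~ s) j))%R.
Hypothesis fM : forall j s, (u <= s <= t)%R -> (`|f j s| <= M)%R.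

(** Affine correction that makes [f + q] nonnegative and nondecreasing: [q] is at least [M], which
    bounds [|f|], and its slope [a * M] bounds [|a * avg f|]. Formulas for [f] are then differences
    of those for [f + q] and for [q]. *)
Let q (s : R) : R := (M * (1 + a * (s - u)))%R.
Let g j (s : R) : R := (f j s + q s)%R.
Let g' j (s : R) : R := (- (a * avg (f ^~ s) j) + a * M)%R.

Let cf j : continuous (f j). Proof. by move=> s; exact: (derive_continuous (df j s)). Qed.

Let continuous_avg j : continuous (fun s => avg (f ^~ s) j).
Proof.
move=> s; apply: cvgM; first exact: cvg_cst.
elim: (@steps d) => [|v r IH]; first by under eq_fun do rewrite big_nil; rewrite big_nil; exact: cvg_cst.
under eq_fun do rewrite big_cons; rewrite big_cons; apply: cvgD => //; exact: cf.
Qed.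

Let cg' j : continuous (g' j).
Proof.
move=> s; apply: cvgD; last exact: cvg_cst.
by apply: cvgN; apply: cvgM; [exact: cvg_cst|exact: continuous_avg].
Qed.

Let dq (s : R) : is_derive s 1%R q (a * M)%R.
Proof.
have -> : q = (fun s => (a * M) * s + (M - a * M * u))%R by apply/funext => r; rewrite /q; ring.
by apply: is_derive_eq; rewrite addr0; exact: mulr1.
Qed.

Let dg j (s : R) : is_derive s 1%R (g j) (g' j s).
Proof. by have h := df j s; have h' := dq s; exact: is_deriveD. Qed.

Let qM s : (u <= s <= t)%R -> (M <= q s)%R.
Proof.
by move=> /andP[us _]; rewrite ler_peMr// lerDl mulr_ge0 ?subr_ge0// ltW.
Qed.

Let q0 s : (u <= s <= t)%R -> (0 <= q s)%R.
Proof. by move=> h; apply: le_trans (qM h). Qed.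

Let g0 j s : (u <= s <= t)%R -> (0 <= g j s)%R.
Proof.
move=> h; have := fM j h; rewrite ler_norml => /andP[h1 _].
by have := qM h; rewrite /g; lra.
Qed.

Let avgM j s : (u <= s <= t)%R -> (`|avg (f ^~ s) j| <= M)%R.
Proof.
move=> h; rewrite /avg normrM ger0_norm ?invr_ge0// mulrC ler_pdivrMr ?ltr0n ?addn1//.
apply: (le_trans (ler_norm_sum _ _ _)).
apply: (@le_trans _ _ (\sum_(v <- @steps d) M)%R); first by apply: ler_sum => v _; exact: fM.
by rewrite big_const_seq count_predT size_steps iter_addr_0 -[leLHS]mulr_natr addn1.
Qed.

Let g'0 j s : (u <= s <= t)%R -> (0 <= g' j s)%R.
Proof.
move=> h; rewrite /g' addrC -mulrBr mulr_ge0 ?(ltW a0)// subr_ge0.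
by have := avgM j h; rewrite ler_norml => /andP[].
Qed.

Let aM0 s : (u <= s <= t)%R -> (0 <= a * M)%R. Proof. by move=> _; rewrite mulr_ge0// ltW. Qed.

Section path.
Variable w : W.
Hypothesis gw : good_path w.

Let X0 j s : 0 <= X j s w. Proof. exact: wcount_ge0. Qed.
Let nm0 j s : 0 <= nm j s w. Proof. exact: nbr_mean_ge0. Qed.
Let t0 : (0 <= t)%R. Proof. exact: le_trans ut. Qed.

Let mX j : measurable_fun `]u, t[ (fun s : borel R => X j s w).
Proof. by apply: measurable_path_count => //; exact: itv_oo_sub. Qed.

Let mnm j : measurable_fun `]u, t[ (fun s : borel R => nm j s w).
Proof.
apply: emeasurable_funM => //.
by apply: emeasurable_sum => v; exact: mX.
Qed.

Let in_uct s : `]u, t[%classic s -> (u <= s <= t)%R.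
Proof. by rewrite /= in_itv/= => /andP[/ltW -> /ltW ->]. Qed.

(** The backward equation at work: by symmetry of the average, the compensator of the jumps weighted
    by [f] cancels the time derivative of [f], so that only the contributions of [q] remain. *)
Lemma drift_balance :
  lsum (fun j => \int[leb]_(s in `]u, t[) ((g' j s)%:E * X j s w)) +
  lsum (fun j => \int[leb]_(s in `]u, t[) ((a * g j s)%:E * nm j s w)) =
  lsum (fun j => \int[leb]_(s in `]u, t[) ((a * M)%:E * X j s w)) +
  lsum (fun j => \int[leb]_(s in `]u, t[) ((a * q s)%:E * nm j s w)).
Proof.
have mf (h : R -> R) : continuous h -> measurable_fun `]u, t[ ((fun s => (h s)%:E) : borel R -> \bar R).
  by move=> ch; exact: measurable_continuous.
have cg j : continuous (g j) by move=> s; exact: (derive_continuous (dg j s)).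
have cq : continuous q by move=> s; exact: (derive_continuous (dq s)).
have mD : measurable (`]u, t[%classic : set (borel R)) by exact: measurable_itv.
have ag0 j s : (u <= s <= t)%R -> (0 <= a * g j s)%R by move=> h; rewrite mulr_ge0 ?g0// ltW.
have aq0 s : (u <= s <= t)%R -> (0 <= a * q s)%R by move=> h; rewrite mulr_ge0 ?q0// ltW.
have n1 j s : `]u, t[%classic s -> 0 <= (g' j s)%:E * X j s w by move=> /in_uct h; rewrite mule_ge0// lee_fin g'0.
have n2 j s : `]u, t[%classic s -> 0 <= (a * g j s)%:E * nm j s w by move=> /in_uct h; rewrite mule_ge0// lee_fin ag0.
have n3 (j : site) s : `]u, t[%classic s -> 0 <= (a * M)%:E * X j s w by move=> /in_uct h; rewrite mule_ge0// lee_fin (aM0 h).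
have n4 (j : site) s : `]u, t[%classic s -> 0 <= (a * q s)%:E * nm j s w by move=> /in_uct h; rewrite mule_ge0// lee_fin aq0.
have m1 j : measurable_fun `]u, t[ (fun s : borel R => (g' j s)%:E * X j s w).
  by apply: emeasurable_funM; [exact: mf|exact: mX].
have m2 j : measurable_fun `]u, t[ (fun s : borel R => (a * g j s)%:E * nm j s w).
  by apply: emeasurable_funM; [apply: mf => s; apply: cvgM; [exact: cvg_cst|exact: cg]|exact: mnm].
have m3 j : measurable_fun `]u, t[ (fun s : borel R => (a * M)%:E * X j s w).
  by meas.
have m4 j : measurable_fun `]u, t[ (fun s : borel R => (a * q s)%:E * nm j s w).
  by apply: emeasurable_funM; [apply: mf => s; apply: cvgM; [exact: cvg_cst|exact: cq]|exact: mnm].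
rewrite -(integral_lsum_dom leb mD n1 m1) -(integral_lsum_dom leb mD n2 m2).
rewrite -(integral_lsum_dom leb mD n3 m3) -(integral_lsum_dom leb mD n4 m4).
have ls (h : site -> borel R -> \bar R) : (forall j s, `]u, t[%classic s -> 0 <= h j s) ->
    (forall j, measurable_fun `]u, t[ (h j)) -> measurable_fun `]u, t[ (fun s => lsum (h ^~ s)).
  move=> h0 mh; apply: (@emeasurable_fun_cvg _ _ _ _ (fun n s => \sum_(j <- initial n) h j s)).
    by move=> n; exact: emeasurable_sum.
  by move=> s sD; apply: is_cvg_initial_sum => j; exact: h0.
rewrite -ge0_integralD; [|exact: mD|..]; last 4 first.
- by move=> s sD; apply: lsum_ge0 => j; exact: n1.
- exact: (ls _ n1 m1).
- by move=> s sD; apply: lsum_ge0 => j; exact: n2.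
- exact: (ls _ n2 m2).
rewrite -ge0_integralD; [|exact: mD|..]; last 4 first.
- by move=> s sD; apply: lsum_ge0 => j; exact: n3.
- exact: (ls _ n3 m3).
- by move=> s sD; apply: lsum_ge0 => j; exact: n4.
- exact: (ls _ n4 m4).
apply: eq_integral => s; rewrite inE => sD; have us := in_uct sD.
have avg0 (h : site -> R) j : (forall i, 0 <= h i)%R -> (0 <= avg h j)%R.
  by move=> h0; rewrite mulr_ge0 ?invr_ge0// sumr_ge0.
rewrite (lsum_avg (fun j => ag0 j s us) (X0 ^~ s)) (lsum_avg (fun _ : site => aq0 s us) (X0 ^~ s)).
rewrite -lsumD; [|by move=> j; exact: n1|by move=> j; rewrite mule_ge0// lee_fin avg0// => i; exact: ag0].
rewrite -lsumD; [|by move=> j; exact: n3|by move=> j; rewrite mule_ge0// lee_fin avg0// => i; exact: aq0].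
apply: eq_lsum => j.
rewrite -ge0_muleDl ?lee_fin ?g'0 ?avg0//; last by move=> i; exact: ag0.
rewrite -ge0_muleDl ?lee_fin ?(aM0 us) ?avg0//; last by move=> i; exact: aq0.
rewrite -!EFinD; congr (_%:E * _).
rewrite /g' /g; move: (q s) => qs; rewrite /avg -!mulr_sumr big_split/=; ring.
Qed.

Let fin_X j s : (s <= t)%R -> X j s w < +oo.
Proof.
move=> st; apply: le_lt_trans (wcount_mono j gw st) _.
by apply: le_lt_trans (wcount_le j gw t0) _; exact: ltry.
Qed.

Lemma leb_jump_fin (h : R -> R) C j : continuous h -> (forall s, (u <= s <= t)%R -> (0 <= h s <= C)%R) ->
  \int[leb2]_(x in oquad) (jweight h u t j (w, x))%:E < +oo.
Proof.
move=> ch hC; have h0 s : (u <= s <= t)%R -> (0 <= h s)%R by move=> /hC/andP[].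
have C0 : (0 <= C)%R by have /andP[] := hC t (introT andP (conj ut (lexx t))); exact: le_trans.
have T0 : 0 <= total t w by exact: total_ge0.
rewrite leb_jweight//.
apply: (@le_lt_trans _ _ (\int[leb]_(s in `]u, t[) (cst ((a * C)%:E * total t w) s))).
  apply: ge0_le_integral; [exact: measurable_itv|..].
  - by move=> s /in_uct us; rewrite mule_ge0// lee_fin mulr_ge0 ?h0// ltW.
  - apply: emeasurable_funM; last exact: mnm.
    by apply: measurable_continuous => s; apply: cvgM; [exact: cvg_cst|exact: ch].
  - exact: measurable_cst.
  - move=> s /in_uct us; apply: lee_pmul => //.
    + by rewrite lee_fin mulr_ge0 ?h0// ltW.
    + by rewrite lee_fin ler_pM2l//; case/andP: (hC s us).
    + apply: le_trans (nbr_mean_le_total w j t).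
      by apply: (nbr_mean_mono j gw); case/andP: us.
rewrite integral_cst => //.
apply: lte_mul_pinfty; first by rewrite mule_ge0// lee_fin mulr_ge0// ltW.
  rewrite ge0_fin_numE; last by rewrite mule_ge0// lee_fin mulr_ge0// ltW.
  by apply: lte_mul_pinfty; [rewrite lee_fin mulr_ge0// ltW| |exact: total_fin].
by rewrite [X in X < _](lebesgue_measure_itv `]u, t[)/= lte_fin; case: ifP => _; rewrite ?ltry.
Qed.

Let A j h := \int[points N j w]_(x in oquad) (jweight h u t j (w, x))%:E.
Let L j h := \int[leb2]_(x in oquad) (jweight h u t j (w, x))%:E.

(** Integration by parts for [f + q] minus the one for [q]. By [drift_balance] the time integrals
    turn into compensators, and a compensated jump integral is left. Finite sums are exact because
    only finitely many sites are active before [t]. *)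
Theorem evolution_sum : (forall j, points N j w (`[u, u] `*` `[0%R, +oo[) = 0) ->
  [/\ forall j, A j (g j) < +oo, forall j, A j q < +oo, forall j, L j (g j) < +oo, forall j, L j q < +oo &
  exists n0, forall n, (n0 <= n)%N ->
   (\sum_(j <- initial n) (f j t * fine (X j t w) - f j u * fine (X j u w)) =
    \sum_(j <- initial n) ((fine (A j (g j)) - fine (A j q)) - (fine (L j (g j)) - fine (L j q))))%R].
Proof.
move=> nl.
have cg j : continuous (g j) by move=> s; exact: (derive_continuous (dg j s)).
have cq : continuous q by move=> s; exact: (derive_continuous (dq s)).
have caM : continuous (fun _ : R => a * M)%R by move=> s; exact: cvg_cst.
have utt : (u <= t <= t)%R by rewrite ut lexx.
have uut : (u <= u <= t)%R by rewrite ut lexx.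
pose B j := \int[leb]_(s in `]u, t[) ((g' j s)%:E * X j s w).
pose B' j := \int[leb]_(s in `]u, t[) ((a * M)%:E * X j s w).
have A0 j h : (forall s, (u <= s <= t)%R -> (0 <= h s)%R) -> 0 <= A j h.
  by move=> h0; apply: integral_ge0 => x _; rewrite lee_fin; exact: jweight_ge0.
have L0 j h : (forall s, (u <= s <= t)%R -> (0 <= h s)%R) -> 0 <= L j h.
  by move=> h0; apply: integral_ge0 => x _; rewrite lee_fin; exact: jweight_ge0.
have B0 j : 0 <= B j by apply: integral_ge0 => s /in_uct us; rewrite mule_ge0// lee_fin g'0.
have B'0 j : 0 <= B' j by apply: integral_ge0 => s /in_uct us; rewrite mule_ge0// lee_fin (aM0 us).
have E1 j : (g j t)%:E * X j t w = (g j u)%:E * X j u w + A j (g j) + B j.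
  rewrite (wcount_parts j gw u0 ut (dg j) (@cg' j) (g0 j) (g'0 j)).
  by rewrite (path_jweight gw u0 (nl j) (cg j) (g0 j)).
have E2 j : (q t)%:E * X j t w = (q u)%:E * X j u w + A j q + B' j.
  rewrite (wcount_parts j gw u0 ut dq caM q0 aM0).
  by rewrite (path_jweight gw u0 (nl j) cq q0).
have F1 j := fine_balance (fin_X j (lexx t)) (X0 j t) (X0 j u) (g0 j uut) (A0 j _ (g0 j)) (B0 j) (fin_X j ut) (E1 j).
have F2 j := fine_balance (fin_X j (lexx t)) (X0 j t) (X0 j u) (q0 uut) (A0 j _ q0) (B'0 j) (fin_X j ut) (E2 j).
have qt s : (u <= s <= t)%R -> (q s <= q t)%R.
  by move=> /andP[_ st]; rewrite /q ler_wpM2l// lerD2l ler_pM2l// lerD2r.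
have L1 j : L j (g j) < +oo.
  apply: (leb_jump_fin (C := (M + q t)%R) _ (cg j)) => s us; rewrite g0//= lerD ?qt//.
  by have := fM j us; rewrite ler_norml => /andP[].
have L2 j : L j q < +oo by apply: (leb_jump_fin (C := q t) _ cq) => s us; rewrite q0//= qt.
split => //; [by move=> j; have [] := F1 j|by move=> j; have [] := F2 j|].
have [n0 hn0] := good_path_support gw t0; exists n0 => n nn.
have z j s : j \notin initial n -> (s <= t)%R -> X j s w = 0 /\ nm j s w = 0.
  by move=> jn; apply: hn0; apply: contra jn; exact: sub_initial_le.
have ls h : (forall j, 0 <= h j) -> (forall j, j \notin initial n -> h j = 0) -> lsum h = \sum_(j <- initial n) h j.
  by move=> h0; apply: lsum_finite => //; exact: initial_uniq.
have zi (h : R -> R) (Y : site -> R -> W -> \bar R) j : (forall s, (s <= t)%R -> Y j s w = 0) ->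
    \int[leb]_(s in `]u, t[) ((h s)%:E * Y j s w) = 0.
  by move=> Y0; apply: integral0_eq => s /in_uct/andP[_ st]; rewrite Y0// mule0.
have bal := drift_balance.
have LE1 j : \int[leb]_(s in `]u, t[) ((a * g j s)%:E * nm j s w) = L j (g j) by rewrite /L (leb_jweight j w u0 (cg j) (g0 j)).
have LE2 j : \int[leb]_(s in `]u, t[) ((a * q s)%:E * nm j s w) = L j q by rewrite /L (leb_jweight j w u0 cq q0).
have {}bal : lsum B + lsum (fun j => L j (g j)) = lsum B' + lsum (fun j => L j q).
  rewrite -(eq_lsum LE1) -(eq_lsum LE2); exact: bal.
have {}bal : \sum_(j <- initial n) B j + \sum_(j <- initial n) L j (g j) =
    \sum_(j <- initial n) B' j + \sum_(j <- initial n) L j q.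
  rewrite -!ls//.
  - by move=> j; exact: L0.
  - by move=> j jn; rewrite -LE2; apply: zi => s st; have [] := z j s jn st.
  - by move=> j jn; apply: (zi (fun=> a * M)%R) => s st; have [] := z j s jn st.
  - by move=> j; apply: L0; exact: g0.
  - by move=> j jn; rewrite -LE1; apply: zi => s st; have [] := z j s jn st.
  - by move=> j jn; apply: zi => s st; have [] := z j s jn st.
have := fine_sum_balance (fun j => let: And3 _ h _ := F1 j in h) L1 (fun j => let: And3 _ h _ := F2 j in h) L2
   B0 (fun j => L0 j _ (g0 j)) B'0 (fun j => L0 j _ q0) bal.
have E j : (f j t * fine (X j t w) - f j u * fine (X j u w) =
   (fine (A j (g j)) - fine (A j q)) + (fine (B j) - fine (B' j)))%R.
  have [_ _] := F1 j; have [_ _] := F2 j; rewrite {1 2}/g; lra.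
move=> h; under eq_bigr do rewrite E.
by move: h; rewrite big_split/= !sumrB; lra.
Qed.

End path.

(** Points under the intensity before time [t] have marks of at most [a * total t w], so a box of
    that size contains all of those that count. *)
Lemma boxed_jweight (m : {measure set (plane R) -> \bar R}) (w : W) j (h : R -> R) (K : R) :
  good_path w -> continuous h -> (forall s, (u <= s <= t)%R -> (0 <= h s)%R) ->
  (t <= K)%R -> (a * fine (total t w) <= K)%R ->
  \int[mrestr m (measurable_box K)]_x (jweight h u t j (w, x))%:E =
  \int[m]_(x in oquad) (jweight h u t j (w, x))%:E.
Proof.
move=> gw ch h0 tK totK.
have mj : mfunT (fun x => jweight h u t j (w, x)).
  exact: (measurableT_comp (measurable_jweight t j u0 ch) (measurable_pair1 w)).
rewrite integral_mrestr; [|by move=> x; rewrite lee_fin; exact: jweight_ge0|exact/measurable_EFinP].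
rewrite [LHS]integral_mkcond [RHS]integral_mkcond; apply: eq_integral => x _; rewrite !patchE.
case: (boolP (x \in oquad)) => [|/negP Qx]; last first.
  case: ifPn => // xK; exfalso; apply: Qx; move: xK; rewrite !inE /box /rect /oquad/=.
  by rewrite !in_itv/= !andbT => -[/andP[-> _] /andP[-> _]].
rewrite inE => Qx; case: ifPn => // /negP xK.
rewrite /jweight/= /below indicE; case: (boolP ((w, x) \in below_set j)) => [|_]; last by rewrite mulr0.
rewrite inE => -[_ /=]; rewrite /window/=; case: (boolP (_ && _)) => [/andP[us st]|_]; last by rewrite mulr0 mul0r.
move=> xr; exfalso; apply: xK; rewrite inE /box /rect/=.
move: (Qx) us st xr; rewrite ptimeE//; case: x {Qx} => s z [/=]; rewrite !in_itv/= !andbT => s0 z0 us st zr.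
rewrite s0 z0 (le_trans (ltW st) tK)/=; split => //; rewrite -lee_fin; apply: (le_trans zr).
apply: (le_trans (rate_le_total j gw (ltW s0) (ltW st))).
by rewrite -(@fineK _ (total t w)) ?lee_fin// ge0_fin_numE ?total_ge0// total_fin// (le_trans u0).
Qed.

Section square.
Variables (phi : W -> R) (B : R).
Hypothesis phiB : forall w, (0 <= phi w <= B)%R.
Hypothesis mphi : mfunT (phi : sigmaT (F u) -> R).

Let weight j (z : W * plane R) : R := (phi z.1 * jweight (f j) u t j z)%R.

Let weight_bound j z : (`|weight j z| <= B * (M * expR (b * t)))%R.
Proof.
have /andP[p0 pB] := phiB z.1.
rewrite /weight normrM ger0_norm// ler_pM//.
rewrite /jweight /window.
have Me : (0 <= M * expR (b * t))%R by rewrite mulr_ge0// expR_ge0.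
case: (boolP (_ && _)) => [/andP[h1 h2]|_]; last by rewrite mulr0 mul0r normr0.
rewrite mulr1 !normrM /below indicE normr_nat.
case: (_ \in _); last by rewrite mulr0.
rewrite mulr1 ler_pM// ?fM ?(ltW h1) ?(ltW h2)//.
by rewrite ger0_norm ?expR_ge0// ler_expR ler_pM2l// ltW.
Qed.

Let mphiT : mfunT phi.
Proof. exact: (sub_sigma_mfun (filtration_measurable hF u0)). Qed.

Let predictable_weight j : mfunT (weight j : sigmaT (pred_gen F) -> R).
Proof.
have -> : weight j = (fun z => f j (ptime z.2) * expR (b * ptime z.2) * (phi z.1 * window u t z) * below j z)%R.
  by apply/funext => z; rewrite /weight /jweight; ring.
apply: measurable_funM; last first.
  by apply: measurable_indic; exact: below_set_predictable.
apply: measurable_funM; last first.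
  by apply: predictable_window => // w; case/andP: (phiB w).
apply: measurable_funM; last exact: predictable_exp.
by apply: measurableT_comp; [exact: continuous_measurable_fun|exact: (predictable_ptime hF)].
Qed.

Let S n w : R := (\sum_(j <- initial n) comp_int N n%:R j (weight j) w)%R.

Let cg j : continuous (g j). Proof. by move=> s; exact: (derive_continuous (dg j s)). Qed.
Let cq : continuous q. Proof. by move=> s; exact: (derive_continuous (dq s)). Qed.

Let S_eventually w : good_path w -> (forall j, points N j w (`[u, u] `*` `[0%R, +oo[) = 0) ->
  exists n0, forall n, (n0 <= n)%N ->
    (S n w = phi w * \sum_(j <- initial n) (f j t * fine (X j t w) - f j u * fine (X j u w)))%R.
Proof.
move=> gw nl; have [A1 A2 L1 L2 [n0 hn0]] := evolution_sum gw nl.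
exists (maxn n0 (maxn (Num.bound t) (Num.bound (a * fine (total t w))))) => n.
rewrite !geq_max => /and3P[nn0 nt ntot].
have t0 : (0 <= t)%R by exact: le_trans ut.
have tn : (t <= n%:R)%R by rewrite (le_trans (ltW (archi_boundP t0)))// ler_nat.
have Tn : (a * fine (total t w) <= n%:R)%R.
  have h : (0 <= a * fine (total t w))%R by rewrite mulr_ge0 ?(ltW a0)// fine_ge0// total_ge0.
  by rewrite (le_trans (ltW (archi_boundP h)))// ler_nat.
rewrite hn0// mulr_sumr; apply: eq_bigr => j _.
have mw (h : R -> R) : continuous h -> mfunT (fun x => jweight h u t j (w, x)).
  by move=> ch; exact: (measurableT_comp (measurable_jweight t j u0 ch) (measurable_pair1 w)).
have E x : weight j (w, x) = (phi w * (jweight (g j) u t j (w, x) - jweight q u t j (w, x)))%R.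
  by rewrite /weight /jweight /g/=; ring.
have bp := boxed_jweight (points N j w) j gw (@cg j) (g0 j) tn Tn.
have bq := boxed_jweight (points N j w) j gw cq q0 tn Tn.
have lp := boxed_jweight leb2 j gw (@cg j) (g0 j) tn Tn.
have lq := boxed_jweight leb2 j gw cq q0 tn Tn.
rewrite /comp_int /boxed_int /boxed_mean /box_points /boxed_leb mulrBr.
have Em (m : {measure set (plane R) -> \bar R}) := eq_Rintegral m (fun x (_ : x \in setT) => E x).
rewrite !Em; clear Em E.
have jg x : (0 <= jweight (g j) u t j (w, x))%R by apply: jweight_ge0; exact: g0.
have jq x : (0 <= jweight q u t j (w, x))%R by apply: jweight_ge0; exact: q0.
congr (_ - _)%R.
  exact: (Rintegral_scaled_diff (phi w) (mw _ (@cg j)) (mw _ cq) jg jq bp bq (A1 j) (A2 j)).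
exact: (Rintegral_scaled_diff (phi w) (mw _ (@cg j)) (mw _ cq) jg jq lp lq (L1 j) (L2 j)).
Qed.

(** On the box of size [n] the isometry applies. On almost every path the compensated sums over
    boxes are eventually equal to the quantity squared in [D], so Fatou's lemma passes to the
    limit. *)
Theorem second_moment (D : W -> \bar R) : mfunT D -> (forall w, 0 <= D w) ->
  {ae P, forall w, exists n0, forall n, (n0 <= n)%N -> D w =
    ((phi w * \sum_(j <- initial n) (f j t * fine (X j t w) - f j u * fine (X j u w))) ^+ 2)%:E} ->
  \int[P]_w D w <= lsum (fun j => \int[P]_w (((phi w) ^+ 2)%:E *
     \int[leb]_(s in `]u, t[) ((a * (f j s ^+ 2 * expR (b * s)))%:E * nm j s w))).
Proof.
move=> mD D0 hD.
apply: (@integral_limit_le _ _ _ P D (fun n w => (S n w ^+ 2)%:E)) => //.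
- move=> n; apply/measurable_EFinP; apply: measurable_funX; apply: measurable_sum => j.
  by have [] := comp_int_square_bounded hF hN (ler0n R n) j (weight_bound j) (predictable_weight j).
- by move=> n w; rewrite lee_fin sqr_ge0.
- have hl : {ae P, forall w, forall j, points N j w (`[u, u] `*` `[0%R, +oo[) = 0}.
    by apply: forall_site_ae => j; exact: (line_null j u0).
  apply: filterS3 hD hl (good_path_ae) => w [n1 h1] nl gw.
  have [n2 h2] := S_eventually gw nl.
  apply: cvg_near_cst; exists (maxn n1 n2) => // n /=; rewrite geq_max => /andP[hn1 hn2].
  by rewrite (h1 n hn1) (h2 n hn2).
apply: nearW => n; rewrite (comp_int_isometry hF hN (ler0n R n) (initial_uniq n) weight_bound predictable_weight).
have fe0 j s : (0 <= a * (f j s ^+ 2 * expR (b * s)))%R.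
  by rewrite mulr_ge0 ?(ltW a0)// mulr_ge0 ?sqr_ge0 ?expR_ge0.
have I0 j w : 0 <= (phi w ^+ 2)%:E * \int[leb]_(s in `]u, t[) ((a * (f j s ^+ 2 * expR (b * s)))%:E * nm j s w).
  rewrite mule_ge0 ?lee_fin ?sqr_ge0//; apply: integral_ge0 => s _.
  by apply: mule_ge0; [rewrite lee_fin|exact: nbr_mean_ge0].
apply: (@le_trans _ _ (\sum_(j <- initial n) \int[P]_w (((phi w) ^+ 2)%:E *
     \int[leb]_(s in `]u, t[) ((a * (f j s ^+ 2 * expR (b * s)))%:E * nm j s w)))); last first.
  apply: seq_sum_le_lsum; [|exact: initial_uniq].
  by move=> j; exact: integral_ge0.
apply: lee_sum => j _.
(* Indicators are idempotent, so the square of a jump integrand is again one, with [f] replaced by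
   [h]; the factor [expR (b * s)] in [h] is the second copy of the jump size. *)
pose h (s : R) : R := (f j s ^+ 2 * expR (b * s))%R.
have ch : continuous h.
  move=> s; apply: cvgM; first by apply: cvgM; exact: cf.
  apply: (@cvg_comp _ _ _ (fun s : R => b * s)%R expR); last exact: continuous_expR.
  by apply: cvgM; [exact: cvg_cst|exact: cvg_id].
have h0 s : (u <= s <= t)%R -> (0 <= h s)%R by rewrite /h mulr_ge0 ?sqr_ge0 ?expR_ge0.
have E w x : ((weight j (w, x)) ^+ 2)%:E = ((phi w) ^+ 2)%:E * (jweight h u t j (w, x))%:E.
  rewrite -EFinM; congr EFin; rewrite /weight /jweight /h /window /below indicE/=.
  by case: (_ && _); case: (_ \in _); rewrite /=; ring.
have mw w : mfunT (fun x => (jweight h u t j (w, x))%:E).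
  apply/measurable_EFinP.
  exact: (measurableT_comp (measurable_jweight t j u0 ch) (measurable_pair1 w)).
have j0 w x : 0 <= (jweight h u t j (w, x))%:E by rewrite lee_fin; exact: jweight_ge0.
apply: ge0_le_integral => //.
- by move=> w _; apply: integral_ge0 => x _; rewrite lee_fin sqr_ge0.
- apply: (@measurable_boxed_leb_integral _ _ _ _ (fun z => ((weight j z) ^+ 2)%:E)).
    by move=> z; rewrite lee_fin sqr_ge0.
  apply/measurable_EFinP; apply: measurable_funX.
  exact: (sub_sigma_mfun (pred_gen_measurable hF) (predictable_weight j)).
- apply: emeasurable_funM; first by apply/measurable_EFinP; exact: measurable_funX.
  apply: (@measurable_time_integral (fun s w => (a * (f j s ^+ 2 * expR (b * s)))%:E * nm j s w)).
  + apply: emeasurable_funM.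
      apply/measurable_EFinP; apply: measurable_funM => //.
      apply: measurable_funM; last exact: predictable_exp.
      apply: measurable_funX.
      by apply: measurableT_comp; [exact: continuous_measurable_fun|exact: (predictable_ptime hF)].
    apply: emeasurable_funM => //.
    by apply: emeasurable_sum => v; exact: wcount_predictable.
  + by move=> s w; apply: mule_ge0; [rewrite lee_fin|exact: nbr_mean_ge0].
  + exact: measurable_itv.
  + exact: itv_oo_sub.
move=> w _.
rewrite -(leb_jweight j w u0 ch h0).
have p0 : 0 <= (phi w ^+ 2)%:E by rewrite lee_fin sqr_ge0.
have -> : \int[boxed_leb n%:R]_x ((weight j (w, x)) ^+ 2)%:E =
    (phi w ^+ 2)%:E * \int[boxed_leb n%:R]_x (jweight h u t j (w, x))%:E.
  rewrite -(@ge0_integralZl _ _ _ (boxed_leb n%:R) _ measurableT _ (mw w) _ (fun x _ => j0 w x) p0).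
  by apply: eq_integral => x _; exact: E.
have I2 : 0 <= \int[boxed_leb n%:R]_x (jweight h u t j (w, x))%:E by apply: integral_ge0 => x _; exact: j0.
have I3 : \int[boxed_leb n%:R]_x (jweight h u t j (w, x))%:E =
  \int[leb2]_(x in box n%:R) (jweight h u t j (w, x))%:E := @integral_mrestr _ _ _ leb2 _ (measurable_box n%:R) _ (j0 w) (mw w).
have I4 : \int[leb2]_(x in box n%:R) (jweight h u t j (w, x))%:E <=
    \int[leb2]_(x in oquad) (jweight h u t j (w, x))%:E.
  apply: ge0_subset_integral.
  - exact: measurable_box.
  - by apply: measurableX; exact: measurable_itv.
  - exact: measurable_funTS.
  - by move=> x _; exact: j0.
  - by rewrite -bigcup_box => x xn; exists n.
apply: lee_pmul; [exact: p0|exact: I2|exact: lexx|rewrite I3; exact: I4].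
Qed.

End square.

End backward_equation.

End evolution.

(** * Second moments of the total mass and of the weight at a site *)

Section moments.
Local Notation e u := (expR (b * u))%:E.
Local Notation predictable f := (mfunT (f : sigmaT (pred_gen F) -> \bar R)).

Section time_integrals.
Variables (f : R -> W -> \bar R) (D : set R).
Hypotheses (mf : mfunT (fun z : W * plane R => f (ptime z.2) z.1)) (f0 : forall s w, 0 <= f s w).
Hypotheses (mD : measurable (D : set (borel R))) (D0 : D `<=` `[0%R, +oo[).

Let k (x : W * borel R) : \bar R := f (ptime (x.2, 0%R : R)) x.1 * (\1_D x.2)%:E.

Let mk : mfunT k.
Proof.
have h : mfunT (fun x : W * borel R => (x.1, (x.2, 0%R)) : W * plane R).
  apply: measurable_fun_pair; first exact: measurable_fst.
  by apply: measurable_fun_pair => //; exact: measurable_snd.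
apply: emeasurable_funM; first exact: (measurableT_comp mf h).
apply/measurable_EFinP; apply: measurableT_comp; last exact: measurable_snd.
exact: measurable_indic.
Qed.

Let k0 x : 0 <= k x. Proof. by rewrite mule_ge0 ?lee_fin. Qed.

Let kE w s : k (w, s) = ((fun s => f s w) \_ D) s.
Proof.
rewrite /k/= patchE indicE; case: ifPn => [sD|_]; last by rewrite mule0.
by rewrite mule1 ptime_line//; move: sD; rewrite inE => /D0/=; rewrite in_itv/= andbT.
Qed.

Let kG s : \int[P]_w k (w, s) = ((fun s => \int[P]_w f s w) \_ D) s.
Proof.
rewrite patchE; case: ifPn => sD.
  by apply: eq_integral => w _; rewrite kE patchE sD.
by rewrite integral0_eq// => w _; rewrite kE patchE (negbTE sD).
Qed.

Lemma expectation_time_integral :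
  \int[P]_w \int[leb]_(s in D) f s w = \int[leb]_(s in D) \int[P]_w f s w.
Proof.
transitivity (\int[P]_w \int[leb]_s k (w, s)).
  by apply: eq_integral => w _; rewrite integral_mkcond; apply: eq_integral => s _; rewrite kE.
rewrite (@fubini_tonelli _ _ _ _ _ P leb k mk k0) [RHS]integral_mkcond; apply: eq_integral => s _.
exact: kG.
Qed.

Lemma measurable_expectation : measurable_fun D (fun s : borel R => \int[P]_w f s w).
Proof.
apply/(measurable_restrictT _ mD).
have -> : (fun s : borel R => \int[P]_w f s w) \_ D = fubini_G P k.
  by apply/funext => s; rewrite /fubini_G kG.
exact: measurable_fun_fubini_tonelli_G.
Qed.

Lemma measurable_path_integral : mfunT (fun w => \int[leb]_(s in D) f s w).
Proof.
have -> : (fun w => \int[leb]_(s in D) f s w) = fubini_F leb k.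
  apply/funext => w; by rewrite /fubini_F [LHS]integral_mkcond; apply: eq_integral => s _; rewrite kE.
exact: measurable_fun_fubini_tonelli_F.
Qed.

End time_integrals.

Lemma nbr_mean_predictable j : predictable (fun z => nm j (ptime z.2) z.1).
Proof.
apply: emeasurable_funM => //.
by apply: emeasurable_sum => v; exact: wcount_predictable.
Qed.

(** Expectation, time integral and sum over sites are exchanged in [second_moment], which leaves an
    inequality to be checked at each fixed time. *)
Theorem second_moment_bound (f : site -> R -> R) (u t M : R) (phi : W -> R) (B : R) (D : W -> \bar R) (G : R -> R) :
  (0 <= u)%R -> (u <= t)%R -> (0 <= M)%R ->
  (forall j (s : R), is_derive s 1%R (f j) (- (a * avg (f ^~ s) j))%R) ->
  (forall j s, (u <= s <= t)%R -> (`|f j s| <= M)%R) ->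
  (forall w, 0 <= phi w <= B)%R ->
  mfunT (phi : sigmaT (F u) -> R) ->
  mfunT D -> (forall w, 0 <= D w) ->
  {ae P, forall w, exists n0, forall n, (n0 <= n)%N -> D w =
    ((phi w * \sum_(j <- initial n) (f j t * fine (X j t w) - f j u * fine (X j u w))) ^+ 2)%:E} ->
  continuous G ->
  (forall s, (u <= s <= t)%R ->
    lsum (fun j => (f j s ^+ 2)%:E * \int[P]_w (((phi w) ^+ 2)%:E * nm j s w)) <= (G s)%:E) ->
  \int[P]_w D w <= \int[leb]_(s in `]u, t[) (a * expR (b * s) * G s)%:E.
Proof.
move=> u0 ut M0 df fM phiB mphi mD D0 hD cG hG.
apply: le_trans (second_moment u0 ut M0 df fM phiB mphi mD D0 hD) _.
have mphiT : mfunT phi by exact: (sub_sigma_mfun (filtration_measurable hF u0)).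
have p20 w : 0 <= ((phi w) ^+ 2)%:E by rewrite lee_fin sqr_ge0.
have mp2 : mfunT (fun w => ((phi w) ^+ 2)%:E).
  by meas.
have mD' : measurable (`]u, t[%classic : set (borel R)) by exact: measurable_itv.
have Dsub : `]u, t[%classic `<=` `[0%R, +oo[%classic by exact: itv_oo_sub.
have inuct s : `]u, t[%classic s -> (u <= s <= t)%R by rewrite /= in_itv/= => /andP[/ltW -> /ltW ->].
pose c j (s : R) : R := (a * (f j s ^+ 2 * expR (b * s)))%R.
have c0 j s : 0 <= (c j s)%:E by rewrite lee_fin mulr_ge0 ?(ltW a0)// mulr_ge0 ?sqr_ge0 ?expR_ge0.
have cf j : continuous (f j) by move=> s; exact: (derive_continuous (df j s)).
have cc j : continuous (c j).
  move=> s; apply: cvgM; first exact: cvg_cst.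
  apply: cvgM; first by apply: cvgM; exact: cf.
  apply: (@cvg_comp _ _ _ (fun s : R => b * s)%R expR); last exact: continuous_expR.
  by apply: cvgM; [exact: cvg_cst|exact: cvg_id].
have E0 j s : 0 <= \int[P]_w (((phi w) ^+ 2)%:E * nm j s w).
  by apply: integral_ge0 => w _; rewrite mule_ge0 ?nbr_mean_ge0.
have mcn j : mfunT (fun z : W * plane R => ((phi z.1) ^+ 2)%:E * ((c j (ptime z.2))%:E * nm j (ptime z.2) z.1)).
  apply: emeasurable_funM; first exact: measurableT_comp mp2 measurable_fst.
  apply: (predictable_measurable hF); apply: emeasurable_funM; last exact: nbr_mean_predictable.
  apply/measurable_EFinP; apply: measurableT_comp; last exact: (predictable_ptime hF).
  exact: continuous_measurable_fun (cc j).
have cn0 j s w : 0 <= (c j s)%:E * nm j s w by rewrite mule_ge0 ?nbr_mean_ge0.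
have pcn0 j s w : 0 <= ((phi w) ^+ 2)%:E * ((c j s)%:E * nm j s w) by rewrite mule_ge0.
have mcns j w : measurable_fun `]u, t[ (fun s : borel R => (c j s)%:E * nm j s w).
  apply: emeasurable_funM; first exact: measurable_continuous (cc j).
  exact: (section_measurable_nonneg w (nbr_mean_predictable j)).
have mnmP j s : `]u, t[%classic s -> mfunT (fun w => ((phi w) ^+ 2)%:E * nm j s w).
  by move=> /Dsub/=; rewrite in_itv/= andbT => s0; apply: emeasurable_funM => //; exact: measurable_nbr_mean.
have EZ j s : `]u, t[%classic s -> \int[P]_w (((phi w) ^+ 2)%:E * ((c j s)%:E * nm j s w)) =
    (c j s)%:E * \int[P]_w (((phi w) ^+ 2)%:E * nm j s w).
  move=> sD; rewrite -ge0_integralZl//; [|exact: mnmP|by move=> w _; rewrite mule_ge0 ?nbr_mean_ge0].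
  by apply: eq_integral => w _; rewrite muleCA.
have swap j : \int[P]_w (((phi w) ^+ 2)%:E * \int[leb]_(s in `]u, t[) ((c j s)%:E * nm j s w)) =
   \int[leb]_(s in `]u, t[) ((c j s)%:E * \int[P]_w (((phi w) ^+ 2)%:E * nm j s w)).
  transitivity (\int[P]_w \int[leb]_(s in `]u, t[) (((phi w) ^+ 2)%:E * ((c j s)%:E * nm j s w))).
    by apply: eq_integral => w _; rewrite -(@ge0_integralZl _ _ _ leb _ mD' _ (mcns j w) _ (fun s _ => cn0 j s w) (p20 w)).
  rewrite (expectation_time_integral (mcn j) (pcn0 j) mD' Dsub).
  by apply: eq_integral => s; rewrite inE => sD; exact: EZ.
rewrite (eq_lsum swap).
have mE j : measurable_fun `]u, t[ (fun s : borel R => (c j s)%:E * \int[P]_w (((phi w) ^+ 2)%:E * nm j s w)).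
  apply: eq_measurable_fun (measurable_expectation (mcn j) (pcn0 j) mD' Dsub) => s; rewrite inE => sD.
  exact: EZ.
have cE0 j s : `]u, t[%classic s -> 0 <= (c j s)%:E * \int[P]_w (((phi w) ^+ 2)%:E * nm j s w).
  by move=> _; rewrite mule_ge0.
rewrite -(integral_lsum_dom leb mD' cE0 mE).
have cGc : continuous (fun s => a * expR (b * s) * G s)%R.
  move=> s; apply: cvgM; last exact: cG.
  apply: cvgM; first exact: cvg_cst.
  apply: (@cvg_comp _ _ _ (fun s : R => b * s)%R expR); last exact: continuous_expR.
  by apply: cvgM; [exact: cvg_cst|exact: cvg_id].
apply: ge0_le_integral.
- exact: mD'.
- by move=> s sD; apply: lsum_ge0 => j; exact: cE0.
- apply: (@emeasurable_fun_cvg _ _ _ _ (fun n s => \sum_(j <- initial n) ((c j s)%:E * \int[P]_w (((phi w) ^+ 2)%:E * nm j s w)))).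
    by move=> n; exact: emeasurable_sum.
  by move=> s sD; apply: is_cvg_initial_sum => j; exact: cE0.
- exact: measurable_continuous cGc.
move=> s sD; rewrite EFinM; apply: le_trans (lee_wpmul2l _ (hG s (inuct s sD))); last first.
  by rewrite lee_fin mulr_ge0 ?expR_ge0// ltW.
rewrite -lsumZ.
- apply: le_lsum => j; first exact: cE0.
  by rewrite muleA -EFinM /c; rewrite le_eqVlt; apply/orP; left; apply/eqP; congr (_%:E * _); ring.
- by rewrite mulr_ge0 ?expR_ge0// ltW.
- by move=> j; rewrite mule_ge0// lee_fin sqr_ge0.
Qed.

(** Symmetry of the average with the constant weight 1. *)
Lemma mean_total_neighbour (phi : W -> R) s : (0 <= s)%R -> (forall w, 0 <= phi w)%R -> mfunT phi ->
  lsum (fun j => \int[P]_w ((phi w)%:E * nm j s w)) = \int[P]_w ((phi w)%:E * total s w).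
Proof.
move=> s0 phi0 mphi; rewrite (integral_total s0 phi0 mphi).
have x0 j : 0 <= \int[P]_w ((phi w)%:E * X j s w).
  by apply: integral_ge0 => w _; rewrite mule_ge0 ?lee_fin ?wcount_ge0.
have := lsum_avg (fun _ : site => @ler01 R) x0.
under [X in _ = X -> _]eq_lsum do rewrite avg_cst mul1e.
move=> <-; apply: eq_lsum => j; rewrite mul1e; exact: mean_neighbour.
Qed.

Definition mart (t : R) (w : W) : R := (expR (- (a * t)) * fine (total t w))%R.

Lemma measurable_mart t : (0 <= t)%R -> mfunT (mart t).
Proof.
move=> t0; apply: measurable_funM => //.
by meas.
Qed.

Lemma mart_ge0 t w : (0 <= mart t w)%R.
Proof. by rewrite mulr_ge0 ?expR_ge0// fine_ge0// total_ge0. Qed.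

Lemma fine_total_sum w t : good_path w -> (0 <= t)%R -> exists n0, forall n, (n0 <= n)%N ->
  fine (total t w) = (\sum_(j <- initial n) fine (X j t w))%R.
Proof.
move=> gw t0; have [n0 h] := good_path_support gw t0; exists n0 => n nn.
have X0 j : 0 <= X j t w by exact: wcount_ge0.
have Xf j : X j t w \is a fin_num.
  by rewrite ge0_fin_numE//; apply: le_lt_trans (wcount_le j gw t0) _; exact: ltry.
rewrite totalE (@lsum_finite _ _ _ (initial n)) ?initial_uniq//.
  by under eq_bigr do rewrite -(fineK (Xf _)); rewrite sumEFin.
move=> j jn; have jn0 : j \notin initial n0 by apply: contra jn; exact: sub_initial_le.
by have [] := h j t jn0 (lexx t).
Qed.

(** [expR (- (a * s))] is the backward solution constant in space. The bracket has rate
    [expR (- (2 * a * s)) * expR (b * s)] times the mass, the mass grows in mean like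
    [expR (a * s)], and the resulting [expR (- ((a - b) * s))] is integrable. *)
Lemma mart_square (phi : W -> R) B u t : (0 <= u)%R -> (u <= t)%R -> (forall w, 0 <= phi w <= B)%R ->
  mfunT (phi : sigmaT (F u) -> R) ->
  \int[P]_w ((phi w * (mart t w - mart u w)) ^+ 2)%:E <=
  (a / (a - b) * expR (- ((2 * a - b) * u)))%:E * \int[P]_w (((phi w) ^+ 2)%:E * total u w).
Proof.
move=> u0 ut phiB mphi; have t0 := le_trans u0 ut.
have mphiT : mfunT phi by exact: (sub_sigma_mfun (filtration_measurable hF u0)).
have p2B w : (0 <= phi w ^+ 2 <= B ^+ 2)%R.
  have /andP[p0 pB] := phiB w; rewrite sqr_ge0/= lerXn2r// nnegrE//; exact: le_trans pB.
have p20 w : (0 <= phi w ^+ 2)%R by rewrite sqr_ge0.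
have mp2 : mfunT (fun w => phi w ^+ 2)%R by meas.
pose T := \int[P]_w (((phi w) ^+ 2)%:E * total u w).
have T0 : 0 <= T by apply: integral_ge0 => w _; rewrite mule_ge0 ?total_ge0 ?lee_fin.
have Tfin : T < +oo.
  rewrite /T (integral_total u0 p20 mp2).
  have := weighted_mean_fin u0 (c := fun=> 1%R) (L := 1%R) _ p2B mp2.
  under eq_lsum do rewrite mul1e; apply=> j; by rewrite ler01 lexx.
pose f (j : site) (s : R) : R := expR (- (a * s)).
have df (j : site) (s : R) : is_derive s 1%R (f j) (- (a * avg (f ^~ s) j))%R.
  have h : is_derive s 1%R (fun s : R => - (a * s))%R (- a)%R.
    by apply: is_derive_eq; rewrite [X in (- X)%R]mulr1.
  have h2 := @is_derive1_comp _ expR (fun s : R => - (a * s))%R s _ _ (is_derive_expR _) h.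
  apply: is_derive_eq h2 _.
  by rewrite /f avg_cst mulrN mulrC.
have f1 (j : site) s : (u <= s <= t)%R -> (`|f j s| <= 1)%R.
  move=> /andP[us _]; rewrite ger0_norm ?expR_ge0// -expR0 ler_expR oppr_le0 mulr_ge0 ?(ltW a0)//.
  exact: le_trans us.
pose G (s : R) : R := (expR (- (2 * a * s)) * (expR (a * (s - u)) * fine T))%R.
have cexp (c c' : R) : continuous (fun s : R => expR (c * s + c'))%R.
  move=> s; apply: (@cvg_comp _ _ _ (fun s : R => c * s + c')%R expR); last exact: continuous_expR.
  by apply: cvgD; [apply: cvgM; [exact: cvg_cst|exact: cvg_id]|exact: cvg_cst].
have cG : continuous G.
  have -> : G = (fun s => expR (- (2 * a) * s + 0) * (expR (a * s + (- (a * u))) * fine T))%R.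
    by apply/funext => s; rewrite /G addr0 mulNr mulrBr.
  by move=> s; apply: cvgM; [exact: cexp|apply: cvgM; [exact: cexp|exact: cvg_cst]].
have bound s : (u <= s <= t)%R ->
    lsum (fun j => (f j s ^+ 2)%:E * \int[P]_w (((phi w) ^+ 2)%:E * nm j s w)) <= (G s)%:E.
  move=> /andP[us _]; have s0 := le_trans u0 us.
  rewrite /f lsumZ ?sqr_ge0//; last first.
    by move=> j; apply: integral_ge0 => w _; rewrite mule_ge0 ?lee_fin ?nbr_mean_ge0.
  rewrite (mean_total_neighbour s0 p20 mp2) /G (EFinM (expR (- (2 * a * s)))); apply: lee_pmul.
  - by rewrite lee_fin sqr_ge0.
  - by apply: integral_ge0 => w _; rewrite mule_ge0 ?total_ge0 ?lee_fin.
  - by rewrite lee_fin -expRM_natl le_eqVlt; apply/orP; left; apply/eqP; congr expR; ring.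
  rewrite EFinM (fineK _) ?ge0_fin_numE//.
  apply: (total_growth u0 us p2B).
  by meas.
have mD : mfunT (fun w => ((phi w * (mart t w - mart u w)) ^+ 2)%:E).
  apply/measurable_EFinP; apply: measurable_funX; apply: measurable_funM => //.
  by apply: measurable_funB; exact: measurable_mart.
have D0 w : 0 <= ((phi w * (mart t w - mart u w)) ^+ 2)%:E by rewrite lee_fin sqr_ge0.
have hD : {ae P, forall w, exists n0, forall n, (n0 <= n)%N -> ((phi w * (mart t w - mart u w)) ^+ 2)%:E =
    ((phi w * \sum_(j <- initial n) (f j t * fine (X j t w) - f j u * fine (X j u w))) ^+ 2)%:E}.
  apply: filterS (good_path_ae) => w gw.
  have [n1 h1] := fine_total_sum gw t0; have [n2 h2] := fine_total_sum gw u0.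
  exists (maxn n1 n2) => n; rewrite geq_max => /andP[hn1 hn2].
  by rewrite /mart (h1 n hn1) (h2 n hn2) sumrB !mulr_sumr.
apply: le_trans (second_moment_bound u0 ut ler01 df f1 phiB mphi mD D0 hD cG bound) _.
rewrite -/T -(@fineK _ T) ?ge0_fin_numE// -EFinM.
have E s : (a * expR (b * s) * G s = a * fine T * expR (- (a * u)) * expR (- ((a - b) * s)))%R.
  rewrite /G; have -> : (- ((a - b) * s) = b * s + (- (2 * a * s) + (a * (s - u) + a * u)))%R by ring.
  by rewrite !expRD; have := expR_gt0 (a * u); rewrite (expRN (a * u)) => eu; field; rewrite gt_eqF.
under eq_integral do rewrite E.
have c0 : (0 <= a * fine T * expR (- (a * u)))%R by rewrite !mulr_ge0 ?expR_ge0 ?fine_ge0 ?(ltW a0).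
have k0 : (0 < a - b)%R by rewrite subr_gt0.
apply: le_trans (expR_integral_le u t c0 k0) _; rewrite lee_fin.
have -> : (- ((2 * a - b) * u) = - (a * u) + - ((a - b) * u))%R by ring.
by rewrite expRD le_eqVlt; apply/orP; left; apply/eqP; field; rewrite gt_eqF.
Qed.

(** The spread bound on the weights passes to neighbour means by symmetry of the average, at the
    price of a factor [1 + eps]. *)
Lemma mean_spread_neighbour (eps s : R) : (0 <= eps)%R -> (0 <= s)%R ->
  lsum (fun j : site => (1 + eps * sqnorm j)%:E * \int[P]_w nm j s w) <= ((1 + eps) * expR (a * (1 + eps) * s))%:E.
Proof.
move=> e0 s0; have c0 (j : site) : (0 <= 1 + eps * sqnorm j :> R)%R.
  by rewrite addr_ge0// mulr_ge0// sqnorm_ge0.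
have x0 j : 0 <= \int[P]_w X j s w by apply: integral_ge0 => w _; exact: wcount_ge0.
have E j : \int[P]_w nm j s w = ((2 * d + 1)%:R^-1)%:E * \sum_(v <- steps) \int[P]_w X (j + v)%R s w.
  have := mean_neighbour (phi := fun=> 1%R) j s0 (fun=> ler01) (@measurable_cst _ _ _ _ _ _).
  under eq_integral do rewrite mul1e.
  by move=> ->; congr (_ * _); apply: eq_bigr => v _; under eq_integral do rewrite mul1e.
under eq_lsum do rewrite E.
rewrite (lsum_avg c0 x0).
apply: (@le_trans _ _ ((1 + eps)%:E * lsum (fun j => (1 + eps * sqnorm j)%:E * \int[P]_w X j s w))).
  rewrite -lsumZ ?addr_ge0//; last by move=> j; rewrite mule_ge0 ?lee_fin.
  apply: le_lsum => j; first by rewrite mule_ge0// lee_fin mulr_ge0 ?invr_ge0// sumr_ge0.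
  rewrite muleA -EFinM; apply: lee_pmul => //; rewrite lee_fin ?avg_weight_le//.
  by rewrite mulr_ge0 ?invr_ge0// sumr_ge0.
rewrite EFinM; apply: lee_wpmul2l; first by rewrite lee_fin addr_ge0.
have := mean_spread_le e0 s0; apply: le_trans.
rewrite (@integral_lsum _ _ _ _ _ (fun j w => (1 + eps * sqnorm j)%:E * X j s w)).
- apply: le_lsum => j; first by rewrite mule_ge0 ?lee_fin.
  rewrite ge0_integralZl ?lee_fin//; [exact: measurable_wcount|].
  by move=> w _; exact: wcount_ge0.
- by move=> j w; rewrite mule_ge0 ?lee_fin ?wcount_ge0.
- by move=> j; apply: emeasurable_funM => //; exact: measurable_wcount.
Qed.

(** The backward solution is [expR (a * (t - s))] times the walk kernel towards [i] minus the
    constant [p]: at time [t] it selects the weight at [i] minus [p] times the mass, at time 0 it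
    leaves the deterministic term. For [s <= t / 2] the kernels are compared, and the cost in [j] is
    averaged by [mean_spread_neighbour]; for later [s] the difference is only bounded by 2, the
    exponential margin being already below the required power of [t]. *)
Lemma spatial_square : exists C T0 : R, [/\ (0 < C)%R, (1 <= T0)%R &
  forall (i : site) (t : R), (T0 <= t)%R -> let p := heat_kernel (a * t) (to_real R i) in
  [/\ (0 <= p <= 1)%R, (`|walk_kernel a t i - p| <= C / Num.sqrt t ^+ d.+1)%R &
  \int[P]_w ((fine (X i t w) - p * fine (total t w) - expR (a * t) * (walk_kernel a t i - p)) ^+ 2)%:E <=
   (C * (expR (a * t) / Num.sqrt t ^+ d.+1) ^+ 2)%:E]].
Proof.
have [C1 [T1 [C10 T11 heat]]] := @walk_kernel_heat R d a a0.
pose dl := (a - b)%R; have dl0 : (0 < dl)%R by rewrite subr_gt0.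
(* [a * (1 + eps) = a + dl / 2]: the spread weight spends half of the margin [dl], the factor
   [(1 + s) ^+ 2] a quarter, and [expR (- (dl / 4 * s))] is left for the time integral. *)
have [eps epsE] : exists eps : R, eps = (dl / (2 * a))%R by eexists.
have eps0 : (0 < eps)%R by rewrite epsE divr_gt0// mulr_gt0.
have eps1 : (eps <= 1)%R by rewrite epsE ler_pdivrMr ?mulr_gt0// mul1r /dl; move: hb a0; lra.
have [K2 K20 hK2] := @square_le_expR R (dl / 4)%R (divr_gt0 dl0 (ltr0n _ 4)).
(* For [s > t / 2] the spare factor [expR (- (3 * dl / 4 * s))] is at most
   [expR (- (3 * dl / 8 * t))], hence at most [K3 / t ^+ d.+1]. *)
have k3 : (0 < 3 * dl / 8)%R by rewrite divr_gt0// mulr_gt0.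
have [K3 K30 hK3] := expRN_le_invX d k3.
pose KG := (C1 ^+ 2 * (eps^-1 * (1 + eps)) * K2 + 4 * K3)%R.
have KG1 : (0 <= C1 ^+ 2 * (eps^-1 * (1 + eps)) * K2)%R.
  by rewrite mulr_ge0 ?(ltW K20)// mulr_ge0 ?sqr_ge0// mulr_ge0 ?invr_ge0 ?addr_ge0 ?(ltW eps0).
have KG2 : (0 <= 4 * K3)%R by rewrite mulr_ge0// ltW.
have KG0 : (0 <= KG)%R by rewrite addr_ge0.
have KC0 : (0 <= a * KG / (dl / 4))%R by rewrite divr_ge0 ?mulr_ge0 ?divr_ge0// ltW.
exists (C1 + a * KG / (dl / 4))%R, T1; split => //; first by rewrite ltr_wpDr.
move=> i t tT p.
have t1 : (1 <= t)%R by exact: le_trans tT.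
have tp : (0 < t)%R by exact: lt_le_trans t1.
have t0 := ltW tp.
pose r := (Num.sqrt t ^+ d.+1)%R.
have r0 : (0 < r)%R by rewrite exprn_gt0// sqrtr_gt0.
have r2 : (r ^+ 2 = t ^+ d.+1)%R by rewrite /r -exprM mulnC exprM sqr_sqrtr.
have sqnorm0 : sqnorm (0 : site)%R = 0%R :> R by rewrite /sqnorm big1// => k _; rewrite mxE expr0n.
have th0 : (0 <= t / 2)%R by rewrite divr_ge0.
have [w0 p01] := heat t 0%R i 0%R tT (lexx _) th0.
have wp : (`|walk_kernel a t i - p| <= C1 / r)%R.
  by move: w0; rewrite sqnorm0 !subr0 !addr0 sqrtr1 !mulr1.
split => //.
  by apply: le_trans wp _; rewrite ler_pM2r ?invr_gt0// lerDl.
pose f (j : site) (s : R) : R := (expR (a * (t - s)) * (walk_kernel a (t - s) (i - j) - p))%R.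
have df (j : site) (s : R) : is_derive s 1%R (f j) (- (a * avg (f ^~ s) j))%R.
  have h1 : is_derive s 1%R (fun s : R => t - s)%R (-1)%R.
    by apply: is_derive_eq (is_deriveB (is_derive_cst t s 1%R) (is_derive_id s 1%R)) _; rewrite sub0r.
  have h2 : is_derive s 1%R (fun s : R => a * (t - s))%R (- a)%R.
    by apply: is_derive_eq (is_derive_mull a h1) _; rewrite mulrN1.
  have h3 := @is_derive1_comp _ expR (fun s : R => a * (t - s))%R s _ _ (is_derive_expR _) h2.
  have h4 := @is_derive1_comp _ (walk_kernel a ^~ (i - j)%R) (fun s : R => t - s)%R s _ _ (is_derive_walk_kernel a (t - s) (i - j)) h1.
  have h5 : is_derive s 1%R (fun s : R => walk_kernel a (t - s) (i - j) - p)%R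
     (a * (avg (walk_kernel a (t - s)) (i - j) - walk_kernel a (t - s) (i - j)) * -1)%R.
    by apply: is_derive_eq; rewrite subr0.
  apply: is_derive_eq (is_deriveM h3 h5) _.
  have -> : avg (f ^~ s) j = (expR (a * (t - s)) * (avg (walk_kernel a (t - s)) (i - j) - p))%R.
    rewrite -[in RHS](avg_cst p j) /avg -mulrBr -sumrB mulrCA; congr (_ * _)%R; rewrite mulr_sumr.
    rewrite -(sum_steps_opp (fun v => f (j + v)%R s)); apply: eq_bigr => v _.
    by rewrite /f opprD opprK addrA.
  by rewrite /GRing.scale/=; ring.
have fw j s : (0 <= s <= t)%R -> (`|f j s| <= expR (a * (t - s)) * 2)%R.
  move=> /andP[s0 st]; rewrite /f normrM ger0_norm ?expR_ge0//; apply: ler_wpM2l; first exact: expR_ge0.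
  apply: (le_trans (ler_normB _ _)); have -> : (2 = 1 + 1 :> R)%R by [].
  apply: lerD; first by apply: walk_kernel_abs_le1; [exact: ltW|rewrite subr_ge0].
  by case/andP: p01 => p0 p1; rewrite ger0_norm.
have fM j s : (0 <= s <= t)%R -> (`|f j s| <= expR (a * t) * 2)%R.
  move=> h; apply: le_trans (fw j s h) _; case/andP: h => s0 _.
  by rewrite ler_pM2r// ler_expR ler_pM2l// gerBl.
have one (w : W) : (0 <= (1 : R) <= 1)%R by rewrite ler01 lexx.
(* With this exponent [expR (b * s) * G s] decays like [expR (- (dl / 4 * s))]. *)
pose h : R := (b + dl / 4)%R.
pose G (s : R) : R := (KG * (expR (a * t) / r) ^+ 2 * expR (- (h * s)))%R.
have cG : continuous G.
  move=> s; apply: cvgM; first exact: cvg_cst.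
  apply: (@cvg_comp _ _ _ (fun s : R => - (h * s))%R expR); last exact: continuous_expR.
  by apply: cvgN; apply: cvgM; [exact: cvg_cst|exact: cvg_id].
have n0 j s : 0 <= \int[P]_w nm j s w by apply: integral_ge0 => w _; exact: nbr_mean_ge0.
have E1 j s : \int[P]_w (((1 : R) ^+ 2)%:E * nm j s w) = \int[P]_w nm j s w.
  by apply: eq_integral => w _; rewrite expr1n mul1e.
have eat2 : (expR (a * t) ^+ 2 = expR (2 * a * t))%R by rewrite -expRM_natl mulrA.
have bound s : (0 <= s <= t)%R ->
    lsum (fun j => (f j s ^+ 2)%:E * \int[P]_w (((1 : R) ^+ 2)%:E * nm j s w)) <= (G s)%:E.
  move=> st; under eq_lsum do rewrite E1; have [s0 s_t] := andP st.
  have [sh|hs] := leP s (t / 2)%R.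
    pose c : R := (expR (2 * a * (t - s)) * (C1 ^+ 2 * (1 + s) ^+ 2 / r ^+ 2) * eps^-1)%R.
    have c0 : (0 <= c)%R.
      rewrite /c mulr_ge0 ?invr_ge0 ?(ltW eps0)// mulr_ge0 ?expR_ge0//.
      by rewrite divr_ge0 ?sqr_ge0// mulr_ge0 ?sqr_ge0.
    apply: (@le_trans _ _ (c%:E * lsum (fun j : site => (1 + eps * sqnorm j)%:E * \int[P]_w nm j s w))).
      rewrite -lsumZ//; last first.
        by move=> j; rewrite mule_ge0// lee_fin addr_ge0// mulr_ge0 ?sqnorm_ge0// ltW.
      apply: le_lsum => j; first by rewrite mule_ge0// lee_fin sqr_ge0.
      rewrite muleA -EFinM; apply: lee_pmul => //; rewrite lee_fin ?sqr_ge0//.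
      have [wj _] := heat t s i j tT s0 sh.
      have sq0 : (0 <= 1 + sqnorm j :> R)%R by rewrite addr_ge0// sqnorm_ge0.
      have wj2 : ((walk_kernel a (t - s) (i - j) - p) ^+ 2 <= C1 ^+ 2 * (1 + s) ^+ 2 * (1 + sqnorm j) / r ^+ 2)%R.
        rewrite -real_normK ?num_real//.
        have -> : (C1 ^+ 2 * (1 + s) ^+ 2 * (1 + sqnorm j) / r ^+ 2 = (C1 * (1 + s) * Num.sqrt (1 + sqnorm j) / r) ^+ 2)%R.
          by rewrite !exprMn exprVn sqr_sqrtr.
        rewrite lerXn2r// nnegrE// !mulr_ge0 ?invr_ge0 ?sqrtr_ge0 ?addr_ge0 ?(ltW C10) ?(ltW r0)//.
      rewrite /f exprMn -expRM_natl (mulrA 2%R) /c -[leRHS]mulrA -[leRHS]mulrA.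
      apply: ler_wpM2l; first exact: expR_ge0.
      apply: (le_trans wj2); move: (C1 ^+ 2)%R (sqr_ge0 C1) ((1 + s) ^+ 2)%R (sqr_ge0 (1 + s)%R) => q q0 v v0.
      have -> : (q * v / r ^+ 2 * (eps^-1 * (1 + eps * sqnorm j)) = q * v * (eps^-1 + sqnorm j) / r ^+ 2)%R.
        by field; rewrite !gt_eqF.
      apply: ler_wpM2r; first by rewrite invr_ge0 sqr_ge0.
      apply: ler_wpM2l; first exact: mulr_ge0.
      by rewrite lerD2r invf_ge1.
    apply: (@le_trans _ _ (c * ((1 + eps) * expR (a * (1 + eps) * s)))%:E).
      rewrite [leRHS]EFinM; apply: lee_wpmul2l; first by rewrite lee_fin.
      exact: mean_spread_neighbour (ltW eps0) s0.
    rewrite lee_fin /c /G.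
    apply: (@le_trans _ _ (C1 ^+ 2 * (eps^-1 * (1 + eps)) * K2 * (expR (a * t) / r) ^+ 2 * expR (- (h * s))))%R; last first.
      by rewrite ler_wpM2r ?expR_ge0// ler_wpM2r ?sqr_ge0// lerDl.
    have -> : (expR (2 * a * (t - s)) * (C1 ^+ 2 * (1 + s) ^+ 2 / r ^+ 2) * eps^-1 * ((1 + eps) * expR (a * (1 + eps) * s)) =
       C1 ^+ 2 * (eps^-1 * (1 + eps)) * (expR (a * t) / r) ^+ 2 * ((1 + s) ^+ 2 * expR (- (h * s) - dl / 4 * s)))%R.
      have -> : (- (h * s) - dl / 4 * s = - (2 * a * t) + (2 * a * (t - s) + a * (1 + eps) * s))%R.
        by rewrite /h epsE /dl; field; rewrite gt_eqF.
      rewrite exprMn eat2 !expRD (expRN (2 * a * t)); have := expR_gt0 (2 * a * t)%R => q0.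
      by field; rewrite !gt_eqF.
    have hs2 : ((1 + s) ^+ 2 * expR (- (h * s) - dl / 4 * s) <= K2 * expR (- (h * s)))%R.
      apply: (@le_trans _ _ (K2 * expR (dl / 4 * s) * expR (- (h * s) - dl / 4 * s))%R).
        by apply: ler_wpM2r; [exact: expR_ge0|exact: hK2].
      by rewrite -mulrA -expRD addrC subrK.
    have -> : (C1 ^+ 2 * (eps^-1 * (1 + eps)) * K2 * (expR (a * t) / r) ^+ 2 * expR (- (h * s)) =
       C1 ^+ 2 * (eps^-1 * (1 + eps)) * (expR (a * t) / r) ^+ 2 * (K2 * expR (- (h * s))))%R by ring.
    apply: ler_wpM2l hs2; apply: mulr_ge0; last exact: sqr_ge0.
    by rewrite mulr_ge0 ?sqr_ge0// mulr_ge0 ?invr_ge0 ?addr_ge0 ?(ltW eps0).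
  pose c : R := (4 * expR (2 * a * (t - s)))%R.
  have c0 : (0 <= c)%R by rewrite mulr_ge0 ?expR_ge0.
  apply: (@le_trans _ _ (c%:E * lsum (fun j : site => (1 + 0 * sqnorm j)%:E * \int[P]_w nm j s w))).
    rewrite -lsumZ//; last by move=> j; rewrite mul0r addr0 mul1e.
    apply: le_lsum => j; first by rewrite mule_ge0// lee_fin sqr_ge0.
    rewrite mul0r addr0 mul1e; apply: lee_pmul => //; rewrite lee_fin ?sqr_ge0//.
    have fj := fw j s st; rewrite -real_normK ?num_real//.
    apply: (@le_trans _ _ ((expR (a * (t - s)) * 2) ^+ 2)%R).
      by rewrite lerXn2r// nnegrE// mulr_ge0 ?expR_ge0.
    by rewrite exprMn -expRM_natl (mulrA 2%R) /c mulrC -natrX.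
  apply: (@le_trans _ _ (c * ((1 + 0) * expR (a * (1 + 0) * s)))%:E).
    rewrite [leRHS]EFinM; apply: lee_wpmul2l; first by rewrite lee_fin.
    exact: mean_spread_neighbour.
  rewrite lee_fin /c /G addr0 mul1r mulr1.
  apply: (@le_trans _ _ (4 * K3 * (expR (a * t) / r) ^+ 2 * expR (- (h * s))))%R; last first.
    by rewrite ler_wpM2r ?expR_ge0// ler_wpM2r ?sqr_ge0// lerDr.
  have -> : (4 * expR (2 * a * (t - s)) * expR (a * s) = 4 * expR (2 * a * t) * expR (- (h * s)) * expR (- (3 * dl / 4 * s)))%R.
    by rewrite -!mulrA -!expRD; congr (_ * expR _)%R; rewrite /h /dl; field.
  have -> : (4 * K3 * (expR (a * t) / r) ^+ 2 * expR (- (h * s)) = 4 * expR (2 * a * t) * expR (- (h * s)) * (K3 / r ^+ 2))%R.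
    by rewrite exprMn eat2 exprVn; ring.
  apply: ler_wpM2l; first by rewrite !mulr_ge0 ?expR_ge0.
  rewrite r2; apply: le_trans (hK3 t tp); rewrite ler_expR lerN2.
  have -> : (3 * dl / 8 * t = 3 * dl / 4 * (t / 2))%R by field.
  by rewrite ler_wpM2l ?(ltW hs)// divr_ge0 ?mulr_ge0// ltW.
pose D w := ((fine (X i t w) - p * fine (total t w) - expR (a * t) * (walk_kernel a t i - p)) ^+ 2)%:E.
have mD : mfunT D.
  by meas.
have D0 w : 0 <= D w by rewrite lee_fin sqr_ge0.
have hD : {ae P, forall w, exists n0, forall n, (n0 <= n)%N -> D w =
    (((1 : R) * \sum_(j <- initial n) (f j t * fine (X j t w) - f j 0 * fine (X j 0%R w))) ^+ 2)%:E}.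
  apply: filterS (good_path_ae) => w gw.
  have [n1 h1] := fine_total_sum gw t0.
  have [n2 h2] := sub_initial [:: (i : site); (0 : site)%R].
  exists (maxn n1 n2) => n; rewrite geq_max => /andP[hn1 hn2].
  have iin : i \in initial n by apply: (sub_initial_le hn2); apply: h2; rewrite inE eqxx.
  have in0 : (0 : site)%R \in initial n by apply: (sub_initial_le hn2); apply: h2; rewrite !inE eqxx orbT.
  rewrite /D (h1 n hn1) mul1r sumrB; congr (_ ^+ 2)%:E; congr (_ - _)%R.
    rewrite mulr_sumr; under [RHS]eq_bigr => j _.
      rewrite /f subrr mulr0 expR0 mul1r walk_kernel0 mulrBl; over.
    rewrite sumrB; congr (_ - _)%R.
    rewrite (bigD1_seq i)/= ?initial_uniq// subrr eqxx mul1r big1 ?addr0// => j ji.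
    by rewrite subr_eq0 eq_sym (negbTE ji) mul0r.
  rewrite (bigD1_seq (0 : site)%R)/= ?initial_uniq// big1 ?addr0.
    by rewrite (weighted_start _ gw) eqxx mulr1 /f !subr0.
  by move=> j j0; rewrite (weighted_start _ gw) (negbTE j0) mulr0.
have M0 : (0 <= expR (a * t) * 2)%R by rewrite mulr_ge0 ?expR_ge0.
apply: le_trans (second_moment_bound (lexx 0%R) t0 M0 df fM one (@measurable_cst _ _ _ _ _ _) mD D0 hD cG bound) _.
have E s : (a * expR (b * s) * G s = a * KG * (expR (a * t) / r) ^+ 2 * expR (- (dl / 4 * s)))%R.
  rewrite /G (_ : - (dl / 4 * s) = b * s + - (h * s))%R; last by rewrite /h; ring.
  by rewrite expRD; ring.
under eq_integral do rewrite E.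
have c0 : (0 <= a * KG * (expR (a * t) / r) ^+ 2)%R by rewrite mulr_ge0 ?sqr_ge0// mulr_ge0// ltW.
apply: le_trans (expR_integral_le 0%R t c0 (divr_gt0 dl0 (ltr0n _ 4))) _.
rewrite lee_fin mulr0 oppr0 expR0 mulr1 mulrAC; apply: ler_wpM2r; first exact: sqr_ge0.
by rewrite lerDr ltW.
Qed.

End moments.

#[local] Hint Resolve measurable_mart : meas.

(** * The martingale limit, and the weights and counts in terms of it *)

Section limit.
Local Notation e u := (expR (b * u))%:E.

Let dl : R := (a - b)%R.
Let dl0 : (0 < dl)%R. Proof. by rewrite subr_gt0. Qed.
Let one (w : W) : (0 <= (1 : R) <= 1)%R. Proof. by rewrite ler01 lexx. Qed.

(** With [phi = 1] and a mean mass of at most [expR (a * u)], [mart_square] bounds the variance of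
    the later increments by [a / dl * expR (- (dl * u))]. *)
Lemma mart_l1 u t : (0 <= u)%R -> (u <= t)%R ->
  \int[P]_w (`|(mart t w - mart u w)%R|%:E) <= ((1 + a / dl) / 2 * expR (- (dl / 2 * u)))%:E.
Proof.
move=> u0 ut; have t0 := le_trans u0 ut.
apply: integral_norm_le.
- exact: expR_gt0.
- by meas.
have := mart_square u0 ut one (@measurable_cst _ _ _ _ _ _).
under eq_integral do rewrite mul1r.
move=> /le_trans; apply.
have -> : \int[P]_w (((1 : R) ^+ 2)%:E * total u w) = \int[P]_w total u w.
  by apply: eq_integral => w _; rewrite expr1n mul1e.
apply: (@le_trans _ _ ((a / dl * expR (- ((2 * a - b) * u)))%:E * (expR (a * u))%:E)).
  apply: lee_wpmul2l; first by rewrite lee_fin mulr_ge0 ?expR_ge0// divr_ge0// ltW.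
  exact: mean_total_le.
rewrite -EFinM lee_fin -[leLHS]mulrA -expRD -expRM_natl le_eqVlt; apply/orP; left; apply/eqP.
by congr (_ * expR _)%R; rewrite /dl; field.
Qed.

(** An upper limit along the integers is measurable and defined for all [w]; almost surely it is the
    limit. *)
Definition mart_limit (w : W) : R := fine (limn_esup (fun k : nat => (mart k%:R w)%:E)).

Lemma measurable_mart_limit : mfunT mart_limit.
Proof.
apply: measurableT_comp => //; apply: measurable_fun_limn_esup => k.
by apply/measurable_EFinP; exact: measurable_mart.
Qed.

Lemma mart_limit_ge0 w : (0 <= mart_limit w)%R.
Proof.
apply: fine_ge0; rewrite limn_esup_lim; apply: lime_ge; first exact: is_cvg_esups.
apply: nearW => m; apply: (@le_trans _ _ (mart m%:R w)%:E); first by rewrite lee_fin mart_ge0.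
by apply: ereal_sup_ubound; exists m => /=.
Qed.

(** The [L^1] norms of the increments over unit steps are dominated by a geometric series of ratio
    [q = expR (- (dl / 2))], so the increments are almost surely summable. *)
Lemma mart_cvg_ae : {ae P, forall w, mart k%:R w @[k --> \oo] --> mart_limit w}.
Proof.
have m1 k : mfunT (fun w => `|(mart k.+1%:R w - mart k%:R w)%R|%:E).
  apply/measurable_EFinP; apply: measurableT_comp => //.
  by apply: measurable_funB; exact: measurable_mart.
pose K := ((1 + a / dl) / 2)%R; have K0 : (0 <= K)%R by rewrite divr_ge0// addr_ge0// divr_ge0// ltW.
pose q := expR (- (dl / 2)); have q0 : (0 < q)%R by exact: expR_gt0.
have q1 : (q < 1)%R by rewrite -[ltRHS]expR0 ltr_expR oppr_lt0 divr_gt0.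
have h : P.-integrable setT (fun w => \sum_(0 <= k <oo) (`|(mart k.+1%:R w - mart k%:R w)%R|%:E)).
  apply/integrableP; split.
    by apply: ge0_emeasurable_sum => // k w _ _; rewrite lee_fin.
  under eq_integral => w _.
    rewrite gee0_abs; last by apply: nneseries_ge0 => k _ _; rewrite lee_fin.
    over.
  rewrite integral_nneseries//.
  apply: (@le_lt_trans _ _ (K / (1 - q))%:E); last exact: ltry.
  apply: lime_le.
    by apply: is_cvg_nneseries => k _ _; apply: integral_ge0 => w _; rewrite lee_fin.
  apply: nearW => n; apply: (@le_trans _ _ (\sum_(0 <= k < n) (K * q ^+ k)%:E)).
    apply: lee_sum => k _; apply: le_trans (mart_l1 (ler0n _ k) _) _; first by rewrite ler_nat.
    by rewrite lee_fin -expRM_natl (mulrC k%:R) mulNr lexx.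
  rewrite sumEFin lee_fin.
  rewrite -[leLHS]/(series (geometric K q) n) geometric_seriesE ?(lt_eqF q1)//=.
  by rewrite ler_pM2r ?invr_gt0 ?subr_gt0// ler_piMr// gerBl exprn_ge0// ltW.
apply: filterS (integrable_ae measurableT h) => w /(_ Logic.I) hw.
have c : cvgn (fun k : nat => mart k%:R w).
  by apply: summable_norm_cvg; move: hw; rewrite fin_numE => /andP[_]; rewrite ltey.
have c' : (fun k : nat => (mart k%:R w)%:E) @ \oo --> (limn (fun k : nat => mart k%:R w))%:E.
  by apply: cvg_EFin => //; exact: nearW.
by rewrite /mart_limit (cvg_limn_einf_sup c').2.
Qed.

Lemma mart_limit_l1 u : (0 <= u)%R ->
  \int[P]_w (`|(mart_limit w - mart u w)%R|%:E) <= ((1 + a / dl) / 2 * expR (- (dl / 2 * u)))%:E.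
Proof.
move=> u0.
apply: (@integral_limit_le _ _ _ P _ (fun k w => `|(mart k%:R w - mart u w)%R|%:E)) => //.
- apply/measurable_EFinP; apply: measurableT_comp => //.
  by apply: measurable_funB; [exact: measurable_mart_limit|exact: measurable_mart].
- move=> k; apply/measurable_EFinP; apply: measurableT_comp => //.
  by apply: measurable_funB; exact: measurable_mart.
- apply: filterS mart_cvg_ae => w hw; apply: cvg_EFin; first exact: nearW.
  by apply: cvg_norm; apply: cvgB => //; exact: cvg_cst.
exists (Num.bound u) => // k /= uk; apply: mart_l1 => //.
by rewrite (le_trans (ltW (archi_boundP u0)))// ler_nat.
Qed.

Lemma mart_limit_square (phi : W -> R) B u : (0 <= u)%R -> (forall w, 0 <= phi w <= B)%R ->
  mfunT (phi : sigmaT (F u) -> R) ->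
  \int[P]_w ((phi w * (mart_limit w - mart u w)) ^+ 2)%:E <=
  (a / dl * expR (- ((2 * a - b) * u)))%:E * \int[P]_w (((phi w) ^+ 2)%:E * total u w).
Proof.
move=> u0 phiB mphi.
have mphiT : mfunT phi by exact: (sub_sigma_mfun (filtration_measurable hF u0)).
apply: (@integral_limit_le _ _ _ P _ (fun k w => ((phi w * (mart k%:R w - mart u w)) ^+ 2)%:E)) => //.
- apply/measurable_EFinP; apply: measurable_funX; apply: measurable_funM => //.
  by apply: measurable_funB; [exact: measurable_mart_limit|exact: measurable_mart].
- by move=> w; rewrite lee_fin sqr_ge0.
- move=> k; apply/measurable_EFinP; apply: measurable_funX; apply: measurable_funM => //.
  by apply: measurable_funB; exact: measurable_mart.
- by move=> k w; rewrite lee_fin sqr_ge0.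
- apply: filterS mart_cvg_ae => w hw; apply: cvg_EFin; first exact: nearW.
  have c : (phi w * (mart k%:R w - mart u w))%R @[k --> \oo] --> (phi w * (mart_limit w - mart u w))%R.
    by apply: cvgM; [exact: cvg_cst|apply: cvgB => //; exact: cvg_cst].
  by apply: cvgM.
exists (Num.bound u) => // k /= uk; apply: (mart_square u0 _ phiB mphi).
by rewrite (le_trans (ltW (archi_boundP u0)))// ler_nat.
Qed.

Lemma mean_mart_limit : exists2 K : R, (0 <= K)%R & \int[P]_w ((mart_limit w)%:E) <= K%:E.
Proof.
have K0 : (0 <= (1 + a / dl) / 2)%R by rewrite divr_ge0// addr_ge0// divr_ge0// ltW.
exists (0 + (1 * ((1 + a / dl) / 2) + 1 * 1))%R; first by rewrite add0r !mul1r addr_ge0.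
have mm := measurable_mart_limit; have m0 := measurable_mart (lexx (0 : R)%R).
apply: (integral_le_lincomb (U := fun w => `|(mart_limit w - mart 0 w)%R|%:E) (V := total 0%R)) => //.
- by meas.
- by meas.
- exact: measurable_total.
- by move=> w; rewrite lee_fin mart_limit_ge0.
- by move=> w; exact: total_ge0.
- by have := mart_limit_l1 (lexx 0%R); rewrite mulr0 oppr0 expR0 mulr1.
- by have := mean_total_le (lexx 0%R); rewrite mulr0 expR0.
apply: nearW => w; rewrite add0e !mul1e /mart mulr0 oppr0 expR0 mul1r.
have := total_ge0 0%R w; case: (total 0%R w) => [v _|_|//]; last by rewrite addey ?leey.
by rewrite -EFinD lee_fin -lerBlDr ler_norm.
Qed.

Lemma expRN_le_sqrt (k : R) : (0 < k)%R ->
  exists2 K : R, (0 < K)%R & forall t, (1 <= t)%R -> (expR (- (k * t)) <= K / Num.sqrt t ^+ d.+1)%R.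
Proof.
move=> k0; have [K K0 hK] := expRN_le_invX d k0; exists K => // t t1.
have t0 : (0 < t)%R by exact: lt_le_trans t1.
apply: le_trans (hK t t0) _; apply: ler_wpM2l; first exact: ltW.
have s1 : (1 <= Num.sqrt t)%R by rewrite -(@sqrtr1 R) ler_wsqrtr.
have r1 : (1 <= Num.sqrt t ^+ d.+1)%R by exact: exprn_ege1.
have r0 : (0 < Num.sqrt t ^+ d.+1)%R by exact: lt_le_trans r1.
rewrite lef_pV2 ?posrE//; last exact: exprn_gt0.
have -> : (t ^+ d.+1 = Num.sqrt t ^+ d.+1 * Num.sqrt t ^+ d.+1)%R by rewrite -exprMn -expr2 sqr_sqrtr// ltW.
by rewrite ler_peMl// ltW.
Qed.

(** Three errors are added: the deterministic one of the starting point, the fluctuation bounded by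
    [spatial_square], and the distance from [mart t] to its limit, which decays exponentially and so
    faster than the power of [t]. *)
Lemma wcount_l1 : exists C T0 : R, [/\ (0 < C)%R, (1 <= T0)%R &
  forall (i : site) (t : R), (T0 <= t)%R -> let p := heat_kernel (a * t) (to_real R i) in
  [/\ (0 <= p <= 1)%R, (`|walk_kernel a t i - p| <= C / Num.sqrt t ^+ d.+1)%R &
  \int[P]_w (`|(fine (X i t w) - p * mart_limit w * expR (a * t))%R|%:E) <=
   (C * (expR (a * t) / Num.sqrt t ^+ d.+1))%:E]].
Proof.
have [C1 [T0 [C10 T01 hS]]] := spatial_square.
have [K2 K20 hK2] := expRN_le_sqrt (divr_gt0 dl0 (ltr0n _ 2)).
pose K1 := ((1 + a / dl) / 2)%R; have K10 : (0 <= K1)%R by rewrite divr_ge0// addr_ge0// divr_ge0// ltW.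
have C2 : (0 <= (1 + C1) / 2 + K1 * K2)%R by apply: addr_ge0; [rewrite divr_ge0// addr_ge0// ltW|rewrite mulr_ge0// ltW].
exists (C1 + ((1 + C1) / 2 + K1 * K2))%R, T0; split => //; first by rewrite ltr_wpDr.
move=> i t tT p; have [p01 wp hsq] := hS i t tT; have [p0 p1] := andP p01.
have t1 : (1 <= t)%R by exact: le_trans tT.
have t0 : (0 <= t)%R by exact: le_trans t1.
pose r := (Num.sqrt t ^+ d.+1)%R.
have r0 : (0 < r)%R by rewrite exprn_gt0// sqrtr_gt0; exact: lt_le_trans t1.
split => //.
  by apply: le_trans wp _; rewrite ler_pM2r ?invr_gt0// lerDl.
have ea0 : (0 < expR (a * t))%R by exact: expR_gt0.
have eta0 : (0 < expR (a * t) / r)%R by rewrite divr_gt0.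
pose c := (expR (a * t) * (walk_kernel a t i - p))%R.
pose Y w := (fine (X i t w) - p * fine (total t w) - c)%R.
have mX : mfunT (fun w => fine (X i t w)) by meas.
have mT : mfunT (fun w => fine (total t w)) by meas.
have mY : mfunT Y by meas.
have h2 := mart_limit_l1 t0.
have mm := measurable_mart_limit; have mt := measurable_mart t0.
have hc : (`|c| <= C1 * (expR (a * t) / r))%R.
  rewrite /c normrM (ger0_norm (ltW ea0)) mulrCA; apply: ler_wpM2l wp; exact: ltW.
have := integral_le_lincomb (f := fun w => `|fine (X i t w) - p * mart_limit w * expR (a * t)|%R%:E)
  (U := fun w => `|Y w|%R%:E) (V := fun w => `|(mart_limit w - mart t w)%R|%:E) (c0 := `|c|%R) (c1 := 1%R) (c2 := expR (a * t)) _ _ _ _ _ _ _ _ _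
  (integral_norm_le eta0 mY hsq) h2.
move=> h; apply: le_trans (h _ _ _ _ _ _ _ _ _ _) _ => //.
- by meas.
- by meas.
- by meas.
- apply: nearW => w; rewrite -!EFinM -!EFinD lee_fin mul1r.
  have -> : (fine (X i t w) - p * mart_limit w * expR (a * t) =
     c + (Y w - p * (expR (a * t) * (mart_limit w - mart t w))))%R.
    rewrite /Y /mart expRN; move: (mart_limit w) (fine (total t w)) (fine (X i t w)) => m T x.
    by field; rewrite gt_eqF.
  apply: (le_trans (ler_normD _ _)); rewrite lerD2l; apply: (le_trans (ler_normB _ _)); rewrite lerD2l.
  rewrite normrM (ger0_norm p0) normrM (ger0_norm (ltW ea0)).
  by rewrite ler_piMl// mulr_ge0// ltW.
rewrite lee_fin mul1r -/K1 -/r.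
have -> : ((C1 + ((1 + C1) / 2 + K1 * K2)) * (expR (a * t) / r) =
  C1 * (expR (a * t) / r) + ((1 + C1) / 2 * (expR (a * t) / r) + K1 * K2 * (expR (a * t) / r)))%R by ring.
apply: lerD => //; apply: lerD => //.
have -> : (expR (a * t) * (K1 * expR (- (dl / 2 * t))) = expR (a * t) * K1 * expR (- (dl / 2 * t)))%R by ring.
have -> : (K1 * K2 * (expR (a * t) / r) = expR (a * t) * K1 * (K2 / r))%R by ring.
by apply: ler_wpM2l; [rewrite mulr_ge0// ltW|exact: hK2].
Qed.

Lemma path_meas_co_count i w t : good_path w -> (0 <= t)%R ->
  points N i w (`[t, t] `*` `[0%R, +oo[) = 0 -> path_meas (Z i ^~ w) `[0%R, t[%classic = ((Z i t w)%:R)%:E.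
Proof.
move=> gw t0 nl; have cf := good_counting gw i.
have J := path_jump_measure i gw.
rewrite (count_jump_measure i gw t0) -J => //.
have [->|tn] := eqVneq t 0%R; first by rewrite set_itvco0 set_itv_ge// bnd_simp ltxx.
have tp : (0 < t)%R by rewrite lt0r tn.
have add (A1 A2 : set R) : measurable (A1 : set (borel R)) -> measurable (A2 : set (borel R)) ->
    A1 `&` A2 = set0 -> path_meas (Z i ^~ w) (A1 `|` A2) = path_meas (Z i ^~ w) A1 + path_meas (Z i ^~ w) A2.
  exact: (@measureU _ _ _ (path_meas (Z i ^~ w))).
have -> : `[0%R, t[%classic = [set (0%R : R)] `|` `]0%R, t[ by rewrite setU1itv// bnd_simp.
have -> : `]0%R, t]%classic = `]0%R, t[ `|` [set t] by rewrite setUitv1// bnd_simp.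
rewrite !add.
- rewrite (path_atom_null gw t0 nl) adde0.
  by rewrite [X in X + _](path_meas_set0 cf) add0e.
- exact: measurable_itv.
- exact: measurable_set1.
- by apply/seteqP; split => // s [/=]; rewrite in_itv/= => /andP[_ st] st'; move: st; rewrite st' ltxx.
- exact: measurable_set1.
- exact: measurable_itv.
- by apply/seteqP; split => // s [/= ->]; rewrite in_itv/= ltxx.
Qed.

(** A jump of the count is [expR (- (b * s))] times the jump of the weight, and integration by parts
    recovers the count from the weights; [(i == 0)] is the initial weight. *)
Lemma count_relation i t : (0 <= t)%R -> {ae P, forall w,
   X i t w < +oo /\ (expR (- (b * t)) * fine (X i t w) +
     fine (\int[leb]_(s in `]0%R, t[) ((b * expR (- (b * s)))%:E * X i s w)) = (Z i t w)%:R + (i == 0)%:R)%R /\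
    \int[leb]_(s in `]0%R, t[) ((b * expR (- (b * s)))%:E * X i s w) < +oo}.
Proof.
move=> t0; apply: filterS2 (line_null i t0) (good_path_ae) => w nl gw.
have cf := good_counting gw i.
have X0 s : 0 <= X i s w by exact: wcount_ge0.
have Xf s : (0 <= s)%R -> X i s w < +oo.
  by move=> s0; apply: le_lt_trans (wcount_le i gw s0) _; exact: ltry.
(* [expR (- (b * s))] decreases, so it is written as [g - q] with [g] and [q] nonnegative and
   nondecreasing. *)
pose g (s : R) : R := (expR (- (b * s)) + b * s)%R.
pose g' (s : R) : R := (b - b * expR (- (b * s)))%R.
pose q (s : R) : R := (b * s)%R.
have cexp : continuous (fun s : R => expR (- (b * s)))%R.
  move=> s; apply: (@cvg_comp _ _ _ (fun s : R => - (b * s))%R expR); last exact: continuous_expR.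
  by apply: cvgN; apply: cvgM; [exact: cvg_cst|exact: cvg_id].
have cg' : continuous g' by move=> s; apply: cvgB; [exact: cvg_cst|apply: cvgM; [exact: cvg_cst|exact: cexp]].
have dq (s : R) : is_derive s 1%R q b.
  by apply: is_derive_eq (is_derive_mull b (is_derive_id s 1%R)) _; rewrite mulr1.
have dg (s : R) : is_derive s 1%R g (g' s).
  have h : is_derive s 1%R (fun s : R => - (b * s))%R (- b)%R := is_deriveN (dq s).
  have h2 := @is_derive1_comp _ expR (fun s : R => - (b * s))%R s _ _ (is_derive_expR _) h.
  by apply: is_derive_eq (is_deriveD h2 (dq s)) _; rewrite /g'; ring.
have q0 s : (0 <= s <= t)%R -> (0 <= q s)%R by move=> /andP[s0 _]; rewrite mulr_ge0// ltW.
have g0 s : (0 <= s <= t)%R -> (0 <= g s)%R by move=> st; rewrite addr_ge0 ?expR_ge0//; exact: q0.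
have g'0 s : (0 <= s <= t)%R -> (0 <= g' s)%R.
  by move=> /andP[s0 _]; rewrite /g' subr_ge0 ler_piMr ?(ltW hb)// -expR0 ler_expR oppr_le0 mulr_ge0// ltW.
have b0 s : (0 <= s <= t)%R -> (0 <= b)%R by move=> _; exact: ltW.
have ttt : (0 <= t <= t)%R by rewrite t0 lexx.
have tt0 : (0 <= (0 : R) <= t)%R by rewrite t0 lexx.
have inoot s : `]0%R, t[%classic s -> (0 <= s <= t)%R by rewrite /= in_itv/= => /andP[/ltW -> /ltW ->].
have incot s : `[0%R, t[%classic s -> (0 <= s <= t)%R by rewrite /= in_itv/= => /andP[-> /ltW ->].
have cb : continuous (fun _ : R => b) by move=> s; exact: cvg_cst.
have E1 := wcount_parts i gw (lexx 0%R) t0 dg cg' g0 g'0.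
have E2 := wcount_parts i gw (lexx 0%R) t0 dq cb q0 b0.
set m := path_meas (Z i ^~ w) in E1 E2.
set A1 := \int[m]_(s in `[0%R, t[) ((g s)%:E * e s) in E1.
set A2 := \int[m]_(s in `[0%R, t[) ((q s)%:E * e s) in E2.
set B1 := \int[leb]_(s in `]0%R, t[) ((g' s)%:E * X i s w) in E1.
set B2 := \int[leb]_(s in `]0%R, t[) (b%:E * X i s w) in E2.
set I := \int[leb]_(s in `]0%R, t[) ((b * expR (- (b * s)))%:E * X i s w).
have A10 : 0 <= A1 by apply: integral_ge0 => s /incot st; rewrite mule_ge0 ?lee_fin ?expR_ge0//; exact: g0.
have A20 : 0 <= A2 by apply: integral_ge0 => s /incot st; rewrite mule_ge0 ?lee_fin ?expR_ge0//; exact: q0.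
have B10 : 0 <= B1 by apply: integral_ge0 => s /inoot st; rewrite mule_ge0 ?lee_fin ?g'0.
have B20 : 0 <= B2 by apply: integral_ge0 => s /inoot st; rewrite mule_ge0 ?lee_fin ?(ltW hb).
have I0 : 0 <= I by apply: integral_ge0 => s /inoot st; rewrite mule_ge0 ?lee_fin// mulr_ge0 ?expR_ge0// ltW.
have EA : A1 = ((Z i t w)%:R)%:E + A2.
  rewrite -(path_meas_co_count gw t0 nl) -/m.
  have -> : m `[0%R, t[%classic = \int[m]_(s in `[0%R, t[) (cst 1%R%:E s).
    by rewrite integral_cst ?mul1e//; exact: measurable_itv.
  rewrite /A2 -ge0_integralD; first (apply: eq_integral => s _ /=; rewrite -!EFinM -EFinD; congr EFin).
  - by rewrite /g mulrDl -expRD addNr expR0.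
  - exact: measurable_itv.
  - by [].
  - exact: measurable_cst.
  - by move=> s /incot st; rewrite mule_ge0 ?lee_fin ?expR_ge0//; exact: q0.
  - apply: emeasurable_funM; last exact: measurable_exp.
    by apply: measurable_continuous => s; exact: (derive_continuous (dq s)).
have mXo : measurable_fun `]0%R, t[ (fun s : borel R => X i s w).
  by apply: (measurable_path_count) => //; exact: itv_oo_sub.
have EB : B2 = B1 + I.
  rewrite /B1 /I -ge0_integralD; first (apply: eq_integral => s; rewrite inE => /inoot st).
  - rewrite -ge0_muleDl ?lee_fin ?g'0//; last by rewrite mulr_ge0 ?expR_ge0// ltW.
    by rewrite -EFinD /g' subrK.
  - exact: measurable_itv.
  - by move=> s /inoot st; rewrite mule_ge0 ?lee_fin ?g'0.
  - by apply: emeasurable_funM => //; exact: measurable_continuous.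
  - by move=> s /inoot st; rewrite mule_ge0 ?lee_fin// mulr_ge0 ?expR_ge0// ltW.
  - apply: emeasurable_funM => //; apply: measurable_continuous => s.
    by apply: cvgM; [exact: cvg_cst|exact: cexp].
have [A1f B1f F1] := fine_balance (Xf t t0) (X0 t) (X0 0%R) (g0 _ tt0) A10 B10 (Xf _ (lexx _)) E1.
have [A2f B2f F2] := fine_balance (Xf t t0) (X0 t) (X0 0%R) (q0 _ tt0) A20 B20 (Xf _ (lexx _)) E2.
have If : I < +oo by apply: le_lt_trans B2f; rewrite EB leeDr.
split; first exact: Xf.
split => //.
clearbody A1 A2 B1 B2 I.
have fA : (fine A1 = (Z i t w)%:R + fine A2)%R by rewrite EA fineD// ge0_fin_numE.
have fB : (fine B2 = fine B1 + fine I)%R by rewrite EB fineD// ge0_fin_numE.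
have x0 : fine (X i 0%R w) = ((i == 0)%:R)%R by rewrite (weighted_start _ gw).
move: F1 F2; rewrite fA fB x0 /g /q !mulr0 oppr0 expR0 addr0; lra.
Qed.

End limit.

#[local] Hint Resolve measurable_mart_limit : meas.

(** * From the weights to the counts *)

Section counts.
Let dl : R := (a - b)%R.
Let dl0 : (0 < dl)%R. Proof. by rewrite subr_gt0. Qed.

(** [a / dl = 1 + b / dl]: in [count_relation] the current weight contributes the 1 and the time
    integral contributes [b / dl]. *)
Definition growth_limit (w : W) : R := (a / dl * mart_limit w)%R.

Lemma mean_wcount_le i s : (0 <= s)%R -> \int[P]_w (fine (X i s w))%:E <= (expR (a * s))%:E.
Proof.
move=> s0; apply: le_trans (mean_total_le s0).
apply: ge0_le_integral => //.
- by move=> w _; rewrite lee_fin fine_ge0// wcount_ge0.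
- by meas.
- exact: measurable_total.
move=> w _; apply: (@le_trans _ _ (X i s w)).
  by have := wcount_ge0 i s w; case: (X i s w) => //= _; rewrite leey.
by rewrite totalE; apply: le_lsum1 => j; exact: wcount_ge0.
Qed.

(** Error in the integrand of [count_relation] when the heat kernel is frozen at the final time
    [t]. *)
Let err (i : site) (t s : R) (w : W) : R :=
  (`|b * expR (- (b * s)) * fine (X i s w) - b * (mart_limit w * heat_kernel (a * t) (to_real R i)) * expR (dl * s)|)%R.

Let measurable_err i t : mfunT (fun z : W * plane R => (err i t (ptime z.2) z.1)%:E).
Proof.
have mp : mfunT (fun z : W * plane R => ptime z.2).
  exact: (sub_sigma_mfun (pred_gen_measurable hF) (predictable_ptime hF)).
have mX : mfunT (fun z : W * plane R => X i (ptime z.2) z.1).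
  exact: (predictable_measurable hF (wcount_predictable i)).
have me c : mfunT (fun z : W * plane R => expR (c * ptime z.2)).
  by meas.
apply/measurable_EFinP; apply: measurableT_comp => //; apply: measurable_funB.
  apply: measurable_funM; last exact: measurableT_comp.
  apply: measurable_funM => //.
  by under eq_fun do rewrite -mulNr; exact: me.
apply: measurable_funM; last exact: me.
apply: measurable_funM => //.
apply: measurable_funM => //.
by apply: measurableT_comp measurable_fst; exact: measurable_mart_limit.
Qed.

(** For [s >= t / 2] the heat kernels at times [s] and [t] are both compared with the walk kernel at
    time [s]; the cost [1 + (t - s)] is absorbed by half of the exponential decay in [t - s]. For
    smaller [s] the mean mass is a sufficient bound, since that decay is then also below the
    required power of [t]. *)
Let mean_err : exists C T0 : R, [/\ (0 < C)%R, (1 <= T0)%R & forall i t s, (T0 <= t)%R -> (0 <= s <= t)%R ->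
  \int[P]_w (err i t s w)%:E <= (C * (expR (dl * t) / Num.sqrt t ^+ d.+1) * expR (- (dl / 2 * (t - s))))%:E].
Proof.
have [C1 [T1 [C10 T11 hX]]] := wcount_l1.
have [C0 [T2 [C00 T21 heat]]] := @walk_kernel_heat R d a a0.
have [K K0 hK] := mean_mart_limit.
have [K2 K20 hK2] := @square_le_expR R (dl / 2)%R (divr_gt0 dl0 (ltr0n _ 2)).
have [K3 K30 hK3] := @expRN_le_sqrt (dl / 4)%R (divr_gt0 dl0 (ltr0n _ 4)).
pose Q : R := (Num.sqrt 2 ^+ d.+1)%R.
have s20 : (0 < Num.sqrt 2 :> R)%R by rewrite sqrtr_gt0.
have Q0 : (0 < Q)%R by rewrite exprn_gt0.
pose M := (C1 * Q + K * (C1 * Q + C0))%R.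
have M0 : (0 <= M)%R by rewrite addr_ge0// ?mulr_ge0 ?addr_ge0 ?mulr_ge0// ltW.
have c10 : (0 <= b * M * K2)%R by rewrite !mulr_ge0// ltW.
have c20 : (0 < b * (1 + K) * K3)%R by rewrite !mulr_gt0// ltr_pwDl.
exists (b * M * K2 + b * (1 + K) * K3)%R, (2 * Num.max T1 T2)%R; split.
- by rewrite ltr_wpDl.
- have : (1 <= Num.max T1 T2)%R by rewrite le_max T11.
  by move=> h; move: h; lra.
move=> i t s tT /andP[s0 st].
have tm : (Num.max T1 T2 <= t / 2)%R by rewrite ler_pdivlMr// mulrC.
have t2T1 : (T1 <= t / 2)%R by apply: le_trans tm; rewrite le_max lexx.
have t2T2 : (T2 <= t / 2)%R by apply: le_trans tm; rewrite le_max lexx orbT.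
have t21 : (1 <= t / 2)%R by exact: le_trans t2T1.
have tt2 : (t / 2 <= t)%R by move: t21; lra.
have t1 : (1 <= t)%R by exact: le_trans tt2.
have tp : (0 < t)%R by exact: lt_le_trans t1.
pose p := heat_kernel (a * t) (to_real R i); pose r := (Num.sqrt t ^+ d.+1)%R.
have r0 : (0 < r)%R by rewrite exprn_gt0// sqrtr_gt0.
have [p01 _ _] := hX i t (le_trans t2T1 tt2); have [p0 p1] := andP p01; rewrite -/p in p0 p1.
have mn := measurable_mart_limit.
have n0 w := mart_limit_ge0 w.
have mXr : mfunT (fun w => fine (X i s w)).
  by meas.
have x0 w : (0 <= fine (X i s w))%R by rewrite fine_ge0// wcount_ge0.
have merr : mfunT (fun w => (err i t s w)%:E).
  apply/measurable_EFinP; apply: measurableT_comp => //; apply: measurable_funB.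
    by apply: measurable_funM => //; exact: measurable_cst.
  apply: measurable_funM => //.
  apply: measurable_funM => //.
  by apply: measurable_funM => //; exact: mn.
have er0 : (0 <= expR (dl * t) / r)%R by rewrite divr_ge0 ?expR_ge0// ltW.
have comb (U : W -> R) (c1 c2 m1 : R) : mfunT U -> (forall w, 0 <= U w)%R ->
    (0 <= c1)%R -> (0 <= c2)%R -> \int[P]_w (U w)%:E <= m1%:E ->
    (forall w, err i t s w <= c1 * U w + c2 * mart_limit w)%R ->
    \int[P]_w (err i t s w)%:E <= (c1 * m1 + c2 * K)%:E.
  move=> mU U0 c1p c2p hU herr; rewrite -[(_ + _)%R]add0r.
  apply: (integral_le_lincomb (U := fun w => (U w)%:E) (V := fun w => (mart_limit w)%:E)) => //.
  - by meas.
  - by meas.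
  - by move=> w; rewrite lee_fin normr_ge0.
  by apply: nearW => w; rewrite add0e -!EFinM -EFinD lee_fin.
have [ts|ts] := leP (t / 2)%R s.
  have sp : (0 < s)%R by apply: lt_le_trans ts; rewrite divr_gt0.
  have [_ wps hXs] := hX i s (le_trans t2T1 ts).
  set ps := heat_kernel (a * s) (to_real R i) in wps hXs.
  have sig : (t - s <= t / 2)%R by move: ts; lra.
  have sig0 : (0 <= t - s)%R by rewrite subr_ge0.
  have [wpt _] := heat t (t - s)%R i 0%R (le_trans t2T2 tt2) sig0 sig.
  have rs : ((Num.sqrt s ^+ d.+1)^-1 <= Q / r)%R.
    have rs0 : (0 < Num.sqrt s ^+ d.+1)%R by rewrite exprn_gt0// sqrtr_gt0.
    rewrite -[leLHS]mul1r ler_pdivrMr// mulrAC ler_pdivlMr// mul1r /Q -exprMn -sqrtrM//.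
    by rewrite lerXn2r// ?nnegrE ?sqrtr_ge0// ler_wsqrtr//; move: ts; lra.
  pose E := expR (dl * s).
  have E0 : (0 <= E)%R by exact: expR_ge0.
  have Eas : (expR (- (b * s)) * expR (a * s) = E)%R by rewrite -expRD /E /dl; congr expR; ring.
  pose gm := (1 + (t - s))%R; have g1 : (1 <= gm)%R by rewrite lerDl.
  have g0 : (0 <= gm)%R by exact: le_trans g1.
  have pps : (`|ps - p| <= (C1 * Q + C0 * gm) / r)%R.
    have -> : (ps - p = (walk_kernel a s i - p) - (walk_kernel a s i - ps))%R by ring.
    apply: (le_trans (ler_normB _ _)); rewrite addrC mulrDl; apply: lerD.
      apply: (le_trans wps); rewrite -mulrA; apply: ler_wpM2l rs; exact: ltW.
    by move: wpt; rewrite subr0 subKr sqnorm0 addr0 sqrtr1 mulr1.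
  have := comb (fun w => `|fine (X i s w) - ps * mart_limit w * expR (a * s)|)%R (b * expR (- (b * s)))%R
     (b * E * `|ps - p|)%R (C1 * (expR (a * s) / Num.sqrt s ^+ d.+1))%R.
  move=> /(_ _ _ _ _ hXs) h; apply: le_trans (h _ _ _ _ _) _.
  - by meas.
  - by move=> w; exact: normr_ge0.
  - by rewrite mulr_ge0 ?expR_ge0// ltW.
  - by rewrite !mulr_ge0// ltW.
  - move=> w; rewrite /err -/p -/E.
    have -> : (b * expR (- (b * s)) * fine (X i s w) - b * (mart_limit w * p) * E =
       b * expR (- (b * s)) * (fine (X i s w) - ps * mart_limit w * expR (a * s)) + b * E * (ps - p) * mart_limit w)%R.
      by rewrite -Eas; ring.
    apply: (le_trans (ler_normD _ _)); rewrite !normrM (ger0_norm (ltW hb)) (ger0_norm (expR_ge0 _)).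
    by rewrite (ger0_norm E0) (ger0_norm (n0 w)).
  rewrite lee_fin.
  apply: (@le_trans _ _ (b * E * (gm * M / r)))%R.
    have -> : (b * expR (- (b * s)) * (C1 * (expR (a * s) / Num.sqrt s ^+ d.+1)) + b * E * `|ps - p| * K =
       b * E * (C1 * (Num.sqrt s ^+ d.+1)^-1 + K * `|ps - p|))%R by rewrite -Eas; ring.
    apply: ler_wpM2l; first by rewrite mulr_ge0// ltW.
    apply: (@le_trans _ _ (C1 * (Q / r) + K * ((C1 * Q + C0 * gm) / r)))%R.
      by apply: lerD; [apply: ler_wpM2l rs; exact: ltW|exact: ler_wpM2l].
    have -> : (C1 * (Q / r) + K * ((C1 * Q + C0 * gm) / r) = (C1 * Q + K * (C1 * Q + C0 * gm)) / r)%R by ring.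
    apply: ler_wpM2r; first by rewrite invr_ge0 ltW.
    have -> : (gm * M = gm * (C1 * Q) + K * (gm * (C1 * Q) + C0 * gm))%R by rewrite /M; ring.
    have c1q : (C1 * Q <= gm * (C1 * Q))%R by rewrite ler_peMl// mulr_ge0// ltW.
    by apply: lerD => //; apply: ler_wpM2l => //; rewrite lerD2r.
  have gK : (gm <= K2 * expR (dl / 2 * (t - s)))%R.
    by apply: le_trans (hK2 _ sig0); rewrite -/gm expr2 ler_peMl.
  apply: (@le_trans _ _ (b * E * (K2 * expR (dl / 2 * (t - s)) * M / r)))%R.
    apply: ler_wpM2l; first by rewrite mulr_ge0// ltW.
    by apply: ler_wpM2r; [rewrite invr_ge0 ltW|exact: ler_wpM2r].
  have -> : (b * E * (K2 * expR (dl / 2 * (t - s)) * M / r) = b * M * K2 * (expR (dl * t) / r) * expR (- (dl / 2 * (t - s))))%R.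
    have h2 : (E * expR (dl / 2 * (t - s)) = expR (dl * t) * expR (- (dl / 2 * (t - s))))%R.
      by rewrite /E -!expRD; congr expR; field.
    transitivity (b * M * K2 * (E * expR (dl / 2 * (t - s))) / r)%R; first by ring.
    by rewrite h2; ring.
  apply: ler_wpM2r; first exact: expR_ge0.
  by apply: ler_wpM2r => //; rewrite lerDl ltW.
pose E := expR (dl * s).
have E0 : (0 <= E)%R by exact: expR_ge0.
have Eas : (expR (- (b * s)) * expR (a * s) = E)%R by rewrite -expRD /E /dl; congr expR; ring.
have h := comb (fun w => fine (X i s w)) (b * expR (- (b * s)))%R (b * E)%R (expR (a * s)) mXr x0.
apply: le_trans (h _ _ (mean_wcount_le i s0) _) _.
- by rewrite mulr_ge0 ?expR_ge0// ltW.
- by rewrite mulr_ge0// ltW.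
- move=> w; rewrite /err -/p -/E; apply: (le_trans (ler_normB _ _)).
  rewrite (ger0_norm (mulr_ge0 (mulr_ge0 (ltW hb) (expR_ge0 _)) (x0 w))).
  rewrite (ger0_norm (mulr_ge0 (mulr_ge0 (ltW hb) (mulr_ge0 (n0 w) p0)) E0)) lerD2l mulrAC; apply: ler_wpM2l; first by rewrite mulr_ge0// ltW.
  by rewrite ler_piMr.
rewrite lee_fin -mulrA Eas.
have -> : (b * E + b * E * K = b * (1 + K) * E)%R by ring.
have -> : (E = expR (dl * t) * (expR (- (dl / 2 * (t - s))) * expR (- (dl / 2 * (t - s)))))%R.
  by rewrite /E -!expRD; congr expR; field.
have e3 : (expR (- (dl / 2 * (t - s))) <= K3 / r)%R.
  apply: le_trans (hK3 t t1); rewrite ler_expR lerN2.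
  have -> : (dl / 4 * t = dl / 2 * (t / 2))%R by field.
  by apply: ler_wpM2l; [rewrite divr_ge0// ltW|move: ts; lra].
apply: (@le_trans _ _ (b * (1 + K) * K3 * (expR (dl * t) / r) * expR (- (dl / 2 * (t - s)))))%R.
  have -> : (b * (1 + K) * K3 * (expR (dl * t) / r) * expR (- (dl / 2 * (t - s))) =
     b * (1 + K) * (expR (dl * t) * (expR (- (dl / 2 * (t - s))) * (K3 / r))))%R by ring.
  apply: ler_wpM2l; first by rewrite mulr_ge0 ?addr_ge0// ltW.
  apply: ler_wpM2l; first exact: expR_ge0.
  apply: ler_wpM2l => //; exact: expR_ge0.
apply: ler_wpM2r; first exact: expR_ge0.
by apply: ler_wpM2r => //; rewrite lerDr.
Qed.

(** [count_relation] leaves the weight at time [t], treated by [wcount_l1], and a time integral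
    whose main part is explicit. The decay of [mean_err] in [t - s] integrates to the factor
    [2 / dl], and the bounded remainders are absorbed because [expR (dl * t)] dominates the power of
    [t]. *)
Lemma count_l1 : exists C T0 : R, [/\ (0 < C)%R, (1 <= T0)%R & forall (i : site) t, (T0 <= t)%R ->
  \int[P]_w (`|((Z i t w)%:R - growth_limit w * heat_kernel (a * t) (to_real R i) * expR (dl * t))%R|%:E) <=
  (C * (expR (dl * t) / Num.sqrt t ^+ d.+1))%:E].
Proof.
have [C1 [T1 [C10 T11 hX]]] := wcount_l1.
have [C2 [T2 [C20 T21 hE]]] := mean_err.
have [K K0 hK] := mean_mart_limit.
have [K3 K30 hK3] := @expRN_le_sqrt dl dl0.
have bd0 : (0 <= b / dl)%R by rewrite divr_ge0// ltW.
have cK0 : (0 <= (1 + b / dl * K) * K3)%R by apply: mulr_ge0; [rewrite addr_ge0// mulr_ge0|exact: ltW].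
have cd0 : (0 <= C2 * (2 / dl))%R by apply: mulr_ge0; [|rewrite divr_ge0//]; exact: ltW.
exists (C1 + (1 + b / dl * K) * K3 + C2 * (2 / dl))%R, (Num.max T1 T2); split.
- by rewrite -addrA ltr_pwDl// addr_ge0.
- by rewrite le_max T11.
move=> i t; rewrite ge_max => /andP[tT1 tT2].
have t1 : (1 <= t)%R by exact: le_trans tT1.
have t0 : (0 < t)%R by exact: lt_le_trans t1.
pose p := heat_kernel (a * t) (to_real R i); pose r := (Num.sqrt t ^+ d.+1)%R.
have r0 : (0 < r)%R by rewrite exprn_gt0// sqrtr_gt0.
have tp := ltW t0.
have [p01 _ hXt] := hX i t tT1; rewrite -/p in p01 hXt; have [p0 _] := andP p01.
have mn := measurable_mart_limit.
have n0 w := mart_limit_ge0 w.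
pose er s w := (err i t s w)%:E.
have er0 s w : 0 <= er s w by rewrite lee_fin normr_ge0.
have mD : measurable (`]0%R, t[%classic : set (borel R)) by exact: measurable_itv.
have Dsub : `]0%R, t[%classic `<=` `[0%R, +oo[%classic := itv_oo_sub (lexx (0 : R)%R).
pose A w := (`|fine (X i t w) - p * mart_limit w * expR (a * t)|)%R.
have mX : mfunT (X i t) := measurable_wcount i tp.
have mXr : mfunT (fun w => fine (X i t w)) by meas.
have mA : mfunT A.
  by meas.
pose f1 w := (expR (- (b * t)))%:E * (A w)%:E.
pose f2 w := (b / dl)%:E * (mart_limit w)%:E.
pose f3 w := \int[leb]_(s in `]0%R, t[) er s w.
have mA1 : mfunT (fun w => (A w)%:E) by meas.
have mn1 : mfunT (fun w => (mart_limit w)%:E) by meas.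
have m1 : mfunT f1 by meas.
have m2 : mfunT f2 by meas.
have m3 : mfunT f3.
  exact: (measurable_path_integral (measurable_err i t) er0 mD Dsub).
have A0 w : 0 <= (A w)%:E by rewrite lee_fin normr_ge0.
have f10 w : 0 <= f1 w by rewrite mule_ge0// lee_fin expR_ge0.
have f20 w : 0 <= f2 w by rewrite mule_ge0// lee_fin.
have f30 w : 0 <= f3 w by apply: integral_ge0 => s _; exact: er0.
have mZ : mfunT (fun w => ((Z i t w)%:R : R)).
  by meas.
have mabs : mfunT (fun w => (`|(Z i t w)%:R - growth_limit w * p * expR (dl * t)|%R)%:E).
  apply/measurable_EFinP; apply: measurableT_comp => //; apply: measurable_funB => //.
  apply: measurable_funM => //.
  apply: measurable_funM => //.
  by apply: measurable_funM => //; exact: mn.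
have path : {ae P, forall w, setT w ->
    (`|((Z i t w)%:R - growth_limit w * p * expR (dl * t))%R|%:E) <= f1 w + (1 + (f2 w + f3 w))}.
  apply: filterS2 (count_relation i (ltW t0)) (good_path_ae) => w [_ [rel If]] gw _.
  have Xf s : (0 <= s)%R -> X i s w < +oo.
    by move=> s0; apply: le_lt_trans (wcount_le i gw s0) _; exact: ltry.
  have Xe s : (0 <= s)%R -> X i s w = (fine (X i s w))%:E.
    by move=> s0; rewrite fineK// ge0_fin_numE ?wcount_ge0// Xf.
  pose f s := (b * expR (- (b * s)) * fine (X i s w))%R.
  pose g s := (b * (mart_limit w * p) * expR (dl * s))%R.
  have inD s : `]0%R, t[%classic s -> (0 <= s)%R by rewrite /= in_itv/= => /andP[/ltW].
  have EI : \int[leb]_(s in `]0%R, t[) ((b * expR (- (b * s)))%:E * X i s w) = \int[leb]_(s in `]0%R, t[) (f s)%:E.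
    by apply: eq_integral => s; rewrite inE => /inD s0; rewrite Xe.
  rewrite EI in rel If.
  have g0 s : (0 <= g s)%R by exact: mulr_ge0 (mulr_ge0 (ltW hb) (mulr_ge0 (n0 w) p0)) (expR_ge0 _).
  have f0 s : (0 <= f s)%R by rewrite mulr_ge0 ?mulr_ge0 ?expR_ge0 ?fine_ge0 ?wcount_ge0// ltW.
  have EJ : \int[leb]_(s in `]0%R, t[) (g s)%:E = (b * (mart_limit w * p) / dl * (expR (dl * t) - 1))%:E.
    have bnp : (0 <= b * (mart_limit w * p))%R by exact: mulr_ge0 (ltW hb) (mulr_ge0 (n0 w) p0).
    by rewrite (integral_expR bnp (lt0r_neq0 dl0) tp) mulr0 expR0.
  have mexp c : measurable_fun `]0%R, t[ (fun s : borel R => expR (c * s)).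
    apply: measurable_funTS; apply: measurableT_comp; first exact: measurable_expR.
    by apply: measurable_funM => //; exact: measurable_cst.
  have mf : measurable_fun `]0%R, t[ (f : borel R -> R).
    apply: measurable_funM.
      apply: measurable_funM => //.
      have -> : (fun s : borel R => expR (- (b * s))) = (fun s => expR (- b * s)) by apply/funext => s; rewrite mulNr.
      exact: mexp.
    by apply: measurableT_comp => //; exact: measurable_path_count.
  have mg : measurable_fun `]0%R, t[ (g : borel R -> R).
    by apply: measurable_funM => //; exact: mexp.
  have gf : \int[leb]_(s in `]0%R, t[) (g s)%:E < +oo by rewrite EJ ltry.
  have := norm_diff_integral_le mD mf mg (fun s _ => f0 s) (fun s _ => g0 s) If gf.
  rewrite EJ -/(f3 w) => hd3.
  move: (f3 w) (f30 w) hd3 => [v| |] v0 // => [|_]; last by rewrite !addey ?leey.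
  rewrite lee_fin => hd3.
  rewrite /f1 /f2 -!EFinM -!EFinD lee_fin.
  move: rel hd3; set I := fine (\int[leb]_(s in _) (f s)%:E); set J := fine (_)%:E => rel hd3.
  have -> : ((Z i t w)%:R = expR (- (b * t)) * fine (X i t w) + I - (i == 0)%:R)%R by rewrite rel addrK.
  have Edl : (expR (- (b * t)) * expR (a * t) = expR (dl * t))%R by rewrite -expRD /dl; congr expR; ring.
  have JE : (J = (b / dl) * mart_limit w * p * (expR (dl * t) - 1))%R by rewrite /J /=; ring.
  have HE : (growth_limit w * p * expR (dl * t) = mart_limit w * p * expR (dl * t) + J + (b / dl) * mart_limit w * p)%R.
    rewrite JE /growth_limit; have -> : (a / dl = 1 + b / dl)%R.
      by rewrite -[X in (X + _)%R](@divff _ dl) ?lt0r_neq0// -mulrDl /dl subrK.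
    by ring.
  have -> : (expR (- (b * t)) * fine (X i t w) + I - (i == 0)%:R - growth_limit w * p * expR (dl * t) =
    expR (- (b * t)) * (fine (X i t w) - p * mart_limit w * expR (a * t)) - (((i == 0)%:R + (b / dl) * mart_limit w * p) - (I - J)))%R.
    by rewrite HE -Edl; ring.
  apply: (le_trans (ler_normB _ _)); rewrite normrM (ger0_norm (expR_ge0 _)); apply: lerD => //.
  apply: (le_trans (ler_normB _ _)); rewrite addrA; apply: lerD => //.
  have bn0 : (0 <= b / dl * mart_limit w)%R by rewrite mulr_ge0.
  rewrite ger0_norm; last by rewrite addr_ge0// mulr_ge0.
  apply: lerD; first by case: (i == 0%R).
  by rewrite ler_piMr//; have [_] := andP p01.
have c30 : (0 <= C2 * (expR (dl * t) / r))%R by rewrite mulr_ge0 ?divr_ge0 ?expR_ge0// ltW.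
have i3 : \int[P]_w f3 w <= (C2 * (expR (dl * t) / r) * (2 / dl))%:E.
  rewrite (expectation_time_integral (measurable_err i t) er0 mD Dsub).
  have dl20 : (0 < dl / 2)%R by rewrite divr_gt0.
  have hs s : `]0%R, t[%classic s -> \int[P]_w er s w <=
     (C2 * (expR (dl * t) / r) * expR (- (dl / 2 * t)) * expR (dl / 2 * s))%:E.
    rewrite /= in_itv/= => /andP[s0 st]; apply: le_trans (hE i t s tT2 _) _; first by rewrite !ltW.
    rewrite lee_fin -[leRHS]mulrA -expRD; have -> : (- (dl / 2 * t) + dl / 2 * s = - (dl / 2 * (t - s)))%R by ring.
    exact: lexx.
  have cc0 : (0 <= C2 * (expR (dl * t) / r) * expR (- (dl / 2 * t)))%R by rewrite mulr_ge0 ?expR_ge0.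
  apply: (@le_trans _ _ (\int[leb]_(s in `]0%R, t[)
     (C2 * (expR (dl * t) / r) * expR (- (dl / 2 * t)) * expR (dl / 2 * s))%:E)).
    apply: ge0_le_integral.
    - exact: mD.
    - by move=> s _; apply: integral_ge0 => w _; exact: er0.
    - exact: (measurable_expectation (measurable_err i t) er0 mD).
    - apply: measurable_funTS; apply/measurable_EFinP; apply: measurable_funM => //.
      by apply: measurableT_comp; [exact: measurable_expR|apply: measurable_funM => //; exact: measurable_cst].
    - exact: hs.
  rewrite (integral_expR cc0 (lt0r_neq0 dl20) tp) mulr0 expR0 lee_fin.
  have -> : (C2 * (expR (dl * t) / r) * expR (- (dl / 2 * t)) / (dl / 2) * (expR (dl / 2 * t) - 1) =
     C2 * (expR (dl * t) / r) * (2 / dl) * (expR (- (dl / 2 * t)) * (expR (dl / 2 * t) - 1)))%R by field; rewrite lt0r_neq0//= lt0r_neq0.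
  have d20 : (0 <= 2 / dl)%R by apply: divr_ge0 => //; exact: ltW.
  rewrite ler_piMr//; first exact: mulr_ge0.
  by rewrite mulrBr -expRD addNr expR0 mulr1 lerBlDr lerDl expR_ge0.
have m23 : mfunT (fun w => f2 w + f3 w) by exact: emeasurable_funD.
have p23 w : 0 <= f2 w + f3 w by exact: adde_ge0.
have i2 := integral_le_lincomb (f := fun w => f2 w + f3 w) (U := fun w => (mart_limit w)%:E) (V := f3) (c0 := 0%R) (c1 := (b / dl)%R) (c2 := 1%R) _ _ _ _ _ _ _ _ _ hK i3.
apply: le_trans (integral_le_lincomb (U := fun w => (A w)%:E) (V := fun w => f2 w + f3 w) (c0 := 1%R) (c1 := expR (- (b * t))) (c2 := 1%R)
  _ _ _ _ _ _ _ _ _ hXt (i2 _ _ _ _ _ _ _ _ _ _) _) _ => //.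
- by apply: nearW => w; rewrite add0e mul1e.
- by apply: filterS path => w /(_ Logic.I); rewrite mul1e addeCA.
rewrite lee_fin add0r !mul1r.
have -> : (expR (- (b * t)) * (C1 * (expR (a * t) / r)) = C1 * (expR (dl * t) / r))%R.
  by rewrite (_ : dl * t = - (b * t) + a * t)%R; [rewrite expRD; ring|rewrite /dl; ring].
have one : (1 <= K3 * (expR (dl * t) / r))%R.
  have := hK3 t t1; rewrite expRN -/r => h.
  rewrite mulrCA -[X in (X <= _)%R](@divff _ (expR (dl * t)))//; last by rewrite lt0r_neq0 ?expR_gt0.
  by apply: ler_wpM2l; [exact: expR_ge0|].
have -> : ((C1 + (1 + b / dl * K) * K3 + C2 * (2 / dl)) * (expR (dl * t) / r) =
  (1 + b / dl * K) * (K3 * (expR (dl * t) / r)) + (C1 * (expR (dl * t) / r) + C2 * (expR (dl * t) / r) * (2 / dl)))%R by ring.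
have kk : (1 + b / dl * K <= (1 + b / dl * K) * (K3 * (expR (dl * t) / r)))%R.
  by rewrite ler_peMr// addr_ge0// mulr_ge0.
by move: kk; lra.
Qed.

End counts.

(** * Convergence at the diffusive scale *)

Section scaling.
Let dl : R := (a - b)%R.
Let dl0 : (0 < dl)%R. Proof. by rewrite subr_gt0. Qed.

Lemma growth_limit_ge0 w : (0 <= growth_limit w)%R.
Proof. by rewrite mulr_ge0 ?divr_ge0 ?mart_limit_ge0// ltW. Qed.

Lemma measurable_growth_limit : mfunT growth_limit.
Proof. by apply: measurable_funM => //; exact: measurable_mart_limit. Qed.

Let scaled_kernel (x : 'rV[R]_d) (t : R) : R := heat_kernel a ((Num.sqrt t)^-1 *: to_real R (floor_site (Num.sqrt t *: x)))%R.

(** Markov's inequality for two errors: that of [count_l1], of which the normalization leaves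
    [(Num.sqrt t)^-1], and that of evaluating the kernel at a rounded site instead of [x]. *)
Let count_tail (x : 'rV[R]_d) : exists C M T0 : R, (1 <= T0)%R /\ forall eps t, (0 < eps)%R -> (T0 <= t)%R ->
  P [set w | (eps <= `|t `^ (d%:R / 2) * expR (- (dl * t)) * (Z (floor_site (Num.sqrt t *: x)) t w)%:R
     - growth_limit w * heat_kernel a x|)%R] <=
  ((C * (Num.sqrt t)^-1 + M * `|scaled_kernel x t - heat_kernel a x|) / eps)%:E.
Proof.
have [C [T0 [C0 T01 hC]]] := count_l1.
have [K K0 hK] := mean_mart_limit.
pose M := (a / dl * K)%R.
have adl0 : (0 <= a / dl)%R by rewrite divr_ge0// ltW.
exists C, M, T0; split => // eps t eps0 tT.
have t1 : (1 <= t)%R by exact: le_trans tT.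
have t0 : (0 < t)%R by exact: lt_le_trans t1.
have s0 : (0 < Num.sqrt t)%R by rewrite sqrtr_gt0.
pose q := scaled_kernel x.
set i := floor_site (Num.sqrt t *: x).
pose Y w := (t `^ (d%:R / 2) * expR (- (dl * t)) * (Z i t w)%:R - growth_limit w * heat_kernel a x)%R.
have mZ : mfunT (fun w => ((Z i t w)%:R : R)) := measurable_count i (ltW t0).
have mH := measurable_growth_limit.
have mY : mfunT Y.
  by meas.
pose D w := (`|(Z i t w)%:R - growth_limit w * heat_kernel (a * t) (to_real R i) * expR (dl * t)|)%R.
have mD : mfunT (fun w => (D w)%:E).
  by meas.
pose c1 := (t `^ (d%:R / 2) * expR (- (dl * t)))%R.
pose c2 := (`|q t - heat_kernel a x|)%R.
have c10 : (0 <= c1)%R by rewrite mulr_ge0 ?powR_ge0 ?expR_ge0.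
have D0 w : 0 <= (D w)%:E by rewrite lee_fin normr_ge0.
have hY w : (`|Y w|%R)%:E <= 0 + (c1%:E * (D w)%:E + (c2 * (a / dl))%:E * (mart_limit w)%:E).
  rewrite add0e -!EFinM -EFinD lee_fin -[(c2 * _ * _)%R]mulrA -/(growth_limit w).
  have e1 : (expR (- (dl * t)) * expR (dl * t) = 1)%R by rewrite -expRD addNr expR0.
  have -> : (Y w = c1 * ((Z i t w)%:R - growth_limit w * heat_kernel (a * t) (to_real R i) * expR (dl * t))
      + (q t - heat_kernel a x) * growth_limit w)%R.
    rewrite /q /scaled_kernel -/i -(heat_kernel_scale (to_real R i) a0 t0) /c1 /Y.
    transitivity (t `^ (d%:R / 2) * expR (- (dl * t)) * (Z i t w)%:R - growth_limit w * heat_kernel a x +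
      growth_limit w * (t `^ (d%:R / 2) * heat_kernel (a * t) (to_real R i)) * (1 - expR (- (dl * t)) * expR (dl * t)))%R; last by ring.
    by rewrite e1 subrr mulr0 addr0.
  by apply: (le_trans (ler_normD _ _)); rewrite (normrM c1) (normrM _ (growth_limit w)) (ger0_norm c10) (ger0_norm (growth_limit_ge0 _)).
rewrite -(@lee_pmul2l _ eps%:E)// ?lte_fin//.
have mYn : mfunT (fun w => (`|Y w|%R)%:E) by meas.
have mn1 : mfunT (fun w => (mart_limit w)%:E) by meas.
have Yn0 w : 0 <= (`|Y w|%R)%:E by rewrite lee_fin.
have mn0 w : 0 <= (mart_limit w)%:E by rewrite lee_fin mart_limit_ge0.
have markov : eps%:E * P [set w | (eps <= `|Y w|)%R] <= _ := markov_le P eps0 mY mYn (fun w => lexx (`|Y w|%R)%:E).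
apply: (le_trans markov).
have cc : (0 <= c2 * (a / dl))%R by exact: mulr_ge0 (normr_ge0 _) adl0.
have h := @integral_le_lincomb _ _ _ P _ _ _ 0%R c1 (c2 * (a / dl))%R _ _ mYn mD mn1 Yn0 D0 mn0 (lexx _) c10 cc (hC i t tT) hK (nearW _ hY).
apply: (le_trans (h _)).
rewrite add0r -(mulrA c2) -/M.
rewrite -EFinM lee_fin [leRHS]mulrCA divff ?lt0r_neq0// mulr1; apply: lerD; last by rewrite mulrC.
have -> : (c1 * (C * (expR (dl * t) / Num.sqrt t ^+ d.+1)) = (expR (- (dl * t)) * expR (dl * t)) * (C * (t `^ (d%:R / 2) / Num.sqrt t ^+ d.+1)))%R by rewrite /c1; ring.
rewrite -expRD addNr expR0 mul1r; apply: ler_wpM2l; first exact: ltW.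
have r0 : (0 < Num.sqrt t ^+ d)%R by rewrite exprn_gt0.
by rewrite powR_half ?(ltW t0)// [(Num.sqrt t ^+ _.+1)%R]exprS invfM mulrCA divff ?mulr1// lt0r_neq0.
Qed.

Lemma count_cvg x : cvg_in_probability P
  (fun t w => t `^ (d%:R / 2) * expR (- (dl * t)) * (Z (floor_site (Num.sqrt t *: x)) t w)%:R)%R
  (fun w => growth_limit w * heat_kernel a x)%R.
Proof.
have [C [M [T0 [T01 h]]]] := count_tail x.
move=> eps eps0.
pose B (t : R) := ((C * (Num.sqrt t)^-1 + M * `|scaled_kernel x t - heat_kernel a x|) / eps)%R.
have Bcvg : B t @[t --> +oo%R] --> (0 : R)%R.
  have -> : (0 = (C * 0 + M * `|heat_kernel a x - heat_kernel a x|) / eps :> R)%R.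
    by rewrite subrr normr0 !mulr0 addr0 mul0r.
  apply: cvgM; last exact: cvg_cst.
  apply: cvgD; first by apply: cvgM; [exact: cvg_cst|exact: inv_sqrt_cvg].
  apply: cvgM; first exact: cvg_cst.
  by apply: cvg_norm; apply: cvgB; [exact: heat_kernel_floor_cvg|exact: cvg_cst].
have BE : (B t)%:E @[t --> +oo%R] --> 0%R%:E by apply: cvg_EFin => //; exact: filterE.
apply: (@squeeze_cvge _ _ _ _ (cst 0) _ (fun t => (B t)%:E)) BE; last exact: cvg_cst.
have : \forall t \near +oo%R, (T0 <= t)%R by apply: nbhs_pinfty_ge; exact: num_real.
apply: filterS => t tT; apply/andP; split; first exact: measure_ge0.
exact: h.
Qed.

(** The error of [count_l1] is of order [t ^ (- (d + 1) / 2)], and [1 / 2] exceeds [1 / 3]. *)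
Lemma count_expectation : exists C T0 : R, [/\ (0 < C)%R, (0 < T0)%R & forall (i : site) t, (T0 <= t)%R ->
  'E_P[fun w => (`|(Z i t w)%:R - growth_limit w * heat_kernel (a * t) (to_real R i) * expR (dl * t)|)%R] <=
  (C * expR (dl * t) / t `^ (d%:R / 2 + 1 / 3))%:E].
Proof.
have [C [T0 [C0 T01 hC]]] := count_l1; exists C, T0; split => //; first exact: lt_le_trans T01.
move=> i t tT; rewrite unlock; apply: le_trans (hC i t tT) _; rewrite lee_fin -mulrA.
have t1 : (1 <= t)%R by exact: le_trans tT.
have t0 : (0 < t)%R by exact: lt_le_trans t1.
apply: ler_wpM2l; first exact: ltW.
apply: ler_wpM2l; first exact: expR_ge0.
rewrite lef_pV2 ?posrE ?powR_gt0 ?exprn_gt0 ?sqrtr_gt0//.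
rewrite -powR_half ?(ltW t0)//; apply: ler_powR => //.
by rewrite -[d.+1]addn1 natrD; lra.
Qed.

End scaling.

(** * Positivity of the limit on survival *)

Section survival.
Local Notation T := (total).

Let dl : R := (a - b)%R.
Let dl0 : (0 < dl)%R. Proof. by rewrite subr_gt0. Qed.

Lemma total_adapted t : (0 <= t)%R -> mfunT (T t : sigmaT (F t) -> \bar R).
Proof.
move=> t0; have -> : T t = fun w => lsum (fun j => X j t w) by apply/funext => w; exact: totalE.
apply: (measurable_lsum (W := sigmaT (F t)) (g := fun j w => X j t w)) => // [j w|j].
  exact: wcount_ge0.
exact: wcount_adapted.
Qed.

Lemma total_adapted_le s t : (0 <= s)%R -> (s <= t)%R -> mfunT (T s : sigmaT (F t) -> \bar R).
Proof. by move=> s0 st; apply: (filtration_measurable_fun s0 st); exact: total_adapted. Qed.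

(** Almost surely this is the absence of jumps between [s] and [t]; in terms of the mass it is
    clearly known at time [t]. *)
Definition quiet (s t : R) : set W := [set w | T t w = T s w].

Lemma quiet_adapted s t : (0 <= s)%R -> (s <= t)%R -> F t (quiet s t).
Proof.
move=> s0 st; have t0 := le_trans s0 st; rewrite -(filtration_id hF t0).
have := measurable_eqe measurableT (total_adapted t0) (total_adapted_le s0 st).
by rewrite setTI.
Qed.

Lemma filtrationI t A B : (0 <= t)%R -> F t A -> F t B -> F t (A `&` B).
Proof.
move=> t0; rewrite -(filtration_id hF t0) => FA FB.
exact: (@measurableI _ (sigmaT (F t))).
Qed.

(** A jump after time [r] adds at least [expR (b * r)] to the weight of its site. *)
Lemma total_gap r t : (0 <= r)%R -> (r <= t)%R -> {ae P, forall w,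
  ((forall j, Z j t w = Z j r w) /\ T t w = T r w) \/ T r w + (expR (b * r))%:E <= T t w}.
Proof.
move=> r0 rt; have t0 := le_trans r0 rt.
have nl s : (0 <= s)%R -> {ae P, forall w, forall j, points N j w (`[s, s] `*` `[0%R, +oo[) = 0}.
  by move=> s0; apply: forall_site_ae => j; exact: (line_null j s0).
apply: filterS3 (nl r r0) (nl t t0) (good_path_ae) => w nr nt gw.
pose m j : {measure set (borel R) -> \bar R} := path_meas (Z j ^~ w).
have x0 j s : 0 <= X j s w by exact: wcount_ge0.
have ZE j : (m j `[r, t[%classic) + ((Z j r w)%:R)%:E = ((Z j t w)%:R)%:E.
  rewrite -(path_meas_co_count gw r0 (nr j)) -(path_meas_co_count gw t0 (nt j)) addeC.
  rewrite -measureU; [|exact: measurable_itv..|]; last first.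
    by apply/seteqP; split => // s [] /=; rewrite !in_itv/= => /andP[_ sr] /andP[rs _]; move: (lt_le_trans sr rs); rewrite ltxx.
  congr (m j _); rewrite -itv_bndbnd_setU// bnd_simp//.
have me : measurable_fun `[r, t[ (fun s : borel R => (expR (b * s))%:E).
  by apply: measurable_funTS; exact: measurable_exp.
have lo j : (expR (b * r))%:E * m j `[r, t[%classic <= \int[m j]_(s in `[r, t[) (expR (b * s))%:E.
  have -> : (expR (b * r))%:E * m j `[r, t[%classic = \int[m j]_(s in `[r, t[) (cst (expR (b * r))%:E s).
    by rewrite integral_cst//; exact: measurable_itv.
  apply: ge0_le_integral => //= s.
  by rewrite in_itv/= => /andP[rs _]; rewrite lee_fin ler_expR ler_wpM2l// ltW.
have [hall|/existsNP[j0 hj0]] := pselect (forall j, Z j t w = Z j r w); [left|right].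
  split => //; rewrite !totalE; apply: eq_lsum => j.
  rewrite (wcount_split j gw r0 rt).
  rewrite null_set_integral ?adde0//.
  have := ZE j; rewrite hall; move: (m j _) => [v| |]// [] /eqP.
  by rewrite -subr_eq0 addrK => /eqP ->.
have cf := good_counting gw j0.
have Zlt : (Z j0 r w < Z j0 t w)%N.
  by rewrite ltn_neqAle (counting_nondecreasing cf r0 rt) andbT; apply/eqP => h; apply: hj0; rewrite h.
have m1 : 1 <= m j0 `[r, t[%classic.
  have := ZE j0; move: (m j0 _) => [v| |]// [] vE; rewrite lee_fin.
  have h : ((Z j0 r w)%:R + 1 <= (Z j0 t w)%:R :> R)%R by rewrite natr1 ler_nat.
  by rewrite -(lerD2r (Z j0 r w)%:R) vE addrC.
have Xj0 : X j0 r w + (expR (b * r))%:E <= X j0 t w.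
  rewrite (wcount_split j0 gw r0 rt); apply: leeD2l; apply: le_trans (lo j0).
  by rewrite -[leLHS]mule1; apply: lee_wpmul2l => //; rewrite lee_fin expR_ge0.
pose g j : \bar R := if j == j0 then (expR (b * r))%:E else 0.
have g0 j : 0 <= g j by rewrite /g; case: ifP => // _; rewrite lee_fin expR_ge0.
have -> : (expR (b * r))%:E = lsum g.
  by rewrite (@lsum_finite _ _ _ [:: j0])// ?big_seq1 /g ?eqxx// => j; rewrite inE => /negbTE ->.
rewrite !totalE -lsumD//; apply: le_lsum => j; first by rewrite adde_ge0.
rewrite /g; case: eqP => [->//|_]; rewrite adde0; exact: (wcount_mono j gw rt).
Qed.

(** On [A] the mean mass grows by a factor of at most [expR (a * h)], whereas every path that is not
    quiet gains at least [expR (b * r)]. Hence such paths make up at most a proportion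
    [c * (expR (a * h) - 1)] of [A]. *)
Lemma quiet_step A c r h : (0 <= r)%R -> (0 <= h)%R -> (0 <= c)%R -> F r A ->
  (forall w, A w -> T r w <= (c * expR (b * r))%:E) ->
  (fine (P A) * (1 - c * (expR (a * h) - 1)) <= fine (P (A `&` quiet r (r + h))))%R.
Proof.
move=> r0 h0 c0 FA hA; have rh : (r <= r + h)%R by rewrite lerDl.
have t0 := le_trans r0 rh.
have mA : measurable A := filtration_measurable hF r0 FA.
have mQ : measurable (quiet r (r + h)) := filtration_measurable hF t0 (quiet_adapted r0 rh).
pose phi w : R := \1_A w.
have phi1 w : (0 <= phi w <= 1)%R by rewrite /phi indicE ler0n lern1 leq_b1.
have mphi : mfunT (phi : sigmaT (F r) -> R).
  by apply: measurable_indic; rewrite /measurable/= filtration_id.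
have mphiT : mfunT phi by meas.
have := total_growth r0 rh phi1 mphi; rewrite (addrC r h) addrK (addrC h r) => G.
have phi0 w : 0 <= (phi w)%:E by rewrite lee_fin; have /andP[] := phi1 w.
pose E := (expR (b * r))%R; have E0 : (0 < E)%R by exact: expR_gt0.
pose D := A `\` quiet r (r + h); have mD : measurable D by exact: measurableD.
have mT s : (0 <= s)%R -> mfunT (fun w => (phi w)%:E * T s w).
  by move=> s0; apply: emeasurable_funM; [exact/measurable_EFinP|exact: measurable_total].
have T0 s w : 0 <= (phi w)%:E * T s w by rewrite mule_ge0// total_ge0.
pose I := \int[P]_w ((phi w)%:E * T r w).
have I0 : 0 <= I by exact: integral_ge0.
have Ile : I <= (c * E * fine (P A))%:E.
  rewrite [leRHS]EFinM -probabilityE//.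
  have -> : P A = \int[P]_w (phi w)%:E by rewrite integral_indic// setIT.
  rewrite -ge0_integralZl_EFin//; [|exact/measurable_EFinP|by rewrite mulr_ge0// ltW].
  have m1 : mfunT (fun w => (c * E)%:E * (phi w)%:E).
    by meas.
  apply: ge0_le_integral => //; first exact: mT.
  move=> w _; rewrite /phi indicE; have [wA|wA] := boolP (w \in A); last by rewrite mul0e mule0.
  by rewrite mul1e mule1; apply: hA; rewrite -inE.
have If : I \is a fin_num by rewrite ge0_fin_numE//; exact: le_lt_trans Ile (ltry _).
have mID : mfunT (fun w => (\1_D w)%:E : \bar R) by meas.
have mED : mfunT (fun w => E%:E * (\1_D w)%:E) by meas.
have ED0 w : 0 <= E%:E * (\1_D w)%:E by rewrite mule_ge0// lee_fin ltW.
have low : I + (E * fine (P D))%:E <= \int[P]_w ((phi w)%:E * T (r + h)%R w).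
  have -> : (E * fine (P D))%:E = \int[P]_w (E%:E * (\1_D w)%:E).
    rewrite ge0_integralZl_EFin//; [|exact: ltW].
    by rewrite integral_indic// setIT EFinM -probabilityE.
  have -> : I + \int[P]_w (E%:E * (\1_D w)%:E) = \int[P]_w ((phi w)%:E * T r w + E%:E * (\1_D w)%:E).
    by rewrite ge0_integralD//; exact: mT.
  have mS : mfunT (fun w => (phi w)%:E * T r w + E%:E * (\1_D w)%:E).
    by meas.
  have S0 w : 0 <= (phi w)%:E * T r w + E%:E * (\1_D w)%:E by rewrite adde_ge0.
  have key : {ae P, forall w, setT w -> (phi w)%:E * T r w + E%:E * (\1_D w)%:E <= (phi w)%:E * T (r + h)%R w}.
    apply: filterS (total_gap r0 rh) => w gap _; rewrite /phi !indicE.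
    have [wA|wA] := boolP (w \in A); last first.
      by rewrite !mul0e add0e (_ : w \in D = false) ?mule0//; apply/negP; rewrite inE => -[]; rewrite -inE (negbTE wA).
    rewrite !mul1e; have [wD|wD] := boolP (w \in D).
      rewrite mule1; case: gap => // -[_ q]; by move: wD; rewrite inE => -[_]; case.
    rewrite mule0 adde0; case: gap => [[_ ->]//|]; apply: le_trans; apply: leeDl; rewrite lee_fin; exact: ltW.
  by apply: ae_ge0_le_integral => //; exact: mT.
have := le_trans low G; rewrite -/I.
move: I If I0 Ile {low G} => [v| |]// _ v0 Ile; rewrite -EFinM -EFinD lee_fin => h1.
have DI := finePDI P mA mQ; rewrite -/D in DI.
set pA := fine (P A) in DI Ile *; set pD := fine (P D) in DI h1; set pQ := fine (P (A `&` _)) in DI *.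
have eh : (0 <= expR (a * h) - 1)%R by rewrite subr_ge0 -expR0 ler_expR mulr_ge0// ltW.
move: Ile v0; rewrite !lee_fin => Ile v0.
have h2 : (E * pD <= (expR (a * h) - 1) * (c * E * pA))%R.
  apply: (@le_trans _ _ ((expR (a * h) - 1) * v)%R); last exact: ler_wpM2l.
  by move: h1; rewrite mulrBl mul1r; lra.
have {}h2 : (pD <= c * (expR (a * h) - 1) * pA)%R.
  rewrite -(ler_pM2l E0); apply: le_trans h2 _; rewrite le_eqVlt; apply/orP; left; apply/eqP; ring.
have -> : pQ = (pA - pD)%R by rewrite DI addrC addKr.
have -> : (pA * (1 - c * (expR (a * h) - 1)) = pA - c * (expR (a * h) - 1) * pA)%R by ring.
by rewrite lerD2l lerN2.
Qed.

(** From [expR (2 * x) >= 1 + 2 * x] and [(1 + 2 * x) * (1 - x) >= 1] on this range. *)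
Lemma expRN2_le (x : R) : (0 <= x <= 2^-1)%R -> (expR (- (2 * x)) <= 1 - x)%R.
Proof.
move=> /andP[x0 x1]; have p : (0 < 1 + 2 * x)%R by rewrite ltr_pwDl// mulr_ge0.
rewrite expRN; apply: (@le_trans _ _ (1 + 2 * x)^-1%R).
  by rewrite lef_pV2 ?posrE ?expR_gt0//; exact: expR_ge1Dx.
by rewrite -[leLHS]mul1r ler_pdivrMr//; nra.
Qed.

(** Successive quiet steps of length [h] after [u], inside [A]. Along them the mass is constant
    while the mass added by a jump increases with time, so the proportions lost decrease
    geometrically and their product stays positive. *)
Let chain (A : set W) (u h : R) := fix chain n :=
  if n is n'.+1 then chain n' `&` quiet (u + n'%:R * h) (u + n'%:R * h + h) else A.

Let chainP A u h n : (0 <= u)%R -> (0 <= h)%R -> F u A ->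
  F (u + n%:R * h)%R (chain A u h n) /\ forall w, chain A u h n w -> A w /\ T (u + n%:R * h)%R w = T u w.
Proof.
move=> u0 h0 FA; elim: n => [|n [IH1 IH2]] /=; first by rewrite mul0r addr0.
have n0 : (0 <= u + n%:R * h)%R by rewrite addr_ge0// mulr_ge0.
have nh : (u + n%:R * h <= u + n%:R * h + h)%R by rewrite lerDl.
have -> : (u + n.+1%:R * h = u + n%:R * h + h)%R by rewrite -natr1; ring.
have nh0 := le_trans n0 nh.
split; last by move=> w [/IH2[Aw <-] q].
by apply: filtrationI => //; [exact: (filtration_nondecreasing hF n0 nh)|exact: quiet_adapted].
Qed.

(* Writing q for exp (- b h), the step from u + n h to u + (n+1) h loses at most the proportion K (exp (a h) - 1) q ^ n. *)
Let chain_probability A u h K : (0 <= u)%R -> (0 < h)%R -> (0 <= K)%R -> F u A ->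
  (forall w, A w -> T u w <= (K * expR (b * u))%:E) -> (K * (expR (a * h) - 1) <= 2^-1)%R -> forall n,
  (fine (P A) * expR (- (2 * (K * (expR (a * h) - 1)) / (1 - expR (- (b * h))))) <= fine (P (chain A u h n)))%R.
Proof.
move=> u0 h0 K0 FA hA; set kp := (K * _)%R => kp2; set q := expR (- (b * h)) => n.
have q0 : (0 < q)%R by exact: expR_gt0.
have q1 : (q < 1)%R by rewrite -expR0 ltr_expR oppr_lt0 mulr_gt0.
have kp0 : (0 <= kp)%R by rewrite mulr_ge0// subr_ge0 -expR0 ler_expR mulr_ge0// ltW.
have q1p : (0 < 1 - q)%R by rewrite subr_gt0.
have pA0 := fineP_ge0 P A.
have e0 : (0 <= 2 * kp / (1 - q))%R by exact: divr_ge0 (mulr_ge0 (ler0n _ 2) kp0) (ltW q1p).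
apply: (@le_trans _ _ (fine (P A) * expR (- (2 * kp / (1 - q)) * (1 - q ^+ n)))%R).
  apply: ler_wpM2l => //; rewrite ler_expR -[leLHS]mulr1 ler_wnM2l//.
    by rewrite oppr_le0.
  by rewrite gerBl exprn_ge0// ltW.
elim: n => [|n IH].
  by rewrite expr0 subrr mulr0 expR0 mulr1.
have [F1 F2] := chainP n u0 (ltW h0) FA.
have n0 : (0 <= u + n%:R * h)%R by rewrite addr_ge0// mulr_ge0// ltW.
have Eq : expR (b * (u + n%:R * h)) = (expR (b * u) / q ^+ n)%R.
  by rewrite -expRM_natl -expRN -expRD; congr expR; ring.
have qn0 : (0 < q ^+ n)%R by rewrite exprn_gt0.
have qn1 : (q ^+ n <= 1)%R by rewrite exprn_ile1// ltW.
have hc w : chain A u h n w -> T (u + n%:R * h)%R w <= (K * q ^+ n * expR (b * (u + n%:R * h)))%:E.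
  move=> /F2[Aw ->]; rewrite Eq; have -> : (K * q ^+ n * (expR (b * u) / q ^+ n) = K * expR (b * u))%R.
    by field; rewrite lt0r_neq0.
  exact: hA.
have c0 : (0 <= K * q ^+ n)%R by rewrite mulr_ge0// ltW.
have st := quiet_step n0 (ltW h0) c0 F1 hc.
have x01 : (0 <= kp * q ^+ n <= 2^-1)%R.
  by rewrite mulr_ge0 ?(ltW qn0)//=; apply: le_trans kp2; rewrite ler_piMr.
apply: le_trans st; rewrite -/(chain _ _ _).
have -> : (K * q ^+ n * (expR (a * h) - 1) = kp * q ^+ n)%R by rewrite /kp; ring.
apply: (@le_trans _ _ (fine (P A) * expR (- (2 * kp / (1 - q)) * (1 - q ^+ n)) * expR (- (2 * (kp * q ^+ n))))%R).
  rewrite -[leRHS]mulrA -expRD; apply: ler_wpM2l => //; rewrite ler_expR le_eqVlt; apply/orP; left; apply/eqP.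
  by rewrite exprS; field; rewrite lt0r_neq0.
apply: ler_pM => //; [by rewrite mulr_ge0 ?expR_ge0|exact: expRN2_le].
Qed.

(** Inspecting integer times makes this a countable intersection; almost surely the mass is
    nondecreasing, so they determine the other times. *)
Definition quiet_after (u : R) : set W := [set w | forall k : nat, T (u + k%:R)%R w = T u w].

Lemma measurable_quiet_after u : (0 <= u)%R -> measurable (quiet_after u).
Proof.
move=> u0; have -> : quiet_after u = \bigcap_k quiet u (u + k%:R)%R.
  by apply/seteqP; split => w h; [move=> k _; exact: h|move=> k; exact: h k Logic.I].
apply: bigcap_measurable => // k _.
have uk : (u <= u + k%:R)%R by rewrite lerDl.
by apply: (filtration_measurable hF (le_trans u0 uk)); exact: quiet_adapted.
Qed.

(** The chain events decrease, and their probabilities all stay above the same positive proportion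
    of that of [A]. *)
Lemma quiet_after_probability K : (0 <= K)%R -> exists p : R, [/\ (0 < p)%R, (p <= 1)%R & forall u A, (0 <= u)%R -> F u A ->
  (forall w, A w -> T u w <= (K * expR (b * u))%:E) -> (p * fine (P A) <= fine (P (A `&` quiet_after u)))%R].
Proof.
move=> K0; pose m := Num.bound (a * (4 * (K + 1)))%R; pose h : R := (m.+1%:R^-1)%R.
have h0 : (0 < h)%R by rewrite invr_gt0.
have K1 : (0 < 4 * (K + 1))%R by rewrite mulr_gt0// ltr_wpDl.
have ah : (a * h <= (4 * (K + 1))^-1)%R.
  rewrite ler_pdivrMr// -[leRHS]mulrC ler_pdivlMr//; apply: ltW.
  apply: (@lt_trans _ _ m%:R); last by rewrite ltr_nat.
  by apply: archi_boundP; rewrite mulr_ge0// ltW.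
have ah0 : (0 <= a * h)%R by rewrite mulr_ge0// ltW.
have ah4 : (a * h <= 4^-1)%R.
  by apply: le_trans ah _; rewrite lef_pV2 ?posrE// ler_peMr// lerDr.
have e2 : (expR (a * h) - 1 <= 2 * (a * h))%R.
  have h1 : (1 - a * h <= expR (- (a * h)))%R by apply: le_trans (expR_ge1Dx _).
  have p1 : (0 < 1 - a * h)%R by lra.
  rewrite expRN in h1; rewrite lerBlDr -[expR _]invrK.
  apply: (@le_trans _ _ (1 - a * h)^-1%R); first by rewrite lef_pV2 ?posrE ?invr_gt0 ?expR_gt0.
  by rewrite -[leLHS]mul1r ler_pdivrMr//; nra.
have kp2 : (K * (expR (a * h) - 1) <= 2^-1)%R.
  apply: (@le_trans _ _ (K * (2 * (4 * (K + 1))^-1)))%R.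
    by apply: ler_wpM2l => //; apply: le_trans e2 _; exact: ler_wpM2l.
  rewrite mulrA ler_pdivrMr//; lra.
have q1 : (0 < 1 - expR (- (b * h)))%R by rewrite subr_gt0 -expR0 ltr_expR oppr_lt0 mulr_gt0.
have kp0 : (0 <= K * (expR (a * h) - 1))%R by rewrite mulr_ge0// subr_ge0 -expR0 ler_expR.
exists (expR (- (2 * (K * (expR (a * h) - 1)) / (1 - expR (- (b * h)))))); split; first exact: expR_gt0.
  by rewrite -[leRHS]expR0 ler_expR oppr_le0; exact: divr_ge0 (mulr_ge0 (ler0n _ 2) kp0) (ltW q1).
move=> u A u0 FA hA.
have FC n := (chainP n u0 (ltW h0) FA).1.
have mC n : measurable (chain A u h n).
  by apply: (filtration_measurable hF _ (FC n)); rewrite addr_ge0// mulr_ge0// ltW.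
have nC n : chain A u h n.+1 `<=` chain A u h n by move=> w [].
have mI : measurable (\bigcap_n chain A u h n) by exact: bigcap_measurable.
have mA : measurable A := filtration_measurable hF u0 FA.
apply: (@le_trans _ _ (fine (P (\bigcap_n chain A u h n)))); last first.
  apply: le_fineP => //; first by apply: measurableI => //; exact: measurable_quiet_after.
  move=> w hw; split; first exact: hw 0%N Logic.I.
  move=> k; have [_ /(_ w)] := chainP (k * m.+1)%N u0 (ltW h0) FA.
  case; first exact: hw.
  by move=> _; rewrite natrM -mulrA [(_ * h)%R]divff ?mulr1.
have := @fine_nonincreasing_cvg _ _ _ P _ mC nC => cv.
rewrite mulrC -(cvg_lim (@Rhausdorff R) cv); apply: limr_ge; first by apply/cvg_ex; eexists; exact: cv.
apply: nearW => n.
exact: chain_probability.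
Qed.

(* On the event the total mass is at least K exp (b u), the conditional variance of mart_limit given the past is a small multiple of (mart u) ^ 2. *)
Lemma no_growth_probability K u A : (0 < K)%R -> (0 <= u)%R -> F u A -> (forall w, A w -> (K * expR (b * u))%:E <= T u w) ->
  (fine (P (A `&` [set w | mart_limit w = 0%R])) <= a / (dl * K) * fine (P A))%R.
Proof.
move=> K0 u0 FA hA.
have mA : measurable A := filtration_measurable hF u0 FA.
pose L := (expR (- (a * u)) * (K * expR (b * u)))%R.
have L0 : (0 < L)%R by rewrite !mulr_gt0 ?expR_gt0.
(* [phi] is the inverse of [mart u] on [A], so [phi * (mart_limit - mart u)] has square 1 at almost
   every point of [A] where [mart_limit] vanishes. *)
pose phi w : R := (\1_A w * mart u w `^ (-1))%R.
have mart0 w := mart_ge0 u w.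
have phiL w : (0 <= phi w <= L^-1)%R.
  rewrite /phi indicE; have [wA|wA] := boolP (w \in A); last by rewrite mul0r lexx invr_ge0 ltW.
  rewrite mul1r powR_ge0/= powR_inv1//.
  have := hA w; rewrite inE in wA => /(_ wA); rewrite /mart.
  case: (T u w) (total_ge0 u w) => [v v0| _|//] /=; last by move=> _; rewrite mulr0 invr0 invr_ge0 ltW.
  rewrite lee_fin => Kv; have vp : (0 < v)%R by apply: lt_le_trans Kv; rewrite mulr_gt0 ?expR_gt0.
  by rewrite lef_pV2 ?posrE ?mulr_gt0 ?expR_gt0// ler_wpM2l ?expR_ge0.
have mphi : mfunT (phi : sigmaT (F u) -> R).
  apply: measurable_funM; first by apply: measurable_indic; rewrite /measurable/= filtration_id.
  apply: (measurableT_comp (measurable_powR (-1)%R)).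
  apply: measurable_funM => //.
  by apply: measurableT_comp => //; exact: total_adapted.
have mphiT : mfunT phi by exact: (sub_sigma_mfun (filtration_measurable hF u0)).
have G := mart_limit_square u0 phiL mphi.
pose B := A `&` [set w | mart_limit w = 0%R].
have mB : measurable B.
  apply: measurableI => //; have -> : [set w | mart_limit w = 0%R] = setT `&` mart_limit @^-1` [set 0%R] by rewrite setTI.
  by apply: (measurable_mart_limit); [exact: measurableT|exact: measurable_set1].
have gfin : {ae P, forall w, T u w < +oo}.
  by apply: filterS (good_path_ae) => w gw; exact: (total_fin gw u0).
have Epos w : A w -> T u w < +oo -> (0 < mart u w)%R /\ T u w = (expR (a * u) * mart u w)%:E.
  move=> Aw; have := hA w Aw; rewrite /mart; case: (T u w) => [v Kv _|//|//] /=.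
  rewrite lee_fin in Kv; have vp : (0 < v)%R by apply: lt_le_trans Kv; rewrite mulr_gt0 ?expR_gt0.
  by rewrite mulr_gt0 ?expR_gt0// mulrA -expRD subrr expR0 mul1r.
have mI (D : set W) : measurable D -> mfunT (fun w => (\1_D w)%:E : \bar R) by move=> mD; apply/measurable_EFinP; exact: measurable_indic.
have low : P B <= \int[P]_w ((phi w * (mart_limit w - mart u w)) ^+ 2)%:E.
  have -> : P B = \int[P]_w (\1_B w)%:E by rewrite integral_indic// setIT.
  have mq : mfunT (fun w => ((phi w * (mart_limit w - mart u w)) ^+ 2)%:E).
    by meas.
  have q0 w : 0 <= ((phi w * (mart_limit w - mart u w)) ^+ 2)%:E by rewrite lee_fin sqr_ge0.
  have key : {ae P, forall w, setT w -> (\1_B w)%:E <= ((phi w * (mart_limit w - mart u w)) ^+ 2)%:E}.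
    apply: filterS gfin => w fw _; rewrite indicE; have [wB|wB] := boolP (w \in B); last exact: q0.
    move: wB; rewrite inE => -[Aw /= ->]; have [mp _] := Epos w Aw fw.
    rewrite /phi indicE mem_set// mul1r powR_inv1 ?(ltW mp)// sub0r mulrN mulVf ?lt0r_neq0//.
    by rewrite sqrrN expr1n.
  by apply: ae_ge0_le_integral => //; exact: mI.
have up : \int[P]_w (((phi w) ^+ 2)%:E * T u w) <= ((expR (a * u) / L) * fine (P A))%:E.
  rewrite [leRHS]EFinM -probabilityE//.
  have -> : P A = \int[P]_w (\1_A w)%:E by rewrite integral_indic// setIT.
  have eL0 : (0 <= expR (a * u) / L)%R by rewrite divr_ge0 ?expR_ge0// ltW.
  have := mI A mA => mIA.
  have i0 w : setT w -> 0 <= (\1_A w)%:E :> \bar R by rewrite lee_fin.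
  rewrite -(ge0_integralZl_EFin P measurableT i0 mIA eL0).
  have m1 : mfunT (fun w => (expR (a * u) / L)%:E * (\1_A w)%:E) by meas.
  have m2 : mfunT (fun w => ((phi w) ^+ 2)%:E * T u w).
    by meas.
  have p1 w : 0 <= ((phi w) ^+ 2)%:E * T u w by rewrite mule_ge0 ?lee_fin ?sqr_ge0// total_ge0.
  have p2 w : 0 <= (expR (a * u) / L)%:E * (\1_A w)%:E by rewrite mule_ge0// lee_fin.
  have key : {ae P, forall w, setT w -> ((phi w) ^+ 2)%:E * T u w <= (expR (a * u) / L)%:E * (\1_A w)%:E}.
    apply: filterS gfin => w fw _; rewrite indicE; have [wA|wA] := boolP (w \in A); last first.
      by rewrite /phi indicE (negbTE wA) mul0r expr0n mul0e mule0.
    have [mp ->] := Epos w (set_mem wA) fw; rewrite mule1 -EFinM lee_fin.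
    have phE : (phi w = (mart u w)^-1)%R by rewrite /phi indicE wA mul1r powR_inv1// ltW.
    have -> : (phi w ^+ 2 * (expR (a * u) * mart u w) = expR (a * u) * phi w)%R by rewrite phE; field; rewrite lt0r_neq0.
    by apply: ler_wpM2l; [exact: expR_ge0|have /andP[] := phiL w].
  exact: ae_ge0_le_integral.
have cst0 : 0 <= (a / dl * expR (- ((2 * a - b) * u)))%:E by rewrite lee_fin mulr_ge0 ?expR_ge0// divr_ge0// ltW.
have := le_trans low (le_trans G (lee_wpmul2l cst0 up)).
rewrite (probabilityE P mB) -EFinM lee_fin => h; apply: le_trans h _; rewrite mulrA; apply: ler_wpM2r; first exact: fineP_ge0.
rewrite le_eqVlt; apply/orP; left; apply/eqP.
have Eu : (expR (- ((2 * a - b) * u)) * expR (a * u) * expR (a * u) / expR (b * u) = 1)%R.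
  by rewrite -expRN -!expRD -[RHS]expR0; congr expR; ring.
have -> : (expR (a * u) / L = K^-1 * (expR (a * u) * expR (a * u) / expR (b * u)))%R.
  by rewrite /L expRN; field; rewrite !lt0r_neq0 ?expR_gt0.
transitivity (a / dl * K^-1 * (expR (- ((2 * a - b) * u)) * expR (a * u) * expR (a * u) / expR (b * u)))%R.
  by ring.
by rewrite Eu mulr1 invfM mulrA.
Qed.

(** By [quiet_after_extinction], survival without growth is almost surely contained in this event,
    which is shown to be null. *)
Definition stalled : set W := [set w | mart_limit w = 0%R] `&` \bigcap_m ~` quiet_after m%:R.

Let mlim0 : measurable [set w | mart_limit w = 0%R].
Proof.
have -> : [set w | mart_limit w = 0%R] = setT `&` mart_limit @^-1` [set 0%R] by rewrite setTI.
by apply: (measurable_mart_limit); [exact: measurableT|exact: measurable_set1].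
Qed.

Let measurable_stalled : measurable stalled.
Proof.
apply: measurableI => //; apply: bigcap_measurable => // m _; apply: measurableC.
exact: measurable_quiet_after.
Qed.

(** The event [A] is split by the mass at time [m]. Above [K * expR (b * m)] the limit vanishes on
    at most half of it, which is what [K = 2 * (a / dl)] achieves; below, the process is quiet
    forever on a proportion of at least [p]. Hence the common bound [1 - p / 2]. *)
Let stalled_proportion : exists2 p : R, (0 < p <= 1)%R & forall (m : nat) A, F m%:R A ->
  (fine (P (A `&` stalled)) <= (1 - p) * fine (P A))%R.
Proof.
pose K := (2 * (a / dl))%R; have K0 : (0 < K)%R by rewrite mulr_gt0// divr_gt0.
have [p [p0 p1 hp]] := quiet_after_probability (ltW K0).
exists (p / 2)%R; first by rewrite divr_gt0//= ler_pdivrMr// mul1r (le_trans p1)// ler1n.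
move=> m A FA; set u : R := m%:R in FA *; have u0 : (0 <= u)%R by rewrite ler0n.
have mA : measurable A := filtration_measurable hF u0 FA.
pose L := [set w | (K * expR (b * u))%:E <= T u w].
have FL : F u L.
  rewrite -(filtration_id hF u0).
  have := @emeasurable_fun_c_infty _ (sigmaT (F u)) R setT (T u) measurableT (total_adapted u0) (K * expR (b * u))%:E.
  by rewrite setTI.
have FLc : F u (~` L).
  rewrite -(filtration_id hF u0); apply: (@measurableC _ (sigmaT (F u))).
  by rewrite /measurable/= filtration_id.
have mL : measurable L := filtration_measurable hF u0 FL.
have mS := measurable_stalled.
have F1 := filtrationI u0 FA FL; have F2 := filtrationI u0 FA FLc.
have h1 : (fine (P (A `&` L `&` [set w | mart_limit w = 0%R])) <= 2^-1 * fine (P (A `&` L)))%R.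
  apply: le_trans (no_growth_probability K0 u0 F1 _) _; first by move=> w [].
  rewrite le_eqVlt; apply/orP; left; apply/eqP; congr (_ * _)%R.
  by rewrite /K; field; rewrite !lt0r_neq0.
have h2 : (p * fine (P (A `&` ~` L)) <= fine (P (A `&` ~` L `&` quiet_after u)))%R.
  by apply: hp => // w [_ /negP]; rewrite -ltNge => /ltW.
have mq := measurable_quiet_after u0.
clearbody L.
have mAL := measurableI _ _ mA mL; have mAD : measurable (A `&` ~` L) by apply: measurableI => //; exact: measurableC.
have s1 : (fine (P (A `&` stalled)) = fine (P (A `&` L `&` stalled)) + fine (P (A `&` ~` L `&` stalled)))%R.
  have := finePDI P (measurableI _ _ mA mS) mL; rewrite addrC => ->.
  by congr (fine (P _) + fine (P _))%R; apply/seteqP; split => w /=; tauto.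
have s2 : (fine (P (A `&` L `&` stalled)) <= 2^-1 * fine (P (A `&` L)))%R.
  apply: le_trans h1; apply: le_fineP; [exact: measurableI|exact: measurableI|].
  by move=> w [? []].
have s3 : (fine (P (A `&` ~` L `&` stalled)) <= (1 - p) * fine (P (A `&` ~` L)))%R.
  apply: (@le_trans _ _ (fine (P ((A `&` ~` L) `\` quiet_after u)))).
    apply: le_fineP; [exact: measurableI|exact: measurableD|].
    by move=> w [? [_ /(_ m Logic.I)]].
  move: h2 (finePDI P mAD mq).
  move: (fine (P (A `&` ~` L))) (fine (P (A `&` ~` L `&` quiet_after u))) (fine (P ((A `&` ~` L) `\` quiet_after u))) => x y z.
  by move=> h e; rewrite mulrBl mul1r; lra.
have s4 : fine (P A) = (fine (P (A `&` L)) + fine (P (A `&` ~` L)))%R.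
  by have := finePDI P mA mL; rewrite addrC setDE => ->.
rewrite s1 s4; have := fineP_ge0 P (A `&` L); have := fineP_ge0 P (A `&` ~` L).
move: s2 s3; move: (fine (P (A `&` L))) (fine (P (A `&` ~` L))) (fine (P (A `&` L `&` stalled))) (fine (P (A `&` ~` L `&` stalled))) => x y z v.
by move=> h3 h4 y0 x0; have q1 := mulr_ge0 (ltW p0) y0; have q2 := ler_wpM2r x0 p1; move: h3 h4 q1 q2; lra.
Qed.

(** An event that fills at most a proportion [1 - p] of each event of the past is null if past
    events approximate it. The approximation has two stages: [C m] decreases to [stalled], and
    [A k], known at time [k], contains [stalled] and is contained in [C m] up to small probabilities
    as [k] grows. This gives [P stalled <= (1 - p) * P stalled]. *)
Let stalled_null : P stalled = 0.
Proof.
have [p /andP[p0 p1] hp] := stalled_proportion.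
have mS := measurable_stalled.
have mn := measurable_mart_limit.
have mlt (f : W -> R) c : mfunT f -> measurable [set w | (f w < c)%R].
  move=> mf; have -> : [set w | (f w < c)%R] = setT `&` f @^-1` `]-oo, c[%classic.
    by rewrite setTI; apply/seteqP; split => w /=; rewrite in_itv.
  by apply: mf => //; exact: measurable_itv.
have mle (f : W -> R) c : mfunT f -> measurable [set w | (f w <= c)%R].
  move=> mf; have -> : [set w | (f w <= c)%R] = setT `&` f @^-1` `]-oo, c]%classic.
    by rewrite setTI; apply/seteqP; split => w /=; rewrite in_itv.
  by apply: mf => //; exact: measurable_itv.
pose dlt (m : nat) : R := (m.+1%:R^-1)%R.
have dlt0 m : (0 < dlt m)%R by rewrite invr_gt0.
pose C m := [set w | (mart_limit w <= dlt m)%R] `&` ~` quiet_after m%:R.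
have mC m : measurable (C m).
  by apply: measurableI; [exact: mle|apply: measurableC; exact: measurable_quiet_after].
have nC m : C m.+1 `<=` C m.
  move=> w [/= h1 h2]; split.
    by apply: le_trans h1 _; rewrite lef_pV2 ?posrE// ler_nat.
  have e1 : (m.+1%:R = m%:R + 1%:R :> R)%R by rewrite -natrD addn1.
  have e2 (k : nat) : (m.+1%:R + k%:R = m%:R + k.+1%:R :> R)%R by rewrite -!natrD addnS.
  by move=> q; apply: h2 => k; rewrite e2 e1 !q.
have CS : \bigcap_m C m = stalled.
  apply/seteqP; split => w; last first.
    move=> [/= h0 hq] m _; split; last exact: hq.
    by rewrite /= h0 ltW.
  move=> h; split; last by move=> m _; have [] := h m Logic.I.
  apply/eqP; rewrite eq_le mart_limit_ge0 andbT.
  apply/ler_addgt0Pr => e e0; rewrite add0r.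
  have [/= hm _] := h (Num.bound e^-1) Logic.I; apply: le_trans hm _.
  rewrite -[leRHS]invrK lef_pV2 ?posrE ?invr_gt0//; apply: ltW.
  by apply: lt_le_trans (archi_boundP _) _; rewrite ?invr_ge0 ?(ltW e0)// ler_nat.
have step m : (fine (P stalled) <= (1 - p) * fine (P (C m)))%R.
  apply/ler_addgt0Pr => e e0.
  (* The inequality is strict here and weak in [C m]: a zero limit eventually brings [mart] strictly
     below [dlt m], while a limit of values below [dlt m] may equal [dlt m]. *)
  pose A k := if (m <= k)%N then [set w | (mart k%:R w < dlt m)%R] `&` ~` quiet m%:R k%:R else set0.
  have FA k : F k%:R (A k).
    have k0 : (0 <= k%:R :> R)%R by rewrite ler0n.
    rewrite /A; case: ifP => [mk|_]; last first.
      by rewrite -(filtration_id hF k0); exact: (@measurable0 _ (sigmaT (F k%:R))).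
    apply: filtrationI => //.
      rewrite -(filtration_id hF k0).
      have mm : mfunT (mart k%:R : sigmaT (F k%:R) -> R).
        apply: measurable_funM => //.
        by apply: measurableT_comp => //; exact: total_adapted.
      have := mm measurableT _ (measurable_itv `]-oo, (dlt m)[); rewrite setTI.
      by congr (_ _); apply/seteqP; split => w /=; rewrite in_itv.
    rewrite -(filtration_id hF k0); apply: (@measurableC _ (sigmaT (F k%:R))).
    by rewrite /measurable/= filtration_id//; apply: quiet_adapted => //; rewrite ler_nat.
  have mA k : measurable (A k) by apply: (filtration_measurable hF _ (FA k)); rewrite ler0n.
  have tmono : {ae P, forall w s t, (s <= t)%R -> T s w <= T t w}.
    apply: filterS (good_path_ae) => w gw s t st; rewrite !totalE; apply: le_lsum => j.
      exact: wcount_ge0.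
    exact: (wcount_mono j gw st).
  have e20 : (0 < e / 2)%R by rewrite divr_gt0.
  have [k1 hk1] : exists k0, forall k, (k0 <= k)%N -> (fine (P (stalled `\` A k)) <= e / 2)%R.
    apply: probability_eventually_null => // [k|]; first exact: measurableD.
    apply: filterS2 (mart_cvg_ae) tmono => w cv mono.
    have [[n0 /(_ m Logic.I)/existsNP[j hj]]|nS] := pselect (stalled w); last by exists 0%N => k _ [].
    have [k0 _ hk0] : \forall k \near \oo, (mart k%:R w < dlt m)%R by apply: (@cvgr_lt _ _ _ _ _ _ cv); rewrite n0.
    exists (maxn k0 (m + j)) => k; rewrite geq_max => /andP[kk0 kmj] [_]; apply.
    rewrite /A (leq_trans _ kmj) ?leq_addr//; split; first exact: hk0.
    rewrite /quiet/= => q; apply: hj; apply/eqP; rewrite eq_le -natrD; apply/andP; split.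
      by rewrite -q; apply: mono; rewrite ler_nat.
    by apply: mono; rewrite ler_nat leq_addr.
  have [k2 hk2] : exists k0, forall k, (k0 <= k)%N -> (fine (P (A k `\` C m)) <= e / 2)%R.
    apply: probability_eventually_null => // [k|]; first exact: measurableD.
    apply: filterS (mart_cvg_ae) => w cv.
    have [q|q] := pselect (quiet_after m%:R w).
      exists 0%N => k _ []; rewrite /A; case: ifP => // mk [_ nq] _; apply: nq.
      by have := q (k - m)%N; rewrite /quiet/= -natrD subnKC.
    have [l|l] := leP (mart_limit w) (dlt m); first by exists 0%N => k _ [_]; apply.
    have [k0 _ hk0] : \forall k \near \oo, (dlt m < mart k%:R w)%R by apply: (@cvgr_gt _ _ _ _ _ _ cv).
    exists k0 => k /hk0 h [Ak _]; move: Ak; rewrite /A; case: ifP => // _ [/= h' _].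
    by have := lt_trans h h'; rewrite ltxx.
  pose k := maxn k1 k2.
  have e1 := hk1 k (leq_maxl _ _); have e2 := hk2 k (leq_maxr _ _).
  have b1 := finePDI P mS (mA k).
  have b2 := finePDI P (mA k) (mC m).
  have b3 := hp k (A k) (FA k); rewrite setIC in b3.
  have b4 := le_fineP P (measurableI _ _ (mA k) (mC m)) (mC m) (@subIsetr _ _ _).
  have b5 : (fine (P (A k)) <= fine (P (C m)) + e / 2)%R by rewrite b2 addrC; exact: lerD.
  have p1' : (0 <= 1 - p)%R by rewrite subr_ge0.
  have b6 := le_trans b3 (ler_wpM2l p1' b5).
  have pe : (0 <= p * e)%R by rewrite mulr_ge0// ltW.
  move: e1 b1 b6 pe; move: (fine (P (stalled `&` A k))) (fine (P (C m))) (fine (P (stalled `\` A k))) (fine (P stalled)) => x y z v.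
  by lra.
have cv := @fine_nonincreasing_cvg _ _ _ P _ mC nC; rewrite CS in cv.
have cv2 : ((1 - p) * fine (P (C m)))%R @[m --> \oo] --> ((1 - p) * fine (P stalled))%R.
  by apply: cvgM => //; exact: cvg_cst.
have le1 : (fine (P stalled) <= (1 - p) * fine (P stalled))%R.
  rewrite -[leRHS](cvg_lim (@Rhausdorff R) cv2); apply: limr_ge; first by apply/cvg_ex; eexists; exact: cv2.
  exact: nearW.
rewrite (probabilityE P mS); congr (_%:E); apply/eqP; rewrite eq_le fineP_ge0 andbT.
by rewrite -(pmulr_rle0 _ p0); move: le1; rewrite mulrBl mul1r; lra.
Qed.

(** If the mass is constant along the integers, [total_gap] and the finiteness of the mass exclude
    further jumps, so all counts are frozen at their finite total. *)
Let quiet_after_extinction : {ae P, forall w (m : nat), quiet_after m%:R w -> extinction Z w}.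
Proof.
have gaps : {ae P, forall w, forall m k : nat, ((forall j, Z j (m%:R + k%:R)%R w = Z j m%:R w) /\ T (m%:R + k%:R)%R w = T m%:R w) \/
    T m%:R w + (expR (b * m%:R))%:E <= T (m%:R + k%:R)%R w}.
  apply: ae_foralln => m; apply: ae_foralln => k; apply: total_gap; first exact: ler0n.
  by rewrite lerDl.
apply: filterS2 gaps (good_path_ae) => w gap gw m q.
have Zq j k : Z j (m%:R + k%:R)%R w = Z j m%:R w.
  have := gap m k; rewrite q => -[[]//|]; have := total_fin gw (ler0n R m).
  case: (T _ w) (total_ge0 m%:R w) => // v _ _; rewrite -EFinD lee_fin gerDl.
  by rewrite leNgt expR_gt0.
have Zc j t : (m%:R <= t)%R -> Z j t w = Z j m%:R w.
  move=> mt; have cf := good_counting gw j.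
  apply/eqP; rewrite eqn_leq; apply/andP; split; last exact: (counting_nondecreasing cf (ler0n R m) mt).
  have t0 : (0 <= t)%R by apply: le_trans mt; rewrite ler0n.
  rewrite -(Zq j (Num.bound t)); apply: (counting_nondecreasing cf t0).
  by apply: (le_trans (ltW (archi_boundP t0))); rewrite lerDr.
rewrite /extinction/=.
have -> : lim ((\esum_(i in [set: site]) ((Z i t w)%:R : R)%:E)%R @[t --> +oo%R]) = (\esum_(i in [set: site]) ((Z i m%:R w)%:R : R)%:E)%R.
  apply/cvg_lim => //; apply: cvg_near_cst; exists (m%:R : R)%R; split; first exact: num_real.
  by move=> t mt; apply: eq_esum => i _; rewrite Zc// ltW.
by rewrite -lsum_esum//; exact: (good_finite gw m).
Qed.

Lemma survival_growth : {ae P, forall w, (~` extinction Z) w -> (0 < mart_limit w)%R}.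
Proof.
have ns : {ae P, forall w, ~ stalled w}.
  by exists stalled; split; [exact: measurable_stalled|exact: stalled_null|move=> w /= /contrapT].
apply: filterS2 ns quiet_after_extinction => w nst ext next.
rewrite lt_neqAle mart_limit_ge0 andbT; apply/negP => /eqP n0; apply: nst; split => // m _ q.
by apply: next; exact: ext q.
Qed.

End survival.

End hawkes.

Local Close Scope ereal_scope.

Theorem theorem20 (R : realType) (d : nat) (hd : (1 <= d)%N)
  (a b : R) (hb : 0 < b) (hab : b < a)
  (dO : measure_display) (Omega : measurableType dO) (P : probability Omega R)
  (F : R -> set (set Omega)) (hF : filtration F)
  (N : 'rV[int]_d -> R.-ker Omega ~> plane R)
  (hN : iid_poisson_measures P F N)
  (Z : 'rV[int]_d -> R -> Omega -> nat)
  (hZ : impulsion_hawkes P F N (fun t => a * expR (- (b * t))) Z) :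
  let alpha0 := a - b in
  exists (C t0 : R) (H : {RV P >-> R}),
    [/\ 0 < C, 0 < t0 & forall w, 0 <= H w] /\
    [/\ (* (i) *)
        forall (i : 'rV[int]_d) (t : R), t0 <= t ->
          ('E_P[fun w => (`|(Z i t w)%:R
                   - H w * heat_kernel (a * t) (to_real R i)
                         * expR (alpha0 * t)|)%R]
           <= (C * expR (alpha0 * t) / t `^ (d%:R / 2 + 1 / 3))%:E)%E,
        (* (ii) *)
        forall x : 'rV[R]_d,
          cvg_in_probability P
            (fun t w => t `^ (d%:R / 2) * expR (- (alpha0 * t))
                        * (Z (floor_site (Num.sqrt t *: x)) t w)%:R)
            (fun w => H w * heat_kernel a x)
      & (* (iii) *)
        {ae P, forall w, (~` extinction Z) w -> 0 < H w}].
Proof.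
move=> alpha0; have a0 : 0 < a by exact: lt_trans hab.
have dl0 : 0 < a - b by rewrite subr_gt0.
have [C [T0 [C0 T00 h1]]] := count_expectation hb hab hF hN hZ.
pose mH := isMeasurableFun.Build _ _ _ _ _ (measurable_growth_limit hF hZ).
pose H : {RV P >-> R} := HB.pack (growth_limit a b Z) mH.
exists C, T0, H; split; first by split => // w; exact: growth_limit_ge0.
split; [exact: h1|exact: (count_cvg hb hab hF hN hZ)|].
apply: filterS (survival_growth hb hab hF hN hZ) => w h /h n0.
by rewrite mulr_gt0// divr_gt0.
Qed.
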